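(* Let $n\geqslant 2$ be an integer and let $q>n$, $p>2$, $A>0$ be real numbers. There exist $\alpha=\alpha(q,n)>0$ (depending only on $q,n$) and $C=C(p,q,n,A)>0$ such that the following holds for every $\varepsilon\in(0,1)$ and every closed, connected, isometrically immersed hypersurface $X:(M^n,g)\to\mathbb{R}^{n+1}$ with $\|H\|_p\,\|X-\overline{X}\|_2\leqslant 1+\varepsilon$ and $\mathrm{Vol}(M)\,\|H\|_q^n\leqslant A$. (i) $$\Bigl\|\,|X-\overline{X}|-\frac{1}{\|H\|_2}\Bigr\|_\infty\leqslant C\varepsilon^{\alpha}\frac{1}{\|H\|_2}.$$ (ii) For any $r\in[1,q)$ there is a constant $C'=C'(p,q,r,n,A)>0$ (depending only on $p,q,r,n,A$) such that, with $\beta=\frac{\alpha(q-r)}{r(q-1)}$, $$\bigl\|\,|H|-\|H\|_2\bigr\|_r\leqslant C'\varepsilon^{\beta}\|H\|_2.$$ (iii) Assume moreover that $q>\max(4,n)$. For any $\rho>0$ and $\eta>0$ there exists $\varepsilon_0=\varepsilon_0(p,q,n,A,\rho,\eta)>0$ such that if $\varepsilon\leqslant\varepsilon_0$ and $M$ satisfies $\|H\|_p\,\|X-\overline{X}\|_2\leqslant 1+\varepsilon$ and $\mathrm{Vol}(M)\,\|H\|_q^n\leqslant A$, then for any $x\in S=\overline{X}+\frac{1}{\|H\|_2}\cdot\mathbb{S}^n$, $$\Bigl|\frac{\mathrm{Vol}\bigl(B(x,\frac{\rho}{\|H\|_2})\cap X(M)\bigr)}{\mathrm{Vol}(M)}-\frac{\mathrm{Vol}\bigl(B(x,\frac{\rho}{\|H\|_2})\cap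 S\bigr)}{\mathrm{Vol}(S)}\Bigr|\leqslant\eta\,\frac{\mathrm{Vol}\bigl(B(x,\frac{\rho}{\|H\|_2})\cap S\bigr)}{\mathrm{Vol}(S)}.$$
   Context: $X$ is a smooth isometric immersion of a closed (compact without boundary) Riemannian $n$-manifold. $\mathrm{Vol}(M)$ is the volume of $(M,g)$, $dv$ its volume measure, and $\overline{X}=\frac{1}{\mathrm{Vol}(M)}\int_M X\,dv\in\mathbb{R}^{n+1}$. If $\nu$ is a local unit normal field, the second fundamental form is $B(\cdot,\cdot)=\langle\nabla^0_{\cdot}\nu,\cdot\rangle$ ($\nabla^0$ the Euclidean connection) and the mean curvature is $H=\frac1n\mathrm{tr}(B)$ (so $|H|$ does not depend on the choice of $\nu$). Norms are normalized: $\|f\|_p^p=\frac{1}{\mathrm{Vol}(M)}\int_M|f|^p\,dv$, with $|f|$ the Euclidean norm for vector-valued $f$, and $\|\cdot\|_\infty$ is the sup norm. $B(x,s)$ denotes the Euclidean ball of $\mathbb{R}^{n+1}$ of center $x$ and radius $s$; $\mathbb{S}^n$ is the unit sphere centered at the origin. $\mathrm{Vol}(B(x,s)\cap X(M))$ denotes the $n$-dimensional volume of the immersed hypersurface in the ball, i.e. the $g$-volume of $X^{-1}(B(x,s))\subset M$ (counted with multiplicity). *)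

(* Defs.v *)
From HB Require Import structures.
From mathcomp Require Import all_boot all_order all_algebra.
From mathcomp Require Import all_classical all_reals all_analysis.

Set Implicit Arguments.
Unset Strict Implicit.
Unset Printing Implicit Defensive.

Import Order.TTheory GRing.Theory Num.Theory.
Import numFieldNormedType.Exports.

Local Open Scope classical_set_scope.
Local Open Scope ring_scope.

(* The library norm on row vectors is the sup norm (with the same topology), so
   the Euclidean norm, balls and spheres are introduced separately. *)
Definition edot (R : realType) (m : nat) (u v : 'rV[R]_m) : R :=
  \sum_(j < m) u 0 j * v 0 j.

Definition enorm (R : realType) (m : nat) (u : 'rV[R]_m) : R :=
  Num.sqrt (edot u u).

Definition eball (R : realType) (m : nat) (c : 'rV[R]_m) (s : R) :
    set 'rV[R]_m :=
  [set y | enorm (y - c) < s].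

Definition esphere (R : realType) (m : nat) (c : 'rV[R]_m) (s : R) :
    set 'rV[R]_m :=
  [set c + s *: y | y in [set y : 'rV[R]_m | enorm y = 1]].

Fixpoint Ck (R : realType) (m : nat) (W : normedModType R) (k : nat)
    (U : set 'rV[R]_m) (f : 'rV[R]_m -> W) {struct k} : Prop :=
  (forall u, U u -> {for u, continuous f}) /\
  if k is k'.+1 then
    forall a : 'I_m,
      (forall u, U u -> derivable f u (delta_mx 0 a)) /\
      Ck k' U ('D_(delta_mx 0 a) f)
  else True.

(* C^infinity on U, for U open; values of f outside U are irrelevant. *)
Definition smooth_on (R : realType) (m : nat) (W : normedModType R)
    (U : set 'rV[R]_m) (f : 'rV[R]_m -> W) : Prop :=
  forall k, Ck k U f.

(* Lebesgue integral on R^m of a nonnegative Borel function, as the m-fold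
   iterated integral (the same way the library builds product measures). *)
Fixpoint lebint (R : realType) (m : nat) : ('rV[R]_m -> \bar R) -> \bar R :=
  match m return ('rV[R]_m -> \bar R) -> \bar R with
  | 0 => fun f => f 0
  | m'.+1 => fun f =>
      (\int[lebesgue_measure]_t
         lebint (fun v : 'rV[R]_m' => f (row_mx (t%:M : 'rV[R]_1) v)))%E
  end.

(* Riemannian volume of U in a coordinate patch with metric matrix G. *)
Definition patch_volume (R : realType) (m : nat) (G : 'rV[R]_m -> 'M[R]_m)
    (U : set 'rV[R]_m) : \bar R :=
  lebint (fun u => (\1_U u * Num.sqrt (\det (G u)))%:E).

(* Row a of the library Jacobian 'J F u is the partial derivative of F along
   the a-th coordinate, so this is the matrix of the metric induced by F. *)
Definition gram (R : realType) (m l : nat) (F : 'rV[R]_m -> 'rV[R]_l)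
    (u : 'rV[R]_m) : 'M[R]_m :=
  'J F u *m ('J F u)^T.

Record smoothManifold (R : realType) (n : nat) := SmoothManifold {
  carrier :> ptopologicalType;
  atlas : Type;
  chart_dom : atlas -> set carrier;
  chart : atlas -> carrier -> 'rV[R]_n;
  param : atlas -> 'rV[R]_n -> carrier;
  chart_at : carrier -> atlas;
  _ : hausdorff_space carrier;
  _ : @second_countable carrier;
  _ : forall x, chart_dom (chart_at x) x;
  _ : forall i, open (chart_dom i);
  _ : forall i, open (chart i @` chart_dom i);
  _ : forall i x, chart_dom i x -> param i (chart i x) = x;
  _ : forall i, {within chart_dom i, continuous (chart i)};
  _ : forall i, {within chart i @` chart_dom i, continuous (param i)};
  _ : forall i j,
        smooth_on ((chart i @` chart_dom i) `&` (param i @^-1` chart_dom j))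
                  (chart j \o param i) }.

Definition chart_im (R : realType) (n : nat) (M : smoothManifold R n)
    (i : atlas M) : set 'rV[R]_n :=
  @chart R n M i @` chart_dom i.

Record riemannianMetric (R : realType) (n : nat) (M : smoothManifold R n) :=
  RiemannianMetric {
  metric_mx : atlas M -> 'rV[R]_n -> 'M[R]_n;
  _ : forall i, smooth_on (chart_im i) (metric_mx i);
  _ : forall i u, chart_im i u -> (metric_mx i u)^T = metric_mx i u;
  _ : forall i u (v : 'rV[R]_n), chart_im i u -> v != 0 ->
        0 < (v *m metric_mx i u *m v^T) 0 0;
  _ : forall i j u,
        chart_im i u -> chart_dom j (@param R n M i u) ->
        let tau := @chart R n M j \o @param R n M i in
        metric_mx i u = 'J tau u *m metric_mx j (tau u) *m ('J tau u)^T }.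

(* X is an immersion because the metric is positive definite. *)
Definition isometric_immersion (R : realType) (n l : nat)
    (M : smoothManifold R n) (g : riemannianMetric M) (X : M -> 'rV[R]_l) :
    Prop :=
  forall i : atlas M,
    smooth_on (chart_im i) (X \o @param R n M i) /\
    forall u, chart_im i u -> gram (X \o @param R n M i) u = metric_mx g i u.

Notation borel T := (g_sigma_algebraType (@open T)).

(* This determines mu uniquely: M is covered by countably many charts. *)
Definition is_volume_measure (R : realType) (n : nat) (M : smoothManifold R n)
    (g : riemannianMetric M) (mu : {measure set (borel M) -> \bar R}) : Prop :=
  forall (i : atlas M) (B : set (borel M)),
    measurable B -> B `<=` chart_dom i ->
    mu B = patch_volume (metric_mx g i) (@chart R n M i @` B).

Record closedHypersurface (R : realType) (n : nat) := ClosedHypersurface {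
  hs_manifold :> smoothManifold R n;
  hs_metric : riemannianMetric hs_manifold;
  hs_map : hs_manifold -> 'rV[R]_n.+1;
  hs_vol : {measure set (borel hs_manifold) -> \bar R};
  _ : compact [set: hs_manifold];
  _ : connected [set: hs_manifold];
  _ : isometric_immersion hs_metric hs_map;
  _ : is_volume_measure hs_metric hs_vol }.

(* The cross product of the rows of 'J F u, normalized; every unit normal at a
   point of a hypersurface is plus or minus this one. *)
Definition unit_normal (R : realType) (n : nat) (F : 'rV[R]_n -> 'rV[R]_n.+1)
    (u : 'rV[R]_n) : 'rV[R]_n.+1 :=
  let N := \row_(j < n.+1) ((-1) ^+ j * \det (col' j ('J F u))) in
  (enorm N)^-1 *: N.

(* Entry (a, b) is <d_a nu, d_b F>. *)
Definition second_form (R : realType) (n : nat)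
    (F nu : 'rV[R]_n -> 'rV[R]_n.+1) (u : 'rV[R]_n) : 'M[R]_n :=
  'J nu u *m ('J F u)^T.

Section Hypersurface.
Variables (R : realType) (n : nat) (M : closedHypersurface R n).

Definition hs_volume (B : set M) : R := fine (hs_vol M B).

Definition hs_average (f : M -> R) : R :=
  (hs_volume setT)^-1 *
  Rintegral (hs_vol M) setT (f : borel M -> R).

Definition hs_norm (p : R) (f : M -> R) : R :=
  hs_average (fun x => `|f x| `^ p) `^ p^-1.

Definition hs_supnorm (f : M -> R) : \bar R :=
  ereal_sup (range (fun x => `|f x|%:E)).

Definition hs_center : 'rV[R]_n.+1 :=
  \row_(j < n.+1) hs_average (fun x => hs_map x 0 j).

Definition hs_dist (x : M) : R := enorm (hs_map x - hs_center).

(* H = tr_g(B) / n at x, for the normal of the preferred chart at x. The choice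
   of chart affects only the sign, hence only |H| and its norms are meaningful;
   H is not a continuous function on M. *)
Definition mean_curvature (x : M) : R :=
  let i := chart_at x in
  let F := @hs_map R n M \o @param R n M i in
  let u := @chart R n M i x in
  n%:R^-1 *
  \tr (invmx (metric_mx (hs_metric M) i u) *m second_form F (unit_normal F) u).

Definition pinched (p q A eps : R) : Prop :=
  hs_norm p mean_curvature * hs_norm 2 hs_dist <= 1 + eps /\
  hs_volume setT * hs_norm q mean_curvature ^+ n <= A.

End Hypersurface.

(* The sphere of radius s is covered, up to an n-dimensionally null equator, by
   the two graph patches (sgn * sqrt (s^2 - |u|^2), u) over |u| < s. *)
Definition hemisphere (R : realType) (n : nat) (c : 'rV[R]_n.+1) (s sgn : R)
    (u : 'rV[R]_n) : 'rV[R]_n.+1 :=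
  c + (row_mx ((sgn * Num.sqrt (s ^+ 2 - edot u u))%:M : 'rV[R]_1) u
        : 'rV[R]_(1 + n)).

(* n-dimensional volume of the intersection of B with esphere c s. *)
Definition sphere_volume (R : realType) (n : nat) (c : 'rV[R]_n.+1) (s : R)
    (B : set 'rV[R]_n.+1) : R :=
  let vol sgn :=
    patch_volume (gram (hemisphere c s sgn))
      ([set u | enorm u < s] `&` hemisphere c s sgn @^-1` B) in
  fine (adde (vol 1) (vol (-1))).

(* Main.v *)
(** Write c for the center of mass, Y = X - c and h = ||H||_2. The divergence
    of the tangential part of Y gives int <nH nu, Y> = n Vol(M), hence Hsiung's
    inequality 1 <= h ||Y||_2. Under the pinching it is nearly an equality, so
    that Y is L^2-close to (H / h^2) nu, and comparing the L^p and L^2 norms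
    of H shows that |H| is L^2-close to h; thus |Y| is L^1-close to 1/h.

    (i) A monotonicity formula with ||H||_q on the right-hand side bounds from
    below the mass of the extrinsic balls of radius at most k / ||H||_q. As |Y|
    is 1-Lipschitz, a large deviation at one point persists on such a ball and
    contradicts the L^1 bound.

    (ii) The same mass bound and connectedness bound the diameter, hence
    ||H||_q by a multiple of h, and one interpolates between L^1 and L^q.

    (iii) For a unit vector e let t = h <Y, e>. Integrating the divergence of
    the tangential part of t^k e shows that the moments m_k of t satisfy
    (k + n) m_(k+1) = k m_(k-1) up to O(sqrt eps). The heights of the unit
    sphere satisfy the same recursion exactly, so by polynomial approximation
    the two laws agree on Lipschitz functions up to a small error. By (i) the
    ball B(x, rho / h) is nearly the cap t > 1 - rho^2 / 2, and the law of
    heights of the sphere has no atoms. *)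
Require Import Defs.
From HB Require Import structures.
From mathcomp Require Import all_boot all_order all_algebra.
From mathcomp Require Import all_classical all_reals all_analysis.
From mathcomp Require Import measurable_realfun ring lra.

Set Implicit Arguments.
Unset Strict Implicit.
Unset Printing Implicit Defensive.

Import Order.TTheory GRing.Theory Num.Theory.
Import numFieldNormedType.Exports.

Local Open Scope classical_set_scope.
Local Open Scope ring_scope.

(** * Functions of class C^1 on open subsets of R^m *)

(** There is no global normal, and the preferred chart jumps from point to point, so everything
    rests on chart-independent objects: [hvec], which is n H nu, the products [nunu] of entries of
    nu, and the tangential gradient [gradM]. Their divergence theorem comes from translation
    invariance of Lebesgue measure and a C^1 partition of unity.

    Monotonicity is a differential inequality for a C^1 ball mass. Its value at infinitesimal radius
    is a dimensional density over Vol(M), and A enters there: Vol(M) ||H||_q^n <= A bounds that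
    density below by a multiple of ||H||_q^n, so the mass bound depends only on the scale-free
    product of the radius and ||H||_q.

    In (iii) laws are compared through finitely many moments, to an accuracy fixed before M is
    given, so the threshold on eps is uniform. Moments also replace rotation invariance of the
    sphere: they do not depend on the direction, so every direction has the law of heights of one
    reference direction. That direction is taken in the plane of the equator, where the absence of
    atoms is the nullity of hyperplanes. *)

Lemma eq_continuous_at (T S : topologicalType) (f g : T -> S) (x : T) :
  f =1 g -> {for x, continuous f} -> {for x, continuous g}.
Proof. by move/funext => ->. Qed.

Lemma continuous_at_sum (R : realType) (T : topologicalType) (I : Type)
    (r : seq I) (P : pred I) (f : I -> T -> R) (x : T) :
  (forall i, P i -> {for x, continuous (f i)}) ->
  {for x, continuous (fun y => \sum_(i <- r | P i) f i y)}.
Proof.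
move=> cf; elim: r => [|i r IH].
  by apply: (@eq_continuous_at _ _ (cst 0)) => [y|]; [rewrite big_nil|exact: cst_continuous].
have [Pi|/negbTE Pi] := boolP (P i); last first.
  by apply: eq_continuous_at IH => y; rewrite big_cons Pi.
apply: (@eq_continuous_at _ _ (f i \+ (fun y => \sum_(i <- r | P i) f i y))).
  by move=> y; rewrite big_cons Pi.
exact: (continuousD (cf i Pi) IH).
Qed.

Section DirectionalDerivative.
Variables (R : realType) (V : normedModType R).
Implicit Types (f : V -> R) (x e : V).

Lemma is_derive_line f x e (t : R) : derivable f (t *: e + x) e ->
  is_derive t 1 (fun s => f (s *: e + x)) ('D_e f (t *: e + x)).
Proof.
move=> df; have E : (fun h : R => h^-1 *: (f ((h *: 1 + t) *: e + x) - f (t *: e + x))) =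
   (fun h : R => h^-1 *: (f (h *: e + (t *: e + x)) - f (t *: e + x))).
  by apply/funext => h; rewrite [h *: 1]mulr1 scalerDl addrA.
split; rewrite /derivable /derive /= ?E //.
Qed.

(** Locating the intermediate point only by [|t| <= |c|] lets one statement serve both signs of
    [c]. *)
Lemma mvt_dir f x e (c : R) :
  (forall t, `|t| <= `|c| -> derivable f (t *: e + x) e) ->
  exists2 t, `|t| <= `|c| & f (c *: e + x) - f x = 'D_e f (t *: e + x) * c.
Proof.
move=> df; pose g s := f (s *: e + x); pose dg s := 'D_e f (s *: e + x).
have gd (t : R) : `|t| <= `|c| -> is_derive t 1 g (dg t).
  by move=> tc; exact/is_derive_line/df.
have gc (a b : R) : (forall t : R, t \in `[a, b] -> `|t| <= `|c|) ->
    {within `[a, b], continuous g}.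
  move=> ab; apply: derivable_within_continuous => t /ab tc.
  by have [] := gd t tc.
have -> : f x = g 0 by rewrite /g scale0r add0r.
have [c0|c0] := leP 0 c.
  have ab (t : R) : t \in `[0, c] -> `|t| <= `|c|.
    by rewrite in_itv/= => /andP[t0 tc]; rewrite !ger0_norm.
  have [t tc E] := MVT_segment c0 (fun t tc => gd t (ab t (subset_itv_oo_cc tc))) (gc _ _ ab).
  by exists t; [exact: ab | rewrite -/(g c) E subr0].
have ab (t : R) : t \in `[c, 0] -> `|t| <= `|c|.
  by rewrite in_itv/= => /andP[t0 tc]; rewrite !ler0_norm ?lerN2// ltW.
have [t tc E] := MVT_segment (ltW c0) (fun t tc => gd t (ab t (subset_itv_oo_cc tc))) (gc _ _ ab).
exists t; first exact: ab.
by rewrite -/(g c) -opprB E sub0r mulrN opprK.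
Qed.

Lemma differentiable_eps (df : {linear V -> R}) f x : continuous df ->
  (forall e : R, 0 < e -> \forall h \near (0 : V), `|f (h + x) - f x - df h| <= e * `|h|) ->
  differentiable f x.
Proof.
move=> dfc H.
have E : f \o shift x = cst (f x) + df +o_ (0 : V) id.
  apply/eqaddoP => e e0; have := H e e0.
  by apply: filterS => h; rewrite !fctE /= opprD addrA.
by apply/diff_locallyP; rewrite (diff_unique dfc E).
Qed.

(** The second difference of [f] over a small parallelogram equals either mixed derivative at some
    point of it, times the square of the side. Continuity of both at [u] then excludes a positive
    gap. *)
Lemma schwarz (U : set V) f a b u : open U -> U u ->
  (forall x, U x -> derivable f x a /\ derivable f x b) ->
  (forall x, U x -> derivable ('D_a f) x b /\ derivable ('D_b f) x a) ->
  {for u, continuous ('D_b ('D_a f))} -> {for u, continuous ('D_a ('D_b f))} ->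
  'D_b ('D_a f) u = 'D_a ('D_b f) u.
Proof.
move=> oU Uu d1 d2 c1 c2.
(* Mean value theorem applied twice: along [p] to the difference of [f] in the direction [r], then
   along [r] to the derivative obtained. *)
have key (p r : V) : (forall x, U x -> derivable f x p) ->
    (forall x, U x -> derivable ('D_p f) x r) -> forall s : R,
    (forall t t', `|t| <= `|s| -> `|t'| <= `|s| -> U (t *: p + (t' *: r + u))) ->
    exists t t' : R, [/\ `|t| <= `|s|, `|t'| <= `|s| &
     f (s *: p + (s *: r + u)) - f (s *: p + u) - f (s *: r + u) + f u =
     'D_r ('D_p f) (t *: p + (t' *: r + u)) * s * s].
  move=> dp dr s sU; pose g y := f (s *: r + y) - f y.
  have sU0 (t : R) : `|t| <= `|s| -> U (t *: p + u).
    by move=> ts; have := sU t 0 ts; rewrite normr0 scale0r add0r; exact.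
  have dsh y : U (s *: r + y) -> is_derive y p (fun y => f (s *: r + y)) ('D_p f (s *: r + y)).
    move=> Uy; have := dp _ Uy.
    have E : (fun h : R => h^-1 *: (f (s *: r + (h *: p + y)) - f (s *: r + y))) =
      (fun h : R => h^-1 *: (f (h *: p + (s *: r + y)) - f (s *: r + y))).
      by apply/funext => h; rewrite addrCA.
    by move=> D; split; rewrite /derivable /derive /= ?E.
  have gd (t : R) : `|t| <= `|s| ->
     is_derive (t *: p + u) p g ('D_p f (s *: r + (t *: p + u)) - 'D_p f (t *: p + u)).
    move=> ts; apply: is_deriveB.
      by apply: dsh; rewrite addrCA; exact: sU.
    by apply/derivableP/dp/sU0.
  have [t ts Et] := @mvt_dir g u p s (fun t ts => @ex_derive _ _ _ _ _ _ _ (gd t ts)).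
  rewrite (@derive_val _ _ _ _ _ _ _ (gd t ts)) in Et.
  have [t' ts' Et'] := @mvt_dir ('D_p f) (t *: p + u) r s
    (fun t' ts' => dr _ (eq_ind _ U (sU t t' ts ts') _ (addrCA _ _ _))).
  exists t, t'; split => //.
  rewrite (addrCA (t *: p)) -Et' -Et /g (addrCA (s *: p)).
  move: (f _) (f _) (f _) (f _) => ? ? ? ?; ring.
apply/eqP; apply/negPn/negP => ne.
pose e := `|'D_b ('D_a f) u - 'D_a ('D_b f) u| / 2.
have e0 : 0 < e by rewrite divr_gt0// normr_gt0 subr_eq0.
have eE : `|'D_b ('D_a f) u - 'D_a ('D_b f) u| = e + e by rewrite /e -splitr.
clearbody e.
have [d /= d0 Hd] : exists2 d : R, 0 < d & forall y, `|u - y| < d ->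
   [/\ U y, `|'D_b ('D_a f) u - 'D_b ('D_a f) y| < e & `|'D_a ('D_b f) u - 'D_a ('D_b f) y| < e].
  have /nbhs_normP[d d0 Hd] : \forall y \near u, [/\ U y,
     `|'D_b ('D_a f) u - 'D_b ('D_a f) y| < e & `|'D_a ('D_b f) u - 'D_a ('D_b f) y| < e].
    have N1 : \forall y \near u, `|'D_b ('D_a f) u - 'D_b ('D_a f) y| < e.
      exact: (cvgrPdist_lt _ _).1 c1 _ e0.
    have N2 : \forall y \near u, `|'D_a ('D_b f) u - 'D_a ('D_b f) y| < e.
      exact: (cvgrPdist_lt _ _).1 c2 _ e0.
    have N3 : \forall y \near u, U y by exact: open_nbhs_nbhs.
    by apply: filterS3 N3 N1 N2 => y; split.
  by exists d.
(* The side for which the whole parallelogram lies in the ball of radius [d]; the added 1 covers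
   [a = b = 0]. *)
pose s := d / (`|a| + `|b| + 1).
have P0 : 0 < `|a| + `|b| + 1 by rewrite ltr_wpDl// addr_ge0.
have s0 : 0 < s by rewrite divr_gt0.
have near_pt (t t' : R) (p r : V) : `|p| + `|r| = `|a| + `|b| -> `|t| <= `|s| -> `|t'| <= `|s| ->
    `|u - (t *: p + (t' *: r + u))| < d.
  move=> pr; rewrite [`|s|]gtr0_norm// => ts ts'.
  rewrite addrA opprD addrCA subrr addr0 normrN.
  rewrite (le_lt_trans (ler_normD _ _))// !normrZ.
  rewrite (@le_lt_trans _ _ (s * (`|a| + `|b|)))//.
    by rewrite -pr mulrDr lerD// ler_wpM2r.
  by rewrite /s mulrAC ltr_pdivrMr// ltr_pM2l// ltrDl.
have [t1 [t2 [h1 h2 E1]]] := key a b (fun x Ux => (d1 x Ux).1) (fun x Ux => (d2 x Ux).1) s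
  (fun t t' ts ts' => let: And3 P _ _ := Hd _ (near_pt t t' a b erefl ts ts') in P).
have [t3 [t4 [h3 h4 E2]]] := key b a (fun x Ux => (d1 x Ux).2) (fun x Ux => (d2 x Ux).2) s
  (fun t t' ts ts' => let: And3 P _ _ := Hd _ (near_pt t t' b a (addrC _ _) ts ts') in P).
have [_ B1 _] := Hd _ (near_pt _ _ a b erefl h1 h2).
have [_ _ B2] := Hd _ (near_pt _ _ b a (addrC _ _) h3 h4).
have EE : 'D_b ('D_a f) (t1 *: a + (t2 *: b + u)) = 'D_a ('D_b f) (t3 *: b + (t4 *: a + u)).
  apply: (mulIf (lt0r_neq0 s0)); apply: (mulIf (lt0r_neq0 s0)).
  apply: (etrans (esym E1)); apply: etrans E2; rewrite (addrCA (s *: a)); congr (_ + _); exact: addrAC.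
have : `|'D_b ('D_a f) u - 'D_a ('D_b f) u| < e + e.
  rewrite EE in B1.
  move: B1 B2; move: ('D_b _ u) ('D_a _ u) ('D_a _ _) => p r z B1 B2.
  have -> : p - r = (p - z) - (r - z) by rewrite opprB addrA subrK.
  exact: le_lt_trans (ler_normB _ _) (ltrD B1 B2).
by rewrite eE ltxx.
Qed.

End DirectionalDerivative.

Section TotalDifferential.
Variables (R : realType) (m : nat).
Implicit Types (f g : 'rV[R]_m -> R) (u h : 'rV[R]_m) (U : set 'rV[R]_m).

Definition pd f (a : 'I_m) : 'rV[R]_m -> R := 'D_(delta_mx 0 a) f.

Lemma norm_delta_mx_le1 (a : 'I_m) : `|delta_mx 0 a : 'rV[R]_m| <= 1.
Proof.
rewrite [`|_|]mx_normrE; apply: bigmax_le => // -[i j] _ /=.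
by rewrite mxE; case: (_ && _); rewrite ?normr1 ?normr0.
Qed.

Lemma norm_coord_le h (a : 'I_m) : `|h 0 a| <= `|h|.
Proof. by rewrite [leRHS]mx_normrE; exact: (le_bigmax _ (fun i => `|h i.1 i.2|) (0, a)). Qed.

Lemma continuous_linear_row (c : 'I_m -> R) :
  continuous (fun h : 'rV[R]_m => \sum_a h 0 a * c a).
Proof.
move=> u; apply: continuous_at_sum => a _.
apply: continuousM; first exact: coord_continuous.
exact: cst_continuous.
Qed.

(** The increment is split into moves along one coordinate at a time. The mean value theorem turns
    each into a partial derivative at a point near [u], where it is [e']-close to its value at
    [u]. *)
Lemma total_differential U f : open U ->
  (forall u, U u -> forall a, derivable f u (delta_mx 0 a)) ->
  (forall u, U u -> forall a, {for u, continuous (pd f a)}) ->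
  forall u, U u -> differentiable f u.
Proof.
move=> oU df cf u Uu.
pose d h := \sum_a h 0 a * pd f a u.
have lin_d : linear d.
  move=> k x y; rewrite /d /GRing.scale/= mulr_sumr -big_split/=.
  by apply: eq_bigr => a _; rewrite !mxE mulrDl mulrA.
pose dL := GRing.isLinear.Build _ _ _ _ d lin_d.
pose dl : {linear _ -> _} := HB.pack d dL.
apply: (@differentiable_eps _ _ dl); first exact: continuous_linear_row.
move=> e e0.
pose e' := e / (m%:R + 1).
have e'0 : 0 < e' by rewrite divr_gt0// ltr_wpDl.
have [r r0 Hr] : exists2 r : R, 0 < r & forall y, `|y| < r -> U (y + u) /\
    forall a, `|pd f a (y + u) - pd f a u| <= e'.
  have N1 : \forall y \near u, U y by exact: open_nbhs_nbhs.
  have N2 : \forall y \near u, forall a, `|pd f a u - pd f a y| <= e'.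
    exact: (@filter_forall _ 'I_m (fun a y => `|pd f a u - pd f a y| <= e') (nbhs u) _
      (fun a => (cvgrPdist_le _ _).1 (cf u Uu a) _ e'0)).
  have [r r0 Hr] := (@nbhs_normP R 'rV[R]_m u _).1 (filterI N1 N2).
  exists r => // y yr; have [] := Hr (y + u).
    by rewrite /ball_ /= opprD addrCA subrr addr0 normrN.
  by move=> /= Uy Hy; split => // a; rewrite distrC.
pose c : R := r / (m%:R + 1).
have c0 : 0 < c by rewrite divr_gt0// ltr_wpDl.
have : \forall h \near (0 : 'rV[R]_m), `|h| < c by exact: nbhs0_lt.
apply: filterS => h hc.
(* Induction on the coordinates already moved. The first bound keeps the intermediate points in the
   ball of radius [r = (m + 1) c], the second accumulates the error. *)
have key (s : seq 'I_m) : (size s <= m)%N ->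
   `|\sum_(a <- s) h 0 a *: delta_mx 0 a : 'rV[R]_m| <= (size s)%:R * `|h| /\
   `|f (\sum_(a <- s) h 0 a *: delta_mx 0 a + u) - f u - \sum_(a <- s) h 0 a * pd f a u|
     <= (size s)%:R * (e' * `|h|).
  elim: s => [|a s IH] sm.
    by rewrite !big_nil add0r subrr subr0 !normr0 !mul0r.
  have [IH1 IH2] := IH (ltnW sm).
  rewrite !big_cons /=; set P := \sum_(_ <- s) _ *: _ in IH1 IH2 *.
  set Q := \sum_(_ <- s) _ in IH2 *.
  have B (t : R) : `|t| <= `|h 0 a| -> `|t *: delta_mx 0 a + P| <= (size s).+1%:R * `|h|.
    move=> th; rewrite (le_trans (ler_normD _ _))// -natr1 mulrDl mul1r addrC lerD//.
    rewrite normrZ (le_trans (ler_pM _ _ th (norm_delta_mx_le1 a)))//.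
    by rewrite mulr1 norm_coord_le.
  have B' (t : R) : `|t| <= `|h 0 a| -> `|t *: delta_mx 0 a + P| < r.
    move=> /B tB; apply: (le_lt_trans tB).
    have -> : r = (m%:R + 1) * c by rewrite /c mulrC divfK// gt_eqF// ltr_wpDl.
    rewrite (@le_lt_trans _ _ ((m%:R + 1) * `|h|))//.
      by rewrite ler_wpM2r// natr1 ler_nat ltnW.
    by rewrite ltr_pM2l// ltr_wpDl.
  split; first exact: B.
  have dfP (t : R) : `|t| <= `|h 0 a| -> derivable f (t *: delta_mx 0 a + (P + u)) (delta_mx 0 a).
    by move=> /B' /Hr[HU _]; apply: df; rewrite addrA.
  have [t th E] := mvt_dir dfP.
  have := (Hr _ (B' _ th)).2 a; rewrite -addrA => Ha.
  rewrite -[_ + P + u]addrA.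
  have -> : f (h 0 a *: delta_mx 0 a + (P + u)) - f u - (h 0 a * pd f a u + Q) =
    (f (h 0 a *: delta_mx 0 a + (P + u)) - f (P + u) - h 0 a * pd f a u)
     + (f (P + u) - f u - Q).
    move: (f _) (f _) (f _) (h 0 a * _) => ? ? ? ?; ring.
  rewrite (le_trans (ler_normD _ _))// -natr1 mulrDl mul1r addrC lerD//.
  rewrite E -/(pd f a) [h 0 a * _]mulrC -mulrBl normrM.
  by rewrite ler_pM// norm_coord_le.
have := (key (enum 'I_m) _).2.
rewrite size_enum_ord => /(_ (leqnn m)).
rewrite !big_enum/= -[\sum_(i in 'I_m) _ *: _]row_sum_delta.
move=> K; apply: (le_trans K).
rewrite mulrA ler_wpM2r// /e' mulrCA ger_pMr// ler_pdivrMr ?ltr_wpDl// mul1r.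
by rewrite lerDl.
Qed.

End TotalDifferential.

Section C1Functions.
Variables (R : realType) (m : nat) (U : set 'rV[R]_m).
Hypothesis oU : open U.
Implicit Types (f g : 'rV[R]_m -> R) (u h : 'rV[R]_m).

Definition C1 f := forall u, U u ->
  differentiable f u /\ forall a, {for u, continuous (pd f a)}.

Lemma open_near_eq (T : Type) (f g : 'rV[R]_m -> T) u : U u ->
  (forall v, U v -> f v = g v) -> \forall v \near u, f v = g v.
Proof.
move=> Uu fg; have : \forall v \near u, U v by exact: open_nbhs_nbhs.
by apply: filterS => v /fg.
Qed.

Lemma continuous_at_eq_on (T : topologicalType) (f g : 'rV[R]_m -> T) u : U u ->
  (forall v, U v -> f v = g v) -> {for u, continuous f} -> {for u, continuous g}.
Proof.
move=> Uu fg cf; rewrite /prop_for /continuous_at -(fg u Uu).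
exact: (cvg_trans (near_eq_cvg (open_near_eq Uu fg)) cf).
Qed.

Lemma pd_eq_on f g u a : U u -> (forall v, U v -> f v = g v) -> pd f a u = pd g a u.
Proof. by move=> Uu fg; apply: near_eq_derive; exact: open_near_eq. Qed.

Lemma C1_intro f (df : 'I_m -> 'rV[R]_m -> R) :
  (forall u, U u -> differentiable f u) ->
  (forall u a, U u -> pd f a u = df a u) ->
  (forall u a, U u -> {for u, continuous (df a)}) -> C1 f.
Proof.
move=> Df Ef Cf u Uu; split=> [|a]; first exact: Df.
by apply: (@continuous_at_eq_on _ (df a)) (Cf _ _ Uu) => // v Uv; rewrite Ef.
Qed.

Lemma C1_partials f :
  (forall u, U u -> forall a, derivable f u (delta_mx 0 a)) ->
  (forall u, U u -> forall a, {for u, continuous (pd f a)}) -> C1 f.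
Proof.
by move=> df cf u Uu; split; [exact: (total_differential oU df cf) | exact: cf].
Qed.

Lemma C1_diff f u : C1 f -> U u -> differentiable f u.
Proof. by move=> /[apply] -[]. Qed.

Lemma C1_pd f u a : C1 f -> U u -> {for u, continuous (pd f a)}.
Proof. by move=> /[apply] -[]. Qed.

Lemma C1_derivable f u v : C1 f -> U u -> derivable f u v.
Proof. by move=> Cf Uu; apply/diff_derivable/C1_diff. Qed.

Lemma C1_continuous f u : C1 f -> U u -> {for u, continuous f}.
Proof. by move=> Cf Uu; exact/differentiable_continuous/C1_diff. Qed.

Lemma eq_C1 f g : (forall u, U u -> f u = g u) -> C1 f -> C1 g.
Proof.
move=> fg Cf; apply: C1_partials => u Uu a.
  by apply: (near_eq_derivable _ (C1_derivable Cf Uu)); exact: open_near_eq.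
apply: (@continuous_at_eq_on _ (pd f a)) (C1_pd Cf Uu) => // v Uv.
exact: pd_eq_on.
Qed.

Lemma pd_cst (c : R) a u : pd (cst c) a u = 0.
Proof. exact: derive_cst. Qed.

Lemma C1_cst (c : R) : C1 (cst c).
Proof.
apply: (@C1_intro _ (fun _ => cst 0)) => [u _|u a _|u a _].
- exact: differentiable_cst.
- exact: pd_cst.
- exact: cst_continuous.
Qed.

Lemma pdD f g a u : C1 f -> C1 g -> U u -> pd (f \+ g) a u = pd f a u + pd g a u.
Proof. by move=> Cf Cg Uu; rewrite /pd deriveD//; exact: C1_derivable. Qed.

Lemma C1D f g : C1 f -> C1 g -> C1 (f \+ g).
Proof.
move=> Cf Cg; apply: (@C1_intro _ (fun a => pd f a \+ pd g a)) => [u Uu|u a Uu|u a Uu].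
- by apply: differentiableD; exact: C1_diff.
- exact: pdD.
- exact: continuousD (C1_pd Cf Uu) (C1_pd Cg Uu).
Qed.

Lemma pdM f g a u : C1 f -> C1 g -> U u ->
  pd (f \* g) a u = pd f a u * g u + f u * pd g a u.
Proof.
move=> Cf Cg Uu; rewrite /pd deriveM; [|exact: C1_derivable..].
by rewrite /GRing.scale/= addrC mulrC [in X in _ + X]mulrC mulrC [in X in _ + X]mulrC (mulrC (g u)).
Qed.

Lemma C1M f g : C1 f -> C1 g -> C1 (f \* g).
Proof.
move=> Cf Cg.
apply: (@C1_intro _ (fun a => (pd f a \* g) \+ (f \* pd g a))) => [u Uu|u a Uu|u a Uu].
- by apply: differentiableM; exact: C1_diff.
- exact: pdM.
- apply: continuousD; apply: continuousM.
  + exact: C1_pd.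
  + exact: C1_continuous.
  + exact: C1_continuous.
  + exact: C1_pd.
Qed.

Lemma pd_comp f (phi : R -> R) a u : C1 f -> U u -> derivable phi (f u) 1 ->
  pd (phi \o f) a u = derive1 phi (f u) * pd f a u.
Proof.
move=> Cf Uu dphi; rewrite /pd deriveE; last first.
  by apply: differentiable_comp; [exact: C1_diff|exact/derivable1_diffP].
rewrite diff_comp; [|exact: C1_diff|exact/derivable1_diffP].
rewrite /= deriv1E// -deriveE//; last exact: C1_diff.
by rewrite mulrC.
Qed.

Lemma C1_comp f (phi : R -> R) : C1 f ->
  (forall u, U u -> derivable phi (f u) 1) ->
  (forall u, U u -> {for f u, continuous (derive1 phi)}) -> C1 (phi \o f).
Proof.
move=> Cf dphi cphi.
apply: (@C1_intro _ (fun a => (derive1 phi \o f) \* pd f a)) => [u Uu|u a Uu|u a Uu].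
- by apply: differentiable_comp; [exact: C1_diff|exact/derivable1_diffP/dphi].
- by rewrite pd_comp//; exact: dphi.
- apply: continuousM; last exact: C1_pd.
  by apply: continuous_comp; [exact: C1_continuous|exact: cphi].
Qed.

Lemma pd_scale (c : R) f a u : C1 f -> U u -> pd (fun x => c * f x) a u = c * pd f a u.
Proof.
move=> Cf Uu; have := pdM a (C1_cst c) Cf Uu.
by rewrite pd_cst mul0r add0r.
Qed.

Lemma C1_scale (c : R) f : C1 f -> C1 (fun x => c * f x).
Proof. by move=> Cf; exact: (C1M (C1_cst c)). Qed.

Lemma C1_sum (I : Type) (r : seq I) (P : pred I) (f : I -> 'rV[R]_m -> R) :
  (forall i, P i -> C1 (f i)) -> C1 (fun u => \sum_(i <- r | P i) f i u).
Proof.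
move=> Cf; elim: r => [|i r IH].
  by apply: eq_C1 (C1_cst 0) => u _; rewrite big_nil.
have [Pi|/negbTE Pi] := boolP (P i); last by apply: eq_C1 IH => u _; rewrite big_cons Pi.
by apply: eq_C1 (C1D (Cf i Pi) IH) => u _; rewrite big_cons Pi.
Qed.

Lemma pd_sum (I : Type) (r : seq I) (P : pred I) (f : I -> 'rV[R]_m -> R) a u :
  (forall i, P i -> C1 (f i)) -> U u ->
  pd (fun u => \sum_(i <- r | P i) f i u) a u = \sum_(i <- r | P i) pd (f i) a u.
Proof.
move=> Cf Uu; elim: r => [|i r IH].
  rewrite big_nil; apply: (etrans _ (pd_cst 0 a u)).
  by apply: pd_eq_on => // v _; rewrite big_nil.
rewrite big_cons; have [Pi|/negbTE Pi] := boolP (P i); last first.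
  by rewrite -IH; apply: pd_eq_on => // v _; rewrite big_cons Pi.
rewrite -IH -pdD//; last 2 first.
- exact: Cf.
- exact: C1_sum.
by apply: pd_eq_on => // v _; rewrite big_cons Pi.
Qed.

Lemma C1_prod (I : Type) (r : seq I) (P : pred I) (f : I -> 'rV[R]_m -> R) :
  (forall i, P i -> C1 (f i)) -> C1 (fun u => \prod_(i <- r | P i) f i u).
Proof.
move=> Cf; elim: r => [|i r IH].
  by apply: eq_C1 (C1_cst 1) => u _; rewrite big_nil.
have [Pi|/negbTE Pi] := boolP (P i); last by apply: eq_C1 IH => u _; rewrite big_cons Pi.
by apply: eq_C1 (C1M (Cf i Pi) IH) => u _; rewrite big_cons Pi.
Qed.

Lemma pd_prod (I : eqType) (r : seq I) (f : I -> 'rV[R]_m -> R) a u :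
  uniq r -> (forall i, C1 (f i)) -> U u ->
  pd (fun u => \prod_(i <- r) f i u) a u =
  \sum_(k <- r) pd (f k) a u * \prod_(i <- r | i != k) f i u.
Proof.
move=> ur Cf Uu; elim: r ur => [_|i r IH /= /andP[ir ur]].
  rewrite big_nil; apply: (etrans _ (pd_cst 1 a u)).
  by apply: pd_eq_on => // v _; rewrite big_nil.
rewrite -(@pd_eq_on (f i \* (fun u => \prod_(i <- r) f i u)))//; last first.
  by move=> v _; rewrite big_cons.
rewrite pdM//; last exact: C1_prod.
rewrite IH// big_cons big_cons eqxx/=; congr (_ * _ + _).
  rewrite big_seq [RHS]big_seq_cond; apply: eq_bigl => j.
  by have [jr|//] := boolP (j \in r); rewrite andTb; apply/esym; apply: contraNneq ir => <-.
rewrite big_distrr/= big_seq [RHS]big_seq; apply: eq_bigr => k kr.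
rewrite big_cons (_ : i != k); first by rewrite mulrCA.
by apply: contraNneq ir => ->.
Qed.

Lemma C1V f : C1 f -> (forall u, U u -> f u != 0) -> C1 (fun u => (f u)^-1).
Proof.
move=> Cf f0; apply: (@C1_comp f (fun x => x^-1)) => // u Uu.
  by apply: derivableV => //; exact: f0.
have E : forall x : R, x != 0 -> derive1 (fun x : R => x^-1) x = - x ^- 2.
  move=> x x0; rewrite derive1E deriveV//.
  by rewrite derive_id /GRing.scale/= mulr1.
have : {for f u, continuous (fun x : R => - (x ^+ 2)^-1)}.
  apply: continuousN; apply: continuousV; first by rewrite sqrf_eq0 f0.
  exact: exprn_continuous.
rewrite /prop_for /continuous_at E ?f0// => H; apply: (cvg_trans _ H).
apply: near_eq_cvg; near=> x; rewrite E//; near: x.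
exact: (open_nbhs_nbhs (conj (@open_neq _ 0) (f0 _ Uu))).
Unshelve. all: by end_near. Qed.

Lemma C1_sqrt f : C1 f -> (forall u, U u -> 0 < f u) -> C1 (fun u => Num.sqrt (f u)).
Proof.
move=> Cf f0; apply: (@C1_comp f (@Num.sqrt R)) => // u Uu.
  by have [] := is_derive1_sqrt (f0 _ Uu).
have E : forall x : R, 0 < x -> derive1 (@Num.sqrt R) x = (2 * Num.sqrt x)^-1.
  by move=> x x0; rewrite derive1E; have [_ ->] := is_derive1_sqrt x0.
have : {for f u, continuous (fun x : R => (2 * Num.sqrt x)^-1)}.
  apply: continuousV; first by rewrite mulf_neq0// gt_eqF// sqrtr_gt0 f0.
  by apply: continuousM; [exact: cst_continuous|exact: sqrt_continuous].
rewrite /prop_for /continuous_at E ?f0// => H; apply: (cvg_trans _ H).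
apply: near_eq_cvg; near=> x; rewrite E//; near: x.
exact: (open_nbhs_nbhs (conj (@open_gt _ 0) (f0 _ Uu))).
Unshelve. all: by end_near. Qed.

End C1Functions.

(** * Immersed patches *)

Section CrossProduct.
Variables (R : realType) (n : nat).
Implicit Types (J : 'M[R]_(n, n.+1)) (u v : 'rV[R]_n.+1).

Definition cross J : 'rV[R]_n.+1 := \row_(j < n.+1) ((-1) ^+ j * \det (col' j J)).

Lemma mulmx_trE (p q r : nat) (A : 'M[R]_(p, q)) (B : 'M[R]_(r, q)) a b :
  (A *m B^T) a b = \sum_j A a j * B b j.
Proof. by rewrite mxE; apply: eq_bigr => j _; rewrite mxE. Qed.

Lemma edotE m (u v : 'rV[R]_m) : edot u v = (u *m v^T) 0 0.
Proof. by rewrite !mxE; apply: eq_bigr => j _; rewrite !mxE. Qed.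

Lemma edot_ge0 m (u : 'rV[R]_m) : 0 <= edot u u.
Proof. by apply: sumr_ge0 => j _; rewrite -expr2 sqr_ge0. Qed.

Lemma edot_eq0 m (u : 'rV[R]_m) : (edot u u == 0) = (u == 0).
Proof.
rewrite psumr_eq0; last by move=> j _; rewrite -expr2 sqr_ge0.
apply/idP/eqP => [/allP u0|->]; last by apply/allP => j _; rewrite !mxE mulr0 eqxx.
apply/rowP => j; rewrite mxE; apply/eqP.
by have := u0 j (mem_index_enum j); rewrite mulf_eq0 orbb.
Qed.

Lemma edot_gt0 m (u : 'rV[R]_m) : u != 0 -> 0 < edot u u.
Proof. by move=> u0; rewrite lt_neqAle edot_ge0 andbT eq_sym edot_eq0. Qed.

Lemma enorm_ge0 m (u : 'rV[R]_m) : 0 <= enorm u.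
Proof. exact: sqrtr_ge0. Qed.

Lemma sqr_enorm m (u : 'rV[R]_m) : enorm u ^+ 2 = edot u u.
Proof. by rewrite sqr_sqrtr// edot_ge0. Qed.

(** Laplace expansion along the added first row: the entries of [cross J] are the cofactors of that
    row. *)
Lemma det_cross v J : \det (col_mx v J : 'M[R]_(1 + n)) = edot v (cross J).
Proof.
rewrite (expand_det_row _ (lshift n 0)) /edot; apply: eq_bigr => j _.
rewrite (col_mxEu v J 0 j) mxE /cofactor /= add0n; congr (_ * (_ * \det _)).
apply/matrixP => a b; rewrite !mxE; case: splitP => k /=.
  by case: k => -[]//= _; rewrite /bump.
rewrite /bump/= add1n => -[] E; congr (J _ _).
by apply/val_inj; rewrite /= E.
Qed.

Lemma cross_ortho J (c : 'I_n) : edot (row c J) (cross J) = 0.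
Proof.
rewrite -det_cross; apply: (@determinant_alternate _ _ _ (lshift n 0) (rshift 1 c)).
  by rewrite eq_lrshift.
by move=> j; rewrite col_mxEu col_mxEd mxE.
Qed.

Definition posdef m (G : 'M[R]_m) := forall v : 'rV_m, v != 0 -> 0 < (v *m G *m v^T) 0 0.

Lemma posdef_unit m (G : 'M[R]_m) : posdef G -> G \in unitmx.
Proof.
move=> pG; rewrite -row_free_unit -kermx_eq0; apply/negPn/negP => /rowV0Pn[v].
move=> /sub_kermxP vG v0; have := pG v v0.
by rewrite vG mul0mx mxE ltxx.
Qed.

Lemma gram_bordered v J : v *m J^T = 0 ->
  (col_mx v J : 'M[R]_(1 + n)) *m (col_mx v J)^T = block_mx (edot v v)%:M 0 0 (J *m J^T).
Proof.
move=> vJ; rewrite tr_col_mx mul_col_row vJ; congr block_mx.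
  by apply/matrixP => i j; rewrite !ord1 -edotE mxE eqxx.
by rewrite -[J *m v^T]trmxK trmx_mul trmxK vJ trmx0.
Qed.

Lemma row_ortho v J : v *m J^T = 0 <-> forall c, edot (row c J) v = 0.
Proof.
have E c : (v *m J^T) 0 c = edot (row c J) v.
  by rewrite /edot mxE; apply: eq_bigr => j _; rewrite !mxE mulrC.
split=> [vJ c|H]; first by rewrite -E vJ mxE.
by apply/rowP => c; rewrite E H mxE.
Qed.

Lemma cross_mul0 J : cross J *m J^T = 0.
Proof. by apply/row_ortho => c; exact: cross_ortho. Qed.

(** By dimension some nonzero [v] is orthogonal to the rows of [J]. Bordering [J] with [v] gives a
    block-diagonal Gram matrix of nonzero determinant, and that determinant is the square of
    [edot v (cross J)]. *)
Lemma cross_neq0 J : posdef (J *m J^T) -> cross J != 0.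
Proof.
move=> /posdef_unit uG; apply/negP => /eqP N0.
have : kermx J^T != 0.
  rewrite -mxrank_eq0 mxrank_ker -lt0n subn_gt0.
  exact: leq_ltn_trans (rank_leq_col _) _.
move=> /rowV0Pn[v /sub_kermxP vJ v0].
have := congr1 determinant (gram_bordered vJ).
rewrite det_mulmx det_tr det_cross N0.
have -> : edot v 0 = 0 by apply: big1 => j _; rewrite mxE mulr0.
rewrite mul0r det_ublock det_scalar1 => /esym/eqP.
rewrite mulf_eq0 edot_eq0 (negbTE v0)/= => /eqP dG.
by move: uG; rewrite unitmxE dG unitr0.
Qed.

(** Border [J] with [N = cross J]: the determinant is [edot N N], its square is [edot N N] times the
    Gram determinant, and one factor cancels. *)
Lemma edot_cross J : posdef (J *m J^T) -> edot (cross J) (cross J) = \det (J *m J^T).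
Proof.
move=> pG; have N0 := cross_neq0 pG.
have := congr1 determinant (gram_bordered (cross_mul0 J)).
rewrite det_mulmx det_tr det_cross det_ublock det_scalar1.
by apply: mulfI; rewrite edot_eq0.
Qed.

Lemma det_gram_gt0 J : posdef (J *m J^T) -> 0 < \det (J *m J^T).
Proof. by move=> pG; rewrite -edot_cross// edot_gt0// cross_neq0. Qed.

(* [J; v] is square and its Gram matrix is block diagonal, which gives its inverse. *)
Lemma tangent_projection J v : J *m J^T \in unitmx -> v *m J^T = 0 -> edot v v = 1 ->
  J^T *m invmx (J *m J^T) *m J = 1%:M - v^T *m v.
Proof.
move=> uG vJ v1; pose K : 'M[R]_(1 + n) := col_mx v J.
pose D' : 'M[R]_(1 + n) := block_mx 1%:M 0 0 (invmx (J *m J^T)).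
have KD : K *m (K^T *m D') = 1%:M.
  rewrite mulmxA gram_bordered// v1 mulmx_block !mul0mx !mulmx0 !addr0 !add0r.
  by rewrite mulmx1 mulmxV// -scalar_mx_block.
have := mulmx1C KD; rewrite /K /D' tr_col_mx mul_row_block !mulmx0 addr0 add0r mulmx1.
by rewrite mul_row_col => <-; rewrite addrC addKr.
Qed.

End CrossProduct.

Section DetDerivative.
Variables (R : realType) (m k : nat) (U : set 'rV[R]_m).
Hypothesis oU : open U.
Variable A : 'rV[R]_m -> 'M[R]_k.
Hypothesis CA : forall i j, C1 U (fun u => A u i j).

Lemma C1_det : C1 U (fun u => \det (A u)).
Proof.
apply: C1_sum => // s _; apply: C1_scale => //; apply: C1_prod => // i _; exact: CA.
Qed.

(** Jacobi's formula. The product rule in the Leibniz sum differentiates one row at a time; each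
    resulting determinant is expanded along its differentiated row. *)
Lemma pd_det u a : U u -> pd (fun u => \det (A u)) a u =
  \sum_i \sum_j pd (fun u => A u i j) a u * cofactor (A u) i j.
Proof.
move=> Uu; rewrite /determinant (pd_sum oU) //; last first.
  by move=> s _; apply: C1_scale => //; apply: C1_prod => // i _; exact: CA.
pose B l := \matrix_(i, j) if i == l then pd (fun u => A u i j) a u else A u i j.
transitivity (\sum_l \det (B l)).
  rewrite exchange_big/=; apply: eq_bigr => s _.
  rewrite (pd_scale oU) //; last by apply: C1_prod => // i _; exact: CA.
  rewrite -mulr_sumr; congr (_ * _); rewrite (pd_prod oU) ?index_enum_uniq//.
  apply: eq_bigr => l _; rewrite [RHS](bigD1 l)//= mxE eqxx; congr (_ * _).
  by apply: eq_bigr => i /negbTE il; rewrite mxE il.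
apply: eq_bigr => l _; rewrite (expand_det_row _ l); apply: eq_bigr => j _.
rewrite mxE eqxx; congr (_ * (_ * \det _)).
by apply/matrixP => i i'; rewrite !mxE eq_sym (negbTE (neq_lift _ _)).
Qed.

End DetDerivative.

Lemma C1_invmx (R : realType) (m k : nat) (U : set 'rV[R]_m) (A : 'rV[R]_m -> 'M[R]_k) i j :
  open U -> (forall i j, C1 U (fun u => A u i j)) -> (forall u, U u -> A u \in unitmx) ->
  C1 U (fun u => invmx (A u) i j).
Proof.
move=> oU CA uA; pose g u := (\det (A u))^-1 * cofactor (A u) j i.
apply: (@eq_C1 _ _ _ oU g) => [u Uu|].
  by rewrite /invmx uA// mxE mxE.
apply: C1M => //; first by apply: C1V => //; [exact: C1_det|move=> u /uA; rewrite unitmxE unitfE].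
apply: C1_scale => //; apply: C1_det => // a b.
by apply: (eq_C1 oU _ (CA (lift j a) (lift i b))) => u _; rewrite !mxE.
Qed.

Section Jacobian.
Variables (R : realType) (m : nat) (U : set 'rV[R]_m).
Hypothesis oU : open U.

Lemma pd_coord l (F : 'rV[R]_m -> 'rV[R]_l) u a j : derivable F u (delta_mx 0 a) ->
  pd (fun u => F u 0 j) a u = 'D_(delta_mx 0 a) F u 0 j.
Proof. by move=> dF; rewrite derive_mx// mxE. Qed.

Lemma continuous_at_coord l (T : topologicalType) (F : T -> 'rV[R]_l) u j :
  {for u, continuous F} -> {for u, continuous (fun u => F u 0 j)}.
Proof.
move=> cF; apply: (@continuous_comp _ _ _ F (fun M : 'rV[R]_l => M 0 j) u cF).
exact: coord_continuous.
Qed.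

Lemma smooth_C1_gen l (F : 'rV[R]_m -> 'rV[R]_l) j k : Ck k.+1 U F ->
  C1 U (fun u => F u 0 j).
Proof.
move=> [_ HF]; apply: (C1_partials oU) => u Uu a.
  by have [/(_ u Uu)/derivable_mxP/(_ 0 j)] := HF a.
have [dF [cF _]] : (forall u, U u -> derivable F u (delta_mx 0 a)) /\
    (forall u, U u -> {for u, continuous ('D_(delta_mx 0 a) F)}) /\ True.
  by have [H1 H2] := HF a; split=> //; split => //; case: k H2 {HF} => [[]|k []].
apply: (continuous_at_eq_on oU Uu (f := fun u => 'D_(delta_mx 0 a) F u 0 j)).
  by move=> v Uv; rewrite pd_coord//; exact: dF.
exact: continuous_at_coord (cF _ Uu).
Qed.

Lemma smooth_C1 l (F : 'rV[R]_m -> 'rV[R]_l) j : smooth_on U F ->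
  C1 U (fun u => F u 0 j).
Proof. by move=> /(_ 1%N); exact: smooth_C1_gen. Qed.

Lemma smooth_pd_C1 l (F : 'rV[R]_m -> 'rV[R]_l) j a : smooth_on U F ->
  C1 U (pd (fun u => F u 0 j) a).
Proof.
move=> /(_ 2%N)[_ /(_ a)[dF H]].
apply: (eq_C1 oU _ (@smooth_C1_gen _ _ j 0%N H)) => u Uu.
by rewrite pd_coord//; exact: dF.
Qed.

Lemma differentiable_row l (F : 'rV[R]_m -> 'rV[R]_l) u :
  (forall j, differentiable (fun u => F u 0 j) u) -> differentiable F u.
Proof.
move=> dF; have -> : F = \sum_(j < l) (fun u => F u 0 j *: (delta_mx 0 j : 'rV[R]_l)).
  apply/funext => v; rewrite fct_sumE; exact: row_sum_delta.
by apply: differentiable_sum => j; exact: differentiableZl.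
Qed.

Lemma jacobianE l (F : 'rV[R]_m -> 'rV[R]_l) u a j : differentiable F u ->
  'J F u a j = pd (fun u => F u 0 j) a u.
Proof.
move=> dF; rewrite pd_coord; last exact: diff_derivable.
by rewrite deriveEjacobian// -rowE [RHS]mxE.
Qed.

Lemma C1_jacobianE l (F : 'rV[R]_m -> 'rV[R]_l) u a j :
  (forall j, C1 U (fun u => F u 0 j)) -> U u -> 'J F u a j = pd (fun u => F u 0 j) a u.
Proof. by move=> CF Uu; apply: jacobianE; apply: differentiable_row => i; exact: C1_diff. Qed.

End Jacobian.

(** * The mean curvature vector as a divergence *)

Section ImmersedPatch.
Variables (R : realType) (n : nat) (U : set 'rV[R]_n).
Hypothesis oU : open U.
Variable F : 'rV[R]_n -> 'rV[R]_n.+1.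
Hypothesis sF : smooth_on U F.
Hypothesis pF : forall u, U u -> posdef (gram F u).

Let J a j := pd (fun u => F u 0 j) a.
Let nu := unit_normal F.

Lemma patch_jacobian u a j : U u -> 'J F u a j = J a j u.
Proof. by move=> Uu; apply: (@C1_jacobianE _ _ U) => // i; exact: smooth_C1. Qed.

Lemma C1_jac a j : C1 U (fun u => 'J F u a j).
Proof.
by apply: (eq_C1 oU _ (smooth_pd_C1 oU j a sF)) => u Uu; rewrite patch_jacobian.
Qed.

Lemma pd_jacC a c j u : U u ->
  pd (fun u => 'J F u c j) a u = pd (fun u => 'J F u a j) c u.
Proof.
move=> Uu.
rewrite -(pd_eq_on (f := J c j) oU a Uu) => [|v Uv]; last by rewrite patch_jacobian.
rewrite -(pd_eq_on (f := J a j) oU c Uu) => [|v Uv]; last by rewrite patch_jacobian.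
have CF := smooth_C1 oU j sF.
apply: (schwarz oU Uu) => [x Ux|x Ux||].
- by split; apply: C1_derivable Ux.
- by split; apply: (C1_derivable (smooth_pd_C1 oU j _ sF)).
- exact: (@C1_pd _ _ _ _ u a (smooth_pd_C1 oU j c sF) Uu).
- exact: (@C1_pd _ _ _ _ u c (smooth_pd_C1 oU j a sF) Uu).
Qed.

Lemma gramE a b u : gram F u a b = \sum_j 'J F u a j * 'J F u b j.
Proof. exact: mulmx_trE. Qed.

Lemma C1_gram a b : C1 U (fun u => gram F u a b).
Proof.
apply: (eq_C1 oU (f := fun u => \sum_j 'J F u a j * 'J F u b j)) => [u _|].
  by rewrite gramE.
by apply: C1_sum => // j _; apply: C1M => //; exact: C1_jac.
Qed.

Lemma pd_gram a b c u : U u -> pd (fun u => gram F u a b) c u =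
  \sum_j (pd (fun u => 'J F u a j) c u * 'J F u b j + 'J F u a j * pd (fun u => 'J F u b j) c u).
Proof.
move=> Uu; rewrite -(pd_eq_on (f := fun u => \sum_j 'J F u a j * 'J F u b j) oU c Uu); last first.
  by move=> v _; rewrite gramE.
rewrite (pd_sum oU)//; last by move=> j _; apply: C1M => //; exact: C1_jac.
by apply: eq_bigr => j _; rewrite (pdM _ (C1_jac a j) (C1_jac b j) Uu).
Qed.

Lemma C1_cross j : C1 U (fun u => cross ('J F u) 0 j).
Proof.
apply: (eq_C1 oU (f := fun u => (-1) ^+ j * \det (col' j ('J F u)))) => [u _|].
  by rewrite mxE.
apply: C1_scale => //; apply: C1_det => // a b.
by apply: (eq_C1 oU _ (C1_jac a (lift j b))) => u _; move: ('J F u) => J'; rewrite mxE.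
Qed.

Lemma unit_normalE u j : nu u 0 j = (enorm (cross ('J F u)))^-1 * cross ('J F u) 0 j.
Proof. by rewrite mxE. Qed.

Lemma enorm_cross u : U u -> enorm (cross ('J F u)) = Num.sqrt (\det (gram F u)).
Proof. by move=> Uu; rewrite /enorm edot_cross//; exact: pF. Qed.

Lemma det_gt0 u : U u -> 0 < \det (gram F u).
Proof. by move=> Uu; apply: det_gram_gt0; exact: pF. Qed.

Lemma sqrt_det_gt0 u : U u -> 0 < Num.sqrt (\det (gram F u)).
Proof. by move=> Uu; rewrite sqrtr_gt0 det_gt0. Qed.

Lemma C1_sqrt_det : C1 U (fun u => Num.sqrt (\det (gram F u))).
Proof. by apply: (C1_sqrt oU) det_gt0; apply: (C1_det oU); exact: C1_gram. Qed.

Lemma C1_nu j : C1 U (fun u => nu u 0 j).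
Proof.
apply: (eq_C1 oU (f := fun u => (Num.sqrt (\det (gram F u)))^-1 * cross ('J F u) 0 j)) => [u Uu|].
  by rewrite unit_normalE enorm_cross.
apply: C1M => //; last exact: C1_cross.
by apply: (C1V oU) C1_sqrt_det _ => u Uu; rewrite gt_eqF// sqrt_det_gt0.
Qed.

Lemma nu_ortho u : nu u *m ('J F u)^T = 0.
Proof. by rewrite -scalemxAl cross_mul0 scaler0. Qed.

Lemma nu_unit u : U u -> edot (nu u) (nu u) = 1.
Proof.
move=> Uu; have N0 := cross_neq0 (pF Uu).
have -> : edot (nu u) (nu u) = (enorm (cross ('J F u)))^-1 ^+ 2 * edot (cross ('J F u)) (cross ('J F u)).
  rewrite /edot mulr_sumr; apply: eq_bigr => j _; rewrite !unit_normalE; ring.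
by rewrite exprVn sqr_enorm mulVf// edot_eq0.
Qed.

Lemma gram_unit u : U u -> gram F u \in unitmx.
Proof. by move=> Uu; apply: posdef_unit; exact: pF. Qed.

Let Gi a b u := invmx (gram F u) a b.
Let sg u := Num.sqrt (\det (gram F u)).

(* The field E_a = sqrt(det G) G^{ab} d_b F, whose divergence is minus the mean curvature vector density. *)
Definition flux a j u :=
  Num.sqrt (\det (gram F u)) * (invmx (gram F u) *m 'J F u) a j.

Lemma C1_Gi a b : C1 U (Gi a b).
Proof. by apply: (C1_invmx _ _ oU) => [i j|u]; [exact: C1_gram|exact: gram_unit]. Qed.

Lemma C1_flux a j : C1 U (flux a j).
Proof.
apply: C1M => //; first exact: C1_sqrt_det.
apply: (eq_C1 oU (f := fun u => \sum_b Gi a b u * 'J F u b j)) => [u _|].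
  by rewrite [RHS]mxE.
by apply: C1_sum => // b _; apply: C1M => //; [exact: C1_Gi|exact: C1_jac].
Qed.

Lemma Gi_sym a b u : Gi a b u = Gi b a u.
Proof.
rewrite /Gi -[in LHS](trmxK (invmx _)) mxE trmx_inv.
by rewrite /gram trmx_mul trmxK.
Qed.

Lemma flux_mul a (v : 'rV[R]_n.+1) u : \sum_j flux a j u * v 0 j =
  sg u * (invmx (gram F u) *m 'J F u *m v^T) a 0.
Proof. by rewrite mulmx_trE mulr_sumr; apply: eq_bigr => j _; rewrite /flux mulrA. Qed.

Lemma flux_nu a u : \sum_j flux a j u * nu u 0 j = 0.
Proof.
rewrite flux_mul -mulmxA -[_ *m (nu u)^T]trmxK trmx_mul trmxK nu_ortho.
by rewrite trmx0 mulmx0 mxE mulr0.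
Qed.

Lemma flux_tangent a c u : U u -> \sum_j flux a j u * 'J F u c j = sg u * (a == c)%:R.
Proof.
move=> Uu; have -> : (a == c)%:R = (1%:M : 'M[R]_n) a c by rewrite mxE.
rewrite -(mulVmx (gram_unit Uu)) /gram mulmxA mulmx_trE mulr_sumr.
by apply: eq_bigr => j _; rewrite /flux mulrA.
Qed.

(** Differentiating the orthogonality [flux_nu] moves the derivative from the field to the normal,
    where it produces the second fundamental form. *)
Lemma div_flux_nu u : U u -> \sum_j (\sum_a pd (flux a j) a u) * nu u 0 j =
  - (sg u * \tr (invmx (gram F u) *m second_form F nu u)).
Proof.
move=> Uu.
have D a : \sum_j (pd (flux a j) a u * nu u 0 j + flux a j u * pd (fun u => nu u 0 j) a u) = 0.
  apply: (etrans _ (pd_cst 0 a u)).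
  rewrite -(pd_eq_on (f := fun u => \sum_j flux a j u * nu u 0 j) oU a Uu); last first.
    by move=> v Uv; rewrite flux_nu.
  rewrite (pd_sum oU)//; last by move=> j _; apply: C1M => //; [exact: C1_flux|exact: C1_nu].
  by apply: eq_bigr => j _; rewrite (pdM _ (C1_flux a j) (C1_nu j) Uu).
have -> : \sum_j (\sum_a pd (flux a j) a u) * nu u 0 j =
   - \sum_a \sum_j flux a j u * pd (fun u => nu u 0 j) a u.
  under eq_bigr do rewrite mulr_suml.
  rewrite exchange_big/= -sumrN; apply: eq_bigr => a _; apply/eqP.
  by rewrite -addr_eq0 -big_split/= D.
congr (- _); rewrite /second_form mxtrace_mulC -mulmxA -[X in \tr (_ *m X)]trmxK trmx_mul trmxK.
rewrite /mxtrace mulr_sumr; apply: eq_bigr => a _.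
rewrite mulmx_trE mulr_sumr; apply: eq_bigr => j _.
rewrite (C1_jacobianE (U := U))//; last exact: C1_nu.
rewrite /flux -mulrA; congr (_ * _); rewrite mulrC; congr (_ * _).
rewrite trmx_inv /gram trmx_mul trmxK; congr (fun_of_matrix _ _ _).
Qed.

(** Differentiate [flux_tangent]. After exchanging second derivatives of [F], the remaining term is
    half of [sg] times the trace of G^-1 d_c G, which is d_c [sg] by Jacobi's formula. *)
Lemma div_flux_tangent c u : U u -> \sum_j (\sum_a pd (flux a j) a u) * 'J F u c j = 0.
Proof.
move=> Uu.
have D a : \sum_j (pd (flux a j) a u * 'J F u c j + flux a j u * pd (fun u => 'J F u c j) a u) =
    (a == c)%:R * pd sg a u.
  rewrite -(pd_scale oU)//; last exact: C1_sqrt_det.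
  rewrite -(pd_eq_on (f := fun u => \sum_j flux a j u * 'J F u c j) oU a Uu); last first.
    by move=> v Uv; rewrite flux_tangent// mulrC.
  rewrite (pd_sum oU)//; last by move=> j _; apply: C1M => //; [exact: C1_flux|exact: C1_jac].
  by apply: eq_bigr => j _; rewrite (pdM _ (C1_flux a j) (C1_jac c j) Uu).
have -> : \sum_j (\sum_a pd (flux a j) a u) * 'J F u c j =
   pd sg c u - \sum_a \sum_j flux a j u * pd (fun u => 'J F u a j) c u.
  under eq_bigr do rewrite mulr_suml.
  rewrite exchange_big/=.
  have -> : pd sg c u = \sum_a (a == c)%:R * pd sg a u.
    rewrite (bigD1 c)//= eqxx mul1r big1 ?addr0// => a /negbTE ->.
    by rewrite mul0r.
  rewrite -sumrB; apply: eq_bigr => a _; rewrite -D big_split/=.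
  rewrite (_ : \sum_j flux a j u * pd (fun u => 'J F u c j) a u =
     \sum_j flux a j u * pd (fun u => 'J F u a j) c u) ?addrK//.
  by apply: eq_bigr => j _; rewrite pd_jacC.
apply/eqP; rewrite subr_eq0; apply/eqP.
have d0 := det_gt0 Uu.
have s0 := sqrt_det_gt0 Uu.
have Cd := C1_det oU C1_gram.
rewrite [LHS](pd_comp (phi := @Num.sqrt R) _ Cd Uu); last first.
  by have [] := is_derive1_sqrt d0.
rewrite derive1E derive_sqrt//.
rewrite (pd_det oU C1_gram _ Uu).
(* Half of the trace of G^-1 d_c G: the two terms of the product rule for G contribute equally
   because G^-1 is symmetric. *)
pose S := \sum_a \sum_b Gi a b u * \sum_j pd (fun u => 'J F u a j) c u * 'J F u b j.
have E1 : \sum_a \sum_j flux a j u * pd (fun u => 'J F u a j) c u = sg u * S.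
  rewrite mulr_sumr; apply: eq_bigr => a _; rewrite mulr_sumr.
  under eq_bigr => j _. rewrite /flux [(_ *m 'J F u) a j]mxE -mulrA mulr_suml mulr_sumr. over.
  rewrite exchange_big/=; apply: eq_bigr => b _; rewrite !mulr_sumr.
  apply: eq_bigr => j _; rewrite /Gi /sg; ring.
have E2 : \sum_i \sum_j pd (fun u => gram F u i j) c u * cofactor (gram F u) i j =
    \det (gram F u) * (S + S).
  have cofE i j : cofactor (gram F u) i j = \det (gram F u) * Gi j i u.
    rewrite /Gi /invmx gram_unit// mxE mxE mulrA divff ?mul1r//.
    by rewrite gt_eqF.
  pose S2 := \sum_a \sum_b Gi a b u * (\sum_j 'J F u a j * pd (fun u => 'J F u b j) c u).
  have S2E : S2 = S; last first.
    rewrite -{2}S2E -big_split mulr_sumr; apply: eq_bigr => a _.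
    rewrite -big_split mulr_sumr; apply: eq_bigr => b _.
    rewrite cofE pd_gram// /= -mulrDr -big_split/= (Gi_sym b a).
    by rewrite mulrC -mulrA.
  rewrite /S exchange_big; apply: eq_bigr => a _; apply: eq_bigr => b _ /=.
  rewrite (Gi_sym b a); congr (_ * _); apply: eq_bigr => j _; exact: mulrC.
have sn0 : sg u != 0 by rewrite gt_eqF.
have E3 : \det (gram F u) = sg u ^+ 2 by rewrite sqr_sqrtr// ltW.
rewrite E1 E2 -/(sg u) E3; move: sn0.
clear E1 E2 E3; by move: (sg u) S => x S x0; field.
Qed.

(** The divergence [Z] is orthogonal to all tangent vectors, so [tangent_projection] reduces it to
    its normal component. *)
Theorem div_flux u j : U u -> \sum_a pd (flux a j) a u =
  - (Num.sqrt (\det (gram F u)) * \tr (invmx (gram F u) *m second_form F nu u) * nu u 0 j).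
Proof.
move=> Uu; pose Z : 'rV[R]_n.+1 := \row_j \sum_a pd (flux a j) a u.
have ZJ : Z *m ('J F u)^T = 0.
  apply/rowP => c; rewrite mulmx_trE [RHS]mxE -[RHS](div_flux_tangent c Uu).
  by apply: eq_bigr => i _; rewrite mxE.
have P := tangent_projection (gram_unit Uu) (nu_ortho u) (nu_unit Uu).
have : Z *m (('J F u)^T *m invmx ('J F u *m ('J F u)^T) *m 'J F u) = 0.
  by rewrite !mulmxA ZJ !mul0mx.
rewrite P mulmxBr mulmx1 mulmxA => /eqP; rewrite subr_eq0 => /eqP/rowP/(_ j).
rewrite [LHS]mxE => ->; rewrite mxE big_ord1 mulmx_trE -mulNr; congr (_ * _).
by rewrite -div_flux_nu//; apply: eq_bigr => i _; rewrite mxE.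
Qed.

End ImmersedPatch.

(** * Lebesgue measure on R^m *)

Section BorelSets.
Variable R : realType.

Lemma open_borel (T : ptopologicalType) (A : set T) : open A ->
  measurable (A : set (borel T)).
Proof. exact: sub_gen_smallest. Qed.

Lemma closed_borel (T : ptopologicalType) (A : set T) : closed A ->
  measurable (A : set (borel T)).
Proof. by move/closed_openC/open_borel/measurableC; rewrite setCK. Qed.

Lemma open_preimage_on (T S : topologicalType) (U : set T) (f : T -> S) (O : set S) :
  open U -> (forall u, U u -> {for u, continuous f}) -> open O ->
  open (U `&` f @^-1` O).
Proof.
move=> oU cf oO; rewrite openE => u [Uu Ofu]; apply: filterI.
  exact: open_nbhs_nbhs.
by apply: (cf u Uu); exact: open_nbhs_nbhs.
Qed.

Lemma measurable_fun_open_on (T : ptopologicalType) (U : set T) (f : T -> R) :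
  open U -> (forall u, U u -> {for u, continuous f}) ->
  measurable_fun (U : set (borel T)) (f : borel T -> R).
Proof.
move=> oU cf; apply: (measurability _ (RGenOpens.measurableE R)).
move=> _ [_ [a [b ->] <-]]; apply: open_borel; apply: open_preimage_on => //.
Qed.

Lemma measurable_fun_borel_on (T S : ptopologicalType) (U : set T) (f : T -> S) :
  open U -> (forall u, U u -> {for u, continuous f}) ->
  measurable_fun (U : set (borel T)) (f : borel T -> borel S).
Proof.
move=> oU cf; apply: (@measurability _ _ (borel T) (borel S) U f (@open S) erefl).
move=> _ [V oV <-]; apply: open_borel; exact: open_preimage_on.
Qed.

Lemma continuous_borel (T : ptopologicalType) (f : T -> R) : continuous f ->
  measurable_fun setT (f : borel T -> R).
Proof. by move=> cf; apply: (measurable_fun_open_on openT) => u _; exact: cf. Qed.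

Definition rat_box m (p : 'rV[rat]_m * rat) : set 'rV[R]_m :=
  [set x | forall j, `|x 0 j - ratr (p.1 0 j)| < ratr p.2].

Lemma open_rat_boxes m (O : set 'rV[R]_m) : open O ->
  O = \bigcup_(p in [set p | rat_box p `<=` O]) rat_box p.
Proof.
move=> oO; apply/seteqP; split=> [x Ox|x [p Hp] /Hp//].
have [e e0 He] := (@nbhs_normP R 'rV[R]_m x _).1 (open_nbhs_nbhs (conj oO Ox)).
have [r] := @rat_in_itvoo R 0 (e / 2) (divr_gt0 e0 (ltr0Sn _ _)).
rewrite in_itv/= => /andP[r0 re].
have H j : exists q : rat, `|x 0 j - ratr q| < ratr r.
  have : x 0 j - ratr r < x 0 j + ratr r by rewrite ltrD2l gtrN.
  move=> /rat_in_itvoo[q]; rewrite in_itv/= => /andP[q1 q2]; exists q.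
  by rewrite distrC ltr_distl q1 q2.
have [q Hq] := choice H.
exists (\row_j q j, r); last by move=> j /=; rewrite mxE.
move=> y /= Hy; apply: He => /=; rewrite [`|_|]mx_normrE.
rewrite (@le_lt_trans _ _ (ratr r + ratr r))//; last first.
  by rewrite [ltRHS](splitr e) ltrD.
apply: bigmax_le => [|[i j] _ /=]; first by rewrite addr_ge0// ltW.
rewrite !mxE ord1 -(subrKA (ratr (q j))) (le_trans (ler_normD _ _))// lerD// ltW//.
by have := Hy j; rewrite mxE distrC.
Qed.

(** The Borel sets are generated by all open sets; an open set is a countable union of rational
    boxes, and a box is a finite intersection of conditions on single coordinates. *)
Lemma measurable_row d (T : measurableType d) m (f : T -> 'rV[R]_m) :
  (forall j, measurable_fun setT (fun x => f x 0 j)) ->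
  measurable_fun setT (f : T -> borel 'rV[R]_m).
Proof.
move=> mf; apply: (@measurability _ _ T (borel 'rV[R]_m) setT f (@open 'rV[R]_m) erefl).
move=> _ [V oV <-]; rewrite setTI (open_rat_boxes oV) preimage_bigcup.
rewrite bigcup_mkcond; apply: countable_bigcupT_measurable => // p.
case: ifPn => // _.
have -> : f @^-1` rat_box p = \big[setI/setT]_(j < m)
    ((fun x => f x 0 j) @^-1` [set y | `|y - ratr (p.1 0 j)| < ratr p.2]).
  rewrite -bigcap_seq; apply/seteqP; split=> [x H j _|x H j]; first exact: H.
  by apply: (H j); rewrite /= mem_index_enum.
apply: bigsetI_measurable => j _; rewrite -[X in measurable X]setTI; apply: mf => //.
have -> : [set y | `|y - ratr (p.1 0 j)| < ratr p.2] =
    `](ratr (p.1 0 j) - ratr p.2), (ratr (p.1 0 j) + ratr p.2)[%classic :> set R.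
  by apply/seteqP; split=> y /=; rewrite in_itv/= ltr_distl.
exact: measurable_itv.
Qed.

Lemma measurable_coord m j :
  measurable_fun setT ((fun v : 'rV[R]_m => v 0 j) : borel 'rV[R]_m -> R).
Proof. by apply: continuous_borel; exact: coord_continuous. Qed.

(** The splitting of a row used in [lebint], with its value retyped from length [1 + m] to
    [m.+1]. *)
Definition consr m (p : R * 'rV[R]_m) : 'rV[R]_m.+1 :=
  row_mx (p.1%:M : 'rV[R]_1) p.2 : 'rV[R]_(1 + m).

Lemma consr0 m (p : R * 'rV[R]_m) : consr p 0 0 = p.1.
Proof.
have -> : (0 : 'I_m.+1) = lshift m (0 : 'I_1) by exact/val_inj.
by rewrite (row_mxEl (p.1%:M : 'rV[R]_1)) mxE.
Qed.

Lemma consrS m (p : R * 'rV[R]_m) j : consr p 0 (lift 0 j) = p.2 0 j.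
Proof.
rewrite /consr (_ : lift 0 j = rshift 1 j); last exact/val_inj.
by rewrite (row_mxEr (p.1%:M : 'rV[R]_1)).
Qed.

Lemma measurable_consr m :
  measurable_fun setT (@consr m : measurableTypeR R * borel 'rV[R]_m -> borel 'rV[R]_m.+1).
Proof.
apply: measurable_row => j; case: (unliftP 0 j) => [i ->|->].
- under eq_fun do rewrite consrS.
  apply: (measurableT_comp (measurable_coord i)); exact: measurable_snd.
- under eq_fun do rewrite consr0.
  exact: measurable_fst.
Qed.

Definition cube m (k : nat) : set 'rV[R]_m := [set x | forall j, `|x 0 j| <= k%:R].
Arguments cube : clear implicits.

Lemma measurable_cube m k : measurable (cube m k : set (borel 'rV[R]_m)).
Proof.
have -> : cube m k = \big[setI/setT]_(j < m)
    ((fun x : 'rV[R]_m => x 0 j) @^-1` `[- k%:R, k%:R]%classic).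
  rewrite -bigcap_seq; apply/seteqP; split=> [x H j _|x H j].
    by have := H j; rewrite /= in_itv/= ler_norml.
  have /= := H j; rewrite in_itv/= ler_norml; apply.
  by rewrite /= mem_index_enum.
apply: bigsetI_measurable => j _; rewrite -[X in measurable X]setTI.
by apply: (measurable_coord j) => //; exact: measurable_itv.
Qed.

Lemma consr_cube m k : @consr m @^-1` cube m.+1 k = `[- k%:R, k%:R]%classic `*` cube m k.
Proof.
apply/seteqP; split=> [[t v] H|[t v] [/= H1 H2] j].
  split => /=; last by move=> j; have := H (lift 0 j); rewrite consrS.
  by have := H 0; rewrite consr0/= in_itv/= ler_norml.
case: (unliftP 0 j) => [i ->|->]; first by rewrite consrS.
by rewrite consr0/=; move: H1; rewrite in_itv/= ler_norml.
Qed.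

Lemma measurable_consr_comp m (f : borel 'rV[R]_m.+1 -> \bar R) : measurable_fun setT f ->
  measurable_fun setT (f \o (@consr m : measurableTypeR R * borel 'rV[R]_m -> borel 'rV[R]_m.+1)).
Proof. by move=> mf; apply: measurableT_comp; [exact: mf|exact: measurable_consr]. Qed.

(** Turns the iterated integral into integration against one measure, so that limit theorems apply.
    The step pushes the product with one-dimensional Lebesgue measure forward along [consr] and uses
    Tonelli; finiteness on cubes is carried along because it gives sigma-finiteness in the next
    dimension. *)
Lemma lebint_measure_exists m :
  exists lam : {sigma_finite_measure set (borel 'rV[R]_m) -> \bar R},
    (forall k, (lam (cube m k) < +oo)%E) /\
    (forall f : 'rV[R]_m -> \bar R,
      measurable_fun setT (f : borel 'rV[R]_m -> \bar R) -> (forall x, (0 <= f x)%E) ->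
      (\int[lam]_x (f : borel 'rV[R]_m -> \bar R) x = lebint f)%E).
Proof.
elim: m => [|m [lam [fin_lam IH]]].
  exists (dirac (0 : borel 'rV[R]_0)); split=> [k|f mf f0].
    by apply: (le_lt_trans (probability_le1 _ _)); rewrite ?ltry//; exact: measurable_cube.
  by rewrite integral_dirac//= diracT mul1e.
pose Phi : measurableTypeR R * borel 'rV[R]_m -> borel 'rV[R]_m.+1 := @consr m.
have mPhi : measurable_fun setT Phi := @measurable_consr m.
pose mu00 : {measure set (borel 'rV[R]_m.+1) -> \bar R} :=
  pushforward (lebesgue_measure \x lam)%E Phi.
pose mu0 := mu00 mPhi.
have fin0 k : (mu0 (cube m.+1 k) < +oo)%E.
  rewrite /mu0/= /pushforward consr_cube product_measure1E//; last exact: measurable_cube.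
  have L (x y : R) : (@lebesgue_measure R `[x, y]%classic < +oo)%E.
    by rewrite lebesgue_measure_itv/=; case: ifP => // _; rewrite ltry.
  apply: lte_mul_pinfty; last exact: fin_lam.
    exact: measure_ge0.
  by rewrite ge0_fin_numE; [exact: L|exact: measure_ge0].
have sf0 : sigma_finite setT mu0.
  exists (cube m.+1) => [|k].
    apply/esym/seteqP; split=> // x _.
    exists (Num.bound (\big[Num.max/0]_j `|x 0 j|)) => // j.
    rewrite ltW// (le_lt_trans _ (archi_boundP _))//.
      exact: (le_bigmax _ (fun j => `|x 0 j|) j).
    exact: bigmax_ge_id.
  by split; [exact: measurable_cube|exact: fin0].
pose sfm := Measure_isSigmaFinite.Build _ _ _ mu0 sf0.
pose mu1 : {sigma_finite_measure set (borel 'rV[R]_m.+1) -> \bar R} := HB.pack (mu0 : set _ -> \bar R) (Measure.class mu0) sfm.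
exists mu1; split => // f mf f0.
rewrite ge0_integral_pushforward//.
have mfP : measurable_fun setT ((f : borel 'rV[R]_m.+1 -> \bar R) \o Phi).
  by apply: measurableT_comp; [exact: mf|exact: mPhi].
rewrite [X in integral _ X]preimage_setT fubini_tonelli1//; last by move=> x; exact: f0.
apply: eq_integral => t _; rewrite /fubini_F IH//; last by move=> x; exact: f0.
by apply: (measurableT_comp mf); apply: (measurableT_comp mPhi); exact: measurable_pair1.
Qed.

Definition lebn m : {sigma_finite_measure set (borel 'rV[R]_m) -> \bar R} :=
  sval (cid (lebint_measure_exists m)).

Lemma lebn_cube_lty m k : (lebn m (cube m k) < +oo)%E.
Proof. by have [+ _] := svalP (cid (lebint_measure_exists m)); exact. Qed.

Lemma lebintE m (f : borel 'rV[R]_m -> \bar R) : measurable_fun setT f ->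
  (forall x, (0 <= f x)%E) -> lebint f = (\int[lebn m]_x f x)%E.
Proof. by move=> mf f0; have [_ ->] := svalP (cid (lebint_measure_exists m)). Qed.

Lemma lebn_succ m (f : borel 'rV[R]_m.+1 -> \bar R) : measurable_fun setT f ->
  (forall x, (0 <= f x)%E) ->
  (\int[lebn m.+1]_x f x = \int[lebesgue_measure]_t \int[lebn m]_v f (consr (t, v)))%E.
Proof.
move=> mf f0; rewrite -lebintE//=; apply: eq_integral => t _.
rewrite -lebintE//; apply: (measurableT_comp mf).
apply: (measurableT_comp (@measurable_consr m)); exact: measurable_pair1.
Qed.

Lemma measurable_lebn_section m (f : borel 'rV[R]_m.+1 -> \bar R) : measurable_fun setT f ->
  (forall x, (0 <= f x)%E) ->
  measurable_fun setT (fun t : measurableTypeR R => \int[lebn m]_v f (consr (t, v)))%E.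
Proof.
move=> mf f0.
exact: (@measurable_fun_fubini_tonelli_F _ _ _ _ _ (lebn m) _ (measurable_consr_comp mf) (fun x => f0 _)).
Qed.

(** The image of Lebesgue measure under the shift agrees with it on half-open intervals, hence
    everywhere by uniqueness. *)
Lemma lebesgue_shift (c : R) (f : measurableTypeR R -> \bar R) : measurable_fun setT f ->
  (forall x, (0 <= f x)%E) ->
  (\int[lebesgue_measure]_t f (t + c)%R = \int[lebesgue_measure]_t f t)%E.
Proof.
move=> mf f0; pose phi : measurableTypeR R -> measurableTypeR R := fun t => t + c.
have mphi : measurable_fun setT phi.
  by apply: continuous_measurable_fun => t; apply: cvgD; [exact: cvg_id|exact: cvg_cst].
pose mu0 : {measure set (measurableTypeR R) -> \bar R} := pushforward (@lebesgue_measure R) phi.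
have E A : measurable A -> lebesgue_measure A = mu0 mphi A.
  apply: lebesgue_measure_unique => _ [[a b] _ <-].
  rewrite /mu0/= /pushforward.
  have -> : phi @^-1` `]a, b]%classic = `](a - c), (b - c)]%classic.
    by apply/seteqP; split=> x; rewrite /phi /= !in_itv/= ltrBlDr lerBrDr.
  rewrite !lebesgue_measure_itv/= !lte_fin ltrD2r -!EFinB; case: ifP => // _.
  by congr EFin; rewrite opprB addrA subrK.
transitivity (\int[mu0 mphi]_t f t)%E.
  by rewrite /mu0/= (ge0_integral_pushforward mphi).
by apply: eq_measure_integral => A mA _; exact/esym/E.
Qed.

Definition tailr m (c : 'rV[R]_m.+1) : 'rV[R]_m := \row_j c 0 (lift 0 j).

Lemma consrD m t (v : 'rV[R]_m) c : consr (t, v) + c = consr (t + c 0 0, v + tailr c).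
Proof.
apply/rowP => j; rewrite mxE; case: (unliftP 0 j) => [i ->|->].
  by rewrite !consrS !mxE.
by rewrite !consr0.
Qed.

Lemma measurable_shift m (c : 'rV[R]_m) :
  measurable_fun setT ((fun u => u + c) : borel 'rV[R]_m -> borel 'rV[R]_m).
Proof.
apply: measurable_fun_borel_on => [|u _]; first exact: openT.
by apply: continuousD; [exact: cvg_id|exact: cst_continuous].
Qed.

Lemma measurable_shift_comp d (T : measurableType d) m (c : 'rV[R]_m) (f : borel 'rV[R]_m -> T) :
  measurable_fun setT f -> measurable_fun setT (fun u : borel 'rV[R]_m => f ((u : 'rV[R]_m) + c)).
Proof. by move=> mf; exact: (measurableT_comp mf (measurable_shift c)). Qed.

Lemma lebn_shift m (c : 'rV[R]_m) (f : borel 'rV[R]_m -> \bar R) : measurable_fun setT f ->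
  (forall x, (0 <= f x)%E) -> (\int[lebn m]_u f (u + c)%R = \int[lebn m]_u f u)%E.
Proof.
elim: m c f => [|m IH] c f mf f0.
  by apply: eq_integral => u _; rewrite [u + c]thinmx0 [in RHS](thinmx0 u).
have mfc : measurable_fun setT (fun u : borel 'rV[R]_m.+1 => f (u + c)).
  exact: measurable_shift_comp mf.
rewrite (lebn_succ mfc (fun=> f0 _)) (lebn_succ mf f0).
rewrite -[RHS](@lebesgue_shift (c 0 0)); last 2 first.
- exact: measurable_lebn_section.
- by move=> t; exact: integral_ge0.
apply: eq_integral => t _.
rewrite -[RHS](IH (tailr c)); last 2 first.
- apply: (measurableT_comp (measurable_consr_comp mf)); exact: measurable_pair1.
- by move=> x; exact: f0.
by apply: eq_integral => v _; rewrite consrD.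
Qed.

End BorelSets.

Arguments cube {R} m k.

Section IntegralOverRn.
Variables (R : realType) (m : nat).
Local Notation mu := (lebn R m).
Implicit Types (f g w : 'rV[R]_m -> R) (u : 'rV[R]_m).

Definition cube_supported k f := forall u, ~ cube m k u -> f u = 0.

Lemma compact_cube k : compact (cube m k : set 'rV[R]_m).
Proof.
have := @rV_compact R m (fun=> `[- k%:R, k%:R]%classic) (fun=> @segment_compact R _ _).
congr compact; apply/seteqP; split=> u H j; have := H j; by rewrite /= in_itv/= ler_norml.
Qed.

Lemma cube_supported_integrable k f : measurable_fun setT (f : borel 'rV[R]_m -> R) ->
  (exists K, forall u, `|f u| <= K) -> cube_supported k f ->
  mu.-integrable setT (EFin \o f).
Proof.
move=> mf [K fK] fk.
have -> : EFin \o f = (EFin \o f) \_ (cube m k).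
  apply/funext => u; rewrite patchE; case: ifPn => // /negP uk.
  by rewrite /= fk// => H; apply: uk; rewrite inE.
apply/(@integrable_mkcond _ _ _ mu (cube m k) (EFin \o f) (@measurable_cube R m k)).
apply: measurable_bounded_integrable.
- exact: measurable_cube.
- exact: lebn_cube_lty.
- exact: measurable_funTS.
- by exists K; split=> [|M KM u _]; [exact: num_real|exact: le_trans (fK u) (ltW KM)].
Qed.

Lemma continuous_cube_bounded k f : continuous f -> cube_supported k f ->
  exists K, forall u, `|f u| <= K.
Proof.
move=> cf fk.
have cnf : {within cube m k, continuous (fun u => `|f u|)}.
  by apply: continuous_subspaceT => u; apply: continuous_comp; [exact: cf|exact: norm_continuous].
have [|c _ Hc] := @compact_EVT_max _ R (fun u => `|f u|) (cube m k) _ (@compact_cube k) cnf.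
  by exists 0 => j; rewrite mxE normr0.
exists `|f c|; move=> u; have [uk|uk] := pselect (cube m k u).
  by apply: Hc; rewrite inE.
by rewrite fk// normr0.
Qed.

Lemma Rintegral_shift (c : 'rV[R]_m) f : mu.-integrable setT (EFin \o f) ->
  mu.-integrable setT (EFin \o (fun u => f (u + c))) /\
  \int[mu]_u f (u + c) = \int[mu]_u f u.
Proof.
move=> /integrableP[mf finf].
have mfc : measurable_fun setT (fun u : borel 'rV[R]_m => (f (u + c))%:E).
  exact: (measurable_shift_comp c mf).
split.
  apply/integrableP; split => //.
  rewrite (@lebn_shift R m c (fun u => `|(f u)%:E|)%E)//.
  exact: (measurableT_comp (@abse_measurable R setT) mf).
rewrite /Rintegral; congr fine; rewrite [LHS]integralE [RHS]integralE.
congr (_ - _)%E.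
  have H := @lebn_shift R m c _ (measurable_funepos mf) (fun x => funepos_ge0 _ x).
  by rewrite -[RHS]H; apply: eq_integral => u _; rewrite !(funeposE, funenegE).
have H := @lebn_shift R m c _ (measurable_funeneg mf) (fun x => funeneg_ge0 _ x).
by rewrite -[RHS]H; apply: eq_integral => u _; rewrite !(funeposE, funenegE).
Qed.

Lemma far_from_cube k u (t : R) a : ~ cube m k.+1 u -> `|t| <= 1 ->
  ~ cube m k (t *: delta_mx 0 a + u).
Proof.
move=> uk t1 H; apply: uk => j.
have := H j; rewrite !mxE => Hj.
have E (x y : R) : x = y + x - y by rewrite [RHS]addrC addKr.
move: Hj; set y := t * _ => Hj; rewrite (E (u 0 j) y).
rewrite (le_trans (ler_normB _ _))// -natr1 lerD//.
by rewrite /y normrM; case: (_ && _); rewrite ?normr1 ?normr0 ?mulr1 ?mulr0.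
Qed.

(** The difference quotients of [w] have integral zero by translation invariance. By the mean value
    theorem they are values of [pd w a] at nearby points, hence uniformly bounded, and dominated
    convergence passes to the derivative. *)
Theorem integral_pd_eq0 k w a : C1 setT w -> cube_supported k w ->
  mu.-integrable setT (EFin \o pd w a) /\ \int[mu]_u pd w a u = 0.
Proof.
move=> Cw wk.
have cw : continuous w by move=> u; exact: (C1_continuous Cw).
have cpd : continuous (pd w a) by move=> u; apply: (C1_pd Cw).
have pdk : cube_supported k.+1 (pd w a).
  move=> u uk; rewrite -(pd_cst 0 a u); apply: near_eq_derive.
  have : \forall v \near u, ~ cube m k v.
    apply: open_nbhs_nbhs; split; last first.
      by move=> H; apply: (@far_from_cube k u 0 a uk); rewrite ?normr0 ?scale0r ?add0r.
    apply: closed_openC; apply: compact_closed; last exact: compact_cube.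
    exact: norm_hausdorff.
  by apply: filterS => v; exact: wk.
have [K HK] := continuous_cube_bounded cpd pdk.
have Ipd : mu.-integrable setT (EFin \o pd w a).
  by apply: (cube_supported_integrable _ _ pdk); [exact: continuous_borel|exists K].
have Iw : mu.-integrable setT (EFin \o w).
  apply: (cube_supported_integrable _ _ wk); first exact: continuous_borel.
  exact: continuous_cube_bounded wk.
split => //.
pose q N u := N.+1%:R * (w (N.+1%:R^-1 *: delta_mx 0 a + u) - w u).
have qE N u : exists2 t, `|t| <= N.+1%:R^-1 & q N u = pd w a (t *: delta_mx 0 a + u).
  have [|t tN E] := @mvt_dir _ _ w u (delta_mx 0 a) N.+1%:R^-1.
    by move=> t _; apply: (C1_derivable Cw).
  exists t; first by rewrite (le_trans tN)// ger0_norm.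
  by rewrite /q E mulrC mulfVK// pnatr_eq0.
have q0 N : \int[mu]_u q N u = 0.
  have [I1 E1] := Rintegral_shift (N.+1%:R^-1 *: delta_mx 0 a) Iw.
  rewrite (_ : q N = fun u => N.+1%:R * (w (u + N.+1%:R^-1 *: delta_mx 0 a) - w u)); last first.
    by apply/funext => u; rewrite /q [_ *: _ + u]addrC.
  rewrite RintegralZl//; last exact: (integrableB measurableT I1 Iw).
  by rewrite RintegralB// E1 subrr mulr0.
have mq N : measurable_fun setT (q N : borel 'rV[R]_m -> R).
  apply: continuous_borel => u.
  apply: (@continuousM _ _ (cst N.+1%:R) (fun u => w (N.+1%:R^-1 *: delta_mx 0 a + u) - w u)).
    exact: cst_continuous.
  apply: continuousB; last exact: cw.
  apply: (@continuous_comp _ _ _ (fun u => N.+1%:R^-1 *: delta_mx 0 a + u) w); last exact: cw.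
  by apply: continuousD; [exact: cst_continuous|exact: cvg_id].
have [_ _ L] : [/\ mu.-integrable setT (EFin \o pd w a),
    [sequence \int[mu]_(x in setT) `|(EFin \o q n) x - (EFin \o pd w a) x|]_n @ \oo --> 0 &
    [sequence \int[mu]_(x in setT) (EFin \o q n) x]_n @ \oo --> \int[mu]_(x in setT) (EFin \o pd w a) x]%E.
  (* [pd w a] vanishes off the cube of size [k.+1], and a shift of length at most 1 costs one more
     unit; hence the dominating indicator of the cube of size [k.+2]. *)
  apply: (@dominated_convergence _ _ R mu setT measurableT _ _
    (EFin \o (fun u => K * \1_(cube m k.+2) u))).
  - by move=> N; apply/measurable_EFinP; exact: mq.
  - by apply/measurable_EFinP; exact: continuous_borel.
  - apply: aeW => u _; apply: cvg_EFin; first by near=> N.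
    apply/cvgrPdist_le => e e0.
    have N1 : \forall y \near u, `|pd w a u - pd w a y| <= e.
      exact: (cvgrPdist_le _ _).1 (cpd u) _ e0.
    have [r r0 Hr] := (@nbhs_normP R 'rV[R]_m u _).1 N1.
    near=> N => /=; have [t tN ->] := qE N u; apply: Hr => /=.
    rewrite opprD addrCA subrr addr0 normrN normrZ.
    rewrite (le_lt_trans (ler_pM _ _ tN (norm_delta_mx_le1 R a)))// mulr1.
    by near: N; exact: near_infty_natSinv_lt (PosNum r0).
  - apply: (cube_supported_integrable (k := k.+2)).
    + apply: measurable_funM; first exact: measurable_cst.
      apply: measurable_indic; exact: measurable_cube.
    + exists `|K| => u; rewrite normrM indicE; case: (_ \in _); rewrite ?normr1 ?normr0 ?mulr1 ?mulr0//.
    + by move=> u uk; rewrite indicE memNset ?mulr0.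
  - apply: aeW => u N _ /=; rewrite lee_fin indicE.
    have [t tN E] := qE N u; rewrite E.
    have [uk|uk] := boolP (u \in cube m k.+2); first by rewrite mulr1 HK.
    rewrite mulr0 pdk ?normr0//; apply: far_from_cube.
      by move=> H; move/negP: uk; apply; rewrite inE.
    by rewrite (le_trans tN)// invf_le1// ler1n.
have E0 : (\int[mu]_x (pd w a x)%:E = 0)%E.
  apply: (cvg_unique _ L) => //=.
  rewrite (_ : (fun n => _) = cst 0%E); first exact: cvg_cst.
  apply/funext => N /=.
  have IqN : mu.-integrable setT (EFin \o q N).
    apply: (cube_supported_integrable (k := k.+2)); first exact: mq.
      by exists K => u; have [t _ ->] := qE N u.
    move=> u uk; have [t tN ->] := qE N u; rewrite pdk//; apply: far_from_cube => //.
    by rewrite (le_trans tN)// invf_le1// ler1n.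
  rewrite -[LHS]fineK; last exact: integrable_fin_num.
  by have := q0 N; rewrite /Rintegral => ->.
by rewrite /Rintegral E0.
Unshelve. all: by end_near. Qed.

End IntegralOverRn.

(** * Lower bounds for the volume of ellipsoids *)

Section SliceVolume.
Variable R : realType.

Lemma measurable_slice m (A : set 'rV[R]_m.+1) t : measurable (A : set (borel 'rV[R]_m.+1)) ->
  measurable ([set v | A (consr (t, v))] : set (borel 'rV[R]_m)).
Proof.
move=> mA; have mc : measurable_fun setT ((fun v => consr (t, v)) : borel 'rV[R]_m -> borel 'rV[R]_m.+1).
  by apply: (measurableT_comp (@measurable_consr R m)); exact: measurable_pair1.
by have := mc measurableT _ mA; rewrite setTI.
Qed.

Lemma measurable_EFin_indic d (T : measurableType d) (A : set T) : measurable A ->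
  measurable_fun setT (fun u => (\1_A u)%:E : \bar R).
Proof. by move=> mA; apply/measurable_EFinP; exact: measurable_indic. Qed.

Lemma lebn_slices m (A : set 'rV[R]_m.+1) : measurable (A : set (borel 'rV[R]_m.+1)) ->
  lebn R m.+1 A = (\int[lebesgue_measure]_t lebn R m [set v | A (consr (t, v))])%E.
Proof.
move=> mA; rewrite -[in LHS](setIT A) -integral_indic// lebn_succ//; last first.
  exact: measurable_EFin_indic.
apply: eq_integral => t _; rewrite -[in RHS](setIT [set v | _]).
by rewrite -integral_indic//; exact: measurable_slice.
Qed.

Lemma lebn_slices_ge m (A : set 'rV[R]_m.+1) (x y c : R) :
  measurable (A : set (borel 'rV[R]_m.+1)) -> x <= y -> 0 <= c ->
  (forall t, x < t < y -> (c%:E <= lebn R m [set v | A (consr (t, v))])%E) ->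
  ((c * (y - x))%:E <= lebn R m.+1 A)%E.
Proof.
move=> mA xy c0 H.
have -> : ((c * (y - x))%:E = \int[lebesgue_measure]_(t in `]x, y[) (cst c%:E) t)%E.
  have L : @lebesgue_measure R `]x, y[%classic = (y - x)%:E.
    rewrite lebesgue_measure_itv/= lte_fin; case: (ltP x y) => [_|yx].
      by rewrite EFinB.
    by rewrite (le_anti (introT andP (conj xy yx))) subrr.
  by rewrite integral_cst// EFinM -L.
rewrite lebn_slices// integral_mkcond; apply: ge0_le_integral => //.
- by move=> t _; rewrite patchE; case: ifP => // _; rewrite lee_fin.
- by apply/(measurable_restrictT _ _).1 => //; exact: measurable_cst.
- have := measurable_lebn_section (measurable_EFin_indic mA) _.
  move=> /(_ (fun=> _)) mS.
  apply: (eq_measurable_fun _ _ (mS _)) => [t _|u].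
    rewrite -[in RHS](setIT [set v | _]) -integral_indic//; exact: measurable_slice.
  by rewrite lee_fin.
- move=> t _; rewrite patchE; case: ifPn => [/set_mem/=|_]; last exact: measure_ge0.
  by rewrite in_itv/=; exact: H.
Qed.

End SliceVolume.

Section Ellipsoid.
Variable R : realType.

Definition quad m (G : 'M[R]_m) (v : 'rV[R]_m) : R := (v *m G *m v^T) 0 0.

Lemma quadE m (G : 'M[R]_m) v : quad G v = \sum_j \sum_i v 0 i * G i j * v 0 j.
Proof.
rewrite /quad mxE; apply: eq_bigr => j _; rewrite mxE mulr_suml.
by apply: eq_bigr => i _; rewrite mxE.
Qed.

Lemma continuous_quad m (G : 'M[R]_m) : continuous (quad G).
Proof.
move=> v; suff H : {for v, continuous (quad G)} by exact: H.
apply: (@eq_continuous_at _ _ (fun v : 'rV[R]_m => \sum_j \sum_i v 0 i * G i j * v 0 j)).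
  by move=> u; rewrite quadE.
apply: continuous_at_sum => j _; apply: continuous_at_sum => i _.
apply: continuousM; last exact: coord_continuous.
by apply: continuousM; [exact: coord_continuous|exact: cst_continuous].
Qed.

Definition ellipsoid m (G : 'M[R]_m) (r : R) : set 'rV[R]_m := [set v | quad G v < r].

Lemma open_ellipsoid m (G : 'M[R]_m) r : open (ellipsoid G r).
Proof.
apply: (@open_comp _ _ (quad G) [set x | x < r]); last exact: open_lt.
by move=> v _; exact: continuous_quad.
Qed.

(** Completing the square; the coefficient of [t ^+ 2] is the Schur complement of [D]. *)
Lemma quad_block m (a : R) (b : 'rV[R]_m) (D : 'M[R]_m) t (w : 'rV[R]_m) :
  D \in unitmx -> D^T = D ->
  let k := b *m invmx D in
  quad (block_mx a%:M b b^T D : 'M[R]_(1 + m)) (row_mx (t%:M : 'rV_1) w) =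
  quad D (w + t *: k) + (a - (b *m invmx D *m b^T) 0 0) * t ^+ 2.
Proof.
move=> uD sD k; rewrite /quad mul_row_block tr_row_mx mul_row_col.
have kD : k *m D = b by rewrite mulmxKV.
have Dk : D *m k^T = b^T by rewrite -[X in X *m _]sD -trmx_mul kD.
rewrite linearD/= linearZ/= !mulmxDl !mulmxDr -!scalemxAl -!scalemxAr kD -!(mulmxA w D) Dk.
rewrite tr_scalar_mx !mul_scalar_mx !mul_mx_scalar -!scalemxAl -/k !mxE.
have bk : \sum_j b 0 j * k^T j 0 = \sum_j k 0 j * b^T j 0.
  by apply: eq_bigr => j _; rewrite [k^T _ _]mxE [b^T _ _]mxE mulrC.
rewrite bk eqxx mulr1n.
by move: (\sum_j k _ _ * _) (\sum_j w _ _ * (_ *m _) _ _) (\sum_j w _ _ * _) (\sum_j b _ _ * _) => *; ring.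
Qed.

Lemma det_schur m (a : R) (b : 'rV[R]_m) (D : 'M[R]_m) : D \in unitmx ->
  \det (block_mx a%:M b b^T D : 'M[R]_(1 + m)) =
  (a - (b *m invmx D *m b^T) 0 0) * \det D.
Proof.
move=> uD; have -> : block_mx a%:M b b^T D =
   block_mx (a - (b *m invmx D *m b^T) 0 0)%:M b 0 D *m block_mx 1%:M 0 (invmx D *m b^T) 1%:M.
  rewrite mulmx_block !mulmx1 !mulmx0 ?mul0mx !add0r mulKVmx// mulmxA; congr block_mx.
  by apply/matrixP => i j; rewrite !ord1 !mxE eqxx !mulr1n subrK.
by rewrite det_mulmx det_ublock det_lblock !det1 det_scalar1 !mulr1.
Qed.

(** Only some dimensional constant is wanted, so no exact volume is computed. In the completed
    square half of [s ^+ 2] is given to the first coordinate and half to the fibre, a translate of a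
    lower-dimensional ellipsoid. *)
Lemma ellipsoid_volume m : exists c : R, 0 < c /\
  forall (G : 'M[R]_m) (s : R), posdef G -> G^T = G -> 0 < s ->
   0 < \det G /\
   ((c * s ^+ m / Num.sqrt (\det G))%:E <= lebn R m (ellipsoid G (s ^+ 2)))%E.
Proof.
elim: m => [|m [c [c0 IH]]].
  exists (fine (lebn R 0 setT)).
  have E0 : lebn R 0 setT = 1%E.
    have := @lebintE R 0 (cst 1%E) (measurable_cst _) (fun _ => lee01).
    by rewrite /= integral_cst// mul1e => <-.
  rewrite E0/=; split => // G s _ _ s0; rewrite det_mx00 sqrtr1 divr1 expr0 mulr1; split => //.
  rewrite (_ : ellipsoid _ _ = setT) ?E0//.
  by apply/seteqP; split => // v _; rewrite /ellipsoid/= quadE big_ord0 exprn_gt0.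
pose q : R := Num.sqrt 2.
have q0 : 0 < q by rewrite sqrtr_gt0.
exists (c / q ^+ m * (2 / q)); split.
  by rewrite mulr_gt0// divr_gt0// exprn_gt0.
move=> G s pG sG s0.
have [a [b [D EG]]] : exists a b (D : 'M[R]_m), G = (block_mx a%:M b b^T D : 'M[R]_(1 + m)).
  pose G' : 'M[R]_(1 + m) := G.
  exists (ulsubmx G' 0 0), (ursubmx G'), (drsubmx G').
  suff : G' = block_mx (ulsubmx G' 0 0)%:M (ursubmx G') (ursubmx G')^T (drsubmx G') by [].
  rewrite -[LHS]submxK; congr block_mx.
    by apply/matrixP => i j; rewrite !ord1 [RHS]mxE eqxx mulr1n.
  by rewrite trmx_ursub /G' sG.
move: pG sG; rewrite EG => pG sG.
have sD : D^T = D.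
  have := sG : (block_mx a%:M b b^T D : 'M[R]_(1 + m))^T = block_mx a%:M b b^T D.
  by rewrite (@tr_block_mx R 1 m 1 m) => /eq_block_mx[_ _ _ ->].
have pD : posdef D.
  move=> w w0; have := (pG : forall v : 'rV[R]_(1 + m), v != 0 ->
    0 < (v *m (block_mx a%:M b b^T D : 'M[R]_(1 + m)) *m v^T) 0 0) (row_mx 0 w).
  rewrite mul_row_block tr_row_mx mul_row_col !mul0mx !add0r trmx0 mulmx0 add0r; apply.
  by apply: contra w0 => /eqP; rewrite -row_mx0 => /eq_row_mx[_ ->].
have uD := posdef_unit pD.
set sg := a - (b *m invmx D *m b^T) 0 0.
have sg0 : 0 < sg.
  have := pG (row_mx (1%:M : 'rV_1) (- (b *m invmx D)) : 'rV_(1 + m)).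
  rewrite -/(quad _ _) quad_block// scale1r addNr {1}/quad !mul0mx mxE add0r expr1n mulr1.
  apply; apply/eqP => /(congr1 (fun M : 'rV[R]_(1 + m) => M 0 (lshift m 0))).
  by rewrite row_mxEl !mxE => /eqP; rewrite mulr1n oner_eq0.
rewrite det_schur// -/sg.
have [dD _] := IH D s pD sD s0.
split; first by rewrite mulr_gt0.
(* The half-width for which [sg * d ^+ 2] is half of [s ^+ 2], since [q ^+ 2 = 2]. *)
pose d := s / (q * Num.sqrt sg).
have d0 : 0 < d by rewrite divr_gt0// mulr_gt0// sqrtr_gt0.
pose V := c * (s / q) ^+ m / Num.sqrt (\det D).
have -> : c / q ^+ m * (2 / q) * s ^+ m.+1 / Num.sqrt (sg * \det D) = V * (d - - d).
  rewrite /V /d sqrtrM; last exact: ltW.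
  have : Num.sqrt sg != 0 by rewrite gt_eqF// sqrtr_gt0.
  have : Num.sqrt (\det D) != 0 by rewrite gt_eqF// sqrtr_gt0.
  have : q != 0 by rewrite gt_eqF.
  rewrite exprSr expr_div_n; move: (Num.sqrt _) (Num.sqrt _) => x y q1 y1 x1.
  have : q ^+ m != 0 by rewrite expf_neq0.
  move: (q ^+ m) (s ^+ m) => Q S Q0; field.
  by rewrite q1 y1 x1 Q0.
apply: lebn_slices_ge.
- apply: open_borel; exact: open_ellipsoid.
- by rewrite (@le_trans _ _ 0)// ?ltW// oppr_lt0.
- by rewrite divr_ge0 ?sqrtr_ge0// mulr_ge0 ?exprn_ge0// ?divr_ge0// ltW.
move=> t td.
pose k := b *m invmx D.
have sq0 : 0 < s / q by rewrite divr_gt0.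
have [_ HV] := IH D (s / q) pD sD sq0.
apply: (le_trans HV).
have sub : [set v | ellipsoid D ((s / q) ^+ 2) (v + t *: k)] `<=`
    [set v | ellipsoid (block_mx a%:M b b^T D : 'M[R]_(1 + m)) (s ^+ 2) (consr (t, v))].
  move=> v; rewrite /ellipsoid/= /consr/= quad_block// -/sg -/k => Hv.
  have t2 : sg * t ^+ 2 <= (s / q) ^+ 2.
    have : t ^+ 2 <= d ^+ 2.
      rewrite -real_normK ?num_real// ler_sqr ?nnegrE ?(ltW d0)//.
      by rewrite ltW// ltr_norml.
    rewrite -(ler_pM2l sg0) => /le_trans; apply.
    rewrite le_eqVlt; apply/orP; left; apply/eqP; rewrite /d -{1}(sqr_sqrtr (ltW sg0)).
    have y0 : Num.sqrt sg != 0 by rewrite gt_eqF// sqrtr_gt0.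
    have q1 : q != 0 by rewrite gt_eqF.
    by move: (Num.sqrt sg) y0 => y y0; field; rewrite q1 y0.
  have E : s ^+ 2 = (s / q) ^+ 2 + (s / q) ^+ 2.
    by rewrite expr_div_n sqr_sqrtr// -splitr.
  by rewrite E ltr_leD.
apply: (@le_trans _ _ (lebn R m [set v | ellipsoid D ((s / q) ^+ 2) (v + t *: k)])).
  have mE : measurable (ellipsoid D ((s / q) ^+ 2) : set (borel 'rV[R]_m)).
    apply: open_borel; exact: open_ellipsoid.
  rewrite -[in leLHS](setIT (ellipsoid _ _)) -integral_indic//.
  rewrite -(@lebn_shift R m (t *: k))//; last exact: measurable_EFin_indic.
  rewrite (_ : (fun u => _) = fun u => (\1_[set v | ellipsoid D ((s / q) ^+ 2) (v + t *: k)] u)%:E)//.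
  rewrite integral_indic ?setIT//.
  by have := measurable_shift (t *: k) measurableT mE; rewrite setTI.
apply: le_measure => //; rewrite inE.
  by have := measurable_shift (t *: k) measurableT (open_borel (@open_ellipsoid m D ((s / q) ^+ 2))); rewrite setTI.
by apply: measurable_slice; apply: open_borel; exact: open_ellipsoid.
Qed.

Lemma lebn_open_gt0 m (O : set 'rV[R]_m) : open O -> O !=set0 -> (0 < lebn R m O)%E.
Proof.
move=> oO [u Ou]; have [e e0 He] := (@nbhs_normP R 'rV[R]_m u _).1 (open_nbhs_nbhs (conj oO Ou)).
have [c [c0 /(_ 1%:M e)]] := ellipsoid_volume m.
have p1 : posdef (1%:M : 'M[R]_m).
  by move=> v v0; rewrite mulmx1 -edotE edot_gt0.
move=> /(_ p1 (trmx1 _ _) e0)[_]; rewrite det1 sqrtr1 divr1 => H.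
apply: (@lt_le_trans _ _ (lebn R m (ellipsoid 1%:M (e ^+ 2)))).
  by apply: lt_le_trans H; rewrite lte_fin mulr_gt0// exprn_gt0.
have mE : measurable (ellipsoid 1%:M (e ^+ 2) : set (borel 'rV[R]_m)).
  by apply: open_borel; exact: open_ellipsoid.
pose A := [set v : 'rV[R]_m | ellipsoid 1%:M (e ^+ 2) (v + - u)].
have mA : measurable (A : set (borel 'rV[R]_m)).
  by have := measurable_shift (- u) measurableT mE; rewrite setTI.
apply: (@le_trans _ _ (lebn R m A)).
  rewrite -[in leLHS](setIT (ellipsoid _ _)) -integral_indic//.
  rewrite -(@lebn_shift R m (- u))//; last exact: measurable_EFin_indic.
  rewrite (_ : (fun v => _) = fun v => (\1_A v)%:E)//.
  by rewrite integral_indic ?setIT.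
apply: le_measure; rewrite ?inE//; first exact: open_borel.
move=> v; rewrite /A/= /ellipsoid/= /quad mulmx1 -edotE => Hv; apply: He => /=.
rewrite [`|_|]mx_normrE bigmax_lt// => -[i j] _ /=; rewrite ord1.
rewrite -(@ltr_pXn2r _ 2%N)// ?nnegrE ?(ltW e0)// real_normK ?num_real//.
apply: le_lt_trans Hv; rewrite /edot (bigD1 j)//= !mxE -expr2 -[leLHS]addr0.
apply: lerD; first by rewrite -sqrrN opprB.
by apply: sumr_ge0 => l _; rewrite -expr2 sqr_ge0.
Qed.

End Ellipsoid.

(** * Cutoffs of class C^1 and extension by zero *)

Section PositivePartSquared.
Variable R : realType.

(** A C^1 function positive exactly for [z > 0], from which every bump and cutoff below is built.
    Its quadratic Taylor bound also permits differentiation under an average. *)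
Definition pos2 (z : R) : R := (Num.max z 0) ^+ 2.

Lemma pos2_taylor (z h : R) : `|pos2 (z + h) - pos2 z - 2 * Num.max z 0 * h| <= h ^+ 2.
Proof.
rewrite /pos2; have h2 : 0 <= h ^+ 2 by exact: sqr_ge0.
case: (leP z 0) => z0; case: (leP (z + h) 0) => zh.
- by rewrite expr0n/= subrr mulr0 mul0r subrr normr0.
- rewrite expr0n/= mulr0 mul0r !subr0 ger0_norm ?sqr_ge0//.
  by rewrite ler_sqr ?nnegrE; lra.
- rewrite expr0n/= sub0r ler_norml; apply/andP; split; nra.
- by rewrite (_ : _ - _ - _ = h ^+ 2) ?ger0_norm//; ring.
Qed.

Lemma is_derive_pos2 (z : R) : is_derive z 1 pos2 (2 * Num.max z 0).
Proof.
have L : (fun h : R => h^-1 *: (pos2 (h *: (1 : R) + z) - pos2 z)) @ 0^' --> 2 * Num.max z 0.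
  apply/cvgrPdist_le => e e0; near=> h.
  have h0 : h != 0 by near: h; exact: nbhs_dnbhs_neq.
  rewrite [h *: (1 : R)]mulr1 (addrC h).
  have -> : 2 * Num.max z 0 - h^-1 *: (pos2 (z + h) - pos2 z) =
     - (h^-1 * (pos2 (z + h) - pos2 z - 2 * Num.max z 0 * h)).
    by rewrite [_ *: _]/(h^-1 * _) [in RHS]mulrBr opprB (mulrCA h^-1) mulVf// mulr1.
  rewrite normrN normrM normfV ler_pdivrMl ?normr_gt0//.
  rewrite (le_trans (pos2_taylor z h))// -real_normK ?num_real// expr2 ler_wpM2l//.
  by near: h; exact: dnbhs0_le.
by split; [exact: cvgP L|exact: cvg_lim L].
Unshelve. all: by end_near. Qed.

Lemma derive1_pos2 : derive1 pos2 = fun z => 2 * Num.max z 0.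
Proof. by apply/funext => z; rewrite derive1E; have [_ ->] := is_derive_pos2 z. Qed.

Lemma continuous_pos2' : continuous (fun z : R => 2 * Num.max z 0).
Proof.
move=> z; suff H : {for z, continuous (fun z : R => 2 * Num.max z 0)} by exact: H.
apply: continuousM; first exact: cst_continuous.
by apply: continuous_max; [exact: cvg_id|exact: cst_continuous].
Qed.

Lemma C1_pos2 m (U : set 'rV[R]_m) f : open U -> C1 U f -> C1 U (pos2 \o f).
Proof.
move=> oU Cf; apply: C1_comp => // u _; first by have [] := is_derive_pos2 (f u).
by rewrite derive1_pos2; exact: continuous_pos2'.
Qed.

Lemma pos2_ge0 z : 0 <= pos2 z. Proof. exact: sqr_ge0. Qed.

Lemma pos2_gt0 z : (0 < pos2 z) = (0 < z).
Proof.
rewrite /pos2; case: (leP z 0) => z0; first by rewrite expr0n/= ltxx.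
by rewrite exprn_gt0.
Qed.

Lemma pos2_eq0 z : z <= 0 -> pos2 z = 0.
Proof. by move=> z0; rewrite /pos2 (max_r z0) expr0n. Qed.

End PositivePartSquared.

Lemma diff_sum_pd (R : realType) (m : nat) (f : 'rV[R]_m -> R) u v : differentiable f u -> 'D_v f u = \sum_a v 0 a * pd f a u.
Proof.
move=> df; rewrite deriveE// {1}(row_sum_delta v) linear_sum; apply: eq_bigr => a _.
by rewrite linearZ /= /pd deriveE.
Qed.

Section C1Supplement.
Variables (R : realType) (m : nat).
Implicit Types (U V : set 'rV[R]_m) (f : 'rV[R]_m -> R).

Lemma C1_setU U V f : C1 U f -> C1 V f -> C1 (U `|` V) f.
Proof. by move=> CU CV u [/CU|/CV]. Qed.

Lemma C1_sub U V f : V `<=` U -> C1 U f -> C1 V f.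
Proof. by move=> VU CU u /VU/CU. Qed.

Definition zext U f u := if u \in U then f u else 0.

(** [U] and the complement of [K] are open and cover the space; the extension is [f] on the first
    and 0 on the second. *)
Lemma C1_zext U K f : open U -> closed K -> K `<=` U -> C1 U f ->
  (forall u, U u -> ~ K u -> f u = 0) -> C1 setT (zext U f).
Proof.
move=> oU cK KU Cf f0; apply: (@C1_sub (U `|` ~` K)).
  by move=> u _; have [/KU|] := pselect (K u); [left|right].
apply: C1_setU.
  by apply: (eq_C1 oU _ Cf) => u Uu; rewrite /zext mem_set.
have oK : open (~` K) by exact: closed_openC.
apply: (eq_C1 oK _ (C1_cst oK 0)) => u Ku; rewrite /zext; case: ifPn => // /set_mem Uu.
by rewrite f0.
Qed.

Lemma C1_coord U j : open U -> C1 U (fun u => u 0 j).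
Proof.
move=> oU; apply: (C1_intro oU (df := fun a => cst (a == j)%:R)) => [u _|u a _|u a _].
- exact: differentiable_coord.
- have := @derive_mx R _ 1 m id u (delta_mx 0 a) (@derivable_id _ _ u (delta_mx 0 a)).
  by rewrite derive_id => /rowP/(_ j); rewrite !mxE eqxx/= eq_sym => ->.
- exact: cst_continuous.
Qed.

Lemma C1_comp_row l (V : set 'rV[R]_l) (beta : 'rV[R]_l -> R) (tau : 'rV[R]_m -> 'rV[R]_l) U :
  open U -> C1 V beta -> (forall j, C1 U (fun u => tau u 0 j)) -> (forall u, U u -> V (tau u)) ->
  C1 U (beta \o tau) /\ forall u a, U u ->
  pd (beta \o tau) a u = \sum_j pd (fun u => tau u 0 j) a u * pd beta j (tau u).
Proof.
move=> oU Cb Ct UV.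
have dt u : U u -> differentiable tau u.
  by move=> Uu; apply: differentiable_row => j; exact: C1_diff (Ct j) Uu.
have db u : U u -> differentiable beta (tau u) by move=> Uu; exact: C1_diff Cb (UV _ Uu).
have E u a : U u -> pd (beta \o tau) a u = \sum_j pd (fun u => tau u 0 j) a u * pd beta j (tau u).
  move=> Uu; rewrite /pd deriveE; last exact: differentiable_comp (dt _ Uu) (db _ Uu).
  rewrite (diff_comp (dt _ Uu) (db _ Uu))/= -(deriveE _ (dt _ Uu)) -(deriveE _ (db _ Uu)).
  rewrite (diff_sum_pd _ (db _ Uu)); apply: eq_bigr => j _; congr (_ * _).
  by rewrite -[RHS]/(pd _ _ _) pd_coord//; exact: diff_derivable (dt _ Uu).
split => //.
apply: (C1_intro oU (df := fun a u => \sum_j pd (fun u => tau u 0 j) a u * pd beta j (tau u))) => [u Uu|u a Uu|u a Uu].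
- exact: differentiable_comp (dt _ Uu) (db _ Uu).
- exact: E.
- apply: continuous_at_sum => j _; apply: continuousM; first exact: C1_pd (Ct j) Uu.
  apply: (@continuous_comp _ _ _ tau (pd beta j)); first exact/differentiable_continuous/dt.
  exact: C1_pd Cb (UV _ Uu).
Qed.

End C1Supplement.

Lemma sgr_mul_gt0 (R : realType) (x y : R) : x != 0 -> 0 < Num.sg x * y -> Num.sg y = Num.sg x.
Proof.
case: (ltgtP x 0) => [x0|x0|->]; rewrite ?eqxx// => _.
  by rewrite (ltr0_sg x0) mulN1r oppr_gt0 => /ltr0_sg.
by rewrite (gtr0_sg x0) mul1r => /gtr0_sg.
Qed.

(** * Independence of the parametrization *)

Section ReparametrizedPatch.
Variables (R : realType) (n : nat).

Lemma cross_mulmx (A : 'M[R]_n) (J : 'M[R]_(n, n.+1)) : cross (A *m J) = \det A *: cross J.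
Proof.
apply/rowP => j; rewrite !mxE.
have -> : col' j (A *m J) = A *m col' j J.
  by apply/matrixP => a b; rewrite !mxE; apply: eq_bigr => c _; rewrite mxE.
by rewrite det_mulmx mulrCA.
Qed.

Lemma invmx_congr (A G : 'M[R]_n) : A \in unitmx -> G \in unitmx ->
  invmx (A *m G *m A^T) = invmx A^T *m (invmx G *m invmx A).
Proof.
move=> uA uG; have uAT : A^T \in unitmx by rewrite unitmx_tr.
have uP : A *m G *m A^T \in unitmx by rewrite !unitmx_mul uA uG.
apply: (can_inj (mulKmx uP)); rewrite mulmxV// -!mulmxA (mulKVmx uAT) mulKVmx//.
by rewrite mulmxV.
Qed.

Lemma trace_congr (s : R) (A G : 'M[R]_n) (B J : 'M[R]_(n, n.+1)) :
  A \in unitmx -> G \in unitmx ->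
  \tr (invmx (A *m G *m A^T) *m ((s *: (A *m B)) *m (A *m J)^T)) =
  s * \tr (invmx G *m (B *m J^T)).
Proof.
move=> uA uG; have uAT : A^T \in unitmx by rewrite unitmx_tr.
rewrite invmx_congr// -scalemxAl -scalemxAr linearZ/= trmx_mul; congr (_ * _).
rewrite mxtrace_mulC !mulmxA mulmxK// -!mulmxA mxtrace_mulC -!mulmxA mulVmx// mulmx1.
by rewrite mulmxA mxtrace_mulC.
Qed.

Lemma enormZ m (c : R) (u : 'rV[R]_m) : enorm (c *: u) = `|c| * enorm u.
Proof.
rewrite /enorm (_ : edot _ _ = c ^+ 2 * edot u u); last first.
  by rewrite /edot mulr_sumr; apply: eq_bigr => j _; rewrite !mxE; ring.
by rewrite sqrtrM ?sqr_ge0// sqrtr_sqr.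
Qed.

Variables (U V : set 'rV[R]_n) (F Fc : 'rV[R]_n -> 'rV[R]_n.+1) (tau : 'rV[R]_n -> 'rV[R]_n).
Hypothesis oU : open U.
Hypothesis oV : open V.
Hypothesis sF : smooth_on U F.
Hypothesis sFc : smooth_on V Fc.
Hypothesis pF : forall u, U u -> posdef (gram F u).
Hypothesis pFc : forall u, V u -> posdef (gram Fc u).
Hypothesis st : smooth_on U tau.
Hypothesis UV : forall u, U u -> V (tau u).
Hypothesis FE : forall u, U u -> F u = Fc (tau u).

Lemma reparam_pd (w wc : 'rV[R]_n -> R) u a : C1 V wc -> (forall u, U u -> w u = wc (tau u)) -> U u ->
  pd w a u = \sum_b 'J tau u a b * pd wc b (tau u).
Proof.
move=> Cw E Uu; have [_ D] := C1_comp_row oU Cw (fun j => smooth_C1 oU j st) UV.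
rewrite (pd_eq_on (g := wc \o tau) oU a Uu)// D//; apply: eq_bigr => b _.
by rewrite (C1_jacobianE (U := U))// => j; exact: smooth_C1.
Qed.

Lemma reparam_jacobian u : U u -> 'J F u = 'J tau u *m 'J Fc (tau u).
Proof.
move=> Uu; apply/matrixP => a j.
rewrite (C1_jacobianE (U := U) a j (fun j => smooth_C1 oU j sF) Uu).
rewrite (reparam_pd (wc := fun v => Fc v 0 j) a (smooth_C1 oV j sFc) _ Uu); last first.
  by move=> v Uv; rewrite FE.
have E b := C1_jacobianE (U := V) b j (fun j => smooth_C1 oV j sFc) (UV Uu).
by move: ('J Fc _) E => J E; rewrite mxE; apply: eq_bigr => b _; rewrite E.
Qed.

Lemma reparam_gram u : U u -> gram F u = 'J tau u *m gram Fc (tau u) *m ('J tau u)^T.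
Proof. by move=> Uu; rewrite /gram reparam_jacobian// trmx_mul !mulmxA. Qed.

Lemma reparam_unit u : U u -> 'J tau u \in unitmx.
Proof.
move=> Uu; have := posdef_unit (pF Uu).
by rewrite reparam_gram// !unitmx_mul => /andP[/andP[]].
Qed.

Lemma reparam_normal u : U u -> unit_normal F u = Num.sg (\det ('J tau u)) *: unit_normal Fc (tau u).
Proof.
move=> Uu; rewrite -[LHS]/((enorm (cross ('J F u)))^-1 *: cross ('J F u)).
rewrite -[unit_normal Fc _]/((enorm (cross ('J Fc (tau u))))^-1 *: cross ('J Fc (tau u))).
rewrite reparam_jacobian// cross_mulmx enormZ !scalerA; congr (_ *: _).
have d0 : \det ('J tau u) != 0 by rewrite -unitfE -unitmxE reparam_unit.
have N0 : enorm (cross ('J Fc (tau u))) != 0.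
  by rewrite sqrtr_eq0 -ltNge edot_gt0// cross_neq0//; apply: pFc; exact: UV.
rewrite invfM mulrAC; congr (_ * _); rewrite [in LHS](numEsg (\det _)) normrM normr_sg d0 mul1r.
by rewrite mulrC -mulrA normr_id divff ?mulr1// normr_eq0.
Qed.

(** Under a change of chart the normal acquires the sign of the Jacobian determinant. The trace
    acquires the same sign, so it cancels in the product. *)
Lemma reparam_mean_curvature u : U u ->
  \tr (invmx (gram F u) *m second_form F (unit_normal F) u) *: unit_normal F u =
  \tr (invmx (gram Fc (tau u)) *m second_form Fc (unit_normal Fc) (tau u)) *: unit_normal Fc (tau u).
Proof.
move=> Uu; have [s sE] : exists s, s = Num.sg (\det ('J tau u)) by eexists.
have d0 : \det ('J tau u) != 0 by rewrite -unitfE -unitmxE reparam_unit.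
(* An open set on which the sign is constant, so that the relation between the two normals can be
   differentiated. *)
pose W := U `&` [set v | Num.sg (\det ('J tau v)) = s].
have oW : open W.
  have cd v : U v -> {for v, continuous (fun v => \det ('J tau v))}.
    move=> Uv; apply: (C1_continuous (U := U)) => //; apply: (C1_det oU) => a b.
    apply: (eq_C1 oU _ (smooth_pd_C1 oU b a st)) => x Ux.
    by rewrite (C1_jacobianE (U := U))// => j; exact: smooth_C1.
  have -> : W = U `&` (fun v => \det ('J tau v)) @^-1` [set x | 0 < s * x].
    apply/seteqP; split=> v [Uv Hv]; (split; first exact: Uv).
      have dv : \det ('J tau v) != 0 by rewrite -unitfE -unitmxE reparam_unit.
      by rewrite /= -Hv -normrEsg normr_gt0.
    have dv : \det ('J tau v) != 0 by rewrite -unitfE -unitmxE reparam_unit.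
    have {}Hv : 0 < s * \det ('J tau v) := Hv.
    suff : Num.sg (\det ('J tau v)) = s by [].
    by rewrite sE in Hv *; exact: sgr_mul_gt0 d0 Hv.
  apply: open_preimage_on => //.
  have -> : [set x | 0 < s * x] = ( *%R s) @^-1` [set x | 0 < x] by [].
  apply: open_comp => [x _|]; last exact: open_gt.
  exact: mulrl_continuous.
have Wu : W u by split; [exact: Uu|exact: esym sE].
have nE v : W v -> unit_normal F v = s *: unit_normal Fc (tau v).
  move=> [Uv sv]; apply: (etrans (reparam_normal Uv)).
  exact: (congr1 (fun c => c *: unit_normal Fc (tau v)) sv).
have Jn : 'J (unit_normal F) u = s *: ('J tau u *m 'J (unit_normal Fc) (tau u)).
  apply/matrixP => a j.
  rewrite (C1_jacobianE (U := U) a j (fun j => C1_nu oU sF pF j) Uu).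
  have Cn := C1_scale oV s (C1_nu oV sFc pFc j).
  rewrite (pd_eq_on (g := fun v => s * unit_normal Fc (tau v) 0 j) oW a Wu); last first.
    by move=> v Wv; rewrite nE// mxE.
  rewrite (reparam_pd (wc := fun v => s * unit_normal Fc v 0 j) a Cn _ Uu)//.
  have E b := C1_jacobianE (U := V) b j (fun j => C1_nu oV sFc pFc j) (UV Uu).
  have E2 b : pd (fun v => s * unit_normal Fc v 0 j) b (tau u) = s * 'J (unit_normal Fc) (tau u) b j.
    by rewrite E; exact: (pd_scale oV s b (C1_nu oV sFc pFc j) (UV Uu)).
  under eq_bigr => b _ do rewrite E2.
  move: ('J (unit_normal Fc) _) {E E2} => J; rewrite mxE mxE mulr_sumr.
  by apply: eq_bigr => b _; rewrite mulrCA.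
have uJ := reparam_unit Uu; have uG := posdef_unit (pFc (UV Uu)).
have T : \tr (invmx (gram F u) *m second_form F (unit_normal F) u) =
  s * \tr (invmx (gram Fc (tau u)) *m second_form Fc (unit_normal Fc) (tau u)).
  apply: etrans (trace_congr s _ _ uJ uG).
  have E3 (g g' : 'M[R]_n) (b b' j j' : 'M[R]_(n, n.+1)) : g = g' -> b = b' -> j = j' ->
    \tr (invmx g *m (b *m j^T)) = \tr (invmx g' *m (b' *m j'^T)) by move=> -> -> ->.
  exact: E3 (reparam_gram Uu) Jn (reparam_jacobian Uu).
have s1 (x : R) (y : 'rV[R]_n.+1) : (s * x) *: (s *: y) = x *: y.
  by rewrite scalerA mulrAC (_ : s * s = 1) ?mul1r// -expr2 sE sqr_sg d0.
exact: etrans (congr2 (fun x (y : 'rV[R]_n.+1) => x *: y) T (nE _ Wu)) (s1 _ _).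
Qed.

Lemma reparam_gradient (w wc : 'rV[R]_n -> R) u : C1 V wc -> (forall u, U u -> w u = wc (tau u)) ->
  U u ->
  (\row_a pd w a u) *m invmx (gram F u) *m 'J F u =
  (\row_a pd wc a (tau u)) *m invmx (gram Fc (tau u)) *m 'J Fc (tau u).
Proof.
move=> Cw E Uu.
have -> : \row_a pd w a u = (\row_a pd wc a (tau u)) *m ('J tau u)^T.
  apply/rowP => a; rewrite mulmx_trE mxE (reparam_pd a Cw E Uu).
  by apply: eq_bigr => b _; rewrite mulrC mxE.
have uJ := reparam_unit Uu; have uG := posdef_unit (pFc (UV Uu)).
rewrite (reparam_gram Uu) (reparam_jacobian Uu) (invmx_congr uJ uG).
move: ('J tau u) (gram Fc (tau u)) uJ uG => A G uA uG.
have uAT : A^T \in unitmx by rewrite unitmx_tr.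
by rewrite !mulmxA mulmxK// mulmxKV.
Qed.

End ReparametrizedPatch.

(** * The divergence theorem on a closed hypersurface *)

Section ManifoldCharts.
Variables (R : realType) (n : nat) (M : smoothManifold R n).
Local Notation D := (@chart_dom R n M).
Local Notation phi := (@chart R n M).
Local Notation par := (@param R n M).
Local Notation U := (@chart_im R n M).

Lemma sm_hausdorff : hausdorff_space M. Proof. by case: M. Qed.

Lemma chart_at_dom x : D (chart_at x) x. Proof. by case: M x. Qed.

Lemma open_chart_dom i : open (D i). Proof. by case: M i. Qed.

Lemma open_chart_im i : open (U i). Proof. by rewrite /chart_im; case: M i. Qed.

Lemma paramK i x : D i x -> par i (phi i x) = x. Proof. by case: M i x. Qed.

Lemma chart_imP i x : D i x -> U i (phi i x). Proof. by move=> Dx; exists x. Qed.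

Lemma param_dom i u : U i u -> D i (par i u).
Proof. by move=> [x Dx <-]; rewrite paramK. Qed.

Lemma chartK i u : U i u -> phi i (par i u) = u.
Proof. by move=> [x Dx <-]; rewrite paramK. Qed.

Lemma chart_continuous i x : D i x -> {for x, continuous (phi i)}.
Proof.
move=> Dx; have : {within D i, continuous (phi i)} by case: M i x Dx.
by rewrite continuous_open_subspace; [apply; rewrite inE|exact: open_chart_dom].
Qed.

Lemma param_continuous i u : U i u -> {for u, continuous (par i)}.
Proof.
move=> Uu; have : {within U i, continuous (par i)} by rewrite /chart_im; case: M i u Uu.
by rewrite continuous_open_subspace; [apply; rewrite inE|exact: open_chart_im].
Qed.

Definition overlap i j := U i `&` (par i @^-1` D j).

Lemma open_overlap i j : open (overlap i j).
Proof.
by apply: open_preimage_on => [|u|]; [exact: open_chart_im|exact: param_continuous|exact: open_chart_dom].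
Qed.

Lemma transition_smooth i j : smooth_on (overlap i j) (phi j \o par i).
Proof. by rewrite /overlap /chart_im; case: M i j. Qed.

Lemma transition_im i j u : overlap i j u -> U j (phi j (par i u)).
Proof. by move=> [_ Du]; exact: chart_imP. Qed.

Lemma transitionK i j u : overlap i j u -> par j (phi j (par i u)) = par i u.
Proof. by move=> [_ Du]; exact: paramK. Qed.

Definition C1man (w : M -> R) := forall i, C1 (U i) (w \o par i).

Lemma C1man_continuous w : C1man w -> continuous w.
Proof.
move=> Cw x; pose i := chart_at x; have Dx := chart_at_dom x.
have oD := open_chart_dom i.
suff H : {for x, continuous ((w \o par i) \o phi i)}.
  rewrite /continuous_at -{2}(paramK Dx); apply: (cvg_trans _ H).
  apply: near_eq_cvg; near=> y; rewrite /= paramK//; near: y; exact: open_nbhs_nbhs.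
apply: continuous_comp; first exact: chart_continuous.
by apply: C1_continuous (Cw i) _; exact: chart_imP.
Unshelve. all: by end_near. Qed.

(** Any other chart image is covered by its overlap with chart [i], where the chain rule applies,
    and the preimage of the complement of [K], where [b] vanishes. *)
Lemma C1man_chart i (K : set M) (beta : 'rV[R]_n -> R) (b : M -> R) :
  closed K -> K `<=` D i -> C1 (U i) beta -> (forall x, D i x -> b x = beta (phi i x)) ->
  (forall x, ~ K x -> b x = 0) -> C1man b.
Proof.
move=> cK KD Cb bE b0 j.
pose V := U j `&` par j @^-1` ~` K.
have oV : open V.
  apply: open_preimage_on => [|u|]; [exact: open_chart_im|exact: param_continuous|].
  exact: closed_openC.
have sub : U j `<=` overlap j i `|` V.
  move=> u Uu; have [Ku|Ku] := pselect (K (par j u)); last by right.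
  by left; split => //; exact: KD.
apply: (C1_sub sub); apply: C1_setU.
  have [C _] := C1_comp_row (@open_overlap j i) Cb
     (fun k => smooth_C1 (@open_overlap j i) k (@transition_smooth j i)) (@transition_im j i).
  apply: (eq_C1 (@open_overlap j i) _ C) => u [Uu Du].
  by rewrite /= bE.
by apply: (eq_C1 oV _ (C1_cst oV 0)) => u [Uu Ku]; rewrite /= b0.
Qed.

Lemma C1manD w1 w2 : C1man w1 -> C1man w2 -> C1man (fun x => w1 x + w2 x).
Proof. by move=> C1w C2w i; exact: (C1D (@open_chart_im i) (C1w i) (C2w i)). Qed.

Lemma C1manM w1 w2 : C1man w1 -> C1man w2 -> C1man (fun x => w1 x * w2 x).
Proof. by move=> C1w C2w i; exact: (C1M (@open_chart_im i) (C1w i) (C2w i)). Qed.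

Lemma C1man_cst c : C1man (fun=> c).
Proof. by move=> i; exact: (C1_cst (@open_chart_im i) c). Qed.

Lemma C1man_sum (I : Type) (r : seq I) (P : pred I) (w : I -> M -> R) :
  (forall k, P k -> C1man (w k)) -> C1man (fun x => \sum_(k <- r | P k) w k x).
Proof.
move=> Cw i; by apply: (@C1_sum _ _ _ (@open_chart_im i) I r P (fun k => w k \o par i)) => k Pk; exact: Cw.
Qed.

Lemma C1manV w : C1man w -> (forall x, w x != 0) -> C1man (fun x => (w x)^-1).
Proof. by move=> Cw w0 i; apply: (C1V (@open_chart_im i) (Cw i)) => u _; exact: w0. Qed.

Lemma C1man_comp w (f : R -> R) : C1man w -> (forall z, derivable f z 1) ->
  continuous (derive1 f) -> C1man (f \o w).
Proof.
move=> Cw df cf i; apply: (C1_comp (@open_chart_im i) (f := w \o par i)) => // u _.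
exact: cf.
Qed.

End ManifoldCharts.

(** * Tangential gradient and mean curvature vector *)

Section HypersurfaceGeometry.
Variables (R : realType) (n : nat) (M : closedHypersurface R n).
Local Notation D := (@chart_dom R n M).
Local Notation phi := (@chart R n M).
Local Notation par := (@param R n M).
Local Notation U := (@chart_im R n M).
Local Notation X := (@hs_map R n M).

Definition local_map i : 'rV[R]_n -> 'rV[R]_n.+1 := X \o par i.

Lemma hs_compact : compact [set: M]. Proof. by case: M. Qed.

Lemma hs_connected : connected [set: M]. Proof. by case: M. Qed.

Lemma patch_smooth i : smooth_on (U i) (local_map i).
Proof. by rewrite /local_map; case: M i => m g X' mu c1 c2 H c3 i; have [] := H i. Qed.

Lemma patch_gram i u : U i u -> gram (local_map i) u = metric_mx (hs_metric M) i u.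
Proof. by rewrite /local_map; case: M i u => m g X' mu c1 c2 H c3 i u; have [_ +] := H i; exact. Qed.

Lemma patch_posdef i u : U i u -> posdef (gram (local_map i) u).
Proof.
move=> Uu v v0; rewrite patch_gram//.
by case: (hs_metric M) => m ? ? H ?; exact: H.
Qed.

Lemma hs_volE i (B : set M) : measurable (B : set (borel M)) -> B `<=` D i ->
  hs_vol M B = patch_volume (metric_mx (hs_metric M) i) (phi i @` B).
Proof. by case: M i B => m g X' mu c1 c2 c3 H i B; exact: H. Qed.

Lemma patch_transition i j u : @overlap _ _ M i j u ->
  local_map i u = local_map j (phi j (par i u)).
Proof. by move=> H; rewrite /local_map /= (transitionK H). Qed.

Lemma overlap_sub i j : @overlap _ _ M i j `<=` U i. Proof. by move=> u []. Qed.

Lemma smooth_sub m l (V W : set 'rV[R]_m) (f : 'rV[R]_m -> 'rV[R]_l) : W `<=` V ->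
  smooth_on V f -> smooth_on W f.
Proof.
move=> WV sf k; have := sf k; move: f {sf}; elim: k => [|k IH] f [cf H]; split => //.
  by move=> u /WV; exact: cf.
  by move=> u /WV; exact: cf.
move=> a; have [H1 H2] := H a; split; first by move=> u /WV; exact: H1.
exact: IH.
Qed.

(** The Riemannian gradient G^{ab} d_a w d_b F, pushed forward to a vector of the ambient space. *)
Definition grad_patch i (w : M -> R) (u : 'rV[R]_n) : 'rV[R]_n.+1 :=
  (\row_a pd (w \o par i) a u) *m invmx (gram (local_map i) u) *m 'J (local_map i) u.

Definition hvec_patch i (u : 'rV[R]_n) : 'rV[R]_n.+1 :=
  \tr (invmx (gram (local_map i) u) *m second_form (local_map i) (unit_normal (local_map i)) u)
    *: unit_normal (local_map i) u.

Definition gradM (w : M -> R) (x : M) := grad_patch (chart_at x) w (phi (chart_at x) x).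

(* n H nu, which does not depend on the choice of the unit normal. *)
Definition hvec (x : M) := hvec_patch (chart_at x) (phi (chart_at x) x).

Let overlap_at i u : U i u -> @overlap _ _ M i (chart_at (par i u)) u.
Proof. by move=> Uu; split => //; exact: chart_at_dom. Qed.

(** [gradM] is evaluated in the preferred chart, which may change from point to point. Independence
    of the chart gives one formula on a whole chart, and from it continuity. *)
Lemma gradM_param i w u : C1man w -> U i u -> gradM w (par i u) = grad_patch i w u.
Proof.
move=> Cw Uu; have Ou := overlap_at Uu; apply/esym.
apply: (@reparam_gradient R n (overlap i (chart_at (par i u))) (U (chart_at (par i u))) _ _
  (phi (chart_at (par i u)) \o par i)) => //.
- exact: open_overlap.
- exact: open_chart_im.
- exact: smooth_sub (@overlap_sub _ _) (@patch_smooth i).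
- exact: patch_smooth.
- by move=> v /overlap_sub; exact: patch_posdef.
- exact: patch_posdef.
- exact: transition_smooth.
- exact: transition_im.
- exact: patch_transition.
- by move=> v Ov; rewrite /= (transitionK Ov).
Qed.

Lemma hvec_param i u : U i u -> hvec (par i u) = hvec_patch i u.
Proof.
move=> Uu; have Ou := overlap_at Uu; apply/esym.
apply: (@reparam_mean_curvature R n (overlap i (chart_at (par i u))) (U (chart_at (par i u))) _ _
  (phi (chart_at (par i u)) \o par i)) => //.
- exact: open_overlap.
- exact: open_chart_im.
- exact: smooth_sub (@overlap_sub _ _) (@patch_smooth i).
- exact: patch_smooth.
- by move=> v /overlap_sub; exact: patch_posdef.
- exact: patch_posdef.
- exact: transition_smooth.
- exact: transition_im.
- exact: patch_transition.
Qed.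

Lemma continuous_from_charts (f : M -> R) :
  (forall i u, U i u -> {for u, continuous (f \o par i)}) -> continuous f.
Proof.
move=> Cf x; pose i := chart_at x; have Dx : D i x := chart_at_dom x.
have oD : open (D i) by exact: open_chart_dom.
suff H : {for x, continuous ((f \o par i) \o phi i)}.
  rewrite /continuous_at -{2}(paramK Dx); apply: (cvg_trans _ H).
  apply: near_eq_cvg; near=> y; rewrite /= paramK//; near: y; exact: open_nbhs_nbhs.
by apply: continuous_comp; [exact: chart_continuous|apply: Cf; exact: chart_imP].
Unshelve. all: by end_near. Qed.

Lemma C1_coordX j : C1man (fun x => X x 0 j).
Proof. by move=> i; exact: (smooth_C1 (@open_chart_im _ _ M i) j (@patch_smooth i)). Qed.

Lemma continuous_hvec j : continuous (fun x => hvec x 0 j).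
Proof.
apply: continuous_from_charts => i u Uu.
have oU := @open_chart_im _ _ M i.
apply: (continuous_at_eq_on oU Uu (f := fun u => hvec_patch i u 0 j)).
  by move=> v Uv; rewrite /= hvec_param.
have sF := @patch_smooth i; have pF := @patch_posdef i.
pose tr u := \sum_a \sum_b invmx (gram (local_map i) u) a b *
  \sum_l pd (fun u => unit_normal (local_map i) u 0 l) b u * 'J (local_map i) u a l.
apply: (continuous_at_eq_on oU Uu (f := fun u => tr u * unit_normal (local_map i) u 0 j)).
  move=> v Uv; rewrite [RHS]mxE; congr (_ * _); apply: eq_bigr => a _.
  rewrite [RHS]mxE; apply: eq_bigr => b _; congr (_ * _).
  rewrite [RHS]mulmx_trE; apply: eq_bigr => l _; congr (_ * _).
  by rewrite (C1_jacobianE (U := U i))// => l'; exact: C1_nu.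
apply: continuousM; last exact: C1_continuous (C1_nu oU sF pF j) Uu.
apply: continuous_at_sum => a _; apply: continuous_at_sum => b _.
apply: continuousM; first exact: C1_continuous (C1_Gi oU sF pF a b) Uu.
apply: continuous_at_sum => l _; apply: continuousM.
  exact: C1_pd (C1_nu oU sF pF l) Uu.
exact: C1_continuous (C1_jac oU sF a l) Uu.
Qed.

Lemma grad_patchE i w u j : grad_patch i w u 0 j =
  \sum_a pd (w \o par i) a u * (invmx (gram (local_map i) u) *m 'J (local_map i) u) a j.
Proof.
rewrite /grad_patch -mulmxA; move: (_ *m 'J _ _) => A.
by rewrite mxE; apply: eq_bigr => a _; rewrite mxE.
Qed.

Lemma continuous_gradM w j : C1man w -> continuous (fun x => gradM w x 0 j).
Proof.
move=> Cw; apply: continuous_from_charts => i u Uu.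
have oU := @open_chart_im _ _ M i.
have sF := @patch_smooth i; have pF := @patch_posdef i.
apply: (continuous_at_eq_on oU Uu (f := fun u => \sum_a pd (w \o par i) a u *
  \sum_b invmx (gram (local_map i) u) a b * 'J (local_map i) u b j)).
  move=> v Uv; rewrite /= gradM_param// grad_patchE; apply: eq_bigr => a _.
  by congr (_ * _); rewrite [RHS]mxE.
apply: continuous_at_sum => a _; apply: continuousM; first exact: C1_pd (Cw i) Uu.
apply: continuous_at_sum => b _; apply: continuousM.
  exact: C1_continuous (C1_Gi oU sF pF a b) Uu.
exact: C1_continuous (C1_jac oU sF b j) Uu.
Qed.

Lemma gradM_at w x j : gradM w x 0 j = \sum_a pd (w \o par (chart_at x)) a (phi (chart_at x) x) *
  (invmx (gram (local_map (chart_at x)) (phi (chart_at x) x)) *m 'J (local_map (chart_at x)) (phi (chart_at x) x)) a j.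
Proof. exact: grad_patchE. Qed.

Let at_im (x : M) : U (chart_at x) (phi (chart_at x) x).
Proof. by apply: chart_imP; exact: chart_at_dom. Qed.

Lemma gradMD w1 w2 x j : C1man w1 -> C1man w2 ->
  gradM (fun x => w1 x + w2 x) x 0 j = gradM w1 x 0 j + gradM w2 x 0 j.
Proof.
move=> C1w C2w; rewrite !gradM_at -big_split/=; apply: eq_bigr => a _.
by rewrite -mulrDl; congr (_ * _); exact: (pdD a (C1w _) (C2w _) (at_im x)).
Qed.

Lemma gradMM w1 w2 x j : C1man w1 -> C1man w2 ->
  gradM (fun x => w1 x * w2 x) x 0 j = gradM w1 x 0 j * w2 x + w1 x * gradM w2 x 0 j.
Proof.
move=> C1w C2w; rewrite !gradM_at mulr_suml mulr_sumr -big_split/=; apply: eq_bigr => a _.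
rewrite [pd _ _ _](pdM a (C1w _) (C2w _) (at_im x)) /= (paramK (chart_at_dom x)).
by move: (pd _ _ _) (pd _ _ _) (fun_of_matrix _ _ _) => *; ring.
Qed.

Lemma gradM_cst c x j : gradM (fun=> c) x 0 j = 0.
Proof. by rewrite gradM_at big1// => a _; rewrite [pd _ _ _]pd_cst mul0r. Qed.

Lemma gradM_sum (I : Type) (r : seq I) (w : I -> M -> R) x j : (forall k, C1man (w k)) ->
  gradM (fun x => \sum_(k <- r) w k x) x 0 j = \sum_(k <- r) gradM (w k) x 0 j.
Proof.
move=> Cw; elim: r => [|k r IH].
  rewrite big_nil; apply: (etrans _ (gradM_cst 0 x j)); congr (gradM _ x 0 j).
  by apply/funext => y; rewrite big_nil.
rewrite big_cons -IH -gradMD//; last by apply: C1man_sum.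
by congr (gradM _ x 0 j); apply/funext => y; rewrite big_cons.
Qed.

Lemma gradM_comp w (f : R -> R) x j : C1man w -> derivable f (w x) 1 ->
  gradM (f \o w) x 0 j = derive1 f (w x) * gradM w x 0 j.
Proof.
move=> Cw df; rewrite !gradM_at mulr_sumr; apply: eq_bigr => a _; rewrite mulrA; congr (_ * _).
have := @pd_comp _ _ _ (w \o par (chart_at x)) f a _ (Cw _) (at_im x).
by rewrite /= (paramK (chart_at_dom x)); exact.
Qed.

(* The coefficients of nu^T nu, which do not depend on the choice of the unit normal. *)
Definition nunu (x : M) (i j : 'I_n.+1) : R := (i == j)%:R - gradM (fun x => X x 0 i) x 0 j.

(** The gradients of the coordinates of the immersion form the matrix of the tangential projection,
    so the identity minus it is nu^T nu. All later uses of a normal go through this pointwise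
    [nu]. *)
Lemma hs_normal (x : M) : (0 < n)%N -> 
  exists nu : 'rV[R]_n.+1, [/\ edot nu nu = 1, forall i j, nunu x i j = nu 0 i * nu 0 j &
      forall j, hvec x 0 j = n%:R * mean_curvature x * nu 0 j].
Proof.
move=> n0; pose c := chart_at x; pose u := phi c x; have Uu : U c u := at_im x.
have oU := @open_chart_im _ _ M c.
have sF := @patch_smooth c; have pF := @patch_posdef c.
exists (unit_normal (local_map c) u); split.
- exact: (nu_unit pF Uu).
- move=> i j; have := tangent_projection (gram_unit pF Uu) (nu_ortho (local_map c) u) (nu_unit pF Uu).
  move=> /matrixP/(_ i j); rewrite [RHS]mxE [in X in _ = X + _]mxE [in X in _ = _ + X]mxE.
  rewrite [in X in _ = _ - X]mxE big_ord1 [in X in _ = _ - X]mxE => E.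
  rewrite /nunu; suff <- : (('J (local_map c) u)^T *m invmx ('J (local_map c) u *m ('J (local_map c) u)^T) *m 'J (local_map c) u) i j
     = gradM (fun x => X x 0 i) x 0 j by rewrite E opprB addrC subrK.
  rewrite gradM_at -mulmxA [LHS]mxE; apply: eq_bigr => a _; congr (_ * _).
  by rewrite mxE; exact: (patch_jacobian oU sF a i Uu).
- move=> j; rewrite [LHS]mxE; congr (_ * _).
  rewrite /mean_curvature mulrA -(patch_gram Uu) divff ?mul1r//.
  by rewrite pnatr_eq0 -lt0n.
Qed.

End HypersurfaceGeometry.

(** * Integrals in charts and the divergence theorem *)

Section WeightedImage.
Local Open Scope ereal_scope.
Context d d' (T : measurableType d) (T' : measurableType d') (R : realType).
Variables (mu : {measure set T -> \bar R}) (lam : {measure set T' -> \bar R}).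
Variables (D : set T) (pi : T' -> T) (w : T' -> R).
Hypothesis mD : measurable D.
Hypothesis mpi : measurable_fun setT pi.
Hypothesis mw : measurable_fun setT w.
Hypothesis w0 : forall u, (0 <= w u)%R.
Hypothesis muE : forall B, measurable B ->
  mu (B `&` D) = \int[lam]_u (\1_B (pi u) * w u)%:E.

Import HBNNSimple.

Let integral_weighted_nnsfun (f : {nnsfun T >-> R}) :
  \int[mu]_(x in D) (f x)%:E = \int[lam]_u (f (pi u) * w u)%:E.
Proof.
under eq_integral do rewrite fimfunE -fsumEFin//.
have mi r : measurable_fun setT (fun u => \1_(f @^-1` [set r]) (pi u) : R).
  exact: (@measurableT_comp _ _ _ _ _ _ (\1_(f @^-1` [set r]) : T -> R)).
rewrite ge0_integral_fsum//; last 2 first.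
- by move=> r; exact/measurable_EFinP/measurable_funTS/measurableT_comp.
- by move=> r z _; rewrite EFinM nnfun_muleindic_ge0.
under [in RHS]eq_integral do rewrite fimfunE mulr_fsuml -fsumEFin//.
rewrite ge0_integral_fsum//; last 2 first.
- move=> r; apply/measurable_EFinP; apply: measurable_funM => //.
  by apply: measurable_funM; first exact: measurable_cst.
- move=> r u _; rewrite lee_fin mulr_ge0// -lee_fin EFinM.
  exact: nnfun_muleindic_ge0.
apply: eq_fsbigr => r _.
rewrite (integralZl_indic mD (fun r => f @^-1` [set r]))//; last first.
  by move=> r0; rewrite preimage_nnfun0.
rewrite integral_indic// muE//.
have [r0|r0] := leP 0%R r.
  rewrite -ge0_integralZl//.
  - by apply: eq_integral => u _; rewrite -EFinM mulrA.
  - by apply/measurable_EFinP; apply: measurable_funM.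
  - by move=> u _; rewrite lee_fin mulr_ge0.
rewrite integral0_eq ?mule0; last by move=> u _; rewrite preimage_nnfun0// indic0 mul0r.
by rewrite integral0_eq// => u _; rewrite preimage_nnfun0// indic0 mulr0 mul0r.
Qed.

(** The hypothesis [muE] is the case of indicators; simple functions and monotone limits give the
    rest. *)
Lemma ge0_integral_weighted (f : T -> \bar R) : measurable_fun setT f -> (forall x, 0 <= f x) ->
  \int[mu]_(x in D) f x = \int[lam]_u (f (pi u) * (w u)%:E).
Proof.
move=> mf f0; pose g := nnsfun_approx measurableT mf.
have mfp : measurable_fun setT (f \o pi) by exact: measurableT_comp mf mpi.
transitivity (\int[mu]_(x in D) (limn (fun n => (g n x)%:E))).
  by apply: eq_integral => x _; apply/esym/cvg_lim => //=; exact: cvg_nnsfun_approx.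
rewrite monotone_convergence//; last 3 first.
  by move=> n; exact/measurable_EFinP/measurable_funTS.
  by move=> n x _; rewrite lee_fin.
  by move=> x _ a b ab; rewrite lee_fin; exact/lefP/nd_nnsfun_approx.
under eq_fun do rewrite integral_weighted_nnsfun.
rewrite -monotone_convergence//; last 3 first.
  move=> n; apply/measurable_EFinP; apply: measurable_funM => //.
  exact: (measurableT_comp (measurable_funP (g n)) mpi).
  by move=> n u _; rewrite lee_fin mulr_ge0.
  by move=> u _ a b ab; rewrite lee_fin ler_wpM2r//; exact/lefP/nd_nnsfun_approx.
apply: eq_integral => u _; apply/cvg_lim => //=.
rewrite (_ : (fun n => _) = (fun n => (g n (pi u))%:E * (w u)%:E)); last by apply/funext => n; rewrite EFinM.
by apply: cvgeZr => //; exact: cvg_nnsfun_approx.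
Qed.

Lemma integral_weighted (f : T -> R) : measurable_fun setT f ->
  (\int[mu]_(x in D) (f x)%:E = \int[lam]_u (f (pi u) * w u)%:E)%E.
Proof.
move=> mf; have mfE : measurable_fun setT (EFin \o f) by exact/measurable_EFinP.
rewrite integralE [RHS]integralE.
rewrite (ge0_integral_weighted (measurable_funepos mfE))//.
rewrite (ge0_integral_weighted (measurable_funeneg mfE))//.
congr (_ - _)%E; apply: eq_integral => u _.
  by rewrite !funeposE/= -!EFin_max -EFinM maxr_pMl// mul0r.
by rewrite !funenegE/= -!EFin_max -EFinM maxr_pMl// mul0r mulNr.
Qed.

End WeightedImage.

Lemma lebn_integral_gt0 (R : realType) m (O : set 'rV[R]_m) (f : borel 'rV[R]_m -> R) :
  open O -> O !=set0 -> measurable_fun setT f -> (forall u, 0 <= f u) ->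
  (forall u, O u -> 0 < f u) -> (0 < \int[lebn R m]_u (f u)%:E)%E.
Proof.
move=> oO ON mf f0 fO; have mfE : measurable_fun setT (EFin \o f) by exact/measurable_EFinP.
rewrite lt_neqAle integral_ge0 ?andbT; last by move=> u _; rewrite lee_fin.
apply/eqP => H0; have : (\int[lebn R m]_u `|(EFin \o f) u| = 0)%E.
  by rewrite [RHS]H0; apply: eq_integral => u _; rewrite gee0_abs// lee_fin.
move/(ae_eq_integral_abs (lebn R m) measurableT mfE) => [A [mA A0 HA]].
have mO : measurable (O : set (borel 'rV[R]_m)) by exact: open_borel.
have : (lebn R m O <= lebn R m A)%E.
  apply: le_measure; rewrite ?inE// => u Ou; apply: HA => /= /(_ I) [] f0u.
  by have := fO u Ou; rewrite f0u ltxx.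
rewrite A0 leNgt => /negP; apply.
exact: lebn_open_gt0.
Qed.

Section ChartIntegral.
Variables (R : realType) (n : nat) (M : closedHypersurface R n).
Local Notation D := (@chart_dom R n M).
Local Notation phi := (@chart R n M).
Local Notation par := (@param R n M).
Local Notation U := (@chart_im R n M).
Local Notation X := (@hs_map R n M).
Local Notation mu := (hs_vol M).

(** Totalised by [point] off the chart image; [density] is 0 there, so chart integrals can run over
    all of R^n. *)
Definition chart_inv i (u : borel 'rV[R]_n) : borel M := if u \in U i then par i u else point.

Definition density i (u : borel 'rV[R]_n) : R :=
  zext (U i) (fun u => Num.sqrt (\det (gram (@local_map _ _ M i) u))) u.

Lemma measurable_chart_inv i : measurable_fun setT (@chart_inv i).
Proof.
have mU : measurable (U i : set (borel 'rV[R]_n)) by apply: open_borel; exact: open_chart_im.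
rewrite -(setUv (U i)); apply/measurable_funU => //; first exact: measurableC.
split.
  apply: (eq_measurable_fun (par i : borel 'rV[R]_n -> borel M)).
    by move=> u /set_mem Uu; rewrite /chart_inv mem_set.
  by apply: measurable_fun_borel_on; [exact: open_chart_im|exact: param_continuous].
apply: (eq_measurable_fun (cst point)).
  by move=> u /set_mem Uu; rewrite /chart_inv memNset.
exact: measurable_cst.
Qed.

Lemma density_ge0 i u : 0 <= density i u.
Proof. by rewrite /density /zext; case: ifP => // _; exact: sqrtr_ge0. Qed.

Lemma measurable_density i : measurable_fun setT (density i).
Proof.
have mU : measurable (U i : set (borel 'rV[R]_n)) by apply: open_borel; exact: open_chart_im.
rewrite -(setUv (U i)); apply/measurable_funU => //; first exact: measurableC.
split.
  apply: (eq_measurable_fun ((fun u => Num.sqrt (\det (gram (@local_map _ _ M i) u))) : borel 'rV[R]_n -> R)).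
    by move=> u /set_mem Uu; rewrite /density /zext mem_set.
  apply: measurable_fun_open_on => [|u Uu]; first exact: open_chart_im.
  exact: (C1_continuous (C1_sqrt_det (@open_chart_im _ _ M i) (@patch_smooth _ _ M i) (@patch_posdef _ _ M i)) Uu).
apply: (eq_measurable_fun (cst (0 : R))).
  by move=> u /set_mem Uu; rewrite /density /zext memNset.
exact: measurable_cst.
Qed.

Lemma measurable_chart_dom i : measurable (D i : set (borel M)).
Proof. by apply: open_borel; exact: open_chart_dom. Qed.

Lemma chart_measure i (B : set (borel M)) : measurable B ->
  (mu (B `&` D i) = \int[lebn R n]_u (\1_B (chart_inv i u) * density i u)%:E)%E.
Proof.
move=> mB.
have mD := measurable_chart_dom i.
rewrite (@hs_volE _ _ M i)//; last by apply: measurableI.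
rewrite -lebintE; last 2 first.
- apply/measurable_EFinP; apply: measurable_funM; last exact: measurable_density.
  apply: (@measurableT_comp _ _ _ _ _ _ (\1_B : borel M -> R)); last exact: measurable_chart_inv.
  exact: measurable_indic.
- by move=> u; rewrite lee_fin mulr_ge0// density_ge0.
rewrite /patch_volume; congr lebint; apply/funext => u; congr EFin.
rewrite /density /zext /chart_inv; case: ifPn => [/set_mem Uu|Uu]; last first.
  rewrite mulr0 indicE memNset ?mul0r// => -[x [_ Dx] xu].
  by move/negP: Uu; apply; rewrite inE -xu; exact: chart_imP.
rewrite (patch_gram Uu); congr (_ * _); rewrite !indicE; congr ((nat_of_bool _)%:R).
apply/idP/idP => /set_mem H; apply/mem_set.
  by move: H => [x [Bx Dx] <-]; rewrite paramK.
by exists (par i u); [split => //; exact: param_dom|exact: chartK].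
Qed.

Lemma chart_integral i (f : M -> R) : measurable_fun setT (f : borel M -> R) ->
  (forall x, ~ D i x -> f x = 0) ->
  \int[mu]_x f x = \int[lebn R n]_u (f (chart_inv i u) * density i u).
Proof.
move=> mf f0; rewrite /Rintegral; congr fine.
rewrite -(integral_weighted (measurable_chart_dom i) (measurable_chart_inv i) (measurable_density i)
  (density_ge0 i) (@chart_measure i) mf).
rewrite [RHS]integral_mkcond; apply: eq_integral => x _.
by rewrite patchE; case: ifPn => // /negP xD; rewrite f0// => Dx; apply: xD; rewrite inE.
Qed.

(** The parameter [r] is a squared radius, here and in [chart_ball], [bump] and [chart_radius]. *)
Definition eclosed_ball (c : 'rV[R]_n) (r : R) : set 'rV[R]_n := [set v | edot (v - c) (v - c) <= r].

Lemma continuous_edotB m (c : 'rV[R]_m) : continuous (fun v : 'rV[R]_m => edot (v - c) (v - c)).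
Proof.
move=> v; suff H : {for v, continuous (fun v : 'rV[R]_m => edot (v - c) (v - c))} by exact: H.
have cj j : {for v, continuous (fun v : 'rV[R]_m => (v - c) 0 j)}.
  apply: (@eq_continuous_at _ _ ((fun v : 'rV[R]_m => v 0 j) - cst (c 0 j))).
    by move=> u; rewrite !mxE.
  by apply: continuousB; [exact: coord_continuous|exact: cst_continuous].
apply: continuous_at_sum => j _; apply: continuousM; exact: cj.
Qed.

Lemma closed_eclosed_ball c r : closed (eclosed_ball c r).
Proof.
have := @closed_comp _ _ (fun v : 'rV[R]_n => edot (v - c) (v - c)) [set x | x <= r].
by apply; [move=> v _; exact: continuous_edotB|exact: closed_le].
Qed.

Lemma eclosed_ball_cube c r : exists k, eclosed_ball c r `<=` cube n k.
Proof.
exists (Num.bound (`|c| + (1 + `|r|))) => v H j.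
rewrite -(subrK (c 0 j) (v 0 j)) (le_trans (ler_normD _ _))//.
rewrite ltW// (le_lt_trans _ (archi_boundP _))//.
rewrite addrC lerD ?norm_coord_le//.
have h : `|v 0 j - c 0 j| ^+ 2 <= `|r|.
  rewrite real_normK ?num_real// (le_trans _ (ler_norm _))// (le_trans _ H)//.
  rewrite /edot (bigD1 j)//= !mxE -expr2 lerDl.
  by apply: sumr_ge0 => l _; rewrite -expr2 sqr_ge0.
move: (`|v 0 j - c 0 j|) (`|r|) (normr_ge0 (v 0 j - c 0 j)) (normr_ge0 r) h => x y x0 y0 h.
nra.
Qed.

Lemma compact_eclosed_ball c r : compact (eclosed_ball c r).
Proof.
have [k H] := eclosed_ball_cube c r.
exact: subclosed_compact (@closed_eclosed_ball c r) (@compact_cube R n k) H.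
Qed.

Definition chart_ball x r : set M := par (chart_at x) @` eclosed_ball (phi (chart_at x) x) r.

Definition bump x r (y : M) : R := if y \in D (chart_at x) then
  pos2 (r - edot (phi (chart_at x) y - phi (chart_at x) x) (phi (chart_at x) y - phi (chart_at x) x)) else 0.

Lemma chart_ball_exists x : exists r, 0 < r /\
  eclosed_ball (phi (chart_at x) x) r `<=` U (chart_at x).
Proof.
have Ux : U (chart_at x) (phi (chart_at x) x) by apply: chart_imP; exact: chart_at_dom.
have [e e0 He] := (@nbhs_normP R 'rV[R]_n _ _).1 (open_nbhs_nbhs (conj (@open_chart_im _ _ M _) Ux)).
exists ((e / 2) ^+ 2); rewrite exprn_gt0 ?divr_gt0//; split => // v H; apply: He => /=.
rewrite (@le_lt_trans _ _ (e / 2))//; last by rewrite ltr_pdivrMr// ltr_pMr// ltr1n.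
rewrite [`|_|]mx_normrE; apply: bigmax_le => [|[i j] _ /=]; first by rewrite divr_ge0// ltW.
rewrite ord1 -(@ler_pXn2r _ 2%N)// ?nnegrE ?divr_ge0// ?(ltW e0)//.
rewrite real_normK ?num_real// (le_trans _ H)// /edot (bigD1 j)//= !mxE -expr2 -sqrrN opprB lerDl.
by apply: sumr_ge0 => l _; rewrite -expr2 sqr_ge0.
Qed.

Definition chart_radius x : R := sval (cid (chart_ball_exists x)).

Lemma chart_radius_gt0 x : 0 < chart_radius x.
Proof. by have [] := svalP (cid (chart_ball_exists x)). Qed.

Lemma chart_radius_sub x : eclosed_ball (phi (chart_at x) x) (chart_radius x) `<=` U (chart_at x).
Proof. by have [] := svalP (cid (chart_ball_exists x)). Qed.

Definition cball x := chart_ball x (chart_radius x).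

Lemma cball_sub x : cball x `<=` D (chart_at x).
Proof. by move=> _ [u /chart_radius_sub Uu <-]; exact: param_dom. Qed.

Lemma closed_cball x : closed (cball x).
Proof.
apply: (compact_closed (@sm_hausdorff _ _ M)).
apply: continuous_compact; last exact: compact_eclosed_ball.
apply: (continuous_subspaceW (@chart_radius_sub x)).
rewrite continuous_open_subspace; last exact: open_chart_im.
by move=> u /set_mem; exact: param_continuous.
Qed.

Definition cbump x := bump x (chart_radius x).

Lemma cbump_ge0 x y : 0 <= cbump x y.
Proof. by rewrite /cbump /bump; case: ifP => // _; exact: pos2_ge0. Qed.

Lemma cbump_out x y : ~ cball x y -> cbump x y = 0.
Proof.
rewrite /cbump /bump; case: ifPn => // /set_mem Dy H; apply: pos2_eq0.
rewrite subr_le0 leNgt; apply/negP => /ltW h; apply: H.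
by exists (phi (chart_at x) y); [exact: h|exact: paramK].
Qed.

Lemma cbump_self x : 0 < cbump x x.
Proof.
rewrite /cbump /bump mem_set; last exact: chart_at_dom.
rewrite pos2_gt0 subrr (_ : edot _ _ = 0) ?subr0 ?chart_radius_gt0//.
by apply: big1 => j _; rewrite mxE mul0r.
Qed.

Lemma C1_edotB m (V : set 'rV[R]_m) (c : 'rV[R]_m) : open V -> C1 V (fun v => edot (v - c) (v - c)).
Proof.
move=> oV; have Cj j : C1 V (fun v : 'rV[R]_m => (v - c) 0 j).
  have := C1D oV (C1_coord j oV) (C1_cst oV (- c 0 j)).
  by apply: (eq_C1 oV) => v _; rewrite !mxE.
by apply: (C1_sum oV) => j _; apply: C1M.
Qed.

Lemma C1_cbump x : C1man (cbump x).
Proof.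
pose i := chart_at x; have oU := @open_chart_im _ _ M i.
apply: (@C1man_chart R n M i (cball x)
  (@pos2 R \o (fun v => chart_radius x - edot (v - phi i x) (v - phi i x))) (cbump x)).
- exact: closed_cball.
- exact: cball_sub.
- apply: C1_pos2 => //.
  have := C1D oU (C1_cst oU (chart_radius x)) (C1_scale oU (-1) (C1_edotB (phi i x) oU)).
  by apply: (eq_C1 oU) => v _ /=; rewrite mulN1r.
- by move=> y Dy; rewrite /cbump /bump mem_set.
- exact: cbump_out.
Qed.

Lemma cbump_cover : exists s : seq M, forall y, exists2 x, x \in s & 0 < cbump x y.
Proof.
have := @hs_compact _ _ M; rewrite compact_cover.
move=> /(_ M setT (fun x => [set y | 0 < cbump x y])).
case=> [x _|y _|s _ H].
- apply: (@open_comp _ _ (cbump x) [set z | 0 < z]); last exact: open_gt.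
  by move=> y _; exact: (C1man_continuous (@C1_cbump x)).
- by exists y => //=; exact: cbump_self.
- exists (finmap.enum_fset s) => y; have [x /= xs Hx] := H y I.
  by exists x.
Qed.

Lemma density_in i u : U i u -> density i u = Num.sqrt (\det (gram (@local_map _ _ M i) u)).
Proof. by move=> Uu; rewrite /density /zext mem_set. Qed.

Lemma cball_fin x : (mu (cball x) < +oo)%E.
Proof.
pose i := chart_at x; pose K := eclosed_ball (phi i x) (chart_radius x).
have mC : measurable (cball x : set (borel M)) by apply: closed_borel; exact: closed_cball.
have mK : measurable (K : set (borel 'rV[R]_n)).
  by apply: closed_borel; exact: closed_eclosed_ball.
have -> : mu (cball x) = mu (cball x `&` D i) by rewrite setIidl//; exact: cball_sub.
rewrite chart_measure//.
have [k Kk] := eclosed_ball_cube (phi i x) (chart_radius x).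
have [c [c0 Hc]] : exists c : R, 0 <= c /\ forall u, K u -> density i u <= c.
  have cs : {within K, continuous (fun u => Num.sqrt (\det (gram (@local_map _ _ M i) u)))}.
    apply: (continuous_subspaceW (@chart_radius_sub x)).
    rewrite continuous_open_subspace; last exact: open_chart_im.
    move=> u /set_mem Uu.
    exact: (C1_continuous (C1_sqrt_det (@open_chart_im _ _ M i) (@patch_smooth _ _ M i) (@patch_posdef _ _ M i)) Uu).
  have K0 : K (phi i x).
    rewrite /K /eclosed_ball/= subrr (_ : edot _ _ = 0) ?ltW ?chart_radius_gt0//.
    by apply: big1 => j _; rewrite mxE mul0r.
  have [c _ Hc] := @compact_EVT_max _ R _ K (ex_intro _ _ K0) (@compact_eclosed_ball _ _) cs.
  exists (Num.sqrt (\det (gram (@local_map _ _ M i) c))); split; first exact: sqrtr_ge0.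
  by move=> u Ku; rewrite density_in ?Hc ?inE//; exact: chart_radius_sub Ku.
apply: (@le_lt_trans _ _ (\int[lebn R n]_u (c * \1_(cube n k) u)%:E)%E).
  apply: ge0_le_integral => //.
  - by move=> u _; rewrite lee_fin mulr_ge0// density_ge0.
  - apply/measurable_EFinP; apply: measurable_funM; last exact: measurable_density.
    apply: (@measurableT_comp _ _ _ _ _ _ (\1_(cball x) : borel M -> R)); last exact: measurable_chart_inv.
    exact: measurable_indic.
  - apply/measurable_EFinP; apply: measurable_funM => //.
    by apply: measurable_indic; exact: measurable_cube.
  - move=> u _; rewrite lee_fin !indicE; have [Hu|_] := boolP (chart_inv i u \in cball x); last first.
      by rewrite mul0r mulr_ge0.
    have [Uu|Uu] := pselect (U i u); last first.
      by rewrite /density /zext memNset// mulr0 mulr_ge0.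
    move: Hu; rewrite /chart_inv (mem_set Uu) => /set_mem[v Kv vu].
    have uv : u = v by rewrite -(chartK Uu) -vu chartK//; exact: chart_radius_sub Kv.
    have Ku : K u by rewrite uv.
    by rewrite mem_set ?mulr1 ?mul1r ?Hc//; exact: Kk.
under eq_integral do rewrite EFinM.
rewrite ge0_integralZl//; last by apply: measurable_EFin_indic; exact: measurable_cube.
rewrite integral_indic ?setIT//; last exact: measurable_cube.
by apply: lte_mul_pinfty => //; exact: lebn_cube_lty.
Qed.

(** By compactness finitely many chart balls cover [M]; each has finite volume because the density
    is bounded on the corresponding compact ball of R^n. *)
Lemma hs_vol_fin : (mu setT < +oo)%E.
Proof.
have [s Hs] := cbump_cover.
have mC x : measurable (cball x : set (borel M)) by apply: closed_borel; exact: closed_cball.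
apply: (@le_lt_trans _ _ (mu (\big[setU/set0]_(x <- s) cball x))).
  apply: le_measure; rewrite ?inE//; first by apply: bigsetU_measurable => x _; exact: mC.
  move=> y _; have [x xs xy] := Hs y; rewrite -bigcup_seq; exists x => //.
  by apply: contrapT => /cbump_out H; move: xy; rewrite H ltxx.
apply: (@le_lt_trans _ _ (\sum_(x <- s) mu (cball x))%E).
  elim: s {Hs} => [|x s IH]; first by rewrite !big_nil measure0.
  rewrite !big_cons (le_trans (measureU2 _ _ _))//; first by apply: bigsetU_measurable => y _; exact: mC.
  by rewrite leeD2l.
by rewrite big_seq; apply: lte_sum_pinfty => x _; exact: cball_fin.
Qed.

Lemma hs_vol_gt0 : (0 < mu setT)%E.
Proof.
pose x : M := point; pose i := chart_at x.
have mD := measurable_chart_dom i.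
apply: (@lt_le_trans _ _ (mu (setT `&` D i))); last first.
  by apply: le_measure; rewrite ?inE//; exact: measurableI.
rewrite chart_measure//.
apply: (@lebn_integral_gt0 _ _ (U i)).
- exact: open_chart_im.
- by exists (phi i x); apply: chart_imP; exact: chart_at_dom.
- apply: measurable_funM; last exact: measurable_density.
  apply: (@measurableT_comp _ _ _ _ _ _ (\1_setT : borel M -> R)); last exact: measurable_chart_inv.
  exact: measurable_indic.
- by move=> u; rewrite mulr_ge0// density_ge0.
- move=> u Uu; rewrite indicE mem_set// mul1r density_in//.
  exact: (sqrt_det_gt0 (@patch_posdef _ _ M i) Uu).
Qed.

Lemma gradM_zero_on (O' : set M) (w : M -> R) x j : open O' -> O' x -> (forall y, O' y -> w y = 0) ->
  gradM w x 0 j = 0.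
Proof.
move=> oO Ox w0; rewrite gradM_at big1// => a _.
have Ux : U (chart_at x) (phi (chart_at x) x) by apply: chart_imP; exact: chart_at_dom.
rewrite (_ : pd _ _ _ = 0) ?mul0r//.
rewrite -(pd_cst 0 a (phi (chart_at x) x)).
have oV : open (U (chart_at x) `&` par (chart_at x) @^-1` O').
  by apply: open_preimage_on => // [|u]; [exact: open_chart_im|exact: param_continuous].
apply: (pd_eq_on oV a); first by split=> //=; rewrite paramK//; exact: chart_at_dom.
by move=> u [_ /= Hu]; rewrite w0.
Qed.

Lemma continuous_integrable (f : M -> R) : continuous f -> mu.-integrable setT (EFin \o f).
Proof.
move=> cf; apply: measurable_bounded_integrable => //.
- exact: hs_vol_fin.
- exact: continuous_borel.
have cnf : {within [set: M], continuous (fun x => `|f x|)}.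
  by apply: continuous_subspaceT => x; apply: continuous_comp; [exact: cf|exact: norm_continuous].
have [|c _ Hc] := @compact_EVT_max _ R (fun x => `|f x|) [set: M] _ (@hs_compact _ _ M) cnf.
  by exists point.
exists `|f c|; split=> [|K KM x _]; first exact: num_real.
by apply: le_trans (ltW KM); apply: Hc; rewrite inE.
Qed.

Lemma continuous_hvecM (w : M -> R) j : continuous w -> continuous (fun y => w y * hvec y 0 j).
Proof.
move=> cw y; suff H : {for y, continuous (fun y => w y * hvec y 0 j)} by exact: H.
by apply: continuousM; [exact: cw|exact: continuous_hvec].
Qed.

Lemma continuous_div_integrand (w : M -> R) j : C1man w ->
  continuous (fun y => gradM w y 0 j - w y * hvec y 0 j).
Proof.
move=> Cw y; suff H : {for y, continuous (fun y => gradM w y 0 j - w y * hvec y 0 j)} by exact: H.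
apply: continuousB; first exact: continuous_gradM.
by apply: continuous_hvecM; exact: C1man_continuous.
Qed.

(** In the chart the integrand times the density is the coordinate divergence of [w] times the flux
    field: the derivative of [w] gives [gradM], and [div_flux] gives [hvec]. Support in a chart ball
    makes the field C^1 on R^n, so each partial derivative integrates to zero. *)
Lemma divergence_local x (w : M -> R) j : C1man w -> (forall y, ~ cball x y -> w y = 0) ->
  \int[mu]_y (gradM w y 0 j - w y * hvec y 0 j) = 0.
Proof.
move=> Cw w0; pose i := chart_at x; pose K := eclosed_ball (phi i x) (chart_radius x).
have oU := @open_chart_im _ _ M i.
have sF := @patch_smooth _ _ M i; have pF := @patch_posdef _ _ M i.
have cw := C1man_continuous Cw.
have cf : continuous (fun y => gradM w y 0 j - w y * hvec y 0 j).
  exact: continuous_div_integrand.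
have out y : ~ cball x y -> gradM w y 0 j - w y * hvec y 0 j = 0.
  move=> Hy; rewrite w0// mul0r subr0.
  apply: (@gradM_zero_on (~` cball x)) => //.
  by apply: closed_openC; exact: closed_cball.
rewrite (@chart_integral i); last 2 first.
- exact: continuous_borel.
- by move=> y Dy; apply: out => /cball_sub.
pose h a := zext (U i) (fun u => (w \o par i) u * flux (@local_map _ _ M i) a j u).
have wK u : U i u -> ~ K u -> w (par i u) = 0.
  move=> Uu Ku; apply: w0 => -[v Kv vu]; apply: Ku.
  by rewrite -(chartK Uu) -vu chartK//; exact: chart_radius_sub Kv.
have Ch a : C1 setT (h a).
  apply: (@C1_zext _ _ _ K) => //.
  - exact: closed_eclosed_ball.
  - exact: chart_radius_sub.
  - by apply: (C1M oU (Cw i)); exact: (C1_flux oU sF pF).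
  - by move=> u Uu Ku; rewrite /= wK// mul0r.
have [k Kk] := eclosed_ball_cube (phi i x) (chart_radius x).
have hk a : cube_supported k (h a).
  move=> u uk; rewrite /h /zext; case: ifPn => // /set_mem Uu.
  by rewrite /= wK ?mul0r// => /Kk.
have E u : (gradM w (chart_inv i u) 0 j - w (chart_inv i u) * hvec (chart_inv i u) 0 j) * density i u =
    \sum_a pd (h a) a u.
  have [Uu|Uu] := pselect (U i u); last first.
    rewrite /density /zext memNset// mulr0 big1// => a _.
    have oK : open (~` K) by apply: closed_openC; exact: closed_eclosed_ball.
    rewrite -(pd_cst 0 a u); apply/esym; apply: (pd_eq_on oK) => [/chart_radius_sub//|v Kv].
    by rewrite /h /zext; case: ifPn => // /set_mem Uv; rewrite /= wK// mul0r.
  rewrite /chart_inv mem_set// density_in// gradM_param// hvec_param// grad_patchE.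
  under [RHS]eq_bigr => a _.
    rewrite (@pd_eq_on _ _ _ oU _ ((w \o par i) \* flux (@local_map _ _ M i) a j))//; last first.
      by move=> v Uv; rewrite /h /zext mem_set.
    rewrite (pdM a (Cw i) (C1_flux oU sF pF a j) Uu).
    over.
  rewrite big_split/= -mulr_sumr (div_flux oU sF pF j Uu).
  rewrite mulrBl mulrN; congr (_ - _).
    by rewrite mulr_suml; apply: eq_bigr => a _; rewrite /flux mulrA mulrAC.
  rewrite /hvec_patch mxE.
  by move: (w _) (\tr _) (Num.sqrt _) (unit_normal _ _ _ _) => *; ring.
rewrite (_ : (fun u => _) = fun u => \sum_a pd (h a) a u); last by apply/funext => u; exact: E.
have H : forall s : seq 'I_n, (lebn R n).-integrable setT (EFin \o (fun u => \sum_(a <- s) pd (h a) a u)) /\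
    \int[lebn R n]_u (\sum_(a <- s) pd (h a) a u) = 0.
  elim=> [|a s [IH1 IH2]].
    rewrite (_ : (fun u => _) = cst 0); last by apply/funext => u; rewrite big_nil.
    split; first exact: integrable0.
    by rewrite /Rintegral integral0.
  have [I1 I2] := integral_pd_eq0 a (Ch a) (hk a).
  rewrite (_ : (fun u => _) = fun u => pd (h a) a u + \sum_(a <- s) pd (h a) a u); last first.
    by apply/funext => u; rewrite big_cons.
  split; first exact: (integrableD measurableT I1 IH1).
  by rewrite RintegralD// I2 IH2 addr0.
exact: (H (index_enum 'I_n)).2.
Qed.

Theorem divergence_theorem (w : M -> R) j : C1man w ->
  \int[mu]_y gradM w y 0 j = \int[mu]_y (w y * hvec y 0 j).
Proof.
move=> Cw; have [s Hs] := cbump_cover.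
have cw := C1man_continuous Cw.
pose S y := \sum_(x <- s) cbump x y.
have CS : C1man S by apply: C1man_sum => x _; exact: C1_cbump.
have S0 y : S y != 0.
  have [x xs xy] := Hs y; rewrite gt_eqF// /S (big_rem x)//=.
  by rewrite ltr_pwDl// sumr_ge0// => z _; exact: cbump_ge0.
(* The functions [cbump x / S] form a partition of unity subordinate to the chart balls; [S] has no
   zero because the bumps cover [M]. *)
pose wx x y := (S y)^-1 * w y * cbump x y.
have Cwx x : C1man (wx x).
  by apply: C1manM; [apply: C1manM => //; exact: C1manV|exact: C1_cbump].
have wE : w = fun y => \sum_(x <- s) wx x y.
  apply/funext => y; have := S0 y; rewrite -mulr_sumr -/(S y).
  by move: (S y) => z z0; rewrite mulrAC mulVf ?mul1r.
have I0 v : C1man v -> mu.-integrable setT (EFin \o (fun y => gradM v y 0 j - v y * hvec y 0 j)).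
  move=> Cv; apply: continuous_integrable; exact: continuous_div_integrand.
have Z : \int[mu]_y (gradM w y 0 j - w y * hvec y 0 j) = 0.
  have -> : (fun y => gradM w y 0 j - w y * hvec y 0 j) =
      (fun y => \sum_(x <- s) (gradM (wx x) y 0 j - wx x y * hvec y 0 j)).
    apply/funext => y; rewrite {1}wE gradM_sum// sumrB; congr (_ - _).
    by rewrite -mulr_suml; congr (_ * _); rewrite {1}wE.
  have IZ x := @divergence_local x (wx x) j (Cwx x) (fun y Hy => etrans (congr1 _ (cbump_out Hy)) (mulr0 _)).
  move: (wx) IZ (Cwx) => v IZ Cv {Hs S CS S0 wx Cwx wE}.
  suff [] : mu.-integrable setT (EFin \o (fun y => \sum_(x <- s) (gradM (v x) y 0 j - v x y * hvec y 0 j))) /\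
    \int[mu]_y (\sum_(x <- s) (gradM (v x) y 0 j - v x y * hvec y 0 j)) = 0 by [].
  elim: s => [|x s [IH1 IH2]].
    rewrite (_ : (fun u => _) = cst 0); last by apply/funext => u; rewrite big_nil.
    split; first exact: integrable0.
    by rewrite /Rintegral integral0.
  rewrite (_ : (fun u => _) = fun y => (gradM (v x) y 0 j - v x y * hvec y 0 j) + \sum_(x <- s) (gradM (v x) y 0 j - v x y * hvec y 0 j)); last first.
    by apply/funext => u; rewrite big_cons.
  split; first exact: (integrableD measurableT (I0 _ (Cv x)) IH1).
  by rewrite RintegralD ?IZ ?IH2 ?addr0//; exact: I0.
apply/eqP; rewrite -subr_eq0 -RintegralB ?Z//; apply: continuous_integrable.
  exact: continuous_gradM.
exact: continuous_hvecM.
Qed.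

End ChartIntegral.

(** * Averages of continuous functions *)

Section ContinuousFunctions.
Variables (R : realType) (T : topologicalType).
Implicit Types f g : T -> R.

Lemma ctsD f g : continuous f -> continuous g -> continuous (fun x => f x + g x).
Proof.
move=> cf cg x; suff H : {for x, continuous (fun x => f x + g x)} by exact: H.
by apply: continuousD; [exact: cf|exact: cg].
Qed.

Lemma ctsB f g : continuous f -> continuous g -> continuous (fun x => f x - g x).
Proof.
move=> cf cg x; suff H : {for x, continuous (fun x => f x - g x)} by exact: H.
by apply: continuousB; [exact: cf|exact: cg].
Qed.

Lemma ctsM f g : continuous f -> continuous g -> continuous (fun x => f x * g x).
Proof.
move=> cf cg x; suff H : {for x, continuous (fun x => f x * g x)} by exact: H.
by apply: continuousM; [exact: cf|exact: cg].
Qed.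

Lemma cts_cst (c : R) : continuous (fun _ : T => c).
Proof. by move=> x; exact: cst_continuous. Qed.

Lemma cts_comp (h : R -> R) f : continuous h -> continuous f -> continuous (fun x => h (f x)).
Proof.
move=> ch cf x; suff H : {for x, continuous (h \o f)} by exact: H.
by apply: continuous_comp; [exact: cf|exact: ch].
Qed.

Lemma cts_norm f : continuous f -> continuous (fun x => `|f x|).
Proof. by apply: (@cts_comp (fun z => `|z|)) => z; exact: norm_continuous. Qed.

Lemma cts_sqrt f : continuous f -> continuous (fun x => Num.sqrt (f x)).
Proof. by apply: cts_comp => z; exact: sqrt_continuous. Qed.

Lemma cts_exp k f : continuous f -> continuous (fun x => f x ^+ k).
Proof. by apply: (@cts_comp (fun z => z ^+ k)) => z; exact: exprn_continuous. Qed.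

Lemma cts_sum (I : Type) (r : seq I) (P : pred I) (f : I -> T -> R) :
  (forall i, P i -> continuous (f i)) -> continuous (fun x => \sum_(i <- r | P i) f i x).
Proof.
move=> cf x; suff H : {for x, continuous (fun x => \sum_(i <- r | P i) f i x)} by exact: H.
by apply: continuous_at_sum => i Pi; exact: cf.
Qed.

Lemma cts_max f g : continuous f -> continuous g -> continuous (fun x => Num.max (f x) (g x)).
Proof.
move=> cf cg x; suff H : {for x, continuous (fun x => Num.max (f x) (g x))} by exact: H.
by apply: continuous_max; [exact: cf|exact: cg].
Qed.

Lemma powR_norm_continuous (p : R) : 0 < p -> continuous (fun z : R => `|z| `^ p).
Proof.
move=> p0 z; suff H : {for z, continuous (fun z : R => `|z| `^ p)} by exact: H.
have [->|z0] := eqVneq z 0.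
  apply/cvgrPdist_le => e e0; near=> t.
  rewrite normr0 powR0 ?gt_eqF// sub0r normrN ger0_norm ?powR_ge0//.
  rewrite (_ : e = (e `^ p^-1) `^ p); last by rewrite -powRrM mulVf ?gt_eqF// powRr1// ltW.
  apply: (ge0_ler_powR (ltW p0)); rewrite ?nnegrE ?powR_ge0//.
  near: t; have ep : 0 < e `^ p^-1 by exact: powR_gt0.
  apply: filterS (@nbhsx_ballx R R 0 _ ep) => t.
  by rewrite -ball_normE /= sub0r normrN => /ltW.
apply: (@continuous_comp _ _ _ (fun z : R => `|z|) (fun z => z `^ p)); first exact: norm_continuous.
have nz : 0 < `|z| by rewrite normr_gt0.
have [/derivable1_diffP d _] := is_derive1_powR p nz.
exact: differentiable_continuous.
Unshelve. all: by end_near. Qed.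

Lemma cts_powR p f : 0 < p -> (forall x, 0 <= f x) -> continuous f -> continuous (fun x => f x `^ p).
Proof.
move=> p0 f0 cf; have := cts_comp (powR_norm_continuous p0) cf.
by under eq_fun do rewrite ger0_norm//.
Qed.

End ContinuousFunctions.

Ltac cts :=
  match goal with
  | |- continuous (fun _ => ?c) => exact: cts_cst
  | |- continuous (fun x => @?f x - @?g x) => apply: (ctsB (f := f) (g := g)); cts
  | |- continuous (fun x => @?f x + @?g x) => apply: (ctsD (f := f) (g := g)); cts
  | |- continuous (fun x => @?f x * @?g x) => apply: (ctsM (f := f) (g := g)); cts
  | |- continuous (fun x => @?f x ^+ ?k) => apply: (cts_exp (k := k) (f := f)); cts
  | |- continuous (fun x => `|@?f x|) => apply: (cts_norm (f := f)); cts
  | |- continuous (fun x => Num.sqrt (@?f x)) => apply: (cts_sqrt (f := f)); cts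
  | |- continuous (fun x => \sum_(i <- _ | _) _) => apply: cts_sum => ? _; cts
  | |- _ => first [assumption | solve [auto] | idtac]
  end.

Section Average.
Variables (R : realType) (n : nat) (M : closedHypersurface R n).
Local Notation mu := (hs_vol M).
Local Notation E := (@hs_average R n M).
Implicit Types f g : M -> R.

Lemma hs_volume_gt0 : 0 < hs_volume (setT : set M).
Proof. by apply: fine_gt0; rewrite hs_vol_gt0 hs_vol_fin. Qed.

Lemma avgD f g : continuous f -> continuous g -> E (fun x => f x + g x) = E f + E g.
Proof. by move=> cf cg; rewrite /hs_average RintegralD ?mulrDr//; exact: continuous_integrable. Qed.

Lemma avgZ c f : continuous f -> E (fun x => c * f x) = c * E f.
Proof.
by move=> cf; rewrite /hs_average RintegralZl//; [rewrite mulrCA|exact: continuous_integrable].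
Qed.

Lemma avgB f g : continuous f -> continuous g -> E (fun x => f x - g x) = E f - E g.
Proof. by move=> cf cg; rewrite /hs_average RintegralB ?mulrBr//; exact: continuous_integrable. Qed.

Lemma avg_cst c : E (fun=> c) = c.
Proof.
have mf : mu setT \is a fin_num by rewrite ge0_fin_numE// hs_vol_fin.
rewrite /hs_average /Rintegral integral_cst// fineM//=.
by rewrite mulrC -mulrA divff ?mulr1// gt_eqF// hs_volume_gt0.
Qed.

Lemma avg_le f g : continuous f -> continuous g -> (forall x, f x <= g x) -> E f <= E g.
Proof.
move=> cf cg fg; rewrite /hs_average ler_wpM2l ?invr_ge0 ?(ltW hs_volume_gt0)//.
apply: le_Rintegral => //; exact: continuous_integrable.
Qed.

Lemma avg_ge0 f : continuous f -> (forall x, 0 <= f x) -> 0 <= E f.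
Proof. by move=> cf f0; rewrite -(avg_cst 0); apply: avg_le => // x; exact: cst_continuous. Qed.

Lemma avg_sum (I : Type) (r : seq I) (f : I -> M -> R) : (forall i, continuous (f i)) ->
  E (fun x => \sum_(i <- r) f i x) = \sum_(i <- r) E (f i).
Proof.
move=> cf; elim: r => [|i r IH].
  by under [X in E X]eq_fun do rewrite big_nil; rewrite avg_cst big_nil.
under [X in E X]eq_fun do rewrite big_cons.
by rewrite avgD ?big_cons ?IH//; exact: cts_sum.
Qed.

Lemma avg_norm f : continuous f -> `|E f| <= E (fun x => `|f x|).
Proof.
move=> cf; have cnf := cts_norm cf; rewrite ler_norml; apply/andP; split.
  rewrite -[X in X <= _]mulN1r -avgZ//; apply: avg_le => // [|x]; first by cts.
  by rewrite mulN1r lerNl -normrN ler_norm.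
by apply: avg_le => // x; exact: ler_norm.
Qed.

(** Nonnegativity of the variance of [|f|]. *)
Lemma avg_sqr f (a : R) : continuous f -> 0 <= a -> E (fun x => f x ^+ 2) <= a ^+ 2 ->
  E (fun x => `|f x|) <= a.
Proof.
move=> cf a0 H.
have H2 : E (fun x => `|f x|) ^+ 2 <= a ^+ 2.
  apply: le_trans H; have [m Em] : exists m, E (fun x => `|f x|) = m by exists (E (fun x => `|f x|)).
  have : 0 <= E (fun x => (`|f x| - m) ^+ 2).
    apply: avg_ge0 => [|x]; last exact: sqr_ge0.
    by cts.
  have -> : (fun x => (`|f x| - m) ^+ 2) = (fun x => f x ^+ 2 + (m ^+ 2 - 2 * m * `|f x|)).
    by apply/funext => x; rewrite -[f x ^+ 2]real_normK ?num_real//; ring.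
  rewrite avgD ?avgB ?(avgZ (2 * m)) ?avg_cst ?Em; try by cts.
  by move: (E _) => *; nra.
by rewrite -(@ler_pXn2r _ 2%N)// nnegrE avg_ge0//; exact: cts_norm.
Qed.

Lemma young_weighted (t x y : R) : 0 <= t <= 1 -> 0 <= x -> 0 <= y ->
  x `^ t * y `^ (1 - t) <= t * x + (1 - t) * y.
Proof.
move=> /andP[t0 t1] x0 y0.
have [->|tn0] := eqVneq t 0; first by rewrite powRr0 subr0 powRr1// !mul1r mul0r add0r.
have [->|tn1] := eqVneq t 1; first by rewrite subrr powRr0 powRr1// mulr1 mul1r mul0r addr0.
have tp : 0 < t by rewrite lt_neqAle eq_sym tn0.
have sp : 0 < 1 - t by rewrite subr_gt0 lt_neqAle tn1.
have := @conjugate_powR R (x `^ t) (y `^ (1 - t)) t^-1 (1 - t)^-1.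
rewrite !powR_ge0 !invr_gt0 tp sp !invrK addrC subrK => /(_ isT isT isT isT erefl); rewrite -!powRrM !divff ?gt_eqF// !powRr1//.
by rewrite [x * t]mulrC [y * _]mulrC.
Qed.

(** Weighted Young inequality for [f / a] and [g / b]. Positive upper bounds [a], [b] in place of
    the averages themselves avoid a case distinction when an average vanishes. *)
Lemma avg_hoelder f g (t a b : R) : 0 < t -> t < 1 -> continuous f -> continuous g ->
  (forall x, 0 <= f x) -> (forall x, 0 <= g x) -> 0 < a -> 0 < b -> E f <= a -> E g <= b ->
  E (fun x => f x `^ t * g x `^ (1 - t)) <= a `^ t * b `^ (1 - t).
Proof.
move=> t0 t1 cf cg f0 g0 a0 b0 fa gb; have t1' : 0 < 1 - t by rewrite subr_gt0.
pose c := a `^ t * b `^ (1 - t); have c0 : 0 < c by rewrite mulr_gt0 ?powR_gt0.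
have H x : f x `^ t * g x `^ (1 - t) <= c * t / a * f x + c * (1 - t) / b * g x.
  have fa0 : 0 <= f x / a by rewrite divr_ge0// ltW.
  have gb0 : 0 <= g x / b by rewrite divr_ge0// ltW.
  have := @young_weighted t (f x / a) (g x / b); rewrite (ltW t0) (ltW t1) => /(_ isT fa0 gb0) Y.
  have -> : f x `^ t * g x `^ (1 - t) = c * ((f x / a) `^ t * (g x / b) `^ (1 - t)).
    rewrite mulrACA -!powRM ?(ltW a0) ?(ltW b0)//.
    by congr (_ `^ _ * _ `^ _); rewrite mulrCA divff ?mulr1// gt_eqF.
  apply: (le_trans (ler_wpM2l (ltW c0) Y)).
  by rewrite le_eqVlt; apply/orP; left; apply/eqP; ring.
apply: (@le_trans _ _ (E (fun x => c * t / a * f x + c * (1 - t) / b * g x))).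
  apply: avg_le => //; first by apply: ctsM; exact: cts_powR.
  by cts.
rewrite avgD ?avgZ//; try by cts.
apply: (@le_trans _ _ (c * t / a * a + c * (1 - t) / b * b)).
  have ca := ltW (divr_gt0 (mulr_gt0 c0 t0) a0).
  have cb := ltW (divr_gt0 (mulr_gt0 c0 t1') b0).
  by rewrite lerD ?ler_wpM2l.
by rewrite !mulfVK ?gt_eqF// -mulrDr addrC subrK mulr1.
Qed.

End Average.

(** * Integral identities for distance and height *)

Section Identities.
Variables (R : realType) (n : nat) (M : closedHypersurface R n).
Hypothesis hn : (0 < n)%N.
Local Notation X := (@hs_map R n M).
Local Notation E := (@hs_average R n M).
Implicit Types (c e : 'rV[R]_n.+1) (x : M).

Lemma avg_div (w : 'I_n.+1 -> M -> R) : (forall j, C1man (w j)) ->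
  E (fun x => \sum_j gradM (w j) x 0 j) = E (fun x => \sum_j w j x * hvec x 0 j).
Proof.
move=> Cw; rewrite !avg_sum.
- by apply: eq_bigr => j _; rewrite /hs_average divergence_theorem.
- by move=> j; apply: continuous_hvecM; exact: C1man_continuous.
- by move=> j; exact: continuous_gradM.
Qed.

Lemma nunuE (x : M) i j : gradM (fun y => X y 0 i) x 0 j = (i == j)%:R - nunu x i j.
Proof. by rewrite /nunu opprB addrC subrK. Qed.

Lemma C1_coordY c i : C1man (fun x => (X x - c) 0 i).
Proof.
have := C1manD (@C1_coordX _ _ M i) (@C1man_cst _ _ M (- c 0 i)).
by congr C1man; apply/funext => x; rewrite !mxE.
Qed.

Lemma gradM_coordY c i x j : gradM (fun x => (X x - c) 0 i) x 0 j = (i == j)%:R - nunu x i j.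
Proof.
rewrite -nunuE (_ : (fun x => _) = fun x => X x 0 i + - c 0 i); last by apply/funext => y; rewrite !mxE.
apply: (etrans (gradMD x j (@C1_coordX _ _ M i) (C1man_cst (- c 0 i)))).
by rewrite (gradM_cst (M := M) (- c 0 i)) addr0.
Qed.

Definition height c e x := edot (X x - c) e.
Definition dist2 c x := edot (X x - c) (X x - c).
(** The squared normal component <nu, e>^2, written without choosing [nu]. *)
Definition nsq x e := \sum_i \sum_j nunu x i j * e 0 i * e 0 j.

Lemma C1_height c e : C1man (height c e).
Proof. by apply: C1man_sum => i _; apply: C1manM; [exact: C1_coordY|exact: C1man_cst]. Qed.

Lemma C1_dist2 c : C1man (dist2 c).
Proof. by apply: C1man_sum => i _; apply: C1manM; exact: C1_coordY. Qed.

Lemma sum_grad_proj (a : 'I_n.+1 -> R) x j :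
  \sum_i a i * ((i == j)%:R - nunu x i j) = a j - \sum_i a i * nunu x i j.
Proof.
under eq_bigr do rewrite mulrBr; rewrite sumrB (bigD1 j)//= eqxx mulr1 big1 ?addr0// => i /negbTE ->.
by rewrite mulr0.
Qed.

Lemma gradM_height c e x j : gradM (height c e) x 0 j = e 0 j - \sum_i e 0 i * nunu x i j.
Proof.
rewrite -(sum_grad_proj (fun i => e 0 i)) gradM_sum => [|i]; last first.
  by apply: C1manM; [exact: C1_coordY|exact: C1man_cst].
apply: eq_bigr => i _; apply: (etrans (gradMM x j (C1_coordY c i) (C1man_cst (e 0 i)))).
by rewrite (gradM_cst (M := M) (e 0 i)) mulr0 addr0 gradM_coordY mulrC.
Qed.

Lemma gradM_dist2 c x j : gradM (dist2 c) x 0 j =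
  2 * ((X x - c) 0 j - \sum_i (X x - c) 0 i * nunu x i j).
Proof.
rewrite -(sum_grad_proj (fun i => (X x - c) 0 i)) gradM_sum => [|i]; last first.
  by apply: C1manM; exact: C1_coordY.
rewrite mulr_sumr; apply: eq_bigr => i _; apply: (etrans (gradMM x j (C1_coordY c i) (C1_coordY c i))).
by rewrite gradM_coordY; move: ((X x - c) 0 i) (_ - nunu _ _ _) => *; ring.
Qed.

Lemma nsqE x e : edot e e - nsq x e = \sum_j e 0 j * (e 0 j - \sum_i e 0 i * nunu x i j).
Proof.
rewrite /nsq /edot exchange_big/= -sumrB; apply: eq_bigr => j _.
by rewrite mulrBr mulr_sumr; congr (_ - _); apply: eq_bigr => i _; ring.
Qed.

Lemma trace_nunu x : \sum_j ((j == j)%:R - nunu x j j) = n%:R.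
Proof.
have [nu [n1 nE _]] := hs_normal x hn.
under eq_bigr => j _ do rewrite eqxx nE.
by rewrite sumrB sumr_const card_ord -/(edot nu nu) n1 -[n.+1]addn1 natrD addrK.
Qed.

(** Divergence theorem for the field f(|Y|^2) Y with Y = X - c. Its tangential divergence is n f + 2
    f' |Y^T|^2, and |Y^T|^2 is [dist2 c] minus [nsq]. *)
Lemma dist2_identity c (f : R -> R) : (forall z, derivable f z 1) -> continuous (derive1 f) ->
  E (fun x => n%:R * f (dist2 c x) + 2 * derive1 f (dist2 c x) * (dist2 c x - nsq x (X x - c))) =
  E (fun x => f (dist2 c x) * edot (hvec x) (X x - c)).
Proof.
move=> df cf; have Cf : C1man (fun x => f (dist2 c x)) by exact: C1man_comp (C1_dist2 c) df cf.
have := @avg_div (fun j x => f (dist2 c x) * (X x - c) 0 j) _.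
have H j : C1man (fun x => f (dist2 c x) * (X x - c) 0 j) by apply: C1manM => //; exact: C1_coordY.
move/(_ H) => {}H.
transitivity (E (fun x => \sum_j gradM (fun x => f (dist2 c x) * (X x - c) 0 j) x 0 j)).
  congr hs_average; apply/funext => x; rewrite [dist2 c x - _]nsqE.
  transitivity (\sum_j (derive1 f (dist2 c x) * gradM (dist2 c) x 0 j * (X x - c) 0 j +
     f (dist2 c x) * ((j == j)%:R - nunu x j j))); last first.
    apply: eq_bigr => j _; apply/esym; apply: (etrans (gradMM x j Cf (C1_coordY c j))).
    rewrite gradM_coordY; congr (_ * _ + _).
    exact: (gradM_comp (f := f) j (C1_dist2 c)).
  rewrite big_split/= addrC -mulr_sumr trace_nunu [_ * n%:R]mulrC; congr (_ + _).
  rewrite mulr_sumr; apply: eq_bigr => j _; rewrite gradM_dist2.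
  by move: (derive1 f _) (_ 0 j) (\sum_i _) => *; ring.
rewrite H; congr hs_average; apply/funext => x; rewrite /edot mulr_sumr.
by apply: eq_bigr => j _; move: (f _) (hvec x 0 j) (_ 0 j) => *; ring.
Qed.

(** Divergence theorem for the field f(<Y, e>) e; the tangential part of [e] has squared length
    [edot e e - nsq x e]. *)
Lemma height_identity c e (f : R -> R) : (forall z, derivable f z 1) -> continuous (derive1 f) ->
  E (fun x => derive1 f (height c e x) * (edot e e - nsq x e)) =
  E (fun x => f (height c e x) * edot (hvec x) e).
Proof.
move=> df cf; have Cf : C1man (fun x => f (height c e x)) by exact: C1man_comp (C1_height c e) df cf.
have := @avg_div (fun j x => f (height c e x) * e 0 j) _.
have H j : C1man (fun x => f (height c e x) * e 0 j) by apply: C1manM => //; exact: C1man_cst.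
move/(_ H) => {}H.
transitivity (E (fun x => \sum_j gradM (fun x => f (height c e x) * e 0 j) x 0 j)).
  congr hs_average; apply/funext => x; rewrite nsqE mulr_sumr; apply: eq_bigr => j _.
  apply/esym; apply: (etrans (gradMM x j Cf (C1man_cst (e 0 j)))).
  rewrite (gradM_cst (M := M) (e 0 j)) mulr0 addr0.
  apply: (etrans (congr1 (fun z => z * e 0 j) (gradM_comp (f := f) j (C1_height c e) (df _)))).
  by rewrite gradM_height; move: (derive1 f _) (_ 0 j) (\sum_i _) => *; ring.
rewrite H; congr hs_average; apply/funext => x; rewrite /edot mulr_sumr.
by apply: eq_bigr => j _; move: (f _) (hvec x 0 j) (_ 0 j) => *; ring.
Qed.

Lemma continuous_dist2 c : continuous (dist2 c).
Proof. exact: C1man_continuous (C1_dist2 c). Qed.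

Lemma continuous_height c e : continuous (height c e).
Proof. exact: C1man_continuous (C1_height c e). Qed.

Lemma continuous_coordY c i : continuous (fun x => (X x - c) 0 i).
Proof. exact: C1man_continuous (C1_coordY c i). Qed.

Lemma continuous_nunu i j : continuous (fun x : M => nunu x i j).
Proof.
have cg := continuous_gradM (j := j) (@C1_coordX _ _ M i).
by apply: ctsB => //; exact: cts_cst.
Qed.

Lemma continuous_nsq e : continuous (fun x => nsq x e).
Proof.
apply: cts_sum => i _; apply: cts_sum => j _.
have cn := @continuous_nunu i j.
by cts.
Qed.

Definition curv x := `|mean_curvature x|.

Lemma curv_enorm x : enorm (hvec x) = n%:R * curv x.
Proof.
have [nu [n1 _ hE]] := hs_normal x hn.
have -> : hvec x = (n%:R * mean_curvature x) *: nu by apply/rowP => j; rewrite hE mxE.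
by rewrite enormZ /enorm n1 sqrtr1 mulr1 normrM normr_nat.
Qed.

Lemma continuous_curv : continuous curv.
Proof.
have -> : curv = fun x => n%:R^-1 * Num.sqrt (\sum_j hvec x 0 j * hvec x 0 j).
  apply/funext => x; rewrite -/(edot (hvec x) (hvec x)) -/(enorm (hvec x)) curv_enorm mulrA mulVf ?mul1r//.
  by rewrite pnatr_eq0 -lt0n.
apply: ctsM; first exact: cts_cst.
apply: cts_sqrt; apply: cts_sum => j _.
have ch := @continuous_hvec _ _ M j.
by cts.
Qed.

End Identities.

(** * Lower volume density at a point *)

Section FirstOrder.
Variables (R : realType) (m l : nat).

Lemma quad_gram (F : 'rV[R]_m -> 'rV[R]_l) u v : quad (gram F u) v = edot (v *m 'J F u) (v *m 'J F u).
Proof. by rewrite edotE trmx_mul /quad /gram !mulmxA. Qed.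

Lemma edot_coord k (v : 'rV[R]_k) (r : R) j : 0 <= r -> edot v v <= r ^+ 2 -> `|v 0 j| <= r.
Proof.
move=> r0 H; rewrite -(@ler_pXn2r _ 2%N)// ?nnegrE// real_normK ?num_real//.
apply: le_trans H; rewrite /edot (bigD1 j)//= -expr2 lerDl.
by apply: sumr_ge0 => i _; rewrite -expr2 sqr_ge0.
Qed.

Lemma sup_le k (v : 'rV[R]_k) (r : R) : 0 <= r -> (forall j, `|v 0 j| <= r) -> `|v| <= r.
Proof.
move=> r0 H; rewrite [`|v|]mx_normrE; apply: bigmax_le => // -[i j] _ /=.
by rewrite ord1.
Qed.

(** [v] is recovered from [v *m 'J F u] by multiplication with [P], whose entries give the
    constant. *)
Lemma gram_coercive (F : 'rV[R]_m -> 'rV[R]_l) u : gram F u \in unitmx ->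
  exists K : R, 0 < K /\ forall v r, 0 <= r -> quad (gram F u) v <= r ^+ 2 -> `|v| <= K * r.
Proof.
move=> uG; pose P := ('J F u)^T *m invmx (gram F u).
pose K := 1 + \sum_j \sum_a `|P j a|.
have K0 : 0 <= \sum_j \sum_a `|P j a| by apply: sumr_ge0 => j _; apply: sumr_ge0 => a _.
exists K; split=> [|v r r0 H]; first by rewrite ltr_pwDl.
have vE : v = (v *m 'J F u) *m P by rewrite /P mulmxA -(mulmxA v) -/(gram F u) mulmxK.
apply: sup_le => [|a]; first by rewrite mulr_ge0// ltW// ltr_pwDl.
rewrite vE mxE (le_trans (ler_norm_sum _ _ _))// (@le_trans _ _ (\sum_j r * `|P j a|))//.
  apply: ler_sum => j _; rewrite normrM ler_wpM2r//.
  by apply: edot_coord => //; rewrite -quad_gram.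
rewrite -mulr_sumr mulrC ler_wpM2r// /K ler_wpDl// ler_sum// => j _.
by rewrite (bigD1 a)//= lerDl sumr_ge0.
Qed.

(** The linear part uses radius [s / 2], and the remaining half absorbs the Taylor remainder. *)
Lemma first_order_ball (U : set 'rV[R]_m) (F : 'rV[R]_m -> 'rV[R]_l) u : open U -> smooth_on U F -> U u ->
  gram F u \in unitmx ->
  exists s0 : R, 0 < s0 /\ forall s v, 0 < s -> s < s0 -> quad (gram F u) v < (s / 2) ^+ 2 ->
    edot (F (v + u) - F u) (F (v + u) - F u) < s ^+ 2.
Proof.
move=> oU sF Uu uG; have [K [K0 HK]] := gram_coercive uG.
(* With [|v| <= K * (s / 2)] this bounds each coordinate of the remainder by [s / (2 * (1 + l))], so
   the whole remainder has Euclidean length at most [s / 2]. *)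
pose d : R := (K * (1 + l%:R))^-1.
have l0 : 0 < (1 + l%:R) :> R by rewrite ltr_pwDl.
have d0 : 0 < d by rewrite invr_gt0 mulr_gt0.
have N j : \forall h \near (0 : 'rV[R]_m), `|F (h + u) 0 j - F u 0 j - (h *m 'J F u) 0 j| <= d * `|h|.
  have df := C1_diff (smooth_C1 oU j sF) Uu.
  have /eqaddoP/(_ d d0) := diff_locally df.
  apply: filterS => h H.
  have <- : 'd (fun u => F u 0 j) u h = (h *m 'J F u) 0 j; last by rewrite -addrA -opprD; exact: H.
  rewrite -deriveE// diff_sum_pd// mxE; apply: eq_bigr => a _.
  by rewrite (C1_jacobianE (U := U) a j (fun j => smooth_C1 oU j sF) Uu).
have [e e0 He] : exists2 e : R, 0 < e & forall h, `|h| < e ->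
    forall j, `|F (h + u) 0 j - F u 0 j - (h *m 'J F u) 0 j| <= d * `|h|.
  have [e e0 He] := (@nbhs_normP R 'rV[R]_m 0 _).1 (filter_forall _ N).
  by exists e => // h hh j; apply: He; rewrite /= sub0r normrN.
exists (e / K); split=> [|s v s0 se H]; first exact: divr_gt0.
have vK : `|v| <= K * (s / 2) by apply: HK; [rewrite divr_ge0// ltW|exact: ltW].
have ve : `|v| < e.
  apply: (le_lt_trans vK); apply: (@le_lt_trans _ _ (K * s)).
    by rewrite ler_pM2l// ler_pdivrMr// ler_peMr ?ler1n// ltW.
  by rewrite mulrC -ltr_pdivlMr.
have Hj := He v ve.
pose a := v *m 'J F u; pose b := F (v + u) - F u - a.
have bj j : b 0 j ^+ 2 <= (s / (2 * (1 + l%:R))) ^+ 2.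
  rewrite -real_normK ?num_real// ler_pXn2r ?nnegrE//; last by rewrite divr_ge0 ?mulr_ge0 ?ltW.
  have -> : b 0 j = F (v + u) 0 j - F u 0 j - a 0 j by rewrite /b !mxE.
  apply: (le_trans (Hj j)); apply: (@le_trans _ _ (d * (K * (s / 2)))); first by rewrite ler_pM2l.
  rewrite le_eqVlt; apply/orP; left; apply/eqP; rewrite /d.
  by move: K0 l0; move: (1 + l%:R) => x ? ?; field; rewrite !gt_eqF.
have eb : edot b b <= (s / 2) ^+ 2.
  apply: (@le_trans _ _ (\sum_(j < l) (s / (2 * (1 + l%:R))) ^+ 2)).
    by apply: ler_sum => j _; rewrite -expr2.
  rewrite sumr_const card_ord -[X in X <= _]mulr_natr.
  have : 0 <= l%:R :> R by [].
  move: l0; move: (l%:R : R) => x x1 x0.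
  have -> : (s / (2 * (1 + x))) ^+ 2 * x = (s / 2) ^+ 2 * (x / (1 + x) ^+ 2) by field; rewrite gt_eqF.
  by rewrite ler_piMr ?sqr_ge0// ler_pdivrMr ?exprn_gt0// mul1r; nra.
have ea : edot a a < (s / 2) ^+ 2 by rewrite -quad_gram.
have -> : F (v + u) - F u = a + b by rewrite /b addrCA subrr addr0.
clearbody b a.
apply: (@le_lt_trans _ _ (2 * edot a a + 2 * edot b b)).
  rewrite /edot !mulr_sumr -big_split/=; apply: ler_sum => j _.
  rewrite -subr_ge0 (_ : _ - _ = (a 0 j - b 0 j) ^+ 2) ?sqr_ge0//.
  by rewrite !mxE; ring.
by move: (edot a a) (edot b b) ea eb => x y ea eb; nra.
Qed.

End FirstOrder.

(** The constant depends on [n] only, while the admissible radii depend on the point: this is the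
    initial value for the monotonicity formula. Near [x0] the chart preimage of the ball contains an
    ellipsoid of the Gram matrix. *)
Lemma volume_density (R : realType) (n : nat) : exists c : R, 0 < c /\
  forall (M : closedHypersurface R n) (x0 : M), exists s0 : R, 0 < s0 /\
  forall s, 0 < s -> s < s0 ->
    c * s ^+ n <= hs_volume [set x : M | dist2 (hs_map x0) x < s ^+ 2].
Proof.
have [c [c0 Hc]] := ellipsoid_volume R n.
(* A factor 2^n is lost to the radius [s / 2] of the ellipsoid, and a factor 2 to bounding the
   density below by half its value at the centre. *)
exists (c / 2 ^+ n.+1); split=> [|M x0]; first by rewrite divr_gt0// exprn_gt0.
pose i := chart_at x0; pose u := chart i x0; pose F := local_map i; pose G := gram F u.
have oU := @open_chart_im _ _ M i; have sF := @patch_smooth _ _ M i; have pF := @patch_posdef _ _ M i.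
have Uu : chart_im i u by apply: chart_imP; exact: chart_at_dom.
have GT : G^T = G by rewrite /G /gram trmx_mul trmxK.
have uG : G \in unitmx by apply: posdef_unit; exact: pF.
have [s1 [s10 H1]] := first_order_ball oU sF Uu uG.
have [K [K0 HK]] := gram_coercive uG.
have [G0 _] := Hc G 1 (pF _ Uu) GT ltr01.
have sG0 : 0 < Num.sqrt (\det G) by rewrite sqrtr_gt0.
have [e e0 He] : exists2 e : R, 0 < e & forall h, `|h| < e -> chart_im i (h + u) /\
    Num.sqrt (\det G) / 2 <= density i (h + u).
  have cd : {for u, continuous (fun u => Num.sqrt (\det (gram F u)))}.
    exact: C1_continuous (C1_sqrt_det oU sF pF) Uu.
  have N1 : \forall y \near u, chart_im i y by exact: open_nbhs_nbhs.
  have N2 : \forall y \near u, Num.sqrt (\det G) / 2 < Num.sqrt (\det (gram F y)).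
    apply: (@cvgr_gt _ _ _ _ _ _ cd); rewrite ltr_pdivrMr// ltr_pMr//.
    by rewrite ltr1n.
  have [e e0 He] := (@nbhs_normP R 'rV[R]_n u _).1 (filterI N1 N2).
  exists e => // h hh; have [Uh dh] : chart_im i (h + u) /\
      Num.sqrt (\det G) / 2 < Num.sqrt (\det (gram F (h + u))).
    by apply: He; rewrite /= opprD addrCA subrr addr0 normrN.
  by split; [exact: Uh|rewrite (density_in Uh); exact: ltW dh].
exists (Num.min s1 (e / K)); rewrite lt_min s10 divr_gt0//; split=> // s s0.
rewrite lt_min => /andP[ss1 se].
set D := [set x | _].
have mD : measurable (D : set (borel M)).
  apply: open_borel; apply: (@open_comp _ _ (dist2 (hs_map x0)) [set z | z < s ^+ 2]); last exact: open_lt.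
  by move=> y _; exact: continuous_dist2.
have mDfin : (hs_vol M D < +oo)%E.
  by apply: le_lt_trans (hs_vol_fin M); apply: le_measure; rewrite ?inE.
rewrite /hs_volume -lee_fin fineK ?ge0_fin_numE//.
have mDi := @measurable_chart_dom R n M i.
apply: (@le_trans _ _ (hs_vol M (D `&` chart_dom i))); last first.
  by apply: le_measure; rewrite ?inE//; exact: measurableI.
rewrite chart_measure//.
pose Q := ellipsoid G ((s / 2) ^+ 2).
have oQ : open Q := @open_ellipsoid R n G _.
have mQ : measurable (Q : set (borel 'rV[R]_n)) by exact: open_borel.
rewrite -(@lebn_shift _ _ u); last 2 first.
- apply/measurable_EFinP; apply: measurable_funM; last exact: measurable_density.
  apply: (@measurableT_comp _ _ _ _ _ _ (\1_D : borel M -> R)); last exact: measurable_chart_inv.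
  exact: measurable_indic.
- by move=> v; rewrite lee_fin mulr_ge0// density_ge0.
apply: (@le_trans _ _ (\int[lebn R n]_v ((Num.sqrt (\det G) / 2) * \1_Q v)%:E)%E); last first.
  apply: ge0_le_integral => //.
  - by apply/measurable_EFinP; apply: measurable_funM => //; exact: measurable_indic.
  - apply/measurable_EFinP; apply: (@measurable_shift_comp _ _ _ _ u (fun v => \1_D (chart_inv i v) * density i v)).
    apply: measurable_funM; last exact: measurable_density.
    apply: (@measurableT_comp _ _ _ _ _ _ (\1_D : borel M -> R)); last exact: measurable_chart_inv.
    exact: measurable_indic.
  - move=> v _; rewrite lee_fin; have [Qv|Qv] := pselect (Q v); last first.
      by rewrite [\1_Q v]indicE memNset// mulr0 mulr_ge0// density_ge0.
    have vK : `|v| <= K * (s / 2) by apply: HK; [rewrite divr_ge0// ltW|exact: ltW].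
    have ve : `|v| < e.
      apply: (le_lt_trans vK); apply: (@le_lt_trans _ _ (K * s)).
        by rewrite ler_pM2l// ler_pdivrMr// ler_peMr ?ler1n// ltW.
      by rewrite mulrC -ltr_pdivlMr.
    have [Uv dv] := He v ve.
    rewrite [\1_Q v]indicE mem_set// mulr1 indicE mem_set ?mul1r//.
    rewrite /chart_inv mem_set// /D/= /dist2.
    have := H1 s v s0 ss1 Qv.
    by rewrite /F /local_map/= /u paramK//; exact: chart_at_dom.
under eq_integral do rewrite EFinM.
rewrite ge0_integralZl//; [|exact: measurable_EFin_indic..].
rewrite integral_indic// setIT.
have [_ HQ] := Hc G (s / 2) (pF _ Uu) GT (divr_gt0 s0 (ltr0Sn _ 1)).
apply: le_trans (lee_wpmul2l _ HQ); last by rewrite lee_fin divr_ge0// ltW.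
rewrite -EFinM lee_fin le_eqVlt; apply/orP; left; apply/eqP.
rewrite expr_div_n exprS; move: sG0 (@exprn_gt0 R n 2 ltac:(by [])).
by move: (Num.sqrt _) (2 ^+ n) (s ^+ n) => x y z xp yp; field; rewrite !gt_eqF.
Qed.

(** A quadratic error bound survives averaging, so this differentiates averages in a parameter
    without any limit theorem. *)
Lemma is_derive_quadratic (R : realType) (f : R -> R) (z d K : R) :
  (forall h, `|f (z + h) - f z - h * d| <= K * h ^+ 2) -> is_derive z 1 f d.
Proof.
move=> H; have L : (fun h : R => h^-1 *: (f (h *: (1 : R) + z) - f z)) @ 0^' --> d.
  apply/cvgrPdist_le => e e0; near=> h.
  have h0 : h != 0 by near: h; exact: nbhs_dnbhs_neq.
  rewrite [h *: (1 : R)]mulr1 (addrC h).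
  have -> : d - h^-1 *: (f (z + h) - f z) = - (h^-1 * (f (z + h) - f z - h * d)).
    by rewrite [_ *: _]/(h^-1 * _) [in RHS]mulrBr opprB mulrA mulVf// mul1r.
  rewrite normrN normrM normfV ler_pdivrMl ?normr_gt0//.
  rewrite (le_trans (H h))// -real_normK ?num_real// expr2 mulrCA ler_wpM2l//.
  have K1 : 0 < `|K| + 1 by rewrite ltr_wpDl.
  have hh : `|h| <= e / (`|K| + 1) by near: h; apply: dnbhs0_le; rewrite divr_gt0.
  apply: (@le_trans _ _ ((`|K| + 1) * `|h|)).
    by rewrite ler_wpM2r// (le_trans (ler_norm K))// lerDl.
  by rewrite mulrC -ler_pdivlMr.
by split; [exact: cvgP L|exact: cvg_lim L].
Unshelve. all: by end_near. Qed.

Lemma discriminant_le0 (R : realFieldType) (a b c : R) : 0 <= a -> 0 <= c ->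
  (forall x : R, 0 <= a - 2 * x * b + x ^+ 2 * c) -> b ^+ 2 <= a * c.
Proof.
move=> a0 c0 H; have [v0|vn0] := eqVneq c 0.
  have [->|bn0] := eqVneq b 0; first by rewrite v0 mulr0 expr0n.
  have := H ((a + 1) / (2 * b)); rewrite v0 mulr0 addr0.
  have -> : a - 2 * ((a + 1) / (2 * b)) * b = -1 by field.
  by rewrite ler0N1.
have vp : 0 < c by rewrite lt_neqAle eq_sym vn0.
have := H (b / c).
have -> : a - 2 * (b / c) * b + (b / c) ^+ 2 * c = (a * c - b ^+ 2) / c by field.
by rewrite pmulr_lge0 ?invr_gt0// subr_ge0.
Qed.

Lemma edot_enorm (R : realType) m (u v : 'rV[R]_m) : edot u v <= enorm u * enorm v.
Proof.
rewrite (le_trans (ler_norm _))// -(@ler_pXn2r _ 2%N)// ?nnegrE ?mulr_ge0 ?enorm_ge0//.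
rewrite real_normK ?num_real// exprMn !sqr_enorm.
apply: discriminant_le0 => [||x]; [exact: edot_ge0..|].
have -> : edot u u - 2 * x * edot u v + x ^+ 2 * edot v v = edot (u - x *: v) (u - x *: v).
  by rewrite /edot !mulr_sumr -sumrB -big_split/=; apply: eq_bigr => j _; rewrite !mxE; ring.
exact: edot_ge0.
Qed.

Lemma powRD_gt0 (R : realType) (x y t : R) : 0 < t -> t `^ (x + y) = t `^ x * t `^ y.
Proof. by move=> t0; rewrite powRD// (gt_eqF t0) implybT. Qed.

(** * Monotonicity and the mass of extrinsic balls *)

Section MonotoneODE.
Variable R : realType.

(* With [tau = s^-2] and [J tau = I s], the decreasing quantity is
   [(I s / s^N) ^ (1/q) + N / (q - N) * L * s ^ (1 - N/q)]. *)
Lemma ode_monotone (J dJ : R -> R) (N q L : R) : 0 <= N -> N < q -> 0 <= L ->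
  (forall t : R, 0 < t -> is_derive t 1 J (dJ t)) -> (forall t : R, 0 < t -> 0 < J t) ->
  (forall t : R, 0 < t -> N * J t + 2 * t * dJ t <= N * L * t `^ (- 2^-1) * J t `^ (1 - q^-1)) ->
  let K t := J t `^ q^-1 * t `^ (N / q / 2) + N / (q - N) * L * t `^ (- ((1 - N / q) / 2)) in
  forall x y, 0 < x -> x <= y -> K y <= K x.
Proof.
move=> N0 Nq L0 dJE J0 H K x y x0 xy.
have q0 : 0 < q by exact: le_lt_trans Nq.
set a := q^-1; have a0 : 0 < a by rewrite invr_gt0.
pose b := N * a / 2; pose e := (1 - N * a) / 2.
have Na : N * a < 1 by rewrite ltr_pdivrMr// mul1r.
have e0 : 0 < e by rewrite divr_gt0// subr_gt0.
have b0 : 0 <= b by rewrite divr_ge0// mulr_ge0// ltW.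
pose dK t := (a * J t `^ (a - 1) * dJ t) * t `^ b + J t `^ a * (b * t `^ (b - 1)) +
  N / (q - N) * L * (- e * t `^ (- e - 1)).
have dKE (t : R) : 0 < t -> is_derive t 1 K (dK t).
  move=> t0; have Jt := J0 t t0.
  have D1 : is_derive t 1 (fun t => J t `^ a) (a * J t `^ (a - 1) * dJ t).
    have := dJE t t0 => D.
    exact: (@is_derive1_comp R (fun z => z `^ a) J t _ _ (is_derive1_powR a Jt) D).
  have D2 := is_derive1_powR b t0; have D3 := is_derive1_powR (- e) t0.
  have D := is_deriveD (is_deriveM D1 D2) (is_deriveZ (N / (q - N) * L) D3).
  have <- : J t `^ a *: (b * t `^ (b - 1)) + t `^ b *: (a * J t `^ (a - 1) * dJ t) +
     (N / (q - N) * L) *: (- e * t `^ (- e - 1)) = dK t; last exact: D.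
  have Zs (u v : R) : u *: (v : R^o) = u * v by [].
  rewrite /dK !Zs.
  by move: (J t `^ _) (J t `^ _) (t `^ _) (t `^ _) (t `^ _) => *; ring.
have dK0 (t : R) : 0 < t -> dK t <= 0.
  move=> t0; have Jt := J0 t t0; have := H t t0.
  pose A := J t `^ (a - 1); pose T := t `^ (b - 1).
  have A0 : 0 < A by exact: powR_gt0.
  have T0 : 0 < T by exact: powR_gt0.
  have -> : J t `^ (1 - q^-1) = A^-1 by rewrite -powRN opprB.
  have E1 : J t `^ a = J t * A by rewrite mulr_powRB1 ?ltW.
  have E2 : t `^ b = t * T.
    by have := powRD_gt0 1 (b - 1) t0; rewrite addrC subrK powRr1// ltW.
  have E3 : t `^ (- e - 1) = T * t `^ (- 2^-1).
    rewrite -powRD_gt0//.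
    by congr (_ `^ _); rewrite /e /b; field.
  (* This relation fixes the coefficient N / (q - N): the derivative of the second term of [K] then
     cancels the curvature term of the hypothesis. *)
  have E4 : N / (q - N) * e = b.
    rewrite /e /b /a; field; rewrite !gt_eqF//= subr_gt0//.
  rewrite /dK E1 E2 E3 -/A -/T.
  have -> : N / (q - N) * L * (- e * (T * t `^ (- 2^-1))) = - (N / (q - N) * e) * L * T * t `^ (- 2^-1) by ring.
  rewrite E4 /b; move: (t `^ _) => W HW.
  have -> : a * A * dJ t * (t * T) + J t * A * (N * a / 2 * T) + - (N * a / 2) * L * T * W =
     a / 2 * A * T * (N * J t + 2 * t * dJ t - N * L * W * A^-1) by field; rewrite gt_eqF.
  by rewrite mulr_ge0_le0 ?subr_le0// !mulr_ge0 ?ltW// invr_ge0.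
have x20 : 0 < x / 2 by rewrite divr_gt0.
have xx : x / 2 <= x by rewrite ler_pdivrMr// ler_peMr ?ler1n// ltW.
apply: (@ler0_derive1_nincry _ K (x / 2) _ _ _ x y xx xy).
- move=> t; rewrite in_itv/= andbT => /(lt_trans x20) t0.
  by have [] := dKE t t0.
- move=> t; rewrite in_itv/= andbT => /(lt_trans x20) t0.
  by have [_] := dKE t t0; rewrite derive1E => ->; exact: dK0.
- apply: continuous_in_subspaceT => t /set_mem /=; rewrite in_itv/= andbT => /(lt_le_trans x20) t0.
  have [D _] := dKE t t0.
  by apply: differentiable_continuous; exact/derivable1_diffP.
Qed.

End MonotoneODE.

Section Monotonicity.
Variables (R : realType) (n : nat) (M : closedHypersurface R n).
Hypothesis hn : (0 < n)%N.
Variable x0 : M.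
Local Notation X := (@hs_map R n M).
Local Notation E := (@hs_average R n M).
Local Notation r2 := (@dist2 R n M (X x0)).

(** A C^1 substitute for the normalized volume of the extrinsic ball of radius [t ^ (- 1/2)] around
    [X x0]. *)
Definition ball_mass (t : R) := E (fun x => pos2 (1 - t * r2 x)).

Lemma continuous_pos2_comp (T : topologicalType) (f : T -> R) : continuous f -> continuous (fun x => pos2 (f x)).
Proof.
move=> cf; apply: (cts_exp (k := 2)); apply: cts_max => //.
exact: cts_cst.
Qed.

Let cr2 : continuous r2 := @continuous_dist2 _ _ M (X x0).

Let cmass (t : R) : continuous (fun x => pos2 (1 - t * r2 x)).
Proof. by apply: continuous_pos2_comp; cts. Qed.

Let cmax (t : R) : continuous (fun x => Num.max (1 - t * r2 x) 0).
Proof. by apply: cts_max; cts. Qed.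

Lemma is_derive_ball_mass (t : R) :
  is_derive t 1 ball_mass (- 2 * E (fun x => Num.max (1 - t * r2 x) 0 * r2 x)).
Proof.
have cm := @cmax t; have cp := @cmass.
apply: (@is_derive_quadratic _ _ _ _ (E (fun x => r2 x ^+ 2))) => h.
have -> : ball_mass (t + h) - ball_mass t -
    h * (- 2 * E (fun x => Num.max (1 - t * r2 x) 0 * r2 x)) =
    E (fun x => pos2 (1 - (t + h) * r2 x) - pos2 (1 - t * r2 x) -
      (- 2 * h) * (Num.max (1 - t * r2 x) 0 * r2 x)).
  rewrite !(avgB, avgZ); try by cts.
  by rewrite /ball_mass; ring.
apply: le_trans (avg_norm _) _; first by cts.
rewrite [X in _ <= X]mulrC -avgZ; last by cts.
apply: avg_le => [||x]; try by cts.
have := pos2_taylor (1 - t * r2 x) (- h * r2 x).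
rewrite (_ : 1 - t * r2 x + - h * r2 x = 1 - (t + h) * r2 x); last by ring.
rewrite (_ : (- h * r2 x) ^+ 2 = h ^+ 2 * r2 x ^+ 2); last by ring.
by congr (`| _ - _ | <= _); ring.
Qed.

Lemma dist2_ge0 c (x : M) : 0 <= dist2 c x.
Proof. exact: edot_ge0. Qed.

Lemma nsq_ge0 (x : M) e : 0 <= nsq x e.
Proof.
have [nu [_ nE _]] := hs_normal x hn.
suff -> : nsq x e = edot nu e ^+ 2 by exact: sqr_ge0.
rewrite /nsq expr2 /edot mulr_suml; apply: eq_bigr => i _; rewrite mulr_sumr.
by apply: eq_bigr => j _; rewrite nE; ring.
Qed.

(** The bump is used as [f] in [dist2_identity]. Dropping the nonnegative normal term gives an
    inequality; on the support of the bump |Y| is at most [t ^ (- 1/2)]; Hoelder bounds the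
    curvature term. *)
Lemma ball_mass_ineq (q L t : R) : 1 < q -> 0 < L -> 0 < t -> 0 < ball_mass t ->
  E (fun x => curv x `^ q) <= L `^ q ->
  n%:R * ball_mass t + 2 * t * (- 2 * E (fun x => Num.max (1 - t * r2 x) 0 * r2 x)) <=
  n%:R * L * t `^ (- 2^-1) * ball_mass t `^ (1 - q^-1).
Proof.
move=> q1 L0 t0 J0 HL.
have q0 : 0 < q by exact: lt_trans q1.
have cm := @cmax t; have cp := @cmass t; have cc := @continuous_curv _ _ M hn.
pose f z := pos2 (1 - t * z).
have df (z : R) : is_derive z 1 f (- 2 * t * Num.max (1 - t * z) 0).
  apply: (@is_derive_quadratic _ _ _ _ (t ^+ 2)) => h.
  have := pos2_taylor (1 - t * z) (- t * h).
  rewrite (_ : 1 - t * z + - t * h = 1 - t * (z + h)); last by ring.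
  rewrite (_ : (- t * h) ^+ 2 = t ^+ 2 * h ^+ 2); last by ring.
  by congr (`| _ - _ | <= _); ring.
have d1 : derive1 f = fun z => - 2 * t * Num.max (1 - t * z) 0.
  by apply/funext => z; rewrite derive1E; have [_ ->] := df z.
have cd1 : continuous (derive1 f).
  rewrite d1; apply: ctsM; first exact: cts_cst.
  apply: cts_max; last exact: cts_cst.
  by cts; move=> z; exact: cvg_id.
have fE x : f (r2 x) = pos2 (1 - t * r2 x) by [].
have := @dist2_identity _ _ M hn (X x0) f (fun z => @ex_derive _ _ _ _ _ _ _ (df z)) cd1.
rewrite d1 => ID.
have ch : continuous (fun x : M => edot (hvec x) (X x - X x0)).
  apply: cts_sum => j _; have h1 := @continuous_hvec _ _ M j.
  by have h2 := @continuous_coordY _ _ M (X x0) j; cts.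
have cn : continuous (fun x : M => nsq x (X x - X x0)).
  apply: cts_sum => i _; apply: cts_sum => j _; have h1 := @continuous_nunu _ _ M i j.
  have h2 := @continuous_coordY _ _ M (X x0) i; have h3 := @continuous_coordY _ _ M (X x0) j.
  by cts.
have f01 x : 0 <= pos2 (1 - t * r2 x) <= 1.
  have := dist2_ge0 (X x0) x; rewrite /pos2 sqr_ge0 /= => d0.
  rewrite expr_le1//; last by rewrite le_max lexx orbT.
  by rewrite ge_max ler01 andbT gerBl mulr_ge0// ltW.
apply: (@le_trans _ _ (E (fun x => f (r2 x) * edot (hvec x) (X x - X x0)))).
  rewrite -ID /ball_mass.
  rewrite -avgZ// mulrA -avgZ; last by cts.
  rewrite -avgD; try by cts.
  apply: avg_le => [||x]; rewrite /f; try by cts.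
  rewrite lerD2l -subr_ge0.
  have -> : 2 * (- 2 * t * Num.max (1 - t * r2 x) 0) * (r2 x - nsq x (X x - X x0)) -
     2 * t * -2 * (Num.max (1 - t * r2 x) 0 * r2 x) =
     4 * t * Num.max (1 - t * r2 x) 0 * nsq x (X x - X x0) by ring.
  rewrite !mulr_ge0 ?nsq_ge0 ?(ltW t0)//.
  by rewrite le_max lexx orbT.
set s := t `^ (- 2^-1).
have s0 : 0 < s by exact: powR_gt0.
have ts : t * s ^+ 2 = 1.
  by rewrite -powR_mulrn ?ltW// -powRrM mulNr mulVf// -[X in X * _](powRr1 (ltW t0)) -powRD_gt0// subrr powRr0.
apply: (@le_trans _ _ (n%:R * s * E (fun x => pos2 (1 - t * r2 x) * curv x))).
  rewrite -avgZ; last by cts.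
  apply: avg_le => [||x]; rewrite /f; try by cts.
  have /andP[p0 _] := f01 x.
  have [r2s|r2s] := leP (r2 x) (s ^+ 2); last first.
    rewrite pos2_eq0 ?mul0r ?mulr0// subr_le0 -ts ler_wpM2l ?ltW//.
  have -> : n%:R * s * (pos2 (1 - t * r2 x) * curv x) = pos2 (1 - t * r2 x) * (n%:R * curv x * s) by ring.
  rewrite ler_wpM2l// -curv_enorm// (le_trans (edot_enorm _ _))//.
  rewrite ler_wpM2l ?enorm_ge0// -(@ler_pXn2r _ 2%N)// ?nnegrE ?enorm_ge0 ?(ltW s0)//.
  by rewrite sqr_enorm.
rewrite -!mulrA ler_wpM2l// [X in _ <= X]mulrCA ler_wpM2l ?(ltW s0)//.
have q1' : q^-1 < 1 by rewrite invf_lt1.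
have q0' : 0 < q^-1 by rewrite invr_gt0.
(* The bump is at most 1, hence at most its own power [1 - q^-1], the exponent that Hoelder pairs
   with the L^q norm of the curvature. *)
apply: (@le_trans _ _ (E (fun x => pos2 (1 - t * r2 x) `^ (1 - q^-1) * (curv x `^ q) `^ (1 - (1 - q^-1))))).
  have cq : continuous (fun x : M => (curv x `^ q) `^ (1 - (1 - q^-1))).
    apply: cts_powR; [by rewrite subKr|by move=> x; exact: powR_ge0|].
    by apply: cts_powR => // x; exact: normr_ge0.
  have cq' : continuous (fun x : M => pos2 (1 - t * r2 x) `^ (1 - q^-1)).
    by apply: cts_powR => [|x|//]; [rewrite subr_gt0|have /andP[] := f01 x].
  apply: avg_le => [||x]; try by cts.
  rewrite subKr -powRrM divff ?gt_eqF// powRr1 ?normr_ge0//.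
  rewrite ler_wpM2r ?normr_ge0//; have /andP[p0 p1] := f01 x.
  have [->|pn0] := eqVneq (pos2 (1 - t * r2 x)) 0; first exact: powR_ge0.
  by apply: ger1_powR; [rewrite lt_neqAle eq_sym pn0 p0|rewrite gerBl ltW].
have : L * ball_mass t `^ (1 - q^-1) = ball_mass t `^ (1 - q^-1) * (L `^ q) `^ (1 - (1 - q^-1)).
  by rewrite subKr -powRrM divff ?gt_eqF// powRr1 ?ltW// mulrC.
move=> ->; apply: avg_hoelder => //.
- by rewrite subr_gt0.
- by rewrite gtrBl.
- by apply: cts_powR => // x; exact: normr_ge0.
- by move=> x; have /andP[] := f01 x.
- by move=> x; exact: powR_ge0.
- exact: powR_gt0.
Qed.

Lemma ball_mass_le (t t' : R) : t <= t' -> ball_mass t' <= ball_mass t.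
Proof.
move=> tt; have c1 := @cmass t; have c2 := @cmass t'; apply: avg_le => // x.
rewrite /pos2 ler_pXn2r ?nnegrE ?le_max ?lexx ?orbT//.
have H0 : 1 - t' * r2 x <= 1 - t * r2 x by rewrite lerD2l lerN2 ler_wpM2r// dist2_ge0.
by case: (leP (1 - t * r2 x) 0); case: (leP (1 - t' * r2 x) 0) => *; lra.
Qed.

End Monotonicity.

Section AverageIndicator.
Variables (R : realType) (n : nat) (M : closedHypersurface R n).
Local Notation E := (@hs_average R n M).

Lemma hs_volume_indic (D : set M) : measurable (D : set (borel M)) ->
  (hs_vol M).-integrable setT (EFin \o (\1_D : borel M -> R)) /\
  Rintegral (hs_vol M) setT (\1_D : borel M -> R) = hs_volume D.
Proof.
move=> mD; split.
  apply: measurable_bounded_integrable => //; first exact: hs_vol_fin.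
  exists 1; split=> [|K K1 x _]; first exact: num_real.
  by rewrite /= indicE; apply: le_trans (ltW K1); case: (_ \in _); rewrite ?normr1 ?normr0.
by rewrite /Rintegral integral_indic// setIT.
Qed.

Lemma indic_le_avg (D : set M) (f : M -> R) : measurable (D : set (borel M)) -> continuous f ->
  (forall x, (\1_D x : R) <= f x) -> hs_volume D / hs_volume (setT : set M) <= E f.
Proof.
move=> mD cf H; have [i1 i2] := hs_volume_indic mD.
rewrite /hs_average mulrC ler_wpM2l ?invr_ge0 ?(ltW (hs_volume_gt0 M))// -i2.
by apply: le_Rintegral; do ?[exact: i1|exact: continuous_integrable|by []|by move=> x _; exact: H].
Qed.

Lemma avg_le_indic (D : set M) (f : M -> R) : measurable (D : set (borel M)) -> continuous f ->
  (forall x, f x <= (\1_D x : R)) -> E f <= hs_volume D / hs_volume (setT : set M).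
Proof.
move=> mD cf H; have [i1 i2] := hs_volume_indic mD.
rewrite /hs_average [X in _ <= X]mulrC ler_wpM2l ?invr_ge0 ?(ltW (hs_volume_gt0 M))// -i2.
by apply: le_Rintegral; do ?[exact: i1|exact: continuous_integrable|by []|by move=> x _; exact: H].
Qed.

Lemma measurable_sublevel (f : M -> R) (a : R) : continuous f ->
  measurable ([set x | f x < a] : set (borel M)).
Proof.
move=> cf; apply: open_borel; apply: (@open_comp _ _ f [set z | z < a]); last exact: open_lt.
by move=> y _; exact: cf.
Qed.

End AverageIndicator.

(** On the ball of radius [s / 2] the bump is at least (3/4)^2, whence the factor 9/16; the power of
    2 comes from the halved radius. *)
Lemma small_ball_mass (R : realType) (n : nat) : exists c : R, 0 < c /\
  forall (M : closedHypersurface R n) (x0 : M), exists s0 : R, 0 < s0 /\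
  forall s, 0 < s -> s < s0 ->
    c * s ^+ n / hs_volume (setT : set M) <= ball_mass x0 (s `^ (- 2)).
Proof.
have [c [c0 H]] := volume_density R n.
exists (9 / 16 * c / 2 ^+ n); split=> [|M x0]; first by rewrite !mulr_gt0// invr_gt0 exprn_gt0.
have [s0 [s00 Hs]] := H M x0; exists s0; split=> // s sp ss.
have V0 := hs_volume_gt0 M.
have s2 : 0 < s / 2 by rewrite divr_gt0.
have s2s : s / 2 < s0 by apply: le_lt_trans ss; rewrite ler_pdivrMr// ler_peMr ?ler1n// ltW.
have {}Hs := Hs _ s2 s2s.
have tE : s `^ (- 2) = s ^- 2 by rewrite powR_invn// ltW.
have cd := @continuous_dist2 _ _ M (hs_map x0).
have cp : continuous (fun x : M => pos2 (1 - s `^ (- 2) * dist2 (hs_map x0) x)).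
  by apply: continuous_pos2_comp; cts.
have IA : hs_volume [set x : M | dist2 (hs_map x0) x < (s / 2) ^+ 2] / hs_volume (setT : set M) <=
    @hs_average R n M (fun x => 16 / 9 * pos2 (1 - s `^ (- 2) * dist2 (hs_map x0) x)).
  apply: indic_le_avg => [||x]; [exact: measurable_sublevel|by cts|].
  have [xs|xs] := pselect (dist2 (hs_map x0) x < (s / 2) ^+ 2); last first.
    by rewrite indicE memNset// mulr_ge0// pos2_ge0.
  rewrite indicE mem_set//.
  have H1 : 3 / 4 <= 1 - s `^ (- 2) * dist2 (hs_map x0) x.
    rewrite lerBrDr addrC -lerBrDr tE mulrC ler_pdivrMr ?exprn_gt0//.
    by apply: (le_trans (ltW xs)); rewrite expr_div_n; move: (s ^+ 2) (exprn_gt0 2 sp) => z z0; lra.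
  rewrite /pos2 (max_idPl _); last by apply: le_trans H1.
  have -> : true%:R = 1 :> R by [].
  by move: (1 - _) H1 => z z1; nra.
rewrite avgZ// in IA.
rewrite /ball_mass.
have : 0 < (hs_volume (setT : set M))^-1 by rewrite invr_gt0.
have s2n : (s / 2) ^+ n = s ^+ n / 2 ^+ n by rewrite expr_div_n.
rewrite s2n in Hs; have := ler_wpM2r (ltW _) Hs.
move=> /[swap] i0 /(_ _ i0) Hs'; have := le_trans Hs' IA.
rewrite [in X in X -> _]mulrA.
have -> : 9 / 16 * c / 2 ^+ n * s ^+ n / hs_volume [set: M] = 9 / 16 * (c * s ^+ n / 2 ^+ n / hs_volume [set: M]) by ring.
by move: (hs_average _) (c * _ / _ / _) => u v uv; lra.
Qed.

Lemma absorb_half (R : realFieldType) (x y z w : R) :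
  x * y <= z + w -> w <= x / 2 * y -> x / 2 * y <= z.
Proof. by move=> *; lra. Qed.

(** Monotonicity compares radius [s] with an infinitesimal radius, where the density is at least a
    multiple of L^n because Vol(M) <= A / L^n. For [s <= k / L] the curvature term uses up at most
    half of this. *)
Lemma ball_mass_lower (R : realType) (n : nat) (q A : R) : (0 < n)%N -> n%:R < q -> 0 < A ->
  exists c k : R, [/\ 0 < c, 0 < k & forall (M : closedHypersurface R n) (x0 : M) (L s : R), 0 < L ->
    @hs_average R n M (fun x => curv x `^ q) <= L `^ q ->
    hs_volume (setT : set M) * L ^+ n <= A -> 0 < s -> s <= k / L ->
    c * (s * L) ^+ n <= ball_mass x0 (s `^ (- 2))].
Proof.
move=> hn nq A0; have [c1 [c10 H1]] := small_ball_mass R n.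
have n1 : 1 <= n%:R :> R by rewrite ler1n.
have q1 : 1 < q by exact: le_lt_trans nq.
have q0 : 0 < q by exact: lt_trans q1.
pose a := q^-1; have a0 : 0 < a by rewrite invr_gt0.
pose d := 1 - n%:R * a; have d0 : 0 < d by rewrite subr_gt0 ltr_pdivrMr// mul1r.
pose m := (c1 / A) `^ a; have m0 : 0 < m by rewrite powR_gt0// divr_gt0.
pose g := n%:R / (q - n%:R); have g0 : 0 < g by rewrite divr_gt0// ?subr_gt0// (lt_le_trans _ n1).
(* The value of [s * L] at which the curvature term of [ode_monotone] equals half of the initial
   value. *)
pose k := (m / (2 * g)) `^ d^-1.
have mg0 : 0 < m / (2 * g) by apply: divr_gt0 => //; apply: mulr_gt0.
have m20 : 0 < m / 2 by exact: divr_gt0.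
exists ((m / 2) `^ q), k; split; [exact: powR_gt0|exact: powR_gt0|].
move=> M x0 L s L0 HL HA s0 sk.
have V0 := hs_volume_gt0 M.
have [s1 [s10 Hs1]] := H1 M x0.
(* A parameter [t'] beyond [t] whose radius is below the threshold of the density estimate at [x0];
   large parameters are small radii. *)
have small t : 0 < t -> exists t', [/\ t <= t', 0 < t' & c1 / A * L ^+ n <= ball_mass x0 t' * t' `^ (n%:R / 2)].
  move=> t0; pose r := Num.min (s1 / 2) (t `^ (- 2^-1)).
  have r0 : 0 < r by rewrite lt_min divr_gt0// powR_gt0.
  have rs : r < s1 by rewrite gt_min ltr_pdivrMr// ltr_pMr// ltr1n.
  exists (r `^ (- 2)); split; last first.
  - rewrite -powRrM (_ : -2 * (n%:R / 2) = - n%:R); last by field.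
    rewrite (powR_invn n (ltW r0)) ler_pdivlMr ?exprn_gt0//.
    apply: le_trans (Hs1 r r0 rs).
    rewrite mulrAC -[X in _ <= X]mulrA -!mulrA ler_pM2l//.
    rewrite mulrCA ler_wpM2l ?exprn_ge0 ?(ltW r0)//.
    by rewrite mulrC ler_pdivrMr// mulrC ler_pdivlMr// mulrC.
  - by rewrite powR_gt0.
  - rewrite powRN -[t]invrK lef_pV2 ?posrE ?invr_gt0 ?powR_gt0//.
    rewrite -[X in _ <= X](@powRr1 _ t^-1) ?invr_ge0 ?(ltW t0)//.
    have -> : t^-1 `^ 1 = (t `^ (- 2^-1)) `^ 2.
      by rewrite -powRrM mulNr mulVf// powRN !powRr1 ?invr_ge0 ?ltW.
    by apply: ge0_ler_powR => //; rewrite ?nnegrE ?powR_ge0 ?(ltW r0)// ge_min lexx orbT.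
have J0 t : 0 < t -> 0 < ball_mass x0 t.
  move=> t0; have [t' [tt t'0 H]] := small t t0.
  apply: lt_le_trans (ball_mass_le x0 tt).
  have : 0 < ball_mass x0 t' * t' `^ (n%:R / 2) by apply: lt_le_trans H; rewrite mulr_gt0 ?divr_gt0 ?exprn_gt0.
  by rewrite pmulr_lgt0// powR_gt0.
pose t := s `^ (- 2); have t0 : 0 < t by exact: powR_gt0.
have [t' [tt t'0 Ht']] := small t t0.
have K := @ode_monotone R (ball_mass x0) _ n%:R q L (ler0n _ _) nq (ltW L0)
  (fun t _ => is_derive_ball_mass x0 t) J0
  (fun t t0 => ball_mass_ineq hn q1 L0 t0 (J0 t t0) HL) t t' t0 tt.
have mE : m * L `^ (n%:R * a) = (c1 / A * L ^+ n) `^ a.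
  by rewrite powRM ?exprn_ge0 ?ltW// ?divr_gt0// powRrM powR_mulrn// ltW.
have E1 x : 0 < x -> ball_mass x0 x `^ q^-1 * x `^ (n%:R / q / 2) = (ball_mass x0 x * x `^ (n%:R / 2)) `^ a.
  move=> xp; rewrite powRM ?powR_ge0 ?(ltW (J0 _ xp))// -powRrM.
  by congr (_ * _ `^ _); rewrite /a mulrAC.
have low : m * L `^ (n%:R * a) <= (ball_mass x0 t * t `^ (n%:R / 2)) `^ a + g * L * t `^ (- (d / 2)).
  rewrite -E1//; apply: le_trans K; rewrite E1// mE ler_wpDr//.
    by rewrite mulr_ge0 ?powR_ge0// mulr_ge0 ?ltW.
  apply: (ge0_ler_powR (ltW a0)) => //; rewrite nnegrE mulr_ge0 ?powR_ge0//.
  - by rewrite divr_ge0// ltW.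
  - by rewrite exprn_ge0// ltW.
  - exact: ltW (J0 _ _).
have kd : k `^ d = m / (2 * g).
  by rewrite /k -powRrM mulVf ?gt_eqF// powRr1// ltW.
have up : g * L * t `^ (- (d / 2)) <= m / 2 * L `^ (n%:R * a).
  rewrite -powRrM (_ : -2 * - (d / 2) = d); last by field.
  apply: (@le_trans _ _ (g * L * (k / L) `^ d)).
    apply: ler_wpM2l; first by rewrite mulr_ge0 ?ltW.
    by apply: (ge0_ler_powR (ltW d0)) => //; rewrite nnegrE ltW// (lt_le_trans s0).
  rewrite powRM ?invr_ge0 ?(ltW L0) ?powR_ge0// kd -(powR_inv1 (ltW L0)) -powRrM mulN1r.
  rewrite -[X in g * X](powRr1 (ltW L0)).
  rewrite le_eqVlt; apply/orP; left; apply/eqP.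
  transitivity (g * (m / (2 * g)) * (L `^ 1 * L `^ (- d))); first by ring.
  rewrite -powRD_gt0// (_ : 1 - d = n%:R * a); last by rewrite /d; ring.
  by congr (_ * _); field; rewrite gt_eqF.
have fin : m / 2 * L `^ (n%:R * a) <= (ball_mass x0 t * t `^ (n%:R / 2)) `^ a.
  exact: absorb_half low up.
have := @ge0_ler_powR R q (ltW q0) _ _ _ _ fin; rewrite !nnegrE => /(_ _ _).
rewrite powR_ge0 mulr_ge0 ?powR_ge0 ?divr_ge0 ?(ltW m0)// => /(_ isT isT).
rewrite -[X in _ <= X]powRrM mulVf ?gt_eqF// powRr1; last by rewrite mulr_ge0 ?powR_ge0 ?(ltW (J0 _ t0)).
rewrite powRM ?powR_ge0 ?divr_ge0 ?(ltW m0)// -powRrM -mulrA mulVf ?gt_eqF// mulr1 powR_mulrn ?(ltW L0)//.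
rewrite /t -powRrM (_ : -2 * (n%:R / 2) = - n%:R); last by field.
by rewrite (powR_invn n (ltW s0)) ler_pdivlMr ?exprn_gt0// exprMn mulrAC mulrA.
Qed.

Lemma coordBZ (R : pzRingType) m (a b : 'rV[R]_m) k j : (a - k *: b) 0 j = a 0 j - k * b 0 j.
Proof. by rewrite !mxE. Qed.

Lemma enormN (R : realType) m (a : 'rV[R]_m) : enorm (- a) = enorm a.
Proof. by rewrite -scaleN1r enormZ normrN1 mul1r. Qed.

Lemma young_sqr (R : realType) (p a v : R) : 2 < p -> 0 < a -> 0 <= v ->
  v ^+ 2 <= (p - 2) / (p - 1) * a * v + (p - 1)^-1 * a `^ (2 - p) * v `^ p.
Proof.
move=> hp a0 u0; have p2 : 0 < p - 2 by rewrite subr_gt0.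
have p1 : 0 < p - 1 by move: hp; lra.
have [l lE] : exists l, l = (p - 2) / (p - 1) by exists ((p - 2) / (p - 1)).
have l0 : 0 < l by rewrite lE; exact: divr_gt0.
have l1 : (p - 1)^-1 = 1 - l by rewrite lE; field; rewrite gt_eqF.
have l1' : 0 <= 1 - l by rewrite -l1 invr_ge0 ltW.
rewrite -lE l1.
have [->|un0] := eqVneq v 0; first by rewrite expr0n/= mulr0 add0r mulr_ge0 ?powR_ge0// mulr_ge0 ?powR_ge0.
have up : 0 < v by rewrite lt_neqAle eq_sym un0.
have := @young_weighted _ l (a * v) (a `^ (2 - p) * v `^ p).
rewrite (ltW l0) -(subr_ge0 l 1) l1' !mulr_ge0 ?powR_ge0 ?(ltW a0)// => /(_ isT isT isT).
rewrite !powRM ?powR_ge0 ?(ltW a0) ?(ltW up)// -!powRrM.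
rewrite mulrACA -!powRD_gt0//.
have -> : l + (2 - p) * (1 - l) = 0 by rewrite lE; field; rewrite gt_eqF.
have -> : l + p * (1 - l) = 2%:R by rewrite lE; field; rewrite gt_eqF.
by rewrite powRr0 mul1r powR_mulrn ?(ltW up)// !mulrA.
Qed.

(** * Near equality in Hsiung's inequality *)

Section Pinched.
Variables (R : realType) (n : nat) (M : closedHypersurface R n).
Hypothesis hn : (0 < n)%N.
Local Notation X := (@hs_map R n M).
Local Notation E := (@hs_average R n M).
Local Notation u := (@curv R n M).
Local Notation Y := (fun x => X x - hs_center M).
Local Notation rho := (@hs_dist R n M).

Let cu : continuous u := @continuous_curv R n M hn.

Lemma continuous_hs_dist : continuous rho.
Proof. by apply: cts_sqrt; exact: continuous_dist2. Qed.

Lemma hs_dist_ge0 x : 0 <= rho x.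
Proof. exact: enorm_ge0. Qed.

Lemma curv_ge0 x : 0 <= u x.
Proof. exact: normr_ge0. Qed.

Lemma hs_normK (r : R) (f : M -> R) : 0 < r -> continuous f ->
  hs_norm r f `^ r = E (fun x => `|f x| `^ r).
Proof.
move=> r0 cf; rewrite /hs_norm -powRrM mulVf ?gt_eqF// powRr1//.
apply: avg_ge0 => [|x]; last exact: powR_ge0.
by apply: cts_powR => //; exact: cts_norm.
Qed.

Lemma hs_norm_curv r : hs_norm r (@mean_curvature R n M) = hs_norm r u.
Proof. apply: (congr1 (fun f => hs_average f `^ r^-1)); apply/funext => x.
exact: (congr1 (fun z => z `^ r) (esym (normr_id (mean_curvature x)))).
Qed.

Lemma hs_norm_ge0 r (f : M -> R) : 0 <= hs_norm r f.
Proof. exact: powR_ge0. Qed.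

Lemma hs_norm2_sqr (f : M -> R) : continuous f -> hs_norm 2 f ^+ 2 = E (fun x => f x ^+ 2).
Proof.
move=> cf; rewrite -powR_mulrn ?hs_norm_ge0// hs_normK//; congr hs_average; apply/funext => x.
by rewrite powR_mulrn// real_normK// num_real.
Qed.

Lemma avg_cauchy (f g : M -> R) : continuous f -> continuous g ->
  E (fun x => f x * g x) ^+ 2 <= E (fun x => f x ^+ 2) * E (fun x => g x ^+ 2).
Proof.
move=> cf cg; apply: discriminant_le0 => [||z].
- by apply: avg_ge0 => [|x]; [cts|exact: sqr_ge0].
- by apply: avg_ge0 => [|x]; [cts|exact: sqr_ge0].
rewrite -!avgZ; try by cts.
rewrite -avgB; try by cts.
rewrite -avgD; try by cts.
apply: avg_ge0 => [|x]; first by cts.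
by rewrite (_ : _ + _ = (f x - z * g x) ^+ 2) ?sqr_ge0//; ring.
Qed.

Lemma hs_norm_mono (r s : R) (f : M -> R) : 0 < r -> r < s -> continuous f ->
  hs_norm r f <= hs_norm s f.
Proof.
move=> r0 rs cf; have s0 := lt_trans r0 rs; rewrite leNgt; apply/negP => H.
have hr : 0 < hs_norm r f by apply: le_lt_trans H; exact: hs_norm_ge0.
(* Positive even if the [s]-norm vanishes, as [avg_hoelder] requires, and still below the
   [r]-norm. *)
pose k := Num.max (hs_norm s f) (hs_norm r f / 2).
have k0 : 0 < k by rewrite lt_max (divr_gt0 hr)// orbT.
have kr : k < hs_norm r f by rewrite gt_max H/= ltr_pdivrMr// ltr_pMr// ltr1n.
have := @avg_hoelder R n M (fun x => `|f x| `^ s) (fun=> 1) (r / s) (k `^ s) 1.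
have cn : continuous (fun x : M => `|f x| `^ s).
  by apply: cts_powR => //; exact: cts_norm.
have -> : (fun x : M => (`|f x| `^ s) `^ (r / s) * 1 `^ (1 - r / s)) = fun x : M => `|f x| `^ r.
  by apply/funext => x; rewrite powR1 mulr1 -powRrM mulrCA divff ?mulr1// gt_eqF.
rewrite powR1 mulr1 -powRrM mulrCA divff ?mulr1 ?gt_eqF// -!hs_normK// avg_cst => {}H.
have : hs_norm r f `^ r <= k `^ r.
  apply: H => //.
  - exact: divr_gt0.
  - by rewrite ltr_pdivrMr// mul1r.
  - exact: cts_cst.
  - exact: powR_gt0.
  - by apply: (ge0_ler_powR (ltW s0)); rewrite ?nnegrE ?hs_norm_ge0 ?(ltW k0)// le_max lexx.
by apply/negP; rewrite -ltNge; apply: gt0_ltr_powR => //; rewrite ?nnegrE ltW.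
Qed.

Local Notation h := (hs_norm 2 u).
Local Notation D := (hs_norm 2 rho).

Lemma sqr_hs_dist x : rho x ^+ 2 = dist2 (hs_center M) x.
Proof. exact: sqr_enorm. Qed.

(** Minkowski's formula: [dist2_identity] with [f = 1]. *)
Lemma avg_hvec_dot c : E (fun x => edot (hvec x) (X x - c)) = n%:R.
Proof.
have d1 : derive1 (fun _ : R => 1 : R) = fun=> 0 by apply/funext => z; rewrite derive1_cst.
have := @dist2_identity _ _ M hn c (fun=> 1) (fun z => derivable_cst _ _ _).
rewrite d1 => /(_ (@cts_cst _ _ 0)).
under [X in E X = _ -> _]eq_fun do rewrite mulr1 mulr0 mul0r addr0.
rewrite avg_cst => ->; congr hs_average; apply/funext => x; rewrite mul1r//.
Qed.

Lemma continuous_hvec_dot c : continuous (fun x : M => edot (hvec x) (X x - c)).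
Proof.
apply: cts_sum => j _; have h1 := @continuous_hvec _ _ M j.
by have h2 := @continuous_coordY _ _ M c j; cts.
Qed.

Lemma hsiung : 1 <= h * D.
Proof.
have n0 : 0 < n%:R :> R by rewrite ltr0n.
have cr := continuous_hs_dist; have ch := @continuous_hvec_dot (hs_center M).
have H : 1 <= E (fun x => u x * rho x).
  rewrite -(ler_pM2l n0) mulr1 -{1}(avg_hvec_dot (hs_center M)) -avgZ; last by cts.
  apply: avg_le => [||x]; [by []|by cts|].
  by apply: le_trans (edot_enorm _ _) _; rewrite curv_enorm// mulrA.
have := avg_cauchy cu cr; rewrite -(hs_norm2_sqr cu) -(hs_norm2_sqr cr) -exprMn => H2.
have {H2} : 1 <= (h * D) ^+ 2 by apply: le_trans H2; rewrite exprn_ege1.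
by move: (h * D) (mulr_ge0 (hs_norm_ge0 2 u) (hs_norm_ge0 2 rho)) => z *; nra.
Qed.

Lemma h_gt0 : 0 < h.
Proof.
rewrite lt_neqAle hs_norm_ge0 andbT; apply/eqP => h0.
by have := hsiung; rewrite -h0 mul0r ler10.
Qed.

(** The squared length of Y - (H / h^2) nu, since [hvec] is n H nu. *)
Definition defect (x : M) := edot (X x - hs_center M - (n%:R * h ^+ 2)^-1 *: hvec x)
  (X x - hs_center M - (n%:R * h ^+ 2)^-1 *: hvec x).

Lemma defectE x : defect x = rho x ^+ 2 - 2 / (n%:R * h ^+ 2) * edot (hvec x) (X x - hs_center M) +
  h ^- 4 * u x ^+ 2.
Proof.
have n0 : n%:R != 0 :> R by rewrite pnatr_eq0 -lt0n.
have h0 : h != 0 by rewrite gt_eqF// h_gt0.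
have hu : n%:R ^+ 2 * u x ^+ 2 = edot (hvec x) (hvec x) by rewrite -exprMn -curv_enorm// sqr_enorm.
have -> : h ^- 4 * u x ^+ 2 = (n%:R * h ^+ 2)^-1 ^+ 2 * edot (hvec x) (hvec x).
  by rewrite -hu; field; rewrite n0 h0.
rewrite sqr_hs_dist /defect /dist2 /edot !mulr_sumr -sumrB -big_split/=; apply: eq_bigr => j _.
rewrite !coordBZ.
by move: (n%:R * h ^+ 2) (hvec x 0 j) ((X x - hs_center M) 0 j) => *; ring.
Qed.

Lemma continuous_defect : continuous defect.
Proof.
have -> : defect = fun x => rho x ^+ 2 - 2 / (n%:R * h ^+ 2) * edot (hvec x) (X x - hs_center M) +
  h ^- 4 * u x ^+ 2 by apply/funext => x; exact: defectE.
have cr := continuous_hs_dist; have ch := @continuous_hvec_dot (hs_center M).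
by cts.
Qed.

(** Minkowski's formula evaluates the cross term exactly, so the average is precisely the deficit in
    Hsiung's inequality. *)
Lemma avg_defect : E defect = D ^+ 2 - h ^- 2.
Proof.
have n0 : n%:R != 0 :> R by rewrite pnatr_eq0 -lt0n.
have h0 : h != 0 by rewrite gt_eqF// h_gt0.
have cr := continuous_hs_dist; have ch := @continuous_hvec_dot (hs_center M).
have -> : defect = fun x => rho x ^+ 2 - 2 / (n%:R * h ^+ 2) * edot (hvec x) (X x - hs_center M) +
  h ^- 4 * u x ^+ 2 by apply/funext => x; exact: defectE.
rewrite avgD; try by cts.
rewrite avgB; try by cts.
rewrite !avgZ; try by cts.
rewrite avg_hvec_dot -!hs_norm2_sqr//.
by move: (hs_norm 2 rho) h0; move: h => a b a0; field; rewrite n0 a0.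
Qed.

(** The vector (H / h^2) nu has length |H| / h^2; compare |Y| with it, then it with 1/h. *)
Lemma dist_dev_le x : `|rho x - h^-1| <= Num.sqrt (defect x) + `|u x - h| / h ^+ 2.
Proof.
have h0 := h_gt0; have n0 : 0 < n%:R :> R by rewrite ltr0n.
pose w := (n%:R * h ^+ 2)^-1 *: hvec x.
have wE : enorm w = u x / h ^+ 2.
  have k0 : 0 < (n%:R * h ^+ 2)^-1 by rewrite invr_gt0 mulr_gt0// exprn_gt0.
  rewrite enormZ (gtr0_norm k0) (curv_enorm hn).
  by move: h h0 n0 => a a0 n0; field; rewrite !gt_eqF.
have tri (a b : 'rV[R]_n.+1) : enorm a <= enorm (a - b) + enorm b.
  rewrite -(@ler_pXn2r _ 2%N)// ?nnegrE ?addr_ge0 ?enorm_ge0// sqrrD !sqr_enorm.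
  have : edot (a - b) b <= enorm (a - b) * enorm b by exact: edot_enorm.
  have -> : edot a a = edot (a - b) (a - b) + edot (a - b) b *+ 2 + edot b b.
    rewrite /edot -mulr_natr mulr_suml -!big_split/=; apply: eq_bigr => j _; rewrite !mxE; ring.
  by move=> H; rewrite lerD2r lerD2l lerMn2r H orbT.
have H1 : `|rho x - u x / h ^+ 2| <= Num.sqrt (defect x).
  rewrite -/(enorm (X x - hs_center M - w)) -wE.
  have t1 := tri (X x - hs_center M) w.
  have t2 : enorm w <= enorm (X x - hs_center M - w) + enorm (X x - hs_center M).
    have := tri w (X x - hs_center M); by rewrite -(enormN (w - _)) opprB.
  by rewrite /hs_dist ler_norml; apply/andP; split; lra.
have -> : rho x - h^-1 = (rho x - u x / h ^+ 2) + (u x - h) / h ^+ 2.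
  by field; rewrite gt_eqF.
rewrite (le_trans (ler_normD _ _))// lerD// normrM [X in _ * X]ger0_norm// invr_ge0 sqr_ge0//.
Qed.

Lemma curv_le_p p : 2 < p -> h <= hs_norm p u.
Proof. by move=> hp; exact: hs_norm_mono. Qed.

Lemma hs_dist_gt0 : 0 < D.
Proof.
rewrite lt_neqAle hs_norm_ge0 andbT; apply/eqP => h0.
by have := hsiung; rewrite -h0 mulr0 ler10.
Qed.

Variables (p eps : R).
Hypotheses (hp : 2 < p) (eps0 : 0 < eps) (eps1 : eps < 1).
Hypothesis hpin : hs_norm p u * D <= 1 + eps.

Lemma pinch_hD : h * D <= 1 + eps.
Proof. exact: le_trans (ler_wpM2r (hs_norm_ge0 2 rho) (curv_le_p hp)) hpin. Qed.

Lemma pinch_p : hs_norm p u <= (1 + eps) * h.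
Proof.
have D0 := hs_dist_gt0; have := hsiung; move: hpin h_gt0.
by move: h D D0 (hs_norm p u) => a b b0 c H a0 H1; rewrite -(ler_pM2r b0) (le_trans H)// -mulrA ler_peMr// addr_ge0// ltW.
Qed.

Lemma pinch_defect : E defect <= 3 * eps / h ^+ 2.
Proof.
rewrite avg_defect; have := pinch_hD; have := hsiung; have := h_gt0; move: eps0 eps1.
move: h D => a b e0 e1 a0 H1 H2.
rewrite ler_pdivlMr ?exprn_gt0// mulrBl mulVf ?gt_eqF ?exprn_gt0// -exprMn [b * a]mulrC.
by move: (a * b) H1 H2 => z *; nra.
Qed.

Lemma curv_p_le (C : R) : (1 + eps) `^ p <= 1 + C * eps -> E (fun x => u x `^ p) <= h `^ p * (1 + C * eps).
Proof.
move=> HC; have p0 : 0 < p by exact: lt_trans hp.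
have := hs_normK p0 cu; under [in X in _ = X -> _]eq_fun do rewrite ger0_norm ?curv_ge0//.
move=> <-; apply: (@le_trans _ _ (((1 + eps) * h) `^ p)).
  by apply: (ge0_ler_powR (ltW p0)); rewrite ?nnegrE ?hs_norm_ge0 ?mulr_ge0 ?addr_ge0 ?hs_norm_ge0 ?(ltW eps0)// pinch_p.
by rewrite powRM ?hs_norm_ge0 ?addr_ge0 ?(ltW eps0)// mulrC ler_wpM2l// powR_ge0.
Qed.

(** Averaging [young_sqr] at [a = h] bounds the mean of |H| from below by h up to O(eps). The
    variance about h is 2 h^2 - 2 h E|H|, so it is O(eps) as well. *)
Lemma pinch_curv (C : R) : (1 + eps) `^ p <= 1 + C * eps ->
  E (fun x => (u x - h) ^+ 2) <= 2 * C / (p - 2) * eps * h ^+ 2.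
Proof.
move=> HC; have p0 : 0 < p by exact: lt_trans hp.
have h0 := h_gt0; have p2 : 0 < p - 2 by rewrite subr_gt0.
have p1 : 0 < p - 1 by move: hp; lra.
pose l := (p - 2) / (p - 1).
have l0 : 0 < l by exact: divr_gt0.
have l1 : 1 - l = (p - 1)^-1 by rewrite /l; field; rewrite gt_eqF.
have cp : continuous (fun x : M => u x `^ p) by apply: cts_powR => // x; exact: curv_ge0.
have Y x : u x ^+ 2 <= l * h * u x + (1 - l) * h `^ (2 - p) * u x `^ p.
  by rewrite l1; apply: young_sqr => //; exact: curv_ge0.
have EY : h ^+ 2 <= l * h * E u + (1 - l) * h `^ (2 - p) * E (fun x => u x `^ p).
  rewrite hs_norm2_sqr// -!avgZ//.
  rewrite -avgD; try by cts.
  by apply: avg_le => [||x]; [cts|cts|exact: Y].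
have EYp : (1 - l) * h `^ (2 - p) * E (fun x => u x `^ p) <= (1 - l) * (h ^+ 2 * (1 + C * eps)).
  rewrite -mulrA ler_wpM2l ?l1 ?invr_ge0 ?(ltW p1)//.
  apply: (@le_trans _ _ (h `^ (2 - p) * (h `^ p * (1 + C * eps)))).
    by rewrite ler_wpM2l ?powR_ge0// curv_p_le.
  by rewrite mulrA -powRD_gt0// subrK powR_mulrn// ltW.
have := le_trans EY (lerD (lexx _) EYp).
have -> : (fun x => (u x - h) ^+ 2) = (fun x => u x ^+ 2 - (2 * h * u x - h ^+ 2)).
  by apply/funext => x; ring.
rewrite avgB; try by cts.
rewrite avgB; try by cts.
rewrite avgZ// avg_cst -hs_norm2_sqr// l1 /l.
move: h h0 (E u) => a a0 b H.
have {}H : a ^+ 2 * (p - 1) <= (p - 2) * a * b + a ^+ 2 * (1 + C * eps).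
  move: H; rewrite -(ler_pM2r p1) mulrDl.
  by congr (_ <= _ + _); field; rewrite gt_eqF.
rewrite -(ler_pM2r p2).
have -> : 2 * C / (p - 2) * eps * a ^+ 2 * (p - 2) = 2 * C * eps * a ^+ 2 by field; rewrite gt_eqF.
lra.
Qed.

End Pinched.

(** The exponent is raised to an integer [k]; each factor then triples the constant, as (1 + e)(1 +
    z e) <= 1 + 3 z e for z >= 1 and e < 1. *)
Lemma powR1D_le (R : realType) (p : R) : exists C : R, 1 <= C /\
  forall eps, 0 < eps -> eps < 1 -> (1 + eps) `^ p <= 1 + C * eps.
Proof.
pose k := Num.bound `|p|; exists (3 ^+ k); split; first by rewrite exprn_ege1// ler1n.
move=> e e0 e1; apply: (@le_trans _ _ ((1 + e) `^ k%:R)).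
  by apply: ler_powR; [rewrite lerDl ltW|rewrite (le_trans (ler_norm p))// ltW// archi_boundP].
rewrite powR_mulrn ?addr_ge0 ?(ltW e0)//; elim: k => [|k IH]; first by rewrite !expr0 mul1r lerDl ltW.
rewrite exprS (le_trans (ler_wpM2l _ IH)) ?addr_ge0 ?(ltW e0)// exprS.
have : 1 <= 3 ^+ k :> R by rewrite exprn_ege1// ler1n.
move: (3 ^+ k) => z z1.
have A1 : 0 <= (z - 1) * e by rewrite mulr_ge0 ?subr_ge0 ?(ltW e0).
have A2 : 0 <= z * e * (1 - e) by rewrite !mulr_ge0 ?subr_ge0 ?(ltW e0) ?(ltW e1)// (le_trans _ z1).
by nra.
Qed.

(** Quadratic quantities are O(eps), hence the rate [sqrt eps] for first-order ones. The constant
    depends on [p] alone. *)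
Lemma pinching_estimates (R : realType) (p : R) : 2 < p -> exists K : R, 1 <= K /\
  forall n (M : closedHypersurface R n) (eps : R), (0 < n)%N -> 0 < eps -> eps < 1 ->
  hs_norm p (@curv R n M) * hs_norm 2 (@hs_dist R n M) <= 1 + eps ->
  let h := hs_norm 2 (@curv R n M) in
  [/\ @hs_average R n M (fun x => (curv x - h) ^+ 2) <= (K * Num.sqrt eps * h) ^+ 2,
      @hs_average R n M (fun x => `|curv x - h|) <= K * Num.sqrt eps * h,
      @hs_average R n M (fun x => Num.sqrt (defect x)) <= K * Num.sqrt eps / h &
      @hs_average R n M (fun x => `|hs_dist x - h^-1|) <= K * Num.sqrt eps / h].
Proof.
move=> hp; have [C [C1 HC]] := powR1D_le p.
have p2 : 0 < p - 2 by rewrite subr_gt0.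
have c0 : 0 <= 2 * C / (p - 2) by rewrite divr_ge0 ?(ltW p2)// mulr_ge0// (le_trans _ C1).
pose k1 := Num.sqrt (2 * C / (p - 2)); pose k2 : R := Num.sqrt 3.
have k10 : 0 <= k1 := sqrtr_ge0 _; have k20 : 0 <= k2 := sqrtr_ge0 _.
exists (k1 + k2 + 1); split=> [|n M eps hn e0 e1 hpin]; first by rewrite lerDr addr_ge0.
set h := hs_norm 2 _; have h0 : 0 < h := @h_gt0 _ _ M hn.
have hm : h != 0 by rewrite gt_eqF.
have cu := @continuous_curv R n M hn; have cd := @continuous_defect _ _ M hn.
have cr := @continuous_hs_dist R n M.
have s0 : 0 < Num.sqrt eps by rewrite sqrtr_gt0.
have se : Num.sqrt eps ^+ 2 = eps by rewrite sqr_sqrtr// ltW.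
have A1 := pinch_curv hn hp e0 hpin (HC _ e0 e1).
have A2 := pinch_defect hn hp e0 e1 hpin.
rewrite -/h in A1 A2.
have {}A1 : @hs_average R n M (fun x => (curv x - h) ^+ 2) <= (k1 * Num.sqrt eps * h) ^+ 2.
  by apply: le_trans A1 _; rewrite !exprMn se sqr_sqrtr.
have {}A2 : @hs_average R n M (fun x => Num.sqrt (defect x) ^+ 2) <= (k2 * Num.sqrt eps / h) ^+ 2.
  rewrite (_ : (fun x => _) = @defect R n M); last first.
    by apply/funext => x; rewrite sqr_sqrtr// edot_ge0.
  by apply: le_trans A2 _; rewrite expr_div_n exprMn se sqr_sqrtr.
have le1 : k1 * Num.sqrt eps * h <= (k1 + k2 + 1) * Num.sqrt eps * h.
  by rewrite !ler_wpM2r ?(ltW h0) ?(ltW s0)// -addrA lerDl addr_ge0.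
have B1 : @hs_average R n M (fun x => `|curv x - h|) <= k1 * Num.sqrt eps * h.
  apply: avg_sqr => //; [by cts|by rewrite !mulr_ge0 ?(ltW h0)].
have B2 : @hs_average R n M (fun x => Num.sqrt (defect x)) <= k2 * Num.sqrt eps / h.
  rewrite (_ : (fun x => Num.sqrt (defect x)) = fun x => `|Num.sqrt (@defect R n M x)|); last first.
    by apply/funext => x; rewrite ger0_norm ?sqrtr_ge0.
  apply: avg_sqr => //; [by cts|by rewrite !mulr_ge0 ?invr_ge0 ?(ltW h0)].
have B3 : @hs_average R n M (fun x => `|hs_dist x - h^-1|) <= k2 * Num.sqrt eps / h + h ^- 2 * (k1 * Num.sqrt eps * h).
  apply: (@le_trans _ _ (@hs_average R n M (fun x => Num.sqrt (defect x) + h ^- 2 * `|curv x - h|))).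
    apply: avg_le => [||x]; [by cts|by cts|].
    by rewrite [_ * `|_|]mulrC; exact: dist_dev_le.
  rewrite avgD; [|by cts..].
  rewrite avgZ; last by cts.
  by rewrite lerD// ler_wpM2l// invr_ge0 sqr_ge0.
split.
- apply: (le_trans A1); rewrite ler_sqr ?nnegrE// ?mulr_ge0 ?addr_ge0 ?(ltW s0) ?(ltW h0)//.
- exact: le_trans B1 le1.
- apply: (le_trans B2); rewrite !ler_wpM2r ?invr_ge0 ?(ltW h0) ?(ltW s0)//.
  by rewrite addrAC lerDr addr_ge0.
- apply: (le_trans B3).
  have -> : k2 * Num.sqrt eps / h + h ^- 2 * (k1 * Num.sqrt eps * h) = (k1 + k2) * Num.sqrt eps / h by field.
  by rewrite !ler_wpM2r ?invr_ge0 ?(ltW h0) ?(ltW s0)// lerDl.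
Qed.

Lemma enorm_tri (R : realType) m (a b : 'rV[R]_m) : enorm (a + b) <= enorm a + enorm b.
Proof.
rewrite -(@ler_pXn2r _ 2%N)// ?nnegrE ?addr_ge0 ?enorm_ge0// sqrrD !sqr_enorm.
have -> : edot (a + b) (a + b) = edot a a + edot a b *+ 2 + edot b b.
  rewrite /edot -mulr_natr mulr_suml -!big_split/=; apply: eq_bigr => j _; rewrite !mxE; ring.
by rewrite lerD2r lerD2l lerMn2r edot_enorm orbT.
Qed.

Lemma enorm_dist (R : realType) m (a b : 'rV[R]_m) : `|enorm a - enorm b| <= enorm (a - b).
Proof.
have t1 : enorm a <= enorm (a - b) + enorm b by rewrite -{1}(subrK b a) enorm_tri.
have t2 : enorm b <= enorm (a - b) + enorm a by rewrite -(enormN (a - b)) opprB -{1}(subrK a b) enorm_tri.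
by rewrite ler_norml; apply/andP; split; lra.
Qed.

(** * Deviation at a point, connectedness and diameter *)

Section RadiusEstimate.
Variables (R : realType) (n : nat) (M : closedHypersurface R n).
Local Notation X := (@hs_map R n M).
Local Notation E := (@hs_average R n M).

Lemma bump_le1 (x0 x : M) (t : R) : 0 <= t -> 0 <= pos2 (1 - t * dist2 (X x0) x) <= 1.
Proof.
move=> t0; have := dist2_ge0 (X x0) x; rewrite /pos2 sqr_ge0 /= => d0.
rewrite expr_le1//; last by rewrite le_max lexx orbT.
by rewrite ge_max ler01 andbT gerBl mulr_ge0.
Qed.

Lemma bump_support (x0 x : M) (s : R) : 0 < s -> s <= enorm (X x - X x0) ->
  pos2 (1 - s `^ (- 2) * dist2 (X x0) x) = 0.
Proof.
move=> s0 H; rewrite pos2_eq0// subr_le0 powR_invn ?(ltW s0)// mulrC ler_pdivlMr ?exprn_gt0// mul1r.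
by rewrite /dist2 -sqr_enorm ler_pXn2r// nnegrE ?enorm_ge0 ?ltW.
Qed.

Lemma avg_dist_ge (x0 : M) (r s : R) : 0 < s -> s <= `|hs_dist x0 - r| / 2 ->
  `|hs_dist x0 - r| / 2 * ball_mass x0 (s `^ (- 2)) <= E (fun x => `|hs_dist x - r|).
Proof.
move=> s0 H; have cr := @continuous_hs_dist R n M.
have cd := @continuous_dist2 _ _ M (X x0).
have cp : continuous (fun x : M => pos2 (1 - s `^ (- 2) * dist2 (X x0) x)).
  by apply: continuous_pos2_comp; cts.
rewrite -avgZ//; apply: avg_le => [||x]; [by cts|by cts|].
have /andP[p0 p1] := bump_le1 x0 x (powR_ge0 s (- 2)).
have [sx|xs] := leP s (enorm (X x - X x0)); first by rewrite bump_support// mulr0.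
apply: (@le_trans _ _ (`|hs_dist x0 - r| / 2)); first by rewrite ler_piMr// divr_ge0.
have := enorm_dist (X x - hs_center M) (X x0 - hs_center M).
rewrite (_ : _ - _ - (_ - _) = X x - X x0); last by rewrite opprB addrA subrK.
rewrite -/(hs_dist x) -/(hs_dist x0) => Hd.
have := ler_normD (hs_dist x0 - hs_dist x) (hs_dist x - r).
rewrite [_ + (_ - r)](_ : _ = hs_dist x0 - r); last by ring.
rewrite (distrC (hs_dist x0) (hs_dist x)) => Ht.
by have := le_lt_trans Hd xs; lra.
Qed.

Lemma connected_values (f : M -> R) (z : R) (x y : M) : continuous f -> f x <= z -> z <= f y ->
  exists w, f w = z.
Proof.
move=> cf xz zy; have := @connected_continuous_connected _ _ setT f (@hs_connected _ _ M).
move=> /(_ (continuous_subspaceT cf)) /connected_intervalP.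
move=> /(_ (f x) (f y)) H.
have fx : range f (f x) by exists x.
have fy : range f (f y) by exists y.
by have [|w _ <-] := H fx fy z; [rewrite xz zy|exists w].
Qed.

(** At each point at most one of the bumps is nonzero, and it is at most 1. *)
Lemma ball_mass_disjoint (N : nat) (x : 'I_N -> M) (s : R) : 0 < s ->
  (forall i j y, enorm (X y - X (x i)) < s -> enorm (X y - X (x j)) < s -> i = j) ->
  \sum_i ball_mass (x i) (s `^ (- 2)) <= 1.
Proof.
move=> s0 dis.
have cp i : continuous (fun y : M => pos2 (1 - s `^ (- 2) * dist2 (X (x i)) y)).
  by have cd := @continuous_dist2 _ _ M (X (x i)); apply: continuous_pos2_comp; cts.
rewrite -(avg_sum _ cp) -[X in _ <= X](avg_cst M 1).
apply: avg_le => [||y]; [by apply: cts_sum => i _; exact: cp|exact: cts_cst|].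
have [[i Hi]|H] := pselect (exists i, enorm (X y - X (x i)) < s); last first.
  by rewrite big1// => i _; apply: bump_support => //; rewrite leNgt; apply/negP => ?; apply: H; exists i.
rewrite (bigD1 i)//= big1 ?addr0; first by have /andP[] := bump_le1 (x i) y (powR_ge0 s (- 2)).
move=> j ji; apply: bump_support => //; rewrite leNgt; apply/negP => Hj.
by move/eqP: ji; apply; exact: dis Hj Hi.
Qed.

(* On the path of spheres around [X x0] a connected hypersurface meets every
   radius, so a large diameter yields many disjoint balls of definite mass. *)
Lemma diameter_le (c s : R) (N : nat) : 0 < s -> 1 < N%:R * c ->
  (forall x : M, c <= ball_mass x (s `^ (- 2))) ->
  forall x0 x1 : M, enorm (X x1 - X x0) <= 2 * N%:R * s.
Proof.
move=> s0 Nc mass x0 x1; rewrite leNgt; apply/negP => far.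
pose f y := enorm (X y - X x0).
have cf : continuous f by apply: cts_sqrt; exact: continuous_dist2.
(* Distances from [X x0] spaced by [2 * s] keep the balls of radius [s] around the chosen points
   disjoint. *)
have H (i : 'I_N) : exists y, f y = 2 * i%:R * s.
  apply: (@connected_values f _ x0 x1) => //.
    rewrite /f subrr (_ : enorm 0 = 0) ?mulr_ge0 ?(ltW s0)//.
    by rewrite /enorm (_ : edot _ _ = 0) ?sqrtr0// /edot big1// => j _; rewrite mxE mul0r.
  by rewrite (le_trans _ (ltW far))// ler_wpM2r ?(ltW s0)// ler_wpM2l// ler_nat ltnW.
have [x Hx] := choice H.
have := @ball_mass_disjoint N x s s0; rewrite leNgt => /(_ _)/negP; apply; last first.
  rewrite (lt_le_trans Nc)// mulrC mulr_natr -[X in _ *+ X](card_ord N) -sumr_const.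
  by apply: ler_sum => i _.
move=> i j y yi yj; apply/val_inj/eqP => /=; rewrite -(eqr_nat R).
have fi : `|f y - f (x i)| < s.
  by apply: le_lt_trans yi; rewrite (le_trans (enorm_dist _ _))// opprB addrA subrK.
have fj : `|f y - f (x j)| < s.
  by apply: le_lt_trans yj; rewrite (le_trans (enorm_dist _ _))// opprB addrA subrK.
have := le_lt_trans (ler_distD (f y) (f (x i)) (f (x j))) (ltrD _ _).
move=> /(_ s s); rewrite (distrC _ (f y)) => /(_ fi fj).
rewrite !Hx -mulrBl -mulrBr normrM [X in _ * X]gtr0_norm//.
rewrite (_ : s + s = 2 * s) ?ltr_pM2r//; last by ring.
rewrite normrM ger0_norm// gtr_pMr// => ij.
have [ij'|ji|->] := ltngtP i j; last by rewrite eqxx.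
  move: ij; rewrite distrC ger0_norm ?subr_ge0 ?ler_nat 1?ltnW//.
  by rewrite -natrB ?(ltnW ij')// -[1]/(1%:R) ltr_nat ltnS leqn0 subn_eq0 leqNgt ij'.
move: ij; rewrite ger0_norm ?subr_ge0 ?ler_nat 1?ltnW//.
by rewrite -natrB ?(ltnW ji)// -[1]/(1%:R) ltr_nat ltnS leqn0 subn_eq0 leqNgt ji.
Qed.

(** The centre is an average, so |Y(x)|^2 is the mean over y of <Y(x), X x - X y>, at most |Y(x)|
    d. *)
Lemma hs_dist_le_diameter (d : R) : (forall x0 x1 : M, enorm (X x1 - X x0) <= d) ->
  forall x : M, hs_dist x <= d.
Proof.
move=> H x; have d0 : 0 <= d by apply: le_trans (H x x); exact: enorm_ge0.
pose v := X x - hs_center M.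
have cX j : continuous (fun y : M => X y 0 j) := C1man_continuous (@C1_coordX _ _ M j).
have E1 : hs_dist x ^+ 2 = E (fun y => edot v (X x - X y)).
  rewrite sqr_enorm -/v /edot avg_sum => [|j]; last first.
    by apply: (@ctsM _ _ (fun=> v 0 j)); [exact: cts_cst|rewrite (_ : (fun y => _) = fun y : M => X x 0 j - X y 0 j); [by apply: ctsB; [exact: cts_cst|exact: cX]|by apply/funext => y; rewrite !mxE]].
  apply: eq_bigr => j _.
  rewrite (_ : (fun y => _) = fun y : M => v 0 j * X x 0 j - v 0 j * X y 0 j); last first.
    by apply/funext => y; rewrite !mxE; ring.
  have cXj := cX j; rewrite avgB ?avgZ ?avg_cst; [|by cts..].
  by rewrite /v !mxE; move: (E _) => *; ring.
have : hs_dist x ^+ 2 <= hs_dist x * d.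
  rewrite E1 -[X in _ <= X](avg_cst M).
  apply: avg_le => [||y]; [|exact: cts_cst|]; last first.
    by rewrite (le_trans (edot_enorm _ _))// ler_wpM2l ?enorm_ge0.
  apply: cts_sum => j _; apply: (@ctsM _ _ (fun=> v 0 j)); first exact: cts_cst.
  rewrite (_ : (fun y => _) = fun y : M => X x 0 j - X y 0 j); last by apply/funext => y; rewrite !mxE.
  by apply: ctsB; [exact: cts_cst|exact: cX].
have := hs_dist_ge0 x; move: (hs_dist x) => z z0 zd.
have [->|zn0] := eqVneq z 0; first exact: d0.
by rewrite -(@ler_pM2l _ z) ?lt_neqAle ?z0 ?andbT 1?eq_sym// -expr2.
Qed.

End RadiusEstimate.

Lemma hs_norm_ge_inf (R : realType) n (M : closedHypersurface R n) (d : R) : 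
  (forall x : M, hs_dist x <= d) -> hs_norm 2 (@hs_dist R n M) <= d.
Proof.
move=> H; have d0 : 0 <= d by apply: le_trans (H point); exact: hs_dist_ge0.
have cr := @continuous_hs_dist R n M.
rewrite -(@ler_pXn2r _ 2%N)// ?nnegrE ?hs_norm_ge0// hs_norm2_sqr// -[X in _ <= X](avg_cst M).
apply: avg_le => [||x]; [by cts|exact: cts_cst|].
by rewrite ler_pXn2r ?nnegrE ?hs_dist_ge0.
Qed.

(** A deviation [a] at a point persists on a ball of mass of order (a h)^n. The L^1 bound of order
    [sqrt eps] then controls (a h)^(n+1), which gives the exponent 1 / (2 (n + 1)). *)
Definition alpha_exp (R : realType) (n : nat) : R := (2 * n.+1%:R)^-1.

Lemma alpha_exp_gt0 (R : realType) (n : nat) : 0 < alpha_exp R n.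
Proof. by rewrite invr_gt0 mulr_gt0. Qed.

Lemma sqrt_le_powR (R : realType) (eps a : R) : 0 < eps -> eps < 1 -> a <= 2^-1 ->
  Num.sqrt eps <= eps `^ a.
Proof.
move=> e0 e1 a2; rewrite -powR12_sqrt ?(ltW e0)//.
by apply: ger_powR => //; rewrite e0 ltW.
Qed.

Lemma alpha_exp_le (R : realType) (n : nat) : alpha_exp R n <= 2^-1.
Proof. by rewrite lef_pV2 ?posrE ?mulr_gt0// ler_peMr// ler1n. Qed.

Lemma dist_le_max (R : realFieldType) (x y : R) : 0 <= x -> 0 <= y -> `|x - y| <= Num.max x y.
Proof. by move=> x0 y0; rewrite ler_norml; case: (leP x y) => xy; apply/andP; split; lra. Qed.

Lemma powR_mono (R : realType) (r x y : R) : 0 <= r -> 0 <= x -> x <= y -> x `^ r <= y `^ r.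
Proof. by move=> r0 x0 xy; apply: ge0_ler_powR; rewrite ?nnegrE// (le_trans x0). Qed.

(** * Estimates for the radius and for the curvature *)

Section PinchedParts.
Variables (R : realType) (n : nat) (q : R).
Hypotheses (hn : (2 <= n)%N) (hq : n%:R < q).

Let n0 : (0 < n)%N. Proof. exact: leq_trans hn. Qed.
Let q2 : 2 < q. Proof. by apply: le_lt_trans hq; rewrite ler_nat. Qed.
Let q0 : 0 < q. Proof. exact: lt_trans q2. Qed.

Variables (p A : R).
Hypotheses (hp : 2 < p) (A0 : 0 < A).

Lemma pinched_curv (eps : R) (M : closedHypersurface R n) : pinched M p q A eps ->
  [/\ hs_norm p (@curv R n M) * hs_norm 2 (@hs_dist R n M) <= 1 + eps,
      hs_volume (setT : set M) * hs_norm q (@curv R n M) ^+ n <= A &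
      @hs_average R n M (fun x => curv x `^ q) = hs_norm q (@curv R n M) `^ q].
Proof.
move=> [H1 H2]; rewrite !hs_norm_curv in H1 H2; split=> //.
rewrite (hs_normK q0 (@continuous_curv R n M n0)).
by congr hs_average; apply/funext => x; rewrite ger0_norm// curv_ge0.
Qed.

Lemma radius_estimate : exists C : R, 0 < C /\
  forall (eps : R) (M : closedHypersurface R n), 0 < eps -> eps < 1 -> pinched M p q A eps ->
  forall x : M, `|hs_dist x - (hs_norm 2 (@curv R n M))^-1| <=
    C * eps `^ alpha_exp R n / hs_norm 2 (@curv R n M).
Proof.
have [K [K1 HK]] := pinching_estimates hp.
have [c [k [c0 k0 Hck]]] := ball_mass_lower n0 hq A0.
have K0 : 0 < K by exact: lt_le_trans K1.
pose C4 := (K / c) `^ n.+1%:R^-1.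
pose C := 2 * C4 + 2 * K / (c * k ^+ n).
have C40 : 0 < C4 by apply: powR_gt0; exact: divr_gt0.
have C50 : 0 < 2 * K / (c * k ^+ n) by rewrite divr_gt0 ?mulr_gt0 ?exprn_gt0.
have CC : 0 < C by exact: addr_gt0 (mulr_gt0 (ltr0Sn _ 1) C40) C50.
exists C; split => //.
move=> eps M e0 e1 /pinched_curv[H1 H2 H3] x.
have [_ _ _ dev] := HK n M eps n0 e0 e1 H1; move: dev.
have h0 : 0 < hs_norm 2 (@curv R n M) := h_gt0 M n0.
have hL : hs_norm 2 (@curv R n M) <= hs_norm q (@curv R n M) by apply: curv_le_p.
move: h0 hL H2 H3; move: (hs_norm 2 (@curv R n M)) (hs_norm q (@curv R n M)) => h L h0 hL H2 H3 dev.
have L0 : 0 < L by exact: lt_le_trans hL.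
pose a : R := `|hs_dist x - h^-1|; rewrite -/a.
have [a0|a0] := leP a 0.
  by rewrite (le_trans a0)// divr_ge0 ?(ltW h0)// mulr_ge0 ?powR_ge0// ltW.
pose s := Num.min (a / 2) (k / L).
have s0 : 0 < s by rewrite lt_min !divr_gt0.
have sa : s <= a / 2 by rewrite ge_min lexx.
have sk : s <= k / L by rewrite ge_min lexx orbT.
have H3' : @hs_average R n M (fun x => curv x `^ q) <= L `^ q by rewrite H3.
have mass := Hck M x L s L0 H3' H2 s0 sk.
have := le_trans (avg_dist_ge s0 sa) dev; rewrite -/a => dev2.
pose b := a * h; have b0 : 0 < b by exact: mulr_gt0.
(* A lower bound for [s * L] in terms of the scale-free deviation [b = a * h], by [h <= L]. *)
pose m := Num.min (b / 2) k.
have m0 : 0 < m by rewrite lt_min divr_gt0.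
have msL : m <= s * L.
  have -> : s * L = Num.min (a / 2 * L) k.
    by rewrite /s minr_pMl ?(ltW L0)// divfK ?gt_eqF.
  rewrite le_min; apply/andP; split; last by rewrite ge_min lexx orbT.
  rewrite ge_min; apply/orP; left; rewrite /b mulrAC ler_wpM2l// divr_ge0 ?(ltW a0)//.
have key : b / 2 * (c * m ^+ n) <= K * Num.sqrt eps.
  have : a / 2 * (c * (s * L) ^+ n) <= K * Num.sqrt eps / h.
    by apply: le_trans dev2; rewrite ler_wpM2l ?divr_ge0 ?(ltW a0).
  rewrite ler_pdivlMr// => H; apply: le_trans H.
  have -> : a / 2 * (c * (s * L) ^+ n) * h = b / 2 * (c * (s * L) ^+ n) by rewrite /b; ring.
  rewrite ler_wpM2l ?divr_ge0 ?(ltW b0)// ler_wpM2l ?(ltW c0)//.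
  by rewrite ler_pXn2r// nnegrE ltW// mulr_gt0.
rewrite ler_pdivlMr// -/b.
have se : Num.sqrt eps <= eps `^ alpha_exp R n := sqrt_le_powR e0 e1 (alpha_exp_le R n).
(* For a small deviation the mass bound yields its power n + 1. For a large one the ball has
   definite mass, and the linear bound of order [sqrt eps] is weakened to the common exponent. *)
have [bk|kb] := leP (b / 2) k.
  have mE : m = b / 2 by apply/min_idPl.
  rewrite mE in key; have : (b / 2) ^+ n.+1 <= K / c * Num.sqrt eps.
    have -> : K / c * Num.sqrt eps = K * Num.sqrt eps / c by rewrite mulrAC.
    rewrite ler_pdivlMr//; apply: le_trans key; rewrite exprS.
    by rewrite -[X in X <= _]mulrA [X in _ * X <= _]mulrC.
  rewrite -powR_mulrn ?divr_ge0 ?(ltW b0)// => H4.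
  have : b / 2 <= C4 * eps `^ alpha_exp R n.
    have -> : b / 2 = ((b / 2) `^ n.+1%:R) `^ n.+1%:R^-1.
      by rewrite -powRrM divff// powRr1// divr_ge0 ?(ltW b0).
    apply: (@le_trans _ _ ((K / c * Num.sqrt eps) `^ n.+1%:R^-1)).
      by apply: powR_mono; rewrite ?powR_ge0 ?invr_ge0.
    rewrite powRM ?sqrtr_ge0 ?divr_ge0 ?(ltW K0) ?(ltW c0)// ler_wpM2l ?(ltW C40)//.
    by rewrite -powR12_sqrt ?(ltW e0)// -powRrM /alpha_exp invfM.
  rewrite ler_pdivrMr// => H5; apply: (le_trans H5).
  by rewrite /C mulrDl mulrC mulrA lerDl mulr_ge0 ?powR_ge0 ?(ltW C50).
have mE : m = k by apply/min_idPr; exact: ltW.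
rewrite mE in key; apply: (@le_trans _ _ (2 * K / (c * k ^+ n) * eps `^ alpha_exp R n)); last first.
  by rewrite ler_wpM2r ?powR_ge0// /C lerDr mulr_ge0 ?(ltW C40).
rewrite mulrAC ler_pdivlMr ?mulr_gt0 ?exprn_gt0//.
have : K * Num.sqrt eps <= K * eps `^ alpha_exp R n by rewrite ler_wpM2l ?(ltW K0).
move=> H; rewrite -[X in _ <= X]mulrA [X in _ <= X]mulrC -ler_pdivrMr// mulrAC.
exact: le_trans key H.
Qed.

(** At radius [k / L] each ball has mass at least [c1], so the diameter is at most a multiple of 1 /
    L. It bounds ||Y||_2, and Hsiung's inequality 1 <= h ||Y||_2 turns this into a bound of L by a
    multiple of h. *)
Lemma curv_q_le : exists C : R, 1 <= C /\
  forall (eps : R) (M : closedHypersurface R n), 0 < eps -> eps < 1 -> pinched M p q A eps ->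
  hs_norm q (@curv R n M) <= C * hs_norm 2 (@curv R n M).
Proof.
have [c [k [c0 k0 Hck]]] := ball_mass_lower n0 hq A0.
pose c1 := c * k ^+ n; have c10 : 0 < c1 by rewrite mulr_gt0 ?exprn_gt0.
pose N := Num.bound c1^-1.
have Nc : 1 < N%:R * c1.
  by rewrite -ltr_pdivrMr// mul1r archi_boundP// invr_ge0 ltW.
exists (1 + 2 * N%:R * k); split; first by rewrite lerDl !mulr_ge0 ?(ltW k0).
move=> eps M e0 e1 /pinched_curv[H1 H2 H3].
have h0 : 0 < hs_norm 2 (@curv R n M) := h_gt0 M n0.
have hL : hs_norm 2 (@curv R n M) <= hs_norm q (@curv R n M) by apply: curv_le_p.
have hs := hsiung M n0.
move: h0 hL H2 H3 hs; move: (hs_norm 2 (@curv R n M)) (hs_norm q (@curv R n M)) => h L h0 hL H2 H3 hs.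
have L0 : 0 < L by exact: lt_le_trans hL.
have kL : 0 < k / L by exact: divr_gt0.
have mass (x : M) : c1 <= ball_mass x ((k / L) `^ (- 2)).
  have H3' : @hs_average R n M (fun x => curv x `^ q) <= L `^ q by rewrite H3.
  apply: le_trans (Hck M x L (k / L) L0 H3' H2 kL (lexx _)).
  by rewrite divfK ?gt_eqF.
have := hs_norm_ge_inf (hs_dist_le_diameter (diameter_le kL Nc mass)).
move: hs; move: (hs_norm 2 _) => D hD DL.
have : 1 <= h * (2 * N%:R * (k / L)) by apply: le_trans hD _; rewrite ler_wpM2l ?(ltW h0).
rewrite !mulrA ler_pdivlMr// mul1r => H; apply: (le_trans H).
by rewrite mulrDl mul1r -!mulrA mulrC -!mulrA lerDr ltW.
Qed.

Lemma curvature_estimate (r : R) : 1 <= r -> r < q -> exists C : R, 0 < C /\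
  forall (eps : R) (M : closedHypersurface R n), 0 < eps -> eps < 1 -> pinched M p q A eps ->
  hs_norm r (fun x : M => curv x - hs_norm 2 (@curv R n M)) <=
    C * eps `^ (alpha_exp R n * (q - r) / (r * (q - 1))) * hs_norm 2 (@curv R n M).
Proof.
move=> r1 rq; have [K [K1 HK]] := pinching_estimates hp.
have [C5 [C51 HC5]] := curv_q_le.
have K0 : 0 < K by exact: lt_le_trans K1.
have C50 : 0 < C5 by exact: lt_le_trans C51.
have r0 : 0 < r by exact: lt_le_trans r1.
have q1 : 0 < q - 1 by rewrite subr_gt0 (lt_trans _ q2)// ltr1n.
(* The weight for which r = t + (1 - t) q, interpolating the exponent between 1 and [q]. *)
pose t := (q - r) / (q - 1).
have t0 : 0 < t by rewrite divr_gt0// subr_gt0.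
have t1 : t <= 1 by rewrite ler_pdivrMr// mul1r lerD2l lerN2.
have tE : t + q * (1 - t) = r by rewrite /t; field; rewrite gt_eqF.
pose G := K `^ t * (2 * C5 `^ q) `^ (1 - t).
have G0 : 0 < G by rewrite mulr_gt0// powR_gt0// mulr_gt0// powR_gt0.
exists (G `^ r^-1); split; first exact: powR_gt0.
move=> eps M e0 e1 pin; set h := hs_norm 2 (@curv R n M); have [H1 H2 H3] := pinched_curv pin.
have [_ dev _ _] := HK n M eps n0 e0 e1 H1; rewrite -/h in dev.
have Lh := HC5 eps M e0 e1 pin; rewrite -/h in Lh.
have h0 : 0 < h := h_gt0 M n0.
have cu := @continuous_curv R n M n0.
set L := hs_norm q _ in H2 H3 Lh.
have L0 : 0 <= L by exact: hs_norm_ge0.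
have hL : h <= L by apply: curv_le_p.
clearbody h L.
have s0 : 0 < Num.sqrt eps by rewrite sqrtr_gt0.
pose f (x : M) : R := `|curv x - h|.
have cf : continuous f by rewrite /f; cts.
have f0 x : 0 <= f x by exact: normr_ge0.
have cfq : continuous (fun x => f x `^ q) by exact: cts_powR.
have cuq : continuous (fun x : M => curv x `^ q) by apply: cts_powR => // x; exact: curv_ge0.
have Efq : @hs_average R n M (fun x => f x `^ q) <= 2 * (C5 * h) `^ q.
  apply: (@le_trans _ _ (@hs_average R n M (fun x => curv x `^ q + h `^ q))).
    apply: avg_le => [//||x]; first by cts.
    have u0 := curv_ge0 x.
    apply: (@le_trans _ _ (Num.max (curv x) h `^ q)).
      apply: (ge0_ler_powR (ltW q0)); [exact: f0|by rewrite nnegrE le_max u0|].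
      exact: dist_le_max u0 (ltW h0).
    case: (leP (curv x) h) => _; first by rewrite lerDr powR_ge0.
    by rewrite lerDl powR_ge0.
  rewrite (avgD cuq (@cts_cst _ _ _)) (avg_cst M (h `^ q)) H3 mulr_natl mulr2n.
  have hC : h <= C5 * h by rewrite ler_peMl ?(ltW h0).
  exact: lerD (powR_mono (ltW q0) L0 Lh) (powR_mono (ltW q0) (ltW h0) hC).
have main : @hs_average R n M (fun x => f x `^ r) <= (K * Num.sqrt eps * h) `^ t * (2 * (C5 * h) `^ q) `^ (1 - t).
  (* The endpoint [r = 1] is excluded by [avg_hoelder] and is the L^1 estimate itself. *)
  have [tt|tt] := eqVneq t 1.
    have rr : r = 1 by rewrite -tE tt subrr mulr0 addr0.
    rewrite tt subrr powRr0 mulr1 powRr1 ?mulr_ge0 ?(ltW h0) ?(ltW K0) ?(ltW s0)//.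
    by under [X in hs_average X]eq_fun do rewrite rr powRr1//.
  have -> : (fun x => f x `^ r) = (fun x => f x `^ t * (f x `^ q) `^ (1 - t)).
    apply/funext => x; have [->|fx] := eqVneq (f x) 0; first by rewrite (powR0 (lt0r_neq0 r0)) (powR0 (lt0r_neq0 t0)) mul0r.
    by rewrite -powRrM -powRD_gt0 ?tE// lt_neqAle eq_sym fx f0.
  have t1' : t < 1 by rewrite lt_neqAle tt t1.
  have P1 : 0 < K * Num.sqrt eps * h by rewrite !mulr_gt0.
  have P2 : 0 < 2 * (C5 * h) `^ q by rewrite mulr_gt0// powR_gt0// mulr_gt0.
  exact: (@avg_hoelder R n M f (fun x => f x `^ q) t _ _ t0 t1' cf cfq f0 (fun x => powR_ge0 _ _) P1 P2 dev Efq).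
have RE : (K * Num.sqrt eps * h) `^ t * (2 * (C5 * h) `^ q) `^ (1 - t) = G * Num.sqrt eps `^ t * h `^ r.
  rewrite !powRM ?mulr_ge0 ?powR_ge0 ?(ltW C50) ?(ltW K0) ?(ltW h0) ?(ltW s0)//.
  have -> : h `^ r = h `^ t * (h `^ q) `^ (1 - t) by rewrite -powRrM -powRD_gt0// tE.
  rewrite /G powRM ?powR_ge0//.
  rewrite [X in _ * X = _]mulrA mulrACA; congr (_ * _); exact: mulrAC.
rewrite RE in main.
rewrite /hs_norm; apply: (@le_trans _ _ ((G * Num.sqrt eps `^ t * h `^ r) `^ r^-1)).
  apply: ge0_ler_powR; rewrite ?invr_ge0 ?(ltW r0)// ?nnegrE.
  - apply: avg_ge0 => [|x]; last exact: powR_ge0.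
    exact: cts_powR.
  - by rewrite !mulr_ge0 ?powR_ge0 ?(ltW G0).
rewrite (powRM _ (mulr_ge0 (ltW G0) (powR_ge0 _ _)) (powR_ge0 _ _)) (powRM _ (ltW G0) (powR_ge0 _ _)) -(powRrM h) divff ?gt_eqF// powRr1 ?(ltW h0)//.
rewrite ler_wpM2r ?(ltW h0)// ler_wpM2l ?powR_ge0//.
rewrite -powR12_sqrt ?(ltW e0)// -!powRrM; apply: ger_powR; first by rewrite e0 ltW.
(* The interpolation gives the exponent t / (2 r); as alpha is at most 1/2 and eps < 1, the required
   bound is the weaker one. *)
have -> : alpha_exp R n * (q - r) / (r * (q - 1)) = alpha_exp R n * (t / r).
  by rewrite /t; field; rewrite !gt_eqF.
have tr0 : 0 <= t / r := ltW (divr_gt0 t0 r0).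
apply: ler_wpM2r tr0 _ _ _; exact: alpha_exp_le.
Qed.

End PinchedParts.

(** * Moments determine Lipschitz averages *)

Section Bernstein.
Variable R : realType.

(* [(bern n f).[x]] is the expectation of [f] at a binomial variable with
   parameters [n] and [x]; the recursion conditions on the first trial. *)
Fixpoint bern (n : nat) (f : nat -> R) : {poly R} :=
  if n is m.+1 then 'X * bern m (fun k => f k.+1) + (1 - 'X) * bern m f else (f 0%N)%:P.

Lemma bernS n f x : (bern n.+1 f).[x] = x * (bern n (fun k => f k.+1)).[x] + (1 - x) * (bern n f).[x].
Proof. by rewrite /= hornerD !hornerM hornerD hornerN !hornerC hornerX. Qed.

Lemma bern_le n f g x : 0 <= x <= 1 -> (forall k, f k <= g k) -> (bern n f).[x] <= (bern n g).[x].
Proof.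
move=> /andP[x0 x1]; elim: n f g => [|n IH] f g fg; first by rewrite /= !hornerC.
by rewrite !bernS lerD// ler_wpM2l ?subr_ge0 ?IH.
Qed.

Lemma bernD n f g x : (bern n (fun k => f k + g k)).[x] = (bern n f).[x] + (bern n g).[x].
Proof.
elim: n f g => [|n IH] f g; first by rewrite /= !hornerC.
by rewrite !bernS !IH; move: (_.[x]) (_.[x]) (_.[x]) (_.[x]) => *; ring.
Qed.

Lemma bernZ n c f x : (bern n (fun k => c * f k)).[x] = c * (bern n f).[x].
Proof.
elim: n f => [|n IH] f; first by rewrite /= !hornerC.
by rewrite !bernS !IH; move: (_.[x]) (_.[x]) => *; ring.
Qed.

Lemma bern_cst n c x : (bern n (fun=> c)).[x] = c.
Proof. by elim: n => [|n IH]; [rewrite /= hornerC|rewrite bernS IH -mulrDl addrC subrK mul1r]. Qed.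

(** The shift [c] is general because conditioning on the first trial replaces it by [1 + c]. With
    [c = - n x] this is the binomial variance. *)
Lemma bern_sqr n c x : (bern n (fun k => (k%:R + c) ^+ 2)).[x] = (n%:R * x + c) ^+ 2 + n%:R * x * (1 - x).
Proof.
elim: n c => [|n IH] c; first by rewrite /= hornerC; ring.
rewrite bernS IH (_ : (fun k => (k.+1%:R + c) ^+ 2) = fun k => (k%:R + (1 + c)) ^+ 2); last first.
  by apply/funext => k; rewrite -natr1 addrA.
by rewrite IH -natr1; ring.
Qed.

(** The inequality |y| <= d + y^2 / d replaces the Lipschitz error by a quadratic one, whose
    expectation is known from the variance. *)
Lemma bern_approx n (phi : R -> R) (l d x : R) : 0 <= x <= 1 -> 0 < d -> 0 <= l ->
  (forall s t, `|phi s - phi t| <= l * `|s - t|) ->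
  `|(bern n.+1 (fun k => phi (k%:R / n.+1%:R))).[x] - phi x| <= l * (d + (d * n.+1%:R)^-1).
Proof.
move=> x01 d0 l0 Lip; pose N : R := n.+1%:R; have N0 : 0 < N by rewrite ltr0n.
have key k : `|phi (k%:R / N) - phi x| <= l * d + l / (d * N ^+ 2) * (k%:R + - (N * x)) ^+ 2.
  apply: (le_trans (Lip _ _)).
  have -> : l * d + l / (d * N ^+ 2) * (k%:R + - (N * x)) ^+ 2 = l * (d + (k%:R / N - x) ^+ 2 / d).
    by field; rewrite !gt_eqF.
  apply: ler_wpM2l => //; move: (k%:R / N - x) => y.
  rewrite -[y ^+ 2]real_normK ?num_real//; move: (`|y|) (normr_ge0 y) => z z0.
  rewrite -subr_ge0 (_ : _ - _ = ((z - d / 2) ^+ 2 + 3 / 4 * d ^+ 2) / d); last by field; rewrite gt_eqF.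
  by rewrite divr_ge0 ?(ltW d0)// addr_ge0 ?sqr_ge0// mulr_ge0 ?sqr_ge0.
have B : (bern n.+1 (fun k => l * d + l / (d * N ^+ 2) * (k%:R + - (N * x)) ^+ 2)).[x] <= l * (d + (d * N)^-1).
  rewrite bernD bern_cst bernZ bern_sqr -/N subrr expr0n add0r.
  have -> : l * d + l / (d * N ^+ 2) * (N * x * (1 - x)) = l * (d + (d * N)^-1 * (x * (1 - x))).
    by field; rewrite !gt_eqF.
  rewrite ler_wpM2l// lerD2l ler_piMr ?invr_ge0 ?mulr_ge0 ?(ltW d0) ?(ltW N0)//.
  by move: x01 => /andP[? ?]; nra.
rewrite ler_norml; apply/andP; split.
- rewrite lerNl opprB -[X in X - _](bern_cst n.+1 (phi x) x) -mulN1r -bernZ -bernD.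
  apply: le_trans B; apply: bern_le => // k; rewrite mulN1r.
  by apply: le_trans (key k); rewrite distrC ler_norm.
- rewrite -[X in _ - X](bern_cst n.+1 (phi x) x) -mulN1r -bernZ -bernD.
  apply: le_trans B; apply: bern_le => // k; rewrite mulN1r.
  by apply: le_trans (key k); rewrite ler_norm.
Qed.

Lemma lipschitz_poly_approx (phi : R -> R) (l e T : R) : 0 <= l -> 0 < e -> 0 < T ->
  (forall s t, `|phi s - phi t| <= l * `|s - t|) ->
  exists P : {poly R}, forall t, `|t| <= T -> `|P.[t] - phi t| <= e.
Proof.
move=> l0 e0 T0 Lip; pose l' := l * (2 * T); have l'0 : 0 <= l' by rewrite !mulr_ge0 ?(ltW T0).
pose psi x := phi (2 * T * x - T).
have Lip' s t : `|psi s - psi t| <= l' * `|s - t|.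
  apply: le_trans (Lip _ _) _; rewrite (_ : _ - _ - _ = 2 * T * (s - t)); last by ring.
  by rewrite normrM (ger0_norm (mulr_ge0 _ (ltW T0)))// mulrA.
have l1 : 0 < l' + 1 by rewrite ltr_wpDl.
(* The degree is taken beyond [d ^- 2], so both terms of the Bernstein error are at most [d], and
   [2 (l' + 1) d = e]. *)
have [d dE] : exists d, d = e / (2 * (l' + 1)) by exists (e / (2 * (l' + 1))).
have d0 : 0 < d by rewrite dE divr_gt0// mulr_gt0.
pose n := Num.bound (d ^- 2).
have nb : d ^- 2 < n.+1%:R.
  apply: lt_le_trans (archi_boundP _) _; first by rewrite invr_ge0 sqr_ge0.
  by rewrite ler_nat leqnSn.
exists (bern n.+1 (fun k => psi (k%:R / n.+1%:R)) \Po ((2 * T)^-1 *: 'X + (2^-1)%:P)) => t tT.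
have xE : ((2 * T)^-1 *: 'X + (2^-1)%:P).[t] = (2 * T)^-1 * t + 2^-1.
  by rewrite hornerD hornerZ hornerX hornerC.
rewrite horner_comp xE.
set x := _ + 2^-1.
have tx : t = 2 * T * x - T by rewrite /x; field; rewrite gt_eqF.
have x01 : 0 <= x <= 1.
  move: tT; rewrite tx ler_norml => /andP[A B]; apply/andP; split.
    by rewrite -(@pmulr_rge0 _ (2 * T)) ?mulr_gt0//; lra.
  by rewrite -(@ler_pM2l _ (2 * T)) ?mulr_gt0//; lra.
rewrite [in phi t]tx; apply: le_trans (bern_approx n x01 d0 l'0 Lip') _.
have dn : (d * n.+1%:R)^-1 <= d.
  rewrite -[X in _ <= X]invrK lef_pV2 ?posrE ?invr_gt0 ?mulr_gt0// ?ltr0n//.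
  rewrite (_ : d^-1 = d * d ^- 2); last by field; rewrite gt_eqF.
  by rewrite ler_pM2l// ltW.
apply: (@le_trans _ _ ((l' + 1) * (d + d))).
  by rewrite ler_pM ?lerD2l ?lerDl// addr_ge0 ?invr_ge0 ?mulr_ge0 ?(ltW d0).
by rewrite le_eqVlt; apply/orP; left; apply/eqP; rewrite dE; field; rewrite gt_eqF.
Qed.

(** A probability law on [-T, T] seen as a positive normalized functional: neither law needs to be
    built as a measure, and monotonicity tests only points of the interval. *)
Definition mean_functional (T : R) (L : (R -> R) -> R) :=
  [/\ L (fun=> 1) = 1,
      forall f g : R -> R, continuous f -> continuous g -> L (fun t => f t + g t) = L f + L g,
      forall (c : R) (f : R -> R), continuous f -> L (fun t => c * f t) = c * L f &
      forall f g : R -> R, continuous f -> continuous g -> (forall t : R, `|t| <= T -> f t <= g t) -> L f <= L g].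

Lemma horner_continuous (P : {poly R}) : continuous (fun t => P.[t]).
Proof.
have -> : (fun t => P.[t]) = fun t => \sum_(i < size P) P`_i * t ^+ i.
  by apply/funext => t; rewrite horner_coef.
apply: cts_sum => i _; apply: ctsM; first exact: cts_cst.
by apply: cts_exp => t; exact: cvg_id.
Qed.

Lemma mean_cst T L c : mean_functional T L -> L (fun=> c) = c.
Proof.
move=> [L1 _ LZ _]; have := LZ c (fun=> 1) (@cts_cst _ _ _); rewrite L1 => E.
by transitivity (c * 1); [rewrite -E; congr L; apply/funext => t; rewrite mulr1|rewrite mulr1].
Qed.

Lemma mean_poly T L (P : {poly R}) : mean_functional T L ->
  L (fun t => P.[t]) = \sum_(i < size P) P`_i * L (fun t => t ^+ i).
Proof.
move=> M; have [L1 LD LZ _] := M.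
have -> : (fun t => P.[t]) = fun t => \sum_(i < size P) P`_i * t ^+ i.
  by apply/funext => t; rewrite horner_coef.
have L0 := mean_cst 0 M.
have cX k : continuous (fun t : R => t ^+ k) by apply: cts_exp => t; exact: cvg_id.
elim: (index_enum _) => [|i s IH].
  by rewrite big_nil -[RHS]L0; congr L; apply/funext => t; rewrite big_nil.
rewrite big_cons -IH -LZ// -LD; first by congr L; apply/funext => t; rewrite big_cons.
  by apply: ctsM => //; exact: cts_cst.
by apply: cts_sum => j _; apply: ctsM => //; exact: cts_cst.
Qed.

(** One polynomial approximates [phi] for both functionals, so the number of moments and their
    accuracy are fixed before the functionals. This uniformity makes the final threshold on eps
    independent of [M]. *)
Lemma mean_functional_compare (phi : R -> R) (l e T : R) : 0 <= l -> 0 < e -> 0 < T ->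
  continuous phi -> (forall s t, `|phi s - phi t| <= l * `|s - t|) ->
  exists (N : nat) (k : R), 0 < k /\ forall L1 L2, mean_functional T L1 -> mean_functional T L2 ->
  (forall i, (i < N)%N -> `|L1 (fun t => t ^+ i) - L2 (fun t => t ^+ i)| <= k) ->
  `|L1 phi - L2 phi| <= e.
Proof.
move=> l0 e0 T0 cphi Lip; have e4 : 0 < e / 4 by rewrite divr_gt0.
have [P HP] := lipschitz_poly_approx l0 e4 T0 Lip.
pose S := \sum_(i < size P) `|P`_i|; have S0 : 0 <= S by apply: sumr_ge0.
have S1 : 0 < S + 1 by rewrite ltr_wpDl.
exists (size P), (e / (2 * (S + 1))); split=> [|L1 L2 M1 M2 H]; first by rewrite divr_gt0// mulr_gt0.
have cP := @horner_continuous P.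
have near L : mean_functional T L -> `|L phi - L (fun t => P.[t])| <= e / 4.
  move=> M; have [L1' LD LZ Lle] := M.
  have cst c := mean_cst c M.
  have cc : continuous (fun _ : R => e / 4) by exact: cts_cst.
  have c1 : continuous (fun t => P.[t] + e / 4) by exact: ctsD.
  have c2 : continuous (fun t => phi t + e / 4) by exact: ctsD.
  rewrite ler_norml; apply/andP; split.
    rewrite lerNl opprB lerBlDr addrC -(cst (e / 4)) -LD//; apply: Lle => // t tT.
    by have := HP t tT; rewrite ler_norml => /andP[A B]; lra.
  rewrite lerBlDr addrC -(cst (e / 4)) -LD//; apply: Lle => // t tT.
  by have := HP t tT; rewrite ler_norml => /andP[A B]; lra.
have mid : `|L1 (fun t => P.[t]) - L2 (fun t => P.[t])| <= e / 2.
  rewrite (mean_poly P M1) (mean_poly P M2) -sumrB (le_trans (ler_norm_sum _ _ _))//.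
  apply: (@le_trans _ _ (S * (e / (2 * (S + 1))))).
    rewrite mulr_suml; apply: ler_sum => i _; rewrite -mulrBr normrM ler_wpM2l//.
    exact: H.
  have -> : e / 2 = (S + 1) * (e / (2 * (S + 1))) by field; rewrite gt_eqF.
  by rewrite ler_wpM2r ?lerDl// divr_ge0 ?(ltW e0)// mulr_ge0 ?(ltW S1).
move: (near L1 M1) (near L2 M2) mid; rewrite !ler_norml => /andP[A1 A2] /andP[B1 B2] /andP[C1 C2].
by apply/andP; split; lra.
Qed.

Definition ramp (a d t : R) := Num.max 0 (Num.min 1 ((t - a) / d)).

Lemma continuous_ramp a d : continuous (ramp a d).
Proof.
apply: cts_max; first exact: cts_cst.
have -> : (fun x : R => Num.min 1 ((x - a) / d)) = fun x : R => - Num.max (- 1) (- ((x - a) / d)).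
  by apply/funext => x; rewrite -oppr_min opprK.
have cX : continuous (fun t : R => t) by move=> t; exact: cvg_id.
move=> x; suff H : {for x, continuous (fun x : R => - Num.max (- 1) (- ((x - a) / d)))} by exact: H.
apply: continuousN; suff H : continuous (fun x : R => Num.max (- 1) (- ((x - a) / d))) by exact: H.
apply: cts_max; first exact: cts_cst.
have -> : (fun x : R => - ((x - a) / d)) = fun x : R => (- d^-1) * (x - a) by apply/funext => y; ring.
by apply: ctsM; [exact: cts_cst|apply: ctsB => //; exact: cts_cst].
Qed.

Lemma ramp_lipschitz a d : 0 < d -> forall s t, `|ramp a d s - ramp a d t| <= d^-1 * `|s - t|.
Proof.
move=> d0 s t; rewrite -[X in X * `|_|]ger0_norm ?invr_ge0 ?(ltW d0)// -normrM mulrC.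
rewrite /ramp (_ : (s - t) / d = (s - a) / d - (t - a) / d); last by ring.
move: ((s - a) / d) ((t - a) / d) => x y.
rewrite ler_norml; have := ler_norm (x - y); have := ler_norm (y - x); rewrite distrC.
by case: (leP 1 x) => ?; case: (leP 1 y) => ?; case: (leP 0 (1 : R)) => ?; case: (leP 0 x) => ?; case: (leP 0 y) => ? *; apply/andP; split; lra.
Qed.

Lemma ramp_ge0 a d t : 0 <= ramp a d t.
Proof. by rewrite /ramp le_max lexx. Qed.

Lemma ramp_le1 a d t : ramp a d t <= 1.
Proof. by rewrite /ramp ge_max ler01/= ge_min lexx. Qed.

Lemma ramp0 a d t : 0 < d -> t <= a -> ramp a d t = 0.
Proof.
move=> d0 ta; rewrite /ramp; have H : (t - a) / d <= 0 by rewrite pmulr_lle0 ?invr_gt0// subr_le0.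
by apply/max_idPl; rewrite ge_min H orbT.
Qed.

Lemma ramp1 a d t : 0 < d -> a + d <= t -> ramp a d t = 1.
Proof.
move=> d0 ta; rewrite /ramp; have H : 1 <= (t - a) / d by rewrite ler_pdivlMr// mul1r lerBrDl.
by rewrite (min_idPl H); apply/max_idPr.
Qed.

End Bernstein.

Section DerivativeRules.
Variables (R : realType) (m : nat) (U : set 'rV[R]_m).
Hypothesis oU : open U.
Implicit Types (f g : 'rV[R]_m -> R) (df dg : 'I_m -> 'rV[R]_m -> R).

(** Pairs a function with explicit partial derivatives, so that those of the fields on the sphere
    are assembled rule by rule. *)
Definition has_pd f df := C1 U f /\ forall u a, U u -> pd f a u = df a u.

Lemma has_pdD f g df dg : has_pd f df -> has_pd g dg ->
  has_pd (fun u => f u + g u) (fun a u => df a u + dg a u).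
Proof.
move=> [Cf Ef] [Cg Eg]; split=> [|u a Uu]; first exact: C1D.
by have H := pdD a Cf Cg Uu; rewrite (Ef u a Uu) (Eg u a Uu) in H; exact: H.
Qed.

Lemma has_pdM f g df dg : has_pd f df -> has_pd g dg ->
  has_pd (fun u => f u * g u) (fun a u => df a u * g u + f u * dg a u).
Proof.
move=> [Cf Ef] [Cg Eg]; split=> [|u a Uu]; first exact: C1M.
by have H := pdM a Cf Cg Uu; rewrite (Ef u a Uu) (Eg u a Uu) in H; exact: H.
Qed.

Lemma has_pd_cst (c : R) : has_pd (fun=> c) (fun _ _ => 0).
Proof. by split=> [|u a Uu]; [exact: C1_cst|exact: pd_cst]. Qed.

Lemma has_pd_coord j : has_pd (fun u => u 0 j) (fun a _ => (a == j)%:R).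
Proof.
split=> [|u a Uu]; first exact: C1_coord.
have := @derive_mx R _ 1 m id u (delta_mx 0 a) (@derivable_id _ _ u (delta_mx 0 a)).
by rewrite derive_id => /rowP/(_ j); rewrite !mxE eqxx/= eq_sym => ->.
Qed.

Lemma has_pd_sum (I : Type) (r : seq I) (f : I -> 'rV[R]_m -> R)
    (Df : I -> 'I_m -> 'rV[R]_m -> R) : (forall i, has_pd (f i) (Df i)) ->
  has_pd (fun u => \sum_(i <- r) f i u) (fun a u => \sum_(i <- r) Df i a u).
Proof.
move=> H; split=> [|u a Uu]; first by apply: C1_sum => // i _; have [] := H i.
rewrite (pd_sum oU r a (fun i _ => (H i).1) Uu).
by apply: eq_bigr => i _; exact: (H i).2.
Qed.

Lemma has_pd_comp f (phi dphi : R -> R) df : has_pd f df ->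
  (forall u, U u -> is_derive (f u) 1 phi (dphi (f u))) ->
  (forall u, U u -> {for f u, continuous (derive1 phi)}) ->
  has_pd (fun u => phi (f u)) (fun a u => dphi (f u) * df a u).
Proof.
move=> [Cf Ef] dp cp; split=> [|u a Uu].
  exact: (C1_comp oU Cf (fun u Uu => @ex_derive _ _ _ _ _ _ _ (dp u Uu)) cp).
have [d1 d2] := dp u Uu.
have H := pd_comp a Cf Uu d1; rewrite derive1E d2 (Ef u a Uu) in H; exact: H.
Qed.

Lemma has_pd_pow f df k : has_pd f df ->
  has_pd (fun u => f u ^+ k) (fun a u => k%:R * f u ^+ k.-1 * df a u).
Proof.
move=> Hf; elim: k => [|k [C IH]].
  have [C E] := has_pd_cst 1; split=> [|u a Uu].
    by apply: (eq_C1 oU _ C) => u _; rewrite expr0.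
  rewrite mul0r mul0r -(E u a Uu); apply: (pd_eq_on oU a Uu) => v _; by rewrite expr0.
have [C2 E2] := has_pdM Hf (conj C IH); split=> [|u a Uu].
  by apply: (eq_C1 oU _ C2) => u _; rewrite exprS.
rewrite (pd_eq_on oU a Uu (g := fun u => f u * f u ^+ k)); last by move=> v _; rewrite exprS.
rewrite E2//= -natr1; case: k {C IH C2 E2} => [|k] /=; first by rewrite !expr0 add0r; ring.
by rewrite exprS; move: (f u) (df a u) (f u ^+ k) (k.+1%:R) => *; ring.
Qed.

Lemma has_pdV f df : has_pd f df -> (forall u, U u -> f u != 0) ->
  has_pd (fun u => (f u)^-1) (fun a u => - df a u / f u ^+ 2).
Proof.
move=> [Cf Ef] f0; have CV := C1V oU Cf f0; split=> // u a Uu.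
have fu := f0 u Uu.
have := pdM a Cf CV Uu.
rewrite (pd_eq_on oU a Uu (g := cst 1)); last by move=> v Uv; rewrite /= divff// f0.
rewrite pd_cst -Ef//; move: (pd f a u) => d; move: (pd _ a u) => e H.
have -> : e = (f u * e) / f u by rewrite mulrAC divff ?mul1r.
have -> : f u * e = - (d / f u) by apply/eqP; rewrite -addr_eq0 addrC -H.
by field.
Qed.

Lemma C1_integrable k (f : 'rV[R]_m -> R) : C1 setT f -> cube_supported k f ->
  (lebn R m).-integrable setT (EFin \o f).
Proof.
move=> Cf fk; have cf : continuous f by move=> u; exact: (C1_continuous Cf).
apply: (cube_supported_integrable _ _ fk); first exact: continuous_borel.
exact: continuous_cube_bounded fk.
Qed.

End DerivativeRules.

(** * Heights on the round sphere *)

Section Sphere.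
Variables (R : realType) (n : nat) (s : R).
Hypothesis s0 : 0 < s.

Definition odisk : set 'rV[R]_n := [set u | edot u u < s ^+ 2].
Definition elevation (u : 'rV[R]_n) := Num.sqrt (s ^+ 2 - edot u u).

Lemma open_disk : open odisk.
Proof.
apply: (@open_comp _ _ (fun u : 'rV[R]_n => edot u u) [set z | z < s ^+ 2]); last exact: open_lt.
by move=> u _; have := @continuous_edotB R n 0 u; under eq_fun do rewrite subr0.
Qed.

Lemma rad_gt0 u : odisk u -> 0 < elevation u.
Proof. by rewrite /odisk/= => H; rewrite sqrtr_gt0 subr_gt0. Qed.

Lemma sqr_rad u : odisk u -> elevation u ^+ 2 = s ^+ 2 - edot u u.
Proof. by move=> H; rewrite sqr_sqrtr// subr_ge0 ltW. Qed.

Lemma rad_le u : elevation u <= s.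
Proof. by rewrite -[X in _ <= X]ger0_norm ?(ltW s0)// -sqrtr_sqr ler_wsqrtr// gerBl edot_ge0. Qed.

Lemma has_pd_rad : has_pd odisk elevation (fun a u => - u 0 a / elevation u).
Proof.
have oU := open_disk.
have z1 : has_pd odisk (fun u => s ^+ 2 + (-1) * edot u u) (fun a u => -2 * u 0 a).
  have [C E] := has_pdD oU (has_pd_cst oU (s ^+ 2)) (has_pdM oU (has_pd_cst oU (-1))
    (has_pd_sum oU (index_enum 'I_n) (fun j => has_pdM oU (has_pd_coord oU j) (has_pd_coord oU j)))).
  split=> // u a Uu; rewrite E//= mul0r !add0r (bigD1 a)//= eqxx big1 => [|j ja]; first by rewrite mulr1n; ring.
  by rewrite eq_sym (negbTE ja) mul0r mulr0 addr0.
have Cr : C1 odisk elevation.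
  apply: (eq_C1 oU _ (C1_sqrt oU z1.1 _)) => u Uu; first by rewrite /elevation mulN1r.
  by rewrite mulN1r subr_gt0.
split=> // u a Uu; have r0 := rad_gt0 Uu.
have := pdM a Cr Cr Uu; rewrite (pd_eq_on oU a Uu (g := fun u => s ^+ 2 + (-1) * edot u u)); last first.
  by move=> v Uv; rewrite mulN1r -sqr_rad//.
rewrite z1.2//; move: (pd elevation a u) => d; move: (elevation u) r0 => r r0 H.
have -> : - u 0 a = r * d by lra.
by field; rewrite gt_eqF.
Qed.

(* [psi M] cuts off the equator, where the graph coordinates degenerate. *)
Definition psi (M : nat) (u : 'rV[R]_n) := pos2 (1 - (M.+1%:R * elevation u)^-1).
(** The derivative of [psi M] with respect to the elevation. *)
Definition kap (M : nat) (u : 'rV[R]_n) :=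
  2 * Num.max (1 - (M.+1%:R * elevation u)^-1) 0 * (M.+1%:R * elevation u ^+ 2)^-1.

Lemma has_pd_psi M : has_pd odisk (psi M) (fun a u => kap M u * (- u 0 a / elevation u)).
Proof.
have oU := open_disk.
have rn u : odisk u -> M.+1%:R * elevation u != 0 by move=> /rad_gt0 r0; rewrite gt_eqF// mulr_gt0.
have H1 := has_pdV oU (has_pdM oU (has_pd_cst oU M.+1%:R) has_pd_rad) rn.
have H2 := has_pdD oU (has_pd_cst oU 1) (has_pdM oU (has_pd_cst oU (-1)) H1).
have [C E] := @has_pd_comp _ _ _ oU _ (@pos2 R) (fun z => 2 * Num.max z 0) _ H2
  (fun u _ => is_derive_pos2 _) (fun u _ => eq_ind_r (fun f => {for _, continuous f}) (@continuous_pos2' R _) (derive1_pos2 R)).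
split=> [|u a Uu].
  by apply: (eq_C1 oU _ C) => u _; rewrite /psi mulN1r.
have r0 := rad_gt0 Uu.
rewrite (pd_eq_on oU a Uu (g := fun u => pos2 (1 + (-1) * (M.+1%:R * elevation u)^-1))); last first.
  by move=> v _; rewrite /psi mulN1r.
rewrite E//= /kap mulN1r; move: (Num.max _ 0) => w.
by move: (elevation u) (M.+1%:R) r0 (ltr0Sn R M) => r N r0 N0; field; rewrite !gt_eqF.
Qed.

(** On the disk, the points of elevation at least [M.+1^-1]; [psi M] vanishes at the others. *)
Definition core (M : nat) : set 'rV[R]_n := [set u | edot u u <= s ^+ 2 - (M.+1%:R) ^- 2].

Lemma closed_core M : closed (core M).
Proof.
have := @closed_comp _ _ (fun v : 'rV[R]_n => edot v v) [set x | x <= s ^+ 2 - M.+1%:R ^- 2].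
apply; last exact: closed_le.
by move=> u _; have := @continuous_edotB R n 0 u; under eq_fun do rewrite subr0.
Qed.

Lemma core_disk M : core M `<=` odisk.
Proof. by move=> u H; apply: le_lt_trans H _; rewrite gtrBl invr_gt0 exprn_gt0. Qed.

Lemma psi_out M u : odisk u -> ~ core M u -> psi M u = 0.
Proof.
move=> Uu H; apply: pos2_eq0; rewrite subr_le0 invf_ge1 ?mulr_gt0 ?rad_gt0//.
have H2 : elevation u ^+ 2 <= M.+1%:R ^- 2.
  rewrite sqr_rad// lerBlDr addrC -lerBlDr leNgt; apply/negP => H3; apply: H; exact: ltW.
rewrite mulrC -ler_pdivlMr// mul1r -(@ler_pXn2r _ 2%N)// ?nnegrE ?invr_ge0 ?(ltW (rad_gt0 Uu))//.
by rewrite exprVn.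
Qed.

Lemma psi01 M u : 0 <= elevation u -> 0 <= psi M u <= 1.
Proof.
move=> r0; rewrite /psi pos2_ge0 /pos2 expr_le1 ?le_max ?lexx ?orbT//.
by rewrite ge_max ler01 andbT gerBl invr_ge0 mulr_ge0.
Qed.

(** The product is 2 max(1 - y, 0) y with y = 1 / (M.+1 elevation). Being uniform in [M], the bound
    dominates [kap M] by a multiple of 1 / elevation, which is integrable. *)
Lemma kap_bound M u : odisk u -> 0 <= kap M u /\ kap M u * elevation u <= 2.
Proof.
move=> Uu; have r0 := rad_gt0 Uu; have N0 := ltr0Sn R M.
have Nr : 0 < M.+1%:R * elevation u by rewrite mulr_gt0.
have mx0 : 0 <= Num.max (1 - (M.+1%:R * elevation u)^-1) 0 by rewrite le_max lexx orbT.
have den0 : 0 <= (M.+1%:R * elevation u ^+ 2)^-1 by rewrite invr_ge0 mulr_ge0 ?sqr_ge0.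
split; first exact: mulr_ge0 (mulr_ge0 _ mx0) den0.
have -> : kap M u * elevation u = 2 * Num.max (1 - (M.+1%:R * elevation u)^-1) 0 * (M.+1%:R * elevation u)^-1.
  by rewrite /kap; move: (Num.max _ _) => w; field; rewrite !gt_eqF//= ?ltr0Sn.
have y0 : 0 < (M.+1%:R * elevation u)^-1 by rewrite invr_gt0.
move: ((M.+1%:R * elevation u)^-1) y0 => y y0; case: (leP (1 - y) 0) => H; nra.
Qed.

Lemma disk_cube : exists k, odisk `<=` cube n k.
Proof.
have [k Hk] := @eclosed_ball_cube R n 0 (s ^+ 2); exists k => u Uu; apply: Hk.
by rewrite /eclosed_ball/= subr0 ltW.
Qed.

Lemma cutoff_divergence M (V : 'I_n -> 'rV[R]_n -> R) (dV : 'rV[R]_n -> R) :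
  (forall b, C1 odisk (V b)) -> (forall b u, odisk u -> ~ core M u -> V b u = 0) ->
  (forall u, odisk u -> \sum_b pd (V b) b u = dV u) ->
  (lebn R n).-integrable setT (EFin \o zext odisk dV) /\ \int[lebn R n]_u zext odisk dV u = 0.
Proof.
move=> CV V0 VE; have oU := open_disk.
have CW b : C1 setT (zext odisk (V b)).
  exact: (C1_zext oU (@closed_core M) (@core_disk M) (CV b) (V0 b)).
have [k Hk] := disk_cube.
have sW b : cube_supported k (zext odisk (V b)).
  by move=> u uk; rewrite /zext; case: ifPn => // /set_mem/Hk.
have -> : zext odisk dV = fun u => \sum_b pd (zext odisk (V b)) b u.
  apply/funext => u; have [Uu|Uu] := pselect (odisk u).
    rewrite /zext mem_set// -VE//; apply: eq_bigr => b _.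
    by apply: (pd_eq_on oU b Uu) => v Uv; rewrite /zext mem_set.
  rewrite /zext memNset// big1// => b _.
  have oK : open (~` core M) by apply: closed_openC; exact: closed_core.
  apply: (etrans _ (pd_cst 0 b u)); apply: (pd_eq_on oK b) => [/core_disk//|v Kv].
  by rewrite /zext; case: ifPn => // /set_mem Uv; rewrite V0.
suff H (t : seq 'I_n) : (lebn R n).-integrable setT (EFin \o (fun u => \sum_(b <- t) pd (zext odisk (V b)) b u)) /\
    \int[lebn R n]_u (\sum_(b <- t) pd (zext odisk (V b)) b u) = 0 by exact: H.
elim: t => [|b t [IH1 IH2]].
  rewrite (_ : (fun u => _) = cst 0); last by apply/funext => u; rewrite big_nil.
  by split; [exact: integrable0|rewrite /Rintegral integral0].
have [I1 I2] := integral_pd_eq0 b (CW b) (sW b).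
rewrite (_ : (fun u => _) = fun u => pd (zext odisk (V b)) b u + \sum_(b <- t) pd (zext odisk (V b)) b u); last first.
  by apply/funext => u; rewrite big_cons.
by split; [exact: (integrableD measurableT I1 IH1)|rewrite RintegralD// I2 IH2 addr0].
Qed.

Section Height.
Variables (al : R) (e : 'rV[R]_n).
Hypothesis ale : al ^+ 2 + edot e e = 1.

(** The height over [u] on the upper hemisphere in the unit direction [(al, e)]; the lower
    hemisphere has [- al] instead. *)
Definition ht (u : 'rV[R]_n) := al * elevation u + edot e u.

Lemma has_pd_ht : has_pd odisk ht (fun a u => al * (- u 0 a / elevation u) + e 0 a).
Proof.
have oU := open_disk.
have [C E] := has_pdD oU (has_pdM oU (has_pd_cst oU al) has_pd_rad)
  (has_pd_sum oU (index_enum 'I_n) (fun j => has_pdM oU (has_pd_cst oU (e 0 j)) (has_pd_coord oU j))).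
split=> // u a Uu; rewrite E// mul0r add0r; congr (_ + _).
rewrite (bigD1 a)//= eqxx big1 ?addr0 ?mul0r ?add0r ?mulr1// => j ja.
by rewrite eq_sym (negbTE ja) mul0r mulr0 addr0.
Qed.

(** In graph coordinates and up to powers of [s]: the gradient of the height on the sphere, times
    its k-th power, times the area density 1 / elevation, cut off near the equator. *)
Definition hfield M k b (u : 'rV[R]_n) :=
  psi M u * (elevation u)^-1 * (s ^+ 2 * e 0 b + (-1) * (ht u * u 0 b)) * ht u ^+ k.

Lemma hfield_divergence M k u : odisk u -> 
  (forall b, C1 odisk (hfield M k b)) /\ \sum_b pd (hfield M k b) b u =
  psi M u / elevation u * (k%:R * ht u ^+ k.-1 * (s ^+ 2 - ht u ^+ 2) - n%:R * ht u ^+ k.+1) +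
  kap M u * (s ^+ 2 * al / elevation u - ht u) * ht u ^+ k.
Proof.
move=> Uu; have oU := open_disk.
have rn v : odisk v -> elevation v != 0 by move=> /rad_gt0 r0; rewrite gt_eqF.
pose H b := has_pdM oU (has_pdM oU (has_pdM oU (has_pd_psi M) (has_pdV oU has_pd_rad rn))
  (has_pdD oU (has_pd_cst oU (s ^+ 2 * e 0 b)) (has_pdM oU (has_pd_cst oU (-1))
    (has_pdM oU has_pd_ht (has_pd_coord oU b))))) (has_pd_pow oU k has_pd_ht).
split=> [b|]; first by have [] := H b.
under eq_bigr => b _ do rewrite ((H b).2 u b Uu)/= eqxx mulr1n.
have r0 := rad_gt0 Uu.
have Suu : edot u u = s ^+ 2 - elevation u ^+ 2 by rewrite sqr_rad// opprB addrC subrK.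
have Sue : edot e u = ht u - al * elevation u by rewrite /ht addrAC subrr add0r.
have See : edot e e = 1 - al ^+ 2 by rewrite -ale addrAC subrr add0r.
move: (psi M u) (kap M u) (elevation u) (ht u) r0 Suu Sue => P K r t r0 Suu Sue.
pose W := k%:R * t ^+ k.-1.
pose T := t ^+ k.
pose g := P / r; pose g' := - K / r ^+ 2 + P / r ^+ 3.
(* Collects the summand by the products of [u 0 b] and [e 0 b], so that the sum involves only u.u,
   e.u and e.e, all known in terms of elevation and height. *)
transitivity (\sum_b (- (g * t * T) + (- g' * t * T + g * al / r * T + g * W * t * al / r) * (u 0 b * u 0 b) +
  (g' * s ^+ 2 * T - g * T - g * W * (s ^+ 2 * al / r + t)) * (e 0 b * u 0 b) +
  (g * s ^+ 2 * W) * (e 0 b * e 0 b))).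
  apply: eq_bigr => b _; rewrite -/W -/T /g /g'.
  by move: (u 0 b) (e 0 b) => x y; field; rewrite gt_eqF.
rewrite !big_split/= -!mulr_sumr -/(edot u u) -/(edot e u) -/(edot e e) Suu Sue See.
rewrite sumr_const card_ord -[_ *+ n]mulr_natl (exprS t k) -/W -/T /g /g'.
by move: T W (n%:R : R) => T W N; field; rewrite gt_eqF.
Qed.

End Height.

End Sphere.

Lemma dominated_integral0 (R : realType) d (T : measurableType d) (mu : {measure set T -> \bar R})
    (f_ : nat -> T -> R) (f g : T -> R) :
  (forall n, measurable_fun setT (f_ n)) -> measurable_fun setT f ->
  (forall x, f_ ^~ x @ \oo --> f x) -> mu.-integrable setT (EFin \o g) ->
  (forall x n, `|f_ n x| <= g x) -> (forall n, \int[mu]_x f_ n x = 0) ->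
  mu.-integrable setT (EFin \o f) /\ \int[mu]_x f x = 0.
Proof.
move=> mf_ mf cf ig fg f0.
have mfE (h : T -> R) : measurable_fun setT h -> measurable_fun setT (EFin \o h) by move=> mh; exact/measurable_EFinP.
have ae1 : {ae mu, forall x, setT x -> (fun n => (f_ n x)%:E) @ \oo --> (f x)%:E}.
  by apply: aeW => x _; apply: cvg_EFin; [exact: nearW|exact: cf].
have ae2 : {ae mu, forall x n, setT x -> (`|(f_ n x)%:E| <= (g x)%:E)%E}.
  by apply: aeW => x n _; rewrite lee_fin.
have [I1 _ C] := @dominated_convergence _ _ _ mu setT measurableT (fun n => EFin \o f_ n) (EFin \o f) (EFin \o g)
  (fun n => mfE _ (mf_ n)) (mfE _ mf) ae1 ig ae2.
split=> //; rewrite /Rintegral.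
have If n : mu.-integrable setT (EFin \o f_ n).
  apply: le_integrable ig => //; first exact: mfE.
  by move=> x _; rewrite /= lee_fin (le_trans (fg x n))// ler_norm.
have E0 : (fun n => \int[mu]_x (EFin \o f_ n) x)%E = cst 0%E.
  apply/funext => n; have := f0 n; rewrite /Rintegral => h.
  by rewrite -(fineK (integrable_fin_num measurableT (If n))) h.
rewrite E0 in C; rewrite (_ : (\int[mu]_x (f x)%:E = 0)%E)//.
by rewrite -[LHS](cvg_lim (@ereal_hausdorff R) C); exact: lim_cst.
Qed.

(** * The law of heights on the sphere *)

Section SphereIntegral.
Variables (R : realType) (n : nat) (s : R).
Hypothesis s0 : 0 < s.
Local Notation disk := (@odisk R n s).
Local Notation elev := (@elevation R n s).
Local Notation L := (lebn R n).

Lemma measurable_zext (U : set 'rV[R]_n) (f : 'rV[R]_n -> R) : open U ->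
  (forall u, U u -> {for u, continuous f}) -> measurable_fun setT (zext U f : borel 'rV[R]_n -> R).
Proof.
move=> oU cf; have mU : measurable (U : set (borel 'rV[R]_n)) by exact: open_borel.
rewrite -(setUv U); apply/measurable_funU => //; first exact: measurableC.
split.
  apply: (eq_measurable_fun (f : borel 'rV[R]_n -> R)); last exact: measurable_fun_open_on.
  by move=> u /set_mem Uu; rewrite /zext mem_set.
apply: (eq_measurable_fun (cst (0 : R))); last exact: measurable_cst.
by move=> u /set_mem Uu; rewrite /zext memNset.
Qed.

Lemma zext_in (U : set 'rV[R]_n) (f : 'rV[R]_n -> R) u : U u -> zext U f u = f u.
Proof. by move=> Uu; rewrite /zext mem_set. Qed.

Lemma zext_out (U : set 'rV[R]_n) (f : 'rV[R]_n -> R) u : ~ U u -> zext U f u = 0.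
Proof. by move=> Uu; rewrite /zext memNset. Qed.

Lemma zext_le (U : set 'rV[R]_n) (f g : 'rV[R]_n -> R) u : (U u -> f u <= g u) -> zext U f u <= zext U g u.
Proof. by rewrite /zext; case: ifPn => // /set_mem Uu; apply. Qed.

Let oU := @open_disk R n s.
Let Crad : C1 disk elev := (@has_pd_rad R n s).1.
Let Cpsi M : C1 disk (psi s M) := (@has_pd_psi R n s M).1.
Let radn u : disk u -> elev u != 0. Proof. by move=> Uu; rewrite gt_eqF// rad_gt0. Qed.
Let Cradv : C1 disk (fun u => (elev u)^-1) := C1V oU Crad radn.

Lemma cutoff_integrable M (f : 'rV[R]_n -> R) : C1 disk f ->
  (forall u, disk u -> ~ core s M u -> f u = 0) -> L.-integrable setT (EFin \o zext disk f).
Proof.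
move=> Cf f0; have [k Hk] := @disk_cube R n s.
apply: (@C1_integrable R n k).
  exact: (C1_zext oU (@closed_core R n s M) (@core_disk R n s M) Cf f0).
by move=> u uk; rewrite /zext; case: ifPn => // /set_mem/Hk.
Qed.

Lemma cutoff_cvg u : disk u -> [/\ (fun M => (M.+1%:R * elev u)^-1) @ \oo --> (0 : R),
  (fun M => psi s M u) @ \oo --> (1 : R) & (fun M => kap s M u) @ \oo --> (0 : R)].
Proof.
move=> Uu; have r0 := rad_gt0 Uu.
have C1 : (fun M => (M.+1%:R * elev u)^-1) @ \oo --> (0 : R).
  rewrite (_ : (fun M => _) = (fun M => harmonic M * (elev u)^-1)); last first.
    by apply/funext => M; rewrite invfM.
  rewrite -(mul0r (elev u)^-1); apply: cvgM; [exact: cvg_harmonic|exact: cvg_cst].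
have C2 : (fun M => 1 - (M.+1%:R * elev u)^-1) @ \oo --> (1 : R).
  by rewrite -[X in _ --> X](subr0 1); apply: cvgB => //; exact: cvg_cst.
have C3 : (fun M => Num.max (1 - (M.+1%:R * elev u)^-1) 0) @ \oo --> (1 : R).
  rewrite [X in _ --> X](_ : 1 = Num.max 1 0); last by rewrite (max_idPl ler01).
  have cm : continuous (fun z : R => Num.max z 0).
    apply: cts_max; last exact: cts_cst.
    by move=> z; exact: cvg_id.
  exact: (continuous_cvg _ (cm 1) C2).
split=> //.
  rewrite -[X in _ --> X](expr1n _ 2); rewrite /psi /pos2.
  exact: (continuous_cvg _ (@exprn_continuous R 2 1) C3).
rewrite (_ : (fun M => kap s M u) = fun M => 2 * Num.max (1 - (M.+1%:R * elev u)^-1) 0 * ((M.+1%:R * elev u)^-1 * (elev u)^-1)); last first.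
  by apply/funext => M; rewrite /kap; congr (_ * _); rewrite expr2 mulrA invfM.
rewrite [X in _ --> X](_ : 0 = 2 * 1 * (0 * (elev u)^-1) :> R); last by rewrite mul0r mulr0.
apply: cvgM; apply: cvgM => //; exact: cvg_cst.
Qed.

(** The divergence of [psi M * elev * u] contains - s^2 psi / elev besides a bounded term and one of
    favourable sign. Its integral is zero, so the cut-off integrals are bounded uniformly in [M],
    and monotone convergence applies. *)
Lemma integrable_inv_rad : L.-integrable setT (EFin \o zext disk (fun u => (elev u)^-1)).
Proof.
pose f M := zext disk (fun u => psi s M u * (elev u)^-1).
have Cf M : C1 disk (fun u => psi s M u * (elev u)^-1) := C1M oU (Cpsi M) Cradv.
have f0 M u : disk u -> ~ core s M u -> psi s M u * (elev u)^-1 = 0.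
  by move=> Uu H; rewrite psi_out ?mul0r.
have If M : L.-integrable setT (EFin \o f M) by exact: cutoff_integrable (Cf M) (f0 M).
have [k Hk] := @disk_cube R n s.
pose B := n.+1%:R * s * fine (L (cube n k)).
have bound M : s ^+ 2 * \int[L]_u f M u <= B.
  pose V b u := psi s M u * elev u * u 0 b.
  have rn v : disk v -> elev v != 0 by exact: radn.
  pose H b := has_pdM oU (has_pdM oU (@has_pd_psi R n s M) (@has_pd_rad R n s)) (has_pd_coord oU b).
  pose dV u := n.+1%:R * (psi s M u * elev u) - s ^+ 2 * (psi s M u * (elev u)^-1) - kap s M u * edot u u.
  have VE u : disk u -> \sum_b pd (V b) b u = dV u.
    move=> Uu; under eq_bigr => b _ do rewrite ((H b).2 u b Uu)/= eqxx mulr1n.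
    have r0 := rad_gt0 Uu; have Suu : edot u u = s ^+ 2 - elev u ^+ 2 by rewrite sqr_rad// opprB addrC subrK.
    rewrite /dV; move: (psi s M u) (kap s M u) (elev u) r0 Suu => P K r r0 Suu.
    transitivity (\sum_b ((- K - P / r) * (u 0 b * u 0 b) + P * r)).
      by apply: eq_bigr => b _; move: (u 0 b) => x; field; rewrite gt_eqF.
    rewrite big_split/= -mulr_sumr -/(edot u u) Suu sumr_const card_ord -[_ *+ n]mulr_natl -natr1.
    by move: (n%:R : R) => N; field; rewrite gt_eqF.
  have [I1 I2] := @cutoff_divergence R n s M V dV (fun b => (H b).1)
    (fun b u Uu Hu => etrans (congr1 (fun z => z * elev u * u 0 b) (psi_out Uu Hu)) ltac:(by rewrite !mul0r)) VE.
  have Cpr : C1 disk (fun u => psi s M u * elev u) := C1M oU (Cpsi M) Crad.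
  have Ipr : L.-integrable setT (EFin \o zext disk (fun u => psi s M u * elev u)).
    by apply: (cutoff_integrable (M := M) Cpr) => u Uu Hu; rewrite psi_out ?mul0r.
  have Iind : L.-integrable setT (EFin \o (\1_(cube n k) : borel 'rV[R]_n -> R)).
    apply/integrableP; split.
      by apply/measurable_EFinP; apply: measurable_indic; exact: (@measurable_cube R n k).
    under eq_integral do rewrite gee0_abs ?lee_fin//.
    by rewrite integral_indic ?setIT//; [exact: lebn_cube_lty|exact: measurable_cube].
  have Icube : L.-integrable setT (EFin \o (fun u => n.+1%:R * s * \1_(cube n k) u)).
    exact: (integrableZl measurableT (n.+1%:R * s) Iind).
  rewrite -RintegralZl//.
  apply: (@le_trans _ _ (\int[L]_u (n.+1%:R * s * \1_(cube n k) u - zext disk dV u))).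
    apply: le_Rintegral => // [||u _].
    - exact: (integrableZl measurableT (s ^+ 2) (If M)).
    - exact: (integrableB measurableT Icube I1).
    have [Uu|Uu] := pselect (disk u); last first.
      rewrite /f !zext_out// mulr0 subr0 !mulr_ge0 ?(ltW s0)//.
    rewrite /f !zext_in// indicE (mem_set (Hk u Uu)) mulr1 /dV.
    have [K0 _] := kap_bound M Uu; have U0 := edot_ge0 u.
    have /andP[P0 P1] := psi01 M (ltW (rad_gt0 Uu)).
    have : psi s M u * elev u <= s by rewrite -[X in _ <= X]mul1r ler_pM ?rad_le ?(ltW (rad_gt0 Uu)).
    move=> /(ler_wpM2l (ler0n R n.+1)); have := mulr_ge0 K0 U0.
    by move: (kap s M u * _) (s ^+ 2 * _) (n.+1%:R * s) (n.+1%:R * _) => *; lra.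
  rewrite RintegralB// I2 subr0 RintegralZl//.
  by rewrite /B /Rintegral integral_indic ?setIT//; exact: measurable_cube.
have mf M : measurable_fun setT (EFin \o f M : borel 'rV[R]_n -> \bar R) by have /integrableP[] := If M.
have fge0 M u : (0 <= (EFin \o f M) u)%E.
  rewrite /= lee_fin /f; have [Uu|Uu] := pselect (disk u); last by rewrite zext_out.
  have r0 := rad_gt0 Uu; have /andP[P0 _] := psi01 M (ltW r0).
  by rewrite zext_in// mulr_ge0 ?invr_ge0 ?(ltW r0).
have ninf u : nondecreasing_seq (fun M => (EFin \o f M) u).
  move=> M N MN; rewrite /= lee_fin /f; apply: zext_le => Uu; have r0 := rad_gt0 Uu.
  rewrite ler_wpM2r ?invr_ge0 ?(ltW r0)// /psi /pos2.
  have H : (N.+1%:R * elev u)^-1 <= (M.+1%:R * elev u)^-1.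
    by rewrite lef_pV2 ?posrE ?mulr_gt0// ler_wpM2r ?(ltW r0)// ler_nat.
  rewrite ler_pXn2r ?nnegrE; [|by []|by rewrite le_max lexx orbT|by rewrite le_max lexx orbT].
  move: ((M.+1%:R * elev u)^-1) ((N.+1%:R * elev u)^-1) H => x y xy.
  by case: (leP (1 - x) 0); case: (leP (1 - y) 0) => *; lra.
have C := @cvg_monotone_convergence _ _ _ L setT measurableT (fun M => EFin \o f M) mf (fun M u _ => fge0 M u)
  (fun u _ => ninf u).
have limE : (fun u => limn (fun M => (EFin \o f M) u)) = EFin \o zext disk (fun u => (elev u)^-1).
  apply/funext => u; apply/cvg_lim => //; apply: cvg_EFin; first exact: nearW.
  rewrite /f; have [Uu|Uu] := pselect (disk u); last first.
    rewrite zext_out//; rewrite (_ : (fun M => _) = cst 0); first exact: cvg_cst.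
    by apply/funext => M; rewrite /= zext_out.
  rewrite zext_in// (_ : _ \o _ = fun M => psi s M u * (elev u)^-1); last first.
    by apply/funext => M; rewrite /= zext_in.
  rewrite -[X in _ --> X]mul1r; apply: cvgM; last exact: cvg_cst.
  by have [] := cutoff_cvg Uu.
apply/integrableP; split.
  apply/measurable_EFinP; apply: measurable_zext => // u Uu.
  exact: C1_continuous Cradv Uu.
under eq_integral => u _.
  rewrite gee0_abs; last first.
    rewrite /= lee_fin; have [Uu|Uu] := pselect (disk u); last by rewrite zext_out.
    by rewrite zext_in// invr_ge0 ltW// rad_gt0.
  over.
rewrite limE in C.
apply: (@le_lt_trans _ _ (s ^- 2 * B)%:E); last exact: ltry.
rewrite -(cvg_lim _ C)//; apply: lime_le; first exact: cvgP C.
apply: nearW => M.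
rewrite -(fineK (integrable_fin_num measurableT (If M))) lee_fin.
rewrite mulrC ler_pdivlMr ?exprn_gt0// mulrC; exact: bound.
Qed.

End SphereIntegral.

Lemma pow_lipschitz (R : realFieldType) (s : R) k : 0 < s -> exists B : R, 0 <= B /\
  forall x y, `|x| <= s -> `|y| <= s -> `|x ^+ k - y ^+ k| <= B * `|x - y|.
Proof.
move=> s0; elim: k => [|k [B [B0 H]]].
  by exists 0; split=> // x y _ _; rewrite !expr0 subrr normr0 mul0r.
exists (s * B + s ^+ k); split; first by rewrite addr_ge0 ?mulr_ge0 ?exprn_ge0// ltW.
move=> x y xs ys; rewrite !exprS.
have -> : x * x ^+ k - y * y ^+ k = x * (x ^+ k - y ^+ k) + (x - y) * y ^+ k by ring.
apply: le_trans (ler_normD _ _) _; rewrite [X in _ <= X]mulrDl !normrM; apply: lerD.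
  by rewrite -mulrA ler_pM// H.
rewrite mulrC; apply: ler_wpM2r => //.
by rewrite normrX lerXn2r ?nnegrE// ltW.
Qed.

Lemma cvg_cutoff (R : realType) (P K : nat -> R) (r x y z : R) : P @ \oo --> (1 : R) -> K @ \oo --> (0 : R) ->
  (fun M => P M / r * x + K M * y * z) @ \oo --> x / r.
Proof.
move=> P1 K0; have -> : x / r = 1 * (r^-1 * x) + 0 * (y * z) by rewrite mul0r addr0 mul1r mulrC.
rewrite (_ : (fun M => _) = fun M => P M * (r^-1 * x) + K M * (y * z)); last by apply/funext => M; rewrite !mulrA.
apply: cvgD; first by apply: cvgM => //; exact: cvg_cst.
by apply: cvgM => //; exact: cvg_cst.
Qed.

Section SphereLaw.
Variables (R : realType) (n : nat) (s : R).
Hypothesis s0 : 0 < s.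
Variables (a : R) (e : 'rV[R]_n).
Hypothesis ae1 : a ^+ 2 + edot e e = 1.
Local Notation disk := (@odisk R n s).
Local Notation elev := (@elevation R n s).
Local Notation L := (lebn R n).
Local Notation tp := (ht s a e).
Local Notation tm := (ht s (- a) e).

Let oU := @open_disk R n s.
Let ae1' : (- a) ^+ 2 + edot e e = 1. Proof. by rewrite sqrrN. Qed.

(** Cauchy-Schwarz for the unit direction [(b, e)] and the point [(elevation, u)] of norm [s],
    carried out on the split coordinates. *)
Lemma ht_le (b : R) u : b ^+ 2 + edot e e = 1 -> disk u -> `|ht s b e u| <= s.
Proof.
move=> be Uu; have r0 := rad_gt0 Uu; have rr := sqr_rad Uu.
have x1 := edot_enorm e u; have x2 := edot_enorm (- e) u.
have NE : edot (- e) u = - edot e u.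
  by rewrite /edot -sumrN; apply: eq_bigr => j _; rewrite mxE mulNr.
rewrite NE enormN in x2; move: be rr; rewrite -!sqr_enorm /ht.
move: (enorm_ge0 e) (enorm_ge0 u) x1 x2; move: (enorm e) (enorm u) (edot e u) (elevation s u) => p q x r p0 q0 x1 x2 be rr.
have xx : x ^+ 2 <= (p * q) ^+ 2.
  by rewrite -[x ^+ 2]real_normK ?num_real// ler_pXn2r ?nnegrE ?mulr_ge0// ler_norml lerNl x2.
have cross : 2 * (b * r * x) <= b ^+ 2 * q ^+ 2 + p ^+ 2 * r ^+ 2.
  have [bq|bq] := eqVneq q 0.
    have -> : x = 0 by apply/eqP; rewrite -sqrf_eq0 eq_le sqr_ge0 andbT (le_trans xx)// bq mulr0 expr0n.
    by rewrite !mulr0; apply: addr_ge0; exact: mulr_ge0 (sqr_ge0 _) (sqr_ge0 _).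
  have qp : 0 < q ^+ 2 by rewrite exprn_gt0// lt_neqAle eq_sym bq.
  rewrite -(ler_pM2r qp) -subr_ge0.
  have -> : (b ^+ 2 * q ^+ 2 + p ^+ 2 * r ^+ 2) * q ^+ 2 - 2 * (b * r * x) * q ^+ 2 =
     (b * q ^+ 2 - r * x) ^+ 2 + r ^+ 2 * ((p * q) ^+ 2 - x ^+ 2) by ring.
  by rewrite addr_ge0 ?sqr_ge0// mulr_ge0 ?sqr_ge0// subr_ge0.
rewrite -(@ler_pXn2r _ 2%N)// ?nnegrE ?(ltW s0)// real_normK ?num_real//.
have -> : s ^+ 2 = r ^+ 2 + q ^+ 2 by rewrite rr subrK.
have -> : r ^+ 2 + q ^+ 2 = (b ^+ 2 + p ^+ 2) * (r ^+ 2 + q ^+ 2) by rewrite be mul1r.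
rewrite -subr_ge0 (_ : _ - _ = (b ^+ 2 * q ^+ 2 + p ^+ 2 * r ^+ 2 - 2 * (b * r * x)) + ((p * q) ^+ 2 - x ^+ 2)); last by ring.
by rewrite addr_ge0 ?subr_ge0.
Qed.

Definition wgt u := zext disk (fun u => (elev u)^-1) u.
Definition zp u := zext disk (fun u => tp u / s) u.
Definition zm u := zext disk (fun u => tm u / s) u.
(** Up to the factor [s], the surface integral over both hemispheres of [phi] of the height divided
    by [s]: the area density of the graph is s / elevation. *)
Definition sph (phi : R -> R) := \int[L]_u ((phi (zp u) + phi (zm u)) * wgt u).

Let Cinv : C1 disk (fun u => (elev u)^-1).
Proof. by apply: (C1V oU (has_pd_rad n s).1) => u Uu; rewrite gt_eqF// rad_gt0. Qed.

Lemma wgt_ge0 u : 0 <= wgt u.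
Proof.
rewrite /wgt; have [Uu|Uu] := pselect (disk u); last by rewrite zext_out.
by rewrite zext_in// invr_ge0 ltW// rad_gt0.
Qed.

Lemma measurable_wgt : measurable_fun setT (wgt : borel 'rV[R]_n -> R).
Proof. by apply: measurable_zext => // u Uu; exact: C1_continuous Cinv Uu. Qed.

Lemma zp_le u : `|zp u| <= 1.
Proof.
rewrite /zp; have [Uu|Uu] := pselect (disk u); last by rewrite zext_out// normr0.
by rewrite zext_in// normrM [X in _ * X]gtr0_norm ?invr_gt0// ler_pdivrMr// mul1r; exact: ht_le.
Qed.

Lemma zm_le u : `|zm u| <= 1.
Proof.
rewrite /zm; have [Uu|Uu] := pselect (disk u); last by rewrite zext_out// normr0.
by rewrite zext_in// normrM [X in _ * X]gtr0_norm ?invr_gt0// ler_pdivrMr// mul1r; exact: ht_le.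
Qed.

Lemma measurable_ht (b : R) : measurable_fun setT (zext disk (fun u => ht s b e u / s) : borel 'rV[R]_n -> R).
Proof.
apply: measurable_zext => // u Uu.
have C := C1M oU (has_pd_ht s b e).1 (C1_cst oU s^-1).
exact: C1_continuous C Uu.
Qed.

Lemma sph_integrable (phi : R -> R) (K : R) : measurable_fun setT phi ->
  (forall t, `|t| <= 1 -> `|phi t| <= K) ->
  L.-integrable setT (EFin \o (fun u => (phi (zp u) + phi (zm u)) * wgt u)).
Proof.
move=> mphi HK; have iw := integrableZl measurableT (2 * K) (integrable_inv_rad n s0).
apply: le_integrable iw => //.
  apply/measurable_EFinP; apply: measurable_funM; last exact: measurable_wgt.
  apply: measurable_funD; apply: (measurableT_comp mphi); exact: measurable_ht.
move=> u _; rewrite /= lee_fin normrM [X in _ <= X]normrM !(ger0_norm (wgt_ge0 u)).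
rewrite ler_wpM2r ?wgt_ge0// (le_trans (ler_normD _ _))// (le_trans (lerD (HK _ (zp_le u)) (HK _ (zm_le u))))//.
have -> : K + K = 2 * K by ring.
exact: ler_norm.
Qed.

Lemma continuous_sph_integrable (phi : R -> R) : continuous phi ->
  L.-integrable setT (EFin \o (fun u => (phi (zp u) + phi (zm u)) * wgt u)).
Proof.
move=> cphi; have cp : continuous (fun t => `|phi t|) by exact: cts_norm.
have [|c _ Hc] := @compact_EVT_max _ R (fun t => `|phi t|) `[(-1 : R), 1]%classic _ (@segment_compact R _ _) (continuous_subspaceT cp).
  by exists 0; rewrite /= in_itv/= lerN10 ler01.
apply: (@sph_integrable phi `|phi c|).
  exact: continuous_measurable_fun.
by move=> t t1; apply: Hc; rewrite inE/= in_itv/= -ler_norml.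
Qed.

Lemma sph1_gt0 : 0 < sph (fun=> 1).
Proof.
have I := @sph_integrable (fun=> 1) 1 (@measurable_cst _ _ _ _ _ _) (fun _ _ => ltac:(by rewrite normr1)).
rewrite /sph /Rintegral fine_gt0//; apply/andP; split; last first.
  by have := integrable_fin_num measurableT I; rewrite fin_numElt => /andP[].
apply: (@lebn_integral_gt0 R n disk) => //.
- by exists 0; rewrite /odisk/= (_ : edot _ _ = 0) ?exprn_gt0// /edot big1// => j _; rewrite mxE mul0r.
- by apply: measurable_funM; [exact: measurable_cst|exact: measurable_wgt].
- by move=> u; rewrite mulr_ge0 ?wgt_ge0.
- by move=> u Uu; rewrite /wgt zext_in// mulr_gt0// invr_gt0 rad_gt0.
Qed.

Lemma sph_mean : mean_functional 1 (fun phi => sph phi / sph (fun=> 1)).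
Proof.
have N0 := sph1_gt0; split.
- by rewrite divff// gt_eqF.
- move=> f g cf cg; rewrite -mulrDl; congr (_ / _).
  rewrite -RintegralD//; [|exact: continuous_sph_integrable|exact: continuous_sph_integrable].
  by congr Rintegral; apply/funext => u; ring.
- move=> c f cf; rewrite mulrA; congr (_ / _).
  rewrite -RintegralZl//; last exact: continuous_sph_integrable.
  by congr Rintegral; apply/funext => u; ring.
- move=> f g cf cg fg; rewrite ler_pM2r ?invr_gt0//.
  apply: le_Rintegral => // [||u _]; [exact: continuous_sph_integrable|exact: continuous_sph_integrable|].
  by rewrite ler_wpM2r ?wgt_ge0// lerD// fg// ?zp_le// zm_le.
Qed.

(** Integrates [hfield_divergence] over both hemispheres and removes the cutoff. On one hemisphere
    the error [kap / elev] is not dominated by 1 / elev; in the sum the equatorial contributions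
    nearly cancel. *)
Lemma sph_moment_identity k :
  sph (fun t => k%:R * t ^+ k.-1 * (1 - t ^+ 2) - n%:R * t ^+ k.+1) = 0.
Proof.
pose Q t := k%:R * t ^+ k.-1 * (s ^+ 2 - t ^+ 2) - n%:R * t ^+ k.+1.
pose dV b M u := psi s M u / elev u * Q (ht s b e u) +
  kap s M u * (s ^+ 2 * b / elev u - ht s b e u) * ht s b e u ^+ k.
have Hb b M : b ^+ 2 + edot e e = 1 ->
    L.-integrable setT (EFin \o zext disk (dV b M)) /\ \int[L]_u zext disk (dV b M) u = 0.
  move=> be; pose V := hfield s b e M k.
  apply: (@cutoff_divergence R n s M V).
  - move=> c u Uu; exact: (hfield_divergence be M k Uu).1.
  - by move=> c u Uu Hu; rewrite /V /hfield psi_out// !mul0r.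
  - by move=> u Uu; exact: (hfield_divergence be M k Uu).2.
pose F M u := zext disk (dV a M) u + zext disk (dV (- a) M) u.
have F0 M : \int[L]_u F M u = 0.
  have [I1 E1] := Hb a M ae1; have [I2 E2] := Hb (- a) M ae1'.
  by rewrite RintegralD// E1 E2 addr0.
have mF M : measurable_fun setT (F M : borel 'rV[R]_n -> R).
  have [/integrableP[/measurable_EFinP m1 _] _] := Hb a M ae1.
  have [/integrableP[/measurable_EFinP m2 _] _] := Hb (- a) M ae1'.
  exact: measurable_funD.
pose F' u := (Q (s * zp u) + Q (s * zm u)) * wgt u.
have CQ : exists C : R, 0 <= C /\ forall t, `|t| <= s -> `|Q t| <= C.
  have cQ : continuous (fun t => `|Q t|).
    have cX : continuous (fun t : R => t) by move=> t; exact: cvg_id.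
    by rewrite /Q; cts.
  have [|c _ Hc] := @compact_EVT_max _ R (fun t => `|Q t|) `[(- s), s]%classic _ (@segment_compact R _ _) (continuous_subspaceT cQ).
    by exists 0; rewrite /= in_itv/= oppr_le0 (ltW s0).
  exists `|Q c|; split=> // t ts; apply: Hc; by rewrite inE/= in_itv/= -ler_norml.
have [C [C0 HC]] := CQ; have [B [B0 HB]] := pow_lipschitz k s0.
pose C2 := s ^+ 2 * `|a| * (B * (2 * `|a|)) + 2 * s ^+ k.+1.
have C20 : 0 <= C2 by rewrite addr_ge0 ?mulr_ge0 ?exprn_ge0 ?(ltW s0).
have bound u M : `|F M u| <= (2 * C + 2 * C2) * wgt u.
  rewrite /F /wgt; have [Uu|Uu] := pselect (disk u); last by rewrite !zext_out// addr0 normr0 mulr0.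
  rewrite !zext_in// /dV; have r0 := rad_gt0 Uu.
  have h1 := ht_le ae1 Uu; have h2 := ht_le ae1' Uu.
  have /andP[P0 P1] := psi01 M (ltW r0); have [K0 K1] := kap_bound M Uu.
  have D : ht s a e u - ht s (- a) e u = 2 * a * elev u by rewrite /ht; ring.
  have T1 := HC _ h1; have T2 := HC _ h2; have T3 := HB _ _ h1 h2; rewrite D in T3.
  have X1 : `|ht s a e u ^+ k.+1| <= s ^+ k.+1 by rewrite normrX lerXn2r ?nnegrE ?(ltW s0).
  have X2 : `|ht s (- a) e u ^+ k.+1| <= s ^+ k.+1 by rewrite normrX lerXn2r ?nnegrE ?(ltW s0).
  rewrite [_ ^+ k.+1]exprS in X1; rewrite [_ ^+ k.+1]exprS in X2; move: X1 X2; move: T1 T2 T3 P0 P1 K0 K1 r0.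
  move: (ht s a e u) (ht s (- a) e u) (psi s M u) (kap s M u) (elev u) => x y P K r T1 T2 T3 P0 P1 K0 K1 r0 X1 X2.
  (* The cancellation: the two heights differ by [2 * a * r], so the difference of their k-th powers
     divided by [r] stays bounded. *)
  have -> : P / r * Q x + K * (s ^+ 2 * a / r - x) * x ^+ k + (P / r * Q y + K * (s ^+ 2 * - a / r - y) * y ^+ k) =
     P / r * (Q x + Q y) + K * (s ^+ 2 * a * ((x ^+ k - y ^+ k) / r) - (x * x ^+ k + y * y ^+ k)).
    by move: (Q x) (Q y) => *; field; rewrite gt_eqF.
  apply: le_trans (ler_normD _ _) _; rewrite [X in _ <= X]mulrDl; apply: lerD.
    rewrite normrM ger0_norm; last by rewrite mulr_ge0 ?invr_ge0 ?(ltW r0).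
    rewrite mulrC; apply: ler_pM => //; first by rewrite mulr_ge0 ?invr_ge0 ?(ltW r0).
      by rewrite (le_trans (ler_normD _ _))// mulr_natl mulr2n lerD.
    by rewrite ler_piMl ?invr_ge0 ?(ltW r0).
  have K2 : K <= 2 * r^-1 by rewrite ler_pdivlMr.
  rewrite normrM (ger0_norm K0) [X in _ <= X]mulrAC; apply: ler_pM => //.
  rewrite (le_trans (ler_normB _ _))// /C2 lerD//.
    rewrite normrM (normrM (s ^+ 2)) (ger0_norm (sqr_ge0 s)) ler_wpM2l ?(mulr_ge0 (sqr_ge0 s) (normr_ge0 a))//.
    rewrite normrM normfV (gtr0_norm r0) ler_pdivrMr// (le_trans T3)//.
    by rewrite !normrM (gtr0_norm r0) ger0_norm// !mulrA.
  by rewrite (le_trans (ler_normD _ _))// mulr_natl mulr2n lerD.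
have cvgF u : F ^~ u @ \oo --> F' u.
  rewrite /F /F' /wgt /zp /zm; have [Uu|Uu] := pselect (disk u); last first.
    rewrite !zext_out// mulr0 (_ : (fun M => _) = cst (0 : R)); first exact: cvg_cst.
    by apply/funext => M; rewrite !zext_out// addr0.
  rewrite !zext_in// (_ : (fun M => _) = fun M => dV a M u + dV (- a) M u); last first.
    by apply/funext => M; rewrite !zext_in.
  have [_ P1 K0] := cutoff_cvg Uu.
  have sz (b : R) : s * (ht s b e u / s) = ht s b e u by rewrite mulrC divfK// gt_eqF.
  by rewrite !sz mulrDl; apply: cvgD; rewrite /dV; exact: cvg_cutoff.
have cX : continuous (fun t : R => t) by move=> t; exact: cvg_id.
have cQs : continuous (fun t => Q (s * t)) by rewrite /Q; cts.
have mF' : measurable_fun setT (F' : borel 'rV[R]_n -> R).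
  by have /integrableP[/measurable_EFinP] := continuous_sph_integrable cQs.
have [_ E] := @dominated_integral0 R _ _ L F F' _ mF mF' cvgF
  (integrableZl measurableT (2 * C + 2 * C2) (integrable_inv_rad n s0)) bound F0.
apply: (@mulfI _ (s ^+ k.+1)); first by rewrite expf_neq0// gt_eqF.
rewrite mulr0 -RintegralZl; last 2 first.
- by [].
- by apply: (@continuous_sph_integrable (fun t => k%:R * t ^+ k.-1 * (1 - t ^+ 2) - n%:R * t ^+ k.+1)); cts.
rewrite -[RHS]E; congr Rintegral; apply/funext => u; rewrite /F' mulrA; congr (_ * _).
have sQ t : s ^+ k.+1 * (k%:R * t ^+ k.-1 * (1 - t ^+ 2) - n%:R * t ^+ k.+1) = Q (s * t).
  rewrite /Q !exprMn; case: k {Q dV Hb F F0 mF F' CQ C C0 HC B B0 HB C2 C20 bound cvgF cQs mF' E} => [|k] /=.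
    by rewrite !mul0r !sub0r; ring.
  by rewrite !exprS; ring.
by rewrite mulrDr !sQ.
Qed.

(** Two consecutive moments are carried together because the recursion has step two. *)
Fixpoint moment2 k : R * R := if k is j.+1 then
  let: (x, y) := moment2 j in (y, j.+1%:R / (j.+1 + n)%:R * x) else (1, 0).

Definition sphere_moment k := (moment2 k).1.

(** The right-hand side involves neither the radius nor the direction; this takes the place of
    rotation invariance. *)
Lemma sph_moment k : (0 < n)%N -> sph (fun t => t ^+ k) / sph (fun=> 1) = sphere_moment k.
Proof.
move=> n0; have [L1 LD LZ _] := sph_mean; have N0 := sph1_gt0.
have cX : continuous (fun t : R => t) by move=> t; exact: cvg_id.
pose G phi := sph phi / sph (fun=> 1).
have rec j : (j + n)%:R * G (fun t => t ^+ j.+1) = j%:R * G (fun t => t ^+ j.-1).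
  have := sph_moment_identity j.
  have -> : (fun t : R => j%:R * t ^+ j.-1 * (1 - t ^+ 2) - n%:R * t ^+ j.+1) =
      (fun t => j%:R * t ^+ j.-1 + (- (j + n)%:R) * t ^+ j.+1).
    by apply/funext => t; rewrite natrD; case: j => [|j] /=; rewrite ?exprS; ring.
  move=> /(congr1 (fun z => z / sph (fun=> 1))); rewrite mul0r.
  rewrite LD; [|by cts|by cts]; rewrite !LZ; [|by cts|by cts].
  by rewrite mulNr => /eqP; rewrite subr_eq0 => /eqP <-.
suff H : G (fun t => t ^+ k) = (moment2 k).1 /\ G (fun t => t ^+ k.+1) = (moment2 k).2 by have [] := H.
elim: k => [|k [IH1 IH2]].
  split; first by rewrite /G /= -[RHS]L1.
  have := rec 0%N; rewrite mul0r => /eqP; rewrite mulf_eq0 pnatr_eq0 add0n eqn0Ngt n0/= => /eqP.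
  by rewrite /=.
rewrite /=; case: (moment2 k) IH1 IH2 => x y /= IH1 IH2; split=> //.
have := rec k.+1; rewrite /= IH1 => H.
have kn : (k.+1 + n)%:R != 0 :> R by rewrite pnatr_eq0.
apply: (mulfI kn); rewrite H; move: kn; move: (k.+1 + n)%:R (k.+1)%:R => c d c0; by field.
Qed.

End SphereLaw.

(** Stability of the recursion under errors. The weight [2 ^+ j] is the one produced by heights that
    are only known to be at most 2. *)
Lemma sphere_moment_stable (R : realType) (n : nat) : (0 < n)%N -> forall k, exists C : R, 0 <= C /\
  forall (m : nat -> R) (T : R), m 0%N = 1 -> 0 <= T ->
  (forall j, `|(j + n)%:R * m j.+1 - j%:R * m j.-1| <= (j + n)%:R * 2 ^+ j * T) ->
  `|m k - (moment2 R n k).1| <= C * T.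
Proof.
move=> n0 k.
suff [C [C0 H]] : exists C : R, 0 <= C /\ forall (m : nat -> R) (T : R), m 0%N = 1 -> 0 <= T ->
  (forall j, `|(j + n)%:R * m j.+1 - j%:R * m j.-1| <= (j + n)%:R * 2 ^+ j * T) ->
  `|m k - (moment2 R n k).1| <= C * T /\ `|m k.+1 - (moment2 R n k).2| <= C * T.
  by exists C; split=> // m T m0 T0 Hm; have [] := H m T m0 T0 Hm.
elim: k => [|k [C [C0 IH]]].
  exists 1; split=> // m T m0 T0 Hm; rewrite /= m0 subrr normr0 mul1r subr0; split=> //.
  have := Hm 0%N; rewrite mul0r subr0 add0n expr0 mulr1 normrM ger0_norm//.
  by rewrite ler_pM2l// ltr0n.
exists (C + 2 ^+ k.+1); split=> [|m T m0 T0 Hm]; first by rewrite addr_ge0// exprn_ge0.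
have [] := IH m T m0 T0 Hm; rewrite /=; case: (moment2 R n k) => x y /= H1 H2.
have P0 : 0 <= 2 ^+ k.+1 * T by rewrite mulr_ge0// exprn_ge0.
split; first by rewrite mulrDl (le_trans H2)// lerDl.
have := Hm k.+1; rewrite /= -mulrA.
have kn : 0 < (k.+1 + n)%:R :> R by rewrite ltr0n.
have kl : k.+1%:R <= (k.+1 + n)%:R :> R by rewrite ler_nat leq_addr.
have k0 : 0 <= k.+1%:R :> R by [].
move: (2 ^+ k.+1) P0 => b P0; move: kn kl k0 H1.
move: (k.+1 + n)%:R (k.+1)%:R (m k) (m k.+2) => c d p r c0 dc d0 H1 H.
have -> : r - d / c * x = (c * r - d * p) / c + d / c * (p - x) by field; rewrite gt_eqF.
apply: le_trans (ler_normD _ _) _; rewrite [X in _ <= X]mulrDl [X in _ <= X]addrC; apply: lerD.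
  by rewrite normrM normfV (gtr0_norm c0) ler_pdivrMr// [_ * c]mulrC.
by rewrite normrM ger0_norm ?divr_ge0 ?(ltW c0)// (le_trans _ H1)// ler_piMl// ler_pdivrMr// mul1r.
Qed.

(** * Heights on a pinched hypersurface *)

Section HeightMoments.
Variables (R : realType) (n : nat) (M : closedHypersurface R n).
Hypothesis hn : (0 < n)%N.
Local Notation X := (@hs_map R n M).
Local Notation E := (@hs_average R n M).
Local Notation h := (hs_norm 2 (@curv R n M)).
Variable e : 'rV[R]_n.+1.
Hypothesis e1 : edot e e = 1.

Definition theight (x : M) := h * height (hs_center M) e x.
(** The first two terms bound |w^2 - 1| for w = |H| / h. The last two are d (4 + d) with d = h
    sqrt(defect), the cost of replacing the height by (H / h) <nu, e> in a square when the height is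
    at most 2. *)
Definition theight_err (x : M) := (curv x / h - 1) ^+ 2 + 2 * `|curv x / h - 1| +
  4 * (h * Num.sqrt (defect x)) + h ^+ 2 * defect x.
Hypothesis t2 : forall x, `|theight x| <= 2.
Local Notation t := theight.

Let h0 : 0 < h := @h_gt0 _ _ M hn.
Let ct : continuous t.
Proof. by have := @continuous_height _ _ M (hs_center M) e => c; rewrite /theight; cts. Qed.
Let cc := @continuous_curv R n M hn.
Let cd := @continuous_defect _ _ M hn.
Let n0 : 0 < n%:R :> R. Proof. by rewrite ltr0n. Qed.

Lemma defect_ge0 (x : M) : 0 <= defect x. Proof. exact: edot_ge0. Qed.

Lemma theight_hvec x : `|t x - edot (hvec x) e / (n%:R * h)| <= h * Num.sqrt (defect x).
Proof.
have hm : h != 0 by rewrite gt_eqF.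
have nm : n%:R != 0 :> R by rewrite gt_eqF.
have -> : t x - edot (hvec x) e / (n%:R * h) =
    h * edot (X x - hs_center M - (n%:R * h ^+ 2)^-1 *: hvec x) e.
  rewrite /theight /height (_ : edot (_ - _ *: _) e = edot (X x - hs_center M) e - (n%:R * h ^+ 2)^-1 * edot (hvec x) e); last first.
    by rewrite /edot mulr_sumr -sumrB; apply: eq_bigr => j _; rewrite coordBZ; ring.
  by move: (edot _ _) (edot _ _) => y z; move: h hm nm => H hm nm; field; rewrite hm nm.
rewrite normrM gtr0_norm// ler_wpM2l ?(ltW h0)//.
rewrite /defect -/(enorm _); set w := X x - _ - _.
have en : enorm e = 1 by rewrite /enorm e1 sqrtr1.
rewrite ler_norml lerNl -[- edot w e](_ : edot (- w) e = _); last first.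
  by rewrite /edot -sumrN; apply: eq_bigr => j _; rewrite mxE mulNr.
by have := edot_enorm w e; have := edot_enorm (- w) e; rewrite enormN en !mulr1 => -> ->.
Qed.

(** The rescaled height is close to (H / h) <nu, e> by [theight_hvec], and |H| / h is close to 1;
    hence its square is close to <nu, e>^2. *)
Lemma theight_nsq x : `|t x ^+ 2 - nsq x e| <= theight_err x.
Proof.
have d1 := theight_hvec x; have [nu [n1 nE hE]] := hs_normal x hn.
have NE : nsq x e = edot nu e ^+ 2.
  rewrite /nsq expr2 /edot mulr_suml; apply: eq_bigr => i _; rewrite mulr_sumr.
  by apply: eq_bigr => j _; rewrite nE; ring.
have N1 : edot nu e ^+ 2 <= 1.
  have En u : edot u u = 1 -> enorm u = 1 by rewrite /enorm => ->; rewrite sqrtr1.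
  rewrite -real_normK ?num_real// expr_le1// ler_norml lerNl -[- edot nu e](_ : edot (- nu) e = _); last first.
    by rewrite /edot -sumrN; apply: eq_bigr => j _; rewrite mxE mulNr.
  by have := edot_enorm nu e; have := edot_enorm (- nu) e; rewrite enormN !En// !mulr1 => -> ->.
have hv : edot (hvec x) e = n%:R * mean_curvature x * edot nu e.
  by rewrite /edot mulr_sumr; apply: eq_bigr => j _; rewrite hE mulrA.
have -> : theight_err x = (curv x / h - 1) ^+ 2 + 2 * `|curv x / h - 1| + 4 * (h * Num.sqrt (defect x)) +
    (h * Num.sqrt (defect x)) ^+ 2 by rewrite exprMn sqr_sqrtr ?defect_ge0.
rewrite NE; rewrite hv in d1.
have vE : n%:R * mean_curvature x * edot nu e / (n%:R * h) = mean_curvature x / h * edot nu e.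
  by move: (edot nu e) (mean_curvature x) h h0 => y z H H0; field; rewrite !gt_eqF.
rewrite vE in d1.
have wE : curv x / h = `|mean_curvature x / h| by rewrite normrM normfV (gtr0_norm h0).
rewrite wE; move: d1 N1 (t2 x); move: (mean_curvature x / h) (edot nu e) (theight x) => w z s.
move: (h * _) => d d1 N1 s2.
have d0 : 0 <= d by exact: le_trans (normr_ge0 _) d1.
have -> : s ^+ 2 - z ^+ 2 = (s ^+ 2 - (w * z) ^+ 2) + z ^+ 2 * (`|w| ^+ 2 - 1).
  by rewrite real_normK ?num_real//; ring.
rewrite (le_trans (ler_normD _ _))// addrC -!addrA addrA; apply: lerD.
  rewrite normrM ger0_norm ?sqr_ge0//; apply: (@le_trans _ _ `|(`|w| ^+ 2 - 1)|).
    by rewrite ler_piMl.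
  rewrite (_ : `|w| ^+ 2 - 1 = (`|w| - 1) ^+ 2 + 2 * (`|w| - 1)); last by ring.
  by apply: le_trans (ler_normD _ _) _; rewrite normrX real_normK ?num_real// normrM [`|2|]ger0_norm.
have -> : s ^+ 2 - (w * z) ^+ 2 = (s - w * z) * (2 * s - (s - w * z)) by ring.
rewrite normrM; apply: (@le_trans _ _ (d * (4 + d))); last by lra.
apply: ler_pM => //; apply: le_trans (ler_normB _ _) _; apply: lerD => //.
by rewrite normrM ger0_norm//; lra.
Qed.

Lemma continuous_theight_err : continuous theight_err.
Proof. by rewrite /theight_err; cts. Qed.

(** Exact consequence of [height_identity] for a power: replacing [nsq] by t^2 and <hvec, e> / (n h)
    by t yields the recursion of the sphere, and the two replacements form the right-hand side. *)
Lemma theight_moment_identity k :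
  (k + n)%:R * E (fun x => t x ^+ k.+1) - k%:R * E (fun x => t x ^+ k.-1) =
  E (fun x => k%:R * t x ^+ k.-1 * (t x ^+ 2 - nsq x e) + n%:R * t x ^+ k * (t x - edot (hvec x) e / (n%:R * h))).
Proof.
pose P : {poly R} := (h ^+ k) *: 'X^k.
have fE z : P.[z] = h ^+ k * z ^+ k by rewrite hornerZ hornerXn.
have dE z : derive1 (horner P) z = h ^+ k * (k%:R * z ^+ k.-1).
  by rewrite -derivE derivZ derivXn hornerZ hornerMn hornerXn mulr_natl.
have df z : derivable (horner P) z 1 by exact: derivable_horner.
have cf : continuous (derive1 (horner P)).
  by rewrite -derivE; exact: horner_continuous.
have H : E (fun x => h ^+ k * (k%:R * height (hs_center M) e x ^+ k.-1) * (1 - nsq x e)) =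
    E (fun x => h ^+ k * height (hs_center M) e x ^+ k * edot (hvec x) e).
  transitivity (E (fun x => derive1 (horner P) (height (hs_center M) e x) * (edot e e - nsq x e))).
    by congr hs_average; apply/funext => x; rewrite dE e1.
  rewrite height_identity//; congr hs_average; apply/funext => x; by rewrite fE.
have ch := @continuous_height _ _ M (hs_center M) e.
have cN := @continuous_nsq _ _ M e.
have cv : continuous (fun x : M => edot (hvec x) e).
  by apply: cts_sum => j _; have c1 := @continuous_hvec _ _ M j; cts.
have ct' := ct.
have hm : h != 0 by rewrite gt_eqF.
have nm : n%:R != 0 :> R by rewrite gt_eqF.
have {}H : k%:R * E (fun x => t x ^+ k.-1 * (1 - nsq x e)) = h^-1 * E (fun x => t x ^+ k * edot (hvec x) e).
  apply: (mulfI hm); rewrite [RHS]mulrA divff// mul1r -!avgZ; do ?[by cts].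
  have -> : (fun x => t x ^+ k * edot (hvec x) e) = fun x => h ^+ k * height (hs_center M) e x ^+ k * edot (hvec x) e.
    by apply/funext => x; rewrite -exprMn.
  rewrite -H; congr hs_average; apply/funext => x; rewrite /theight; case: (k) => [|j] /=; first by rewrite !mul0r !mulr0 mul0r.
  by rewrite exprS exprMn; ring.
rewrite avgD; [|by cts|by cts].
have -> : E (fun x => k%:R * t x ^+ k.-1 * (t x ^+ 2 - nsq x e)) =
    k%:R * (E (fun x => t x ^+ k.-1 * (1 - nsq x e)) - E (fun x => t x ^+ k.-1) + E (fun x => t x ^+ k.+1)).
  rewrite -avgB; [|by cts|by cts]; rewrite -avgD; [|by cts|by cts]; rewrite -avgZ; last by cts.
  congr hs_average; apply/funext => x; case: (k) => [|j]; first by rewrite !mul0r.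
  by rewrite /= !exprS; ring.
have -> : E (fun x => n%:R * t x ^+ k * (t x - edot (hvec x) e / (n%:R * h))) =
    n%:R * E (fun x => t x ^+ k.+1) - h^-1 * E (fun x => t x ^+ k * edot (hvec x) e).
  rewrite -!avgZ; [|by cts|by cts]; rewrite -avgB; [|by cts|by cts].
  congr hs_average; apply/funext => x; rewrite exprS; move: (edot _ _) (t x) (t x ^+ k) h hm nm => y z w H0 hm nm.
  by field; rewrite hm nm.
by rewrite mulrDr mulrBr H natrD; ring.
Qed.

Lemma theight_moment_bound k (T : R) : E theight_err <= T ->
  `|(k + n)%:R * E (fun x => t x ^+ k.+1) - k%:R * E (fun x => t x ^+ k.-1)| <= (k + n)%:R * 2 ^+ k * T.
Proof.
move=> HT; rewrite theight_moment_identity.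
have ch := @continuous_height _ _ M (hs_center M) e.
have cN := @continuous_nsq _ _ M e; have ct' := ct; have ce := continuous_theight_err.
have cv : continuous (fun x : M => edot (hvec x) e).
  by apply: cts_sum => j _; have c1 := @continuous_hvec _ _ M j; cts.
have b0 : 0 <= (k + n)%:R * 2 ^+ k :> R by rewrite mulr_ge0// exprn_ge0.
apply: le_trans (avg_norm _) _; first by cts.
apply: le_trans (ler_wpM2l b0 HT); rewrite -avgZ//.
apply: avg_le => [||x]; [by cts|by cts|].
have H1 := theight_nsq x; have H2 := theight_hvec x; have H3 := t2 x.
have d0 : 0 <= h * Num.sqrt (defect x) by rewrite mulr_ge0 ?(ltW h0).
have H2' : `|t x - edot (hvec x) e / (n%:R * h)| <= theight_err x.
  apply: le_trans H2 _; rewrite /theight_err; have := defect_ge0 x; have := sqr_ge0 h.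
  move=> H40 D0; have := mulr_ge0 H40 D0; move: d0 (sqr_ge0 (curv x / h - 1)) (normr_ge0 (curv x / h - 1)).
  by move: (h * _) (h ^+ 2 * _) (_ ^+ 2) `|_| => *; lra.
move: H1 H2' H3; move: (theight x) (theight_err x) (nsq x e) (edot _ _ / _) => z T' N v H1 H2' H3.
have pw j : (j <= k)%N -> `|z| ^+ j <= 2 ^+ k.
  move=> jk; apply: (@le_trans _ _ (2 ^+ j)); first by rewrite lerXn2r ?nnegrE.
  by rewrite ler_eXn2l ?ltr1n.
apply: le_trans (ler_normD _ _) _; rewrite natrD mulrDl [X in _ <= X]mulrDl; apply: lerD.
  rewrite normrM normrM ger0_norm// normrX; apply: ler_pM => //; rewrite ?mulr_ge0 ?exprn_ge0//.
  by rewrite ler_wpM2l// pw// leq_pred.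
rewrite normrM normrM ger0_norm// normrX; apply: ler_pM => //; rewrite ?mulr_ge0 ?exprn_ge0//.
by rewrite ler_wpM2l// pw.
Qed.

Lemma theight_mean : mean_functional 2 (fun f => E (fun x => f (t x))).
Proof.
split.
- exact: avg_cst.
- by move=> f g cf cg; apply: avgD; exact: cts_comp.
- by move=> c f cf; apply: avgZ; exact: cts_comp.
- move=> f g cf cg fg; apply: avg_le => [||x]; [exact: cts_comp|exact: cts_comp|].
  by apply: fg; exact: t2.
Qed.

End HeightMoments.

Lemma theight_err_bound (R : realType) (p : R) : 2 < p -> exists K : R, 0 <= K /\
  forall n (M : closedHypersurface R n) (eps : R), (0 < n)%N -> 0 < eps -> eps < 1 ->
  hs_norm p (@curv R n M) * hs_norm 2 (@hs_dist R n M) <= 1 + eps ->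
  @hs_average R n M (@theight_err R n M) <= K * Num.sqrt eps.
Proof.
move=> hp; have [K [K1 HK]] := pinching_estimates hp.
exists (K ^+ 2 + 6 * K + 3); split=> [|n M eps hn e0 e1 hpin]; first by have := sqr_ge0 K; lra.
have [A1 A2 A3 _] := HK n M eps hn e0 e1 hpin.
have A4 := pinch_defect hn hp e0 e1 hpin.
have h0 := @h_gt0 _ _ M hn; have cc := @continuous_curv R n M hn; have cd := @continuous_defect _ _ M hn.
rewrite /theight_err; move: A1 A2 A3 A4 h0 cd; move: (hs_norm 2 _) => h A1 A2 A3 A4 h0 cd.
have hm : h != 0 by rewrite gt_eqF.
have s1 : Num.sqrt eps <= 1 by rewrite -[X in _ <= X]sqrtr1 ler_wsqrtr// ltW.
have s0 : 0 < Num.sqrt eps by rewrite sqrtr_gt0.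
have se : Num.sqrt eps ^+ 2 = eps by rewrite sqr_sqrtr// ltW.
have -> : (fun x : M => (curv x / h - 1) ^+ 2 + 2 * `|curv x / h - 1| + 4 * (h * Num.sqrt (defect x)) + h ^+ 2 * defect x) =
  fun x => h ^- 2 * (curv x - h) ^+ 2 + 2 * h^-1 * `|curv x - h| + 4 * h * Num.sqrt (defect x) + h ^+ 2 * defect x.
  apply/funext => x; have -> : curv x / h - 1 = h^-1 * (curv x - h) by rewrite mulrBr mulVf// mulrC.
  by rewrite exprMn exprVn normrM gtr0_norm ?invr_gt0// !mulrA.
rewrite avgD; [|by cts|by cts]; rewrite avgD; [|by cts|by cts]; rewrite avgD; [|by cts|by cts].
rewrite !avgZ; do ?[by cts].
have B1 : h ^- 2 * @hs_average R n M (fun x => (curv x - h) ^+ 2) <= K ^+ 2 * Num.sqrt eps.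
  rewrite mulrC ler_pdivrMr ?exprn_gt0// (le_trans A1)// !exprMn ler_wpM2r ?sqr_ge0// ler_wpM2l ?sqr_ge0//.
  by rewrite expr2 ler_piMl// ltW.
have B2 : 2 * h^-1 * @hs_average R n M (fun x => `|curv x - h|) <= 2 * K * Num.sqrt eps.
  rewrite -!mulrA ler_wpM2l// mulrC ler_pdivrMr//; by rewrite mulrA.
have B3 : 4 * h * @hs_average R n M (fun x => Num.sqrt (defect x)) <= 4 * K * Num.sqrt eps.
  rewrite -!mulrA ler_wpM2l// mulrC -ler_pdivlMr//; by rewrite mulrA.
have B4 : h ^+ 2 * @hs_average R n M (@defect R n M) <= 3 * Num.sqrt eps.
  rewrite mulrC -ler_pdivlMr ?exprn_gt0// (le_trans A4)// ler_wpM2r ?invr_ge0 ?sqr_ge0// ler_wpM2l//.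
  by rewrite -{1}se expr2 ler_piMl// ltW.
have -> : (K ^+ 2 + 6 * K + 3) * Num.sqrt eps =
    K ^+ 2 * Num.sqrt eps + 2 * K * Num.sqrt eps + 4 * K * Num.sqrt eps + 3 * Num.sqrt eps by ring.
by do 3!apply: lerD => //.
Qed.

(** Two block-triangular factorizations of one bordered matrix. *)
Lemma det_rank_one (R : comPzRingType) n (v : 'rV[R]_n) :
  \det (1%:M + v^T *m v) = 1 + (v *m v^T) 0 0.
Proof.
pose A : 'M[R]_(1 + n) := block_mx 1%:M v (- v^T) 1%:M.
have A1 : A = block_mx 1%:M 0 (- v^T) 1%:M *m block_mx 1%:M v 0 (1%:M + v^T *m v).
  by rewrite /A mulmx_block !mul0mx !mulmx0 !mul1mx !mulmx1 !addr0 mulNmx addrCA addNr addr0.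
have A2 : A = block_mx 1%:M v 0 1%:M *m block_mx (1%:M + v *m v^T) 0 (- v^T) 1%:M.
  by rewrite /A mulmx_block !mul0mx !mulmx0 !mul1mx !mulmx1 !add0r mulmxN addrK.
have D1 : \det A = \det (1%:M + v^T *m v).
  by rewrite A1 det_mulmx det_lblock det_ublock !det1 !mul1r.
have D2 : \det A = \det (1%:M + v *m v^T).
  by rewrite A2 det_mulmx det_ublock det_lblock !det1 !mul1r mulr1.
by rewrite -D1 D2 det_mx11 !mxE eqxx.
Qed.

Lemma fine_integralD d (T : measurableType d) (R : realType) (mu : {measure set T -> \bar R}) (f g : T -> R) :
  mu.-integrable setT (EFin \o f) -> mu.-integrable setT (EFin \o g) ->
  fine (\int[mu]_x (f x)%:E + \int[mu]_x (g x)%:E)%E = \int[mu]_x (f x + g x).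
Proof.
move=> If Ig; have F1 := integrable_fin_num measurableT If; have F2 := integrable_fin_num measurableT Ig.
by rewrite RintegralD// fineD.
Qed.

(** * Volumes of spherical caps *)

Section SphereVolume.
Variables (R : realType) (n : nat) (c : 'rV[R]_n.+1) (s : R).
Hypothesis s0 : 0 < s.
Local Notation disk := (@odisk R n s).
Local Notation elev := (@elevation R n s).
Local Notation L := (lebn R n).
Local Notation hemi := (hemisphere c s).

Lemma hemisphereE sg u j : hemi sg u 0 j = c 0 j + consr (sg * elev u, u) 0 j.
Proof. by rewrite /hemisphere mxE. Qed.

(** The hemisphere is a graph, so its Gram matrix is the identity plus a rank-one term built from
    the gradient [v] of the graph function. *)
Lemma det_gram_hemisphere sg u : sg ^+ 2 = 1 -> disk u ->
  \det (gram (hemi sg) u) = (s / elev u) ^+ 2.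
Proof.
move=> sg1 Uu; have oU := @open_disk R n s; have r0 := rad_gt0 Uu.
have H0 := has_pdD oU (has_pd_cst oU (c 0 0)) (has_pdM oU (has_pd_cst oU sg) (has_pd_rad n s)).
have E0 w : c 0 0 + sg * elev w = hemi sg w 0 0 by rewrite hemisphereE consr0.
have HS (j : 'I_n) := has_pdD oU (has_pd_cst oU (c 0 (lift 0 j))) (has_pd_coord oU j).
have ES (j : 'I_n) (w : 'rV[R]_n) : c 0 (lift 0 j) + w 0 j = hemi sg w 0 (lift 0 j) by rewrite hemisphereE consrS.
have C j : C1 disk (fun w => hemi sg w 0 j).
  case: (unliftP 0 j) => [i ->|->]; first by apply: (eq_C1 oU _ (HS i).1) => w _; rewrite ES.
  by apply: (eq_C1 oU _ H0.1) => w _; rewrite E0.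
pose v : 'rV[R]_n := \row_a (- sg * u 0 a / elev u).
have J0 a : 'J (hemi sg) u a 0 = v 0 a.
  rewrite (C1_jacobianE a 0 C Uu) (pd_eq_on oU a Uu (fun w _ => esym (E0 w))) H0.2// mxE.
  by move: (elev u)^-1 (u 0 a) => *; ring.
have JS a j : 'J (hemi sg) u a (lift 0 j) = (a == j)%:R.
  by rewrite (C1_jacobianE a (lift 0 j) C Uu) (pd_eq_on oU a Uu (fun w _ => esym (ES j w))) (HS j).2// add0r.
have -> : gram (hemi sg) u = 1%:M + v^T *m v.
  apply/matrixP => a b; rewrite /gram mulmx_trE big_ord_recl !J0 [RHS]mxE addrC !mxE big_ord1 !mxE.
  congr (_ + _); rewrite (bigD1 a)//= !JS eqxx mul1r big1 ?addr0 1?eq_sym// => j ja.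
  by rewrite JS eq_sym (negbTE ja) mul0r.
rewrite det_rank_one -edotE expr_div_n -[s ^+ 2](subrK (edot u u)) -(sqr_rad Uu) mulrDl divff ?expf_neq0 ?gt_eqF//.
congr (_ + _); rewrite /edot mulr_suml; apply: eq_bigr => j _; rewrite !mxE.
move: (u 0 j) (elev u) r0 => x r r0; have -> : - sg * x / r * (- sg * x / r) = sg ^+ 2 * (x * x / r ^+ 2).
  by field; rewrite gt_eqF.
by rewrite sg1 mul1r.
Qed.

Variable e0 : 'rV[R]_n.+1.
Hypothesis e01 : edot e0 e0 = 1.
Local Notation a := (e0 0 0).
Local Notation e := (tailr e0).

Lemma edot_consr t (v : 'rV[R]_n) (w : 'rV[R]_n.+1) : edot (consr (t, v)) w = t * w 0 0 + edot v (tailr w).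
Proof.
rewrite /edot big_ord_recl consr0; congr (_ + _); apply: eq_bigr => j _.
by rewrite consrS mxE.
Qed.

Lemma dir_split : a ^+ 2 + edot e e = 1.
Proof.
rewrite -e01 /edot [in RHS]big_ord_recl expr2; congr (_ + _).
by apply: eq_bigr => j _; rewrite !mxE.
Qed.

(** Two points of a sphere of radius [s] have squared distance 2 s^2 minus 2 s times the height, so
    the ball cuts out exactly a cap. *)
Lemma hemisphere_eball sg u rho : sg ^+ 2 = 1 -> 0 < rho -> disk u ->
  eball (c + s *: e0) (rho * s) (hemi sg u) <-> 1 - rho ^+ 2 / 2 < ht s (sg * a) e u / s.
Proof.
move=> sg1 rho0 Uu; rewrite /eball/=.
have -> : (enorm (hemi sg u - (c + s *: e0)) < rho * s) =
    (edot (hemi sg u - (c + s *: e0)) (hemi sg u - (c + s *: e0)) < (rho * s) ^+ 2).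
  by rewrite -sqr_enorm ltr_pXn2r ?nnegrE ?enorm_ge0// mulr_ge0 ?ltW.
have -> : hemi sg u - (c + s *: e0) = consr (sg * elev u, u) - s *: e0.
  by apply/rowP => j; rewrite mxE hemisphereE !mxE; ring.
have -> : edot (consr (sg * elev u, u) - s *: e0) (consr (sg * elev u, u) - s *: e0) =
    edot (consr (sg * elev u, u)) (consr (sg * elev u, u)) - 2 * s * edot (consr (sg * elev u, u)) e0 + s ^+ 2 * edot e0 e0.
  rewrite /edot !mulr_sumr -sumrB -big_split/=; apply: eq_bigr => j _; rewrite coordBZ; ring.
rewrite e01 !edot_consr consr0 (_ : tailr _ = u); last by apply/rowP => j; rewrite mxE consrS.
have -> : sg * elev u * (sg * elev u) + edot u u = s ^+ 2.
  have -> : sg * elev u * (sg * elev u) = sg ^+ 2 * elev u ^+ 2 by ring.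
  by rewrite sg1 mul1r sqr_rad// subrK.
have -> : sg * elev u * a + edot u e = ht s (sg * a) e u.
  by rewrite /ht /edot; congr (_ + _); [ring|apply: eq_bigr => j _; rewrite mulrC].
move: (ht _ _ _ _) => z.
have -> : s ^+ 2 - 2 * s * z + s ^+ 2 * 1 = (2 - 2 * (z / s)) * s ^+ 2 by field; rewrite gt_eqF.
rewrite exprMn ltr_pM2r ?exprn_gt0//; move: (z / s) => y.
by split => H; lra.
Qed.

Lemma patch_volume_hemisphere sg (phi : R -> R) (B : set 'rV[R]_n.+1) : sg ^+ 2 = 1 ->
  measurable_fun setT phi -> (forall t, 0 <= phi t <= 1) ->
  (forall u, disk u -> (\1_B (hemi sg u) : R) = phi (ht s (sg * a) e u / s)) ->
  let I := fun u => s * (phi (zext disk (fun u => ht s (sg * a) e u / s) u) * wgt s u) in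
  L.-integrable setT (EFin \o I) /\
  patch_volume (gram (hemi sg)) ([set u | enorm u < s] `&` hemi sg @^-1` B) = (\int[L]_u (I u)%:E)%E.
Proof.
move=> sg1 mphi phi01 HB I.
have mI : measurable_fun setT (I : borel 'rV[R]_n -> R).
  apply: measurable_funM; first exact: measurable_cst.
  apply: measurable_funM; last exact: measurable_wgt.
  by apply: (measurableT_comp mphi); exact: measurable_ht.
have w0 := @wgt_ge0 R n s; have I0 u : 0 <= I u.
  by rewrite !mulr_ge0 ?(ltW s0)//; have /andP[] := phi01 (zext disk (fun u => ht s (sg * a) e u / s) u).
split.
  apply: le_integrable (integrableZl measurableT s (integrable_inv_rad n s0)) => //.
    by apply/measurable_EFinP.
  move=> u _; rewrite /= lee_fin ger0_norm// ger0_norm; last by rewrite mulr_ge0 ?(ltW s0) ?w0.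
  by rewrite ler_wpM2l ?(ltW s0)// ler_piMl ?w0//; have /andP[] := phi01 (zext disk (fun u => ht s (sg * a) e u / s) u).
rewrite -lebintE; last 2 first.
- exact/measurable_EFinP.
- by move=> u; rewrite lee_fin.
congr lebint; apply/funext => u; congr EFin; rewrite /I /wgt.
have dE : disk u = (enorm u < s) :> Prop.
  by rewrite /odisk/= -sqr_enorm ltr_pXn2r ?nnegrE ?enorm_ge0// ltW.
have [Uu|Uu] := pselect (disk u); last first.
  by rewrite !zext_out// !mulr0 indicE memNset ?mul0r// => -[]/=; rewrite -dE.
rewrite !zext_in// -HB// det_gram_hemisphere// sqrtr_sqr ger0_norm ?divr_ge0 ?(ltW s0) ?(ltW (rad_gt0 Uu))//.
rewrite !indicE (_ : (u \in _) = (hemi sg u \in B)); first by rewrite mulrCA.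
by apply/idP/idP; rewrite !inE/= => H; [case: H|split=> //; rewrite -dE].
Qed.

Lemma sphere_volumeE (phi : R -> R) (B : set 'rV[R]_n.+1) :
  measurable_fun setT phi -> (forall t, 0 <= phi t <= 1) ->
  (forall sg u, sg ^+ 2 = 1 -> disk u -> (\1_B (hemi sg u) : R) = phi (ht s (sg * a) e u / s)) ->
  sphere_volume c s B = s * sph s a e phi.
Proof.
move=> mphi phi01 HB.
have [I1 E1] := patch_volume_hemisphere (expr1n _ 2) mphi phi01 (fun u => HB 1 u (expr1n _ 2)).
have s2 : (-1) ^+ 2 = 1 :> R by rewrite sqrrN expr1n.
have [I2 E2] := patch_volume_hemisphere s2 mphi phi01 (fun u => HB (-1) u s2).
transitivity (\int[L]_u (s * (phi (zext disk (fun u => ht s (1 * a) e u / s) u) * wgt s u) +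
    s * (phi (zext disk (fun u => ht s (- 1 * a) e u / s) u) * wgt s u))).
  rewrite -(fine_integralD I1 I2); congr (fine (adde _ _)); [exact: E1|exact: E2].
rewrite /sph -RintegralZl//; last first.
  apply: (sph_integrable s0 dir_split mphi (K := 1)) => t _.
  by have /andP[p0 p1] := phi01 t; rewrite ger0_norm.
by congr Rintegral; apply/funext => u; rewrite /zp /zm mul1r mulN1r; ring.
Qed.

Lemma sphere_volume_eball rho : 0 < rho ->
  sphere_volume c s (eball (c + s *: e0) (rho * s)) = s * sph s a e (fun t => (1 - rho ^+ 2 / 2 < t)%R%:R).
Proof.
move=> rho0; apply: sphere_volumeE.
- have mI : measurable (`]1 - rho ^+ 2 / 2, +oo[%classic : set R) by exact: measurable_itv.
  apply: (eq_measurable_fun (\1_(`]1 - rho ^+ 2 / 2, +oo[%classic : set R) : R -> R)); last exact: measurable_indic.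
  by move=> t _; rewrite indicE mem_setE/= in_itv/= andbT.
- by move=> t; case: (_ < _); rewrite ?lexx ?ler01.
- move=> sg u sg1 Uu; rewrite indicE; congr (nat_of_bool _)%:R.
  apply/idP/idP => [/set_mem H|H]; first by apply/(hemisphere_eball sg1 rho0 Uu).
  by apply/mem_set/(hemisphere_eball sg1 rho0 Uu).
Qed.

Lemma sphere_volume_setT : sphere_volume c s setT = s * sph s a e (fun=> 1).
Proof.
apply: sphere_volumeE => [|t|sg u _ _]; [exact: measurable_cst|by rewrite ler01 lexx|].
by rewrite indicE in_setT.
Qed.

End SphereVolume.

(** * Caps, ramps and the reference direction *)

Lemma lebn_hyperplane (R : realType) n (b : R) :
  measurable ([set u : 'rV[R]_n.+1 | u 0 0 = b] : set (borel 'rV[R]_n.+1)) /\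
  lebn R n.+1 [set u | u 0 0 = b] = 0%E.
Proof.
have mH : measurable ([set u : 'rV[R]_n.+1 | u 0 0 = b] : set (borel 'rV[R]_n.+1)).
  have := @measurable_coord R n.+1 0 measurableT [set b] (@measurable_set1 _ b).
  by rewrite setTI.
split=> //; rewrite lebn_slices//.
have E (t : R) : lebn R n [set v | consr (t, v) 0 0 = b] = lebn R n (if t == b then setT else set0).
  congr (lebn R n _); apply/seteqP; split=> v /=; rewrite consr0.
    by move=> /= ->; rewrite eqxx.
  by case: eqP.
transitivity (\int[@lebesgue_measure R]_t (lebn R n setT * (\1_[set b] t)%:E))%E.
  apply: eq_integral => t _; apply: etrans (E t) _; rewrite indicE; case: eqP => [->|tb].
    by rewrite mem_set// mule1.
  by rewrite memNset// mule0 measure0.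
rewrite ge0_integralZl//; last exact: measurable_EFin_indic.
by rewrite integral_indic// setIT; have /= -> := lebesgue_measure_set1 b; rewrite mule0.
Qed.

Section ReferenceLaw.
Variables (R : realType) (n : nat).
Local Notation e := (delta_mx 0 0 : 'rV[R]_n.+1).
Local Notation L := (lebn R n.+1).
Local Notation disk := (@odisk R n.+1 1).

Lemma edot_delta0 (u : 'rV[R]_n.+1) : edot e u = u 0 0.
Proof.
rewrite /edot (bigD1 ord0)//= mxE !eqxx mul1r big1 ?addr0// => j j0.
by rewrite mxE (negbTE j0) andbF mul0r.
Qed.

Lemma ref_dir : 0 ^+ 2 + edot e e = 1 :> R.
Proof. by rewrite edot_delta0 mxE !eqxx expr0n add0r. Qed.

Lemma ref_z u : disk u -> zp 1 0 e u = u 0 0 /\ zm 1 0 e u = u 0 0.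
Proof.
by move=> Uu; rewrite /zp /zm !zext_in// /ht oppr0 mul0r add0r divr1 edot_delta0.
Qed.

(** In the reference direction the height is [u 0 0] on both hemispheres. Were the inequality false
    for all [d], then in the limit d -> 0, off the null hyperplane [u 0 0 = b], [eta] times the mass
    of a nonempty open cap would be at most 0. The offsets [4 d] and [3 d] leave room for thresholds
    displaced by at most [d]. *)
Lemma ref_gap (b eta : R) : b < 1 -> 0 < eta -> exists2 d : R, 0 < d &
  sph 1 0 e (ramp (b - 4 * d) d) < (1 + eta) * sph 1 0 e (ramp (b + 3 * d) d).
Proof.
move=> b1 eta0; apply: contrapT => /forall2NP Hno.
pose d (k : nat) : R := k.+1%:R^-1; have d0 k : 0 < d k by rewrite invr_gt0.
pose D k t := ramp (b - 4 * d k) (d k) t + (- (1 + eta)) * ramp (b + 3 * d k) (d k) t.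
have cD k : continuous (D k).
  by have c1 := @continuous_ramp R (b - 4 * d k) (d k); have c2 := @continuous_ramp R (b + 3 * d k) (d k); rewrite /D; cts.
have DB k t : `|D k t| <= 2 + eta.
  rewrite /D; have := ramp_ge0 (b - 4 * d k) (d k) t; have := ramp_ge0 (b + 3 * d k) (d k) t.
  have := ramp_le1 (b - 4 * d k) (d k) t; have := ramp_le1 (b + 3 * d k) (d k) t.
  move: (ramp _ _ _) (ramp _ _ _) => x y x1 y1 x0 y0.
  have m1 : 0 <= eta * y by rewrite mulr_ge0// ltW.
  have m2 : eta * y <= eta by rewrite ler_piMr// ltW.
  by rewrite ler_norml; apply/andP; split; lra.
pose phi t : R := - eta * (b < t)%R%:R.
have mphi : measurable_fun setT phi.
  apply: measurable_funM; first exact: measurable_cst.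
  have mI : measurable (`]b, +oo[%classic : set R) by exact: measurable_itv.
  apply: (eq_measurable_fun (\1_(`]b, +oo[%classic : set R) : R -> R)); last exact: measurable_indic.
  by move=> t _; rewrite indicE mem_setE/= in_itv/= andbT.
have phiB t : `|phi t| <= eta.
  rewrite /phi normrM normrN (gtr0_norm eta0) ler_piMr ?(ltW eta0)//.
  by case: (b < t); rewrite ?normr1 ?normr0.
pose F k (u : 'rV[R]_n.+1) := (D k (zp 1 0 e u) + D k (zm 1 0 e u)) * wgt 1 u.
pose f (u : 'rV[R]_n.+1) := (phi (zp 1 0 e u) + phi (zm 1 0 e u)) * wgt 1 u.
pose g (u : 'rV[R]_n.+1) := 2 * (2 + eta) * wgt 1 u.
have IF k : L.-integrable setT (EFin \o F k).
  apply: (sph_integrable ltr01 ref_dir (continuous_measurable_fun (@cD k)) (K := 2 + eta)) => t _; exact: DB.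
have If : L.-integrable setT (EFin \o f).
  apply: (sph_integrable ltr01 ref_dir mphi (K := eta)) => t _; exact: phiB.
have Ig : L.-integrable setT (EFin \o g) by exact: (integrableZl measurableT (2 * (2 + eta)) (integrable_inv_rad n.+1 ltr01)).
have FG u k : `|F k u| <= g u.
  rewrite /F /g normrM (ger0_norm (wgt_ge0 1 u)) ler_wpM2r ?wgt_ge0//.
  apply: le_trans (ler_normD _ _) _; rewrite mulr_natl mulr2n; exact: lerD.
have [mN N0] := @lebn_hyperplane R n b.
have Fcvg : {ae L, forall u, setT u -> (fun k => (F k u)%:E) @ \oo --> (f u)%:E}.
  exists ([set u : 'rV[R]_n.+1 | u 0 0 = b] : set (borel 'rV[R]_n.+1)); split=> // u /= Hu; apply: contrapT => ub; apply: Hu => _.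
  suff H : (fun k => F k u) @ \oo --> f u by apply: cvg_EFin; [exact: nearW|exact: H].
  rewrite /F /f; have [Uu|Uu] := pselect (disk u); last first.
    rewrite /wgt zext_out// mulr0 (_ : (fun k => _) = cst (0 : R)); first exact: cvg_cst.
    by apply/funext => k; rewrite /= mulr0.
  have [-> ->] := ref_z Uu; move: (u 0 0) ub => t tb.
  apply: cvgM; last exact: cvg_cst.
  suff H : (fun k => D k t) @ \oo --> phi t by exact: cvgD.
  (* Away from [t = b] both ramps are eventually constant, as soon as [4 * d k] is below the
     distance of [t] to [b]. *)
  apply: cvg_near_cst.
  have e0 : 0 < `|t - b| / 4 by rewrite divr_gt0// normr_gt0 subr_eq0; apply/eqP.
  near=> k.
  have dk : d k < `|t - b| / 4 by near: k; exact: (near_infty_natSinv_lt (PosNum e0)).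
  rewrite /D /phi; have dk0 := d0 k; case: (ltP b t) => bt.
    rewrite gtr0_norm ?subr_gt0// in dk; rewrite !ramp1//; [by rewrite /=; ring|lra|lra].
  have bt' : t < b by rewrite lt_neqAle bt andbT; apply/eqP.
  rewrite ltr0_norm ?subr_lt0// in dk; rewrite !ramp0//; [by rewrite /=; ring|lra|lra].
have FG' : {ae L, forall u k, setT u -> (`|(F k u)%:E| <= (g u)%:E)%E}.
  by apply: aeW => u k _; rewrite lee_fin.
have mE (h : borel 'rV[R]_n.+1 -> R) : L.-integrable setT (EFin \o h) -> measurable_fun setT (EFin \o h).
  by move=> /integrableP[].
have [_ _ C] := @dominated_convergence _ _ _ L setT measurableT (fun k => EFin \o F k) (EFin \o f) (EFin \o g)
  (fun k => mE _ (IF k)) (mE _ If) Fcvg Ig FG'.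
have F0 k : (0 <= \int[L]_u (EFin \o F k) u)%E.
  rewrite -(fineK (integrable_fin_num measurableT (IF k))) lee_fin.
  have cr1 := @continuous_ramp R (b - 4 * d k) (d k); have cr2 := @continuous_ramp R (b + 3 * d k) (d k).
  have i1 := continuous_sph_integrable ltr01 ref_dir cr1.
  have i2 := continuous_sph_integrable ltr01 ref_dir cr2.
  have -> : fine (\int[L]_u (EFin \o F k) u) =
      sph 1 0 e (ramp (b - 4 * d k) (d k)) + (- (1 + eta)) * sph 1 0 e (ramp (b + 3 * d k) (d k)).
    have i3 := integrableZl measurableT (- (1 + eta)) i2.
    rewrite [X in _ = _ + _ * X]/sph -(RintegralZl (- (1 + eta)) measurableT i2) -(RintegralD measurableT i1 i3).
    by congr Rintegral; apply/funext => u; rewrite /F /D; ring.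
  by rewrite mulNr subr_ge0; have [//|/negP] := Hno (d k); rewrite -leNgt.
have lim0 : (0 <= \int[L]_u (EFin \o f) u)%E.
  by rewrite -(cvg_lim (@ereal_hausdorff R) C); apply: lime_ge; [apply/cvg_ex; eexists; exact: C|exact: nearW].
have : (0 < \int[L]_u (- f u)%:E)%E.
  apply: (@lebn_integral_gt0 R n.+1 (disk `&` [set u | b < u 0 0])).
  - apply: openI; first exact: open_disk.
    apply: (@open_comp _ _ (fun u : 'rV[R]_n.+1 => u 0 0) [set z | b < z]); last exact: open_gt.
    by move=> u _; exact: coord_continuous.
  - pose t := Num.max ((1 + b) / 2) 0; exists (t *: e); split=> /=.
      rewrite /odisk/= (_ : edot _ _ = t ^+ 2); last first.
        by rewrite /edot (bigD1 ord0)//= !mxE !eqxx mulr1 big1 ?addr0// => j j0; rewrite !mxE (negbTE j0) andbF !mulr0.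
      by rewrite ltr_pXn2r ?nnegrE// /t; case: (leP ((1 + b) / 2) 0) => ?; lra.
    by rewrite !mxE !eqxx mulr1 /t; case: (leP ((1 + b) / 2) 0) => ?; lra.
  - by apply: measurableT_comp => //; apply/measurable_EFinP; exact: mE If.
  - move=> u; rewrite /f -mulNr mulr_ge0 ?wgt_ge0// /phi opprD !mulNr !opprK addr_ge0// mulr_ge0// ltW//.
  - move=> u [Uu /= bu]; have [z1 z2] := ref_z Uu; rewrite /f /phi z1 z2 bu/= -mulNr.
    rewrite mulr_gt0//; first by lra.
    by rewrite /wgt zext_in// invr_gt0 rad_gt0.
under eq_integral do rewrite EFinN.
by rewrite integralN/= ?integrable_add_def// oppe_gt0 ltNge lim0.
Unshelve. all: by end_near. Qed.

End ReferenceLaw.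

(** All moments of the two laws coincide, so [mean_functional_compare] applies with every
    accuracy. *)
Lemma sph_law_eq (R : realType) n (phi : R -> R) (l : R) (s s' a a' : R) (e e' : 'rV[R]_n) : (0 < n)%N ->
  0 < s -> 0 < s' -> a ^+ 2 + edot e e = 1 -> a' ^+ 2 + edot e' e' = 1 -> 0 <= l ->
  continuous phi -> (forall s t, `|phi s - phi t| <= l * `|s - t|) ->
  sph s a e phi / sph s a e (fun=> 1) = sph s' a' e' phi / sph s' a' e' (fun=> 1).
Proof.
move=> n0 s0 s'0 ae ae' l0 cphi Lip; apply/eqP; rewrite -subr_eq0 -normr_le0.
apply/ler_addgt0Pr => eps eps0; rewrite add0r.
have [N [k [k0 H]]] := mean_functional_compare l0 eps0 ltr01 cphi Lip.
apply: (H _ _ (sph_mean s0 ae) (sph_mean s'0 ae')) => i _.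
by rewrite !sph_moment// subrr normr0 ltW.
Qed.

Lemma sph_le (R : realType) n (s a : R) (e : 'rV[R]_n) (f g : R -> R) (K : R) : 0 < s -> a ^+ 2 + edot e e = 1 ->
  measurable_fun setT f -> measurable_fun setT g -> (forall t, `|f t| <= K) -> (forall t, `|g t| <= K) ->
  (forall t, f t <= g t) -> sph s a e f / sph s a e (fun=> 1) <= sph s a e g / sph s a e (fun=> 1).
Proof.
move=> s0 ae mf mg fK gK fg; rewrite ler_pM2r ?invr_gt0 ?sph1_gt0//.
apply: le_Rintegral => // [||u _].
- by apply: (sph_integrable s0 ae mf (K := K)) => t _.
- by apply: (sph_integrable s0 ae mg (K := K)) => t _.
- by rewrite ler_wpM2r ?wgt_ge0// lerD.
Qed.

(** [d], [lo] and [hi] are computed in the reference direction and carried to every other by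
    [sph_law_eq]. The names refer to where the ramps start: the lower ramp lies above the indicator,
    so [lo] is the upper bound. *)
Lemma cap_approximation (R : realType) n (b eta : R) : (0 < n)%N -> b < 1 -> 0 < eta ->
  exists d lo hi : R, [/\ 0 < d, 0 < hi, lo <= (1 + eta) * hi &
  forall (s a : R) (e : 'rV[R]_n), 0 < s -> a ^+ 2 + edot e e = 1 ->
   [/\ sph s a e (ramp (b - 4 * d) d) / sph s a e (fun=> 1) = lo,
       sph s a e (ramp (b + 3 * d) d) / sph s a e (fun=> 1) = hi &
       hi <= sph s a e (fun t => (b < t)%R%:R) / sph s a e (fun=> 1) <= lo]].
Proof.
case: n => // n _ b1 eta0; have [d d0 H] := ref_gap n b1 eta0.
pose e0 : 'rV[R]_n.+1 := delta_mx 0 0; have r01 := ref_dir R n.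
pose Z := sph 1 0 e0 (fun=> 1); have Z0 : 0 < Z by apply: sph1_gt0.
have lip x := ramp_lipschitz x d0; have di : 0 <= d^-1 by rewrite invr_ge0 ltW.
pose Lf f := sph 1 0 e0 f / Z.
have ge0 x : 0 <= Lf (ramp x d).
  have [_ _ _ Lle] := sph_mean ltr01 r01; have := mean_cst 0 (sph_mean ltr01 r01) => <-.
  by apply: Lle => [t|t|t _]; [exact: cvg_cst|exact: continuous_ramp|exact: ramp_ge0].
have H' : Lf (ramp (b - 4 * d) d) < (1 + eta) * Lf (ramp (b + 3 * d) d).
  by rewrite /Lf mulrA ltr_pM2r ?invr_gt0.
exists d, (Lf (ramp (b - 4 * d) d)), (Lf (ramp (b + 3 * d) d)); split=> //; last 2 first.
- exact: ltW.
- move=> s a e s0 ae.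
  have E x : sph s a e (ramp x d) / sph s a e (fun=> 1) = Lf (ramp x d).
    exact: (sph_law_eq (ltn0Sn n) s0 ltr01 ae r01 di (@continuous_ramp R x d) (lip x)).
  rewrite !E; split=> //.
  have mI : measurable (`]b, +oo[%classic : set R) by exact: measurable_itv.
  have mb : measurable_fun setT (fun t : R => (b < t)%R%:R : R).
    apply: (eq_measurable_fun (\1_(`]b, +oo[%classic : set R) : R -> R)); last exact: measurable_indic.
    by move=> t _; rewrite indicE mem_setE/= in_itv/= andbT.
  have mr x : measurable_fun setT (ramp x d) by apply: continuous_measurable_fun; exact: continuous_ramp.
  have rB x t : `|ramp x d t| <= 1 by rewrite ger0_norm ?ramp_ge0 ?ramp_le1.
  have bB (t : R) : `|(b < t)%R%:R : R| <= 1 by case: (b < t); rewrite ?normr1 ?normr0.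
  rewrite -!E; apply/andP; split; apply: (@sph_le _ _ _ _ _ _ _ 1) => // t.
    by case: (ltP b t) => bt; [exact: ramp_le1|rewrite ramp0//; lra].
  by case: (ltP b t) => bt; [rewrite ramp1//; lra|exact: ramp_ge0].
have := ge0 (b - 4 * d); move: (Lf _) (Lf _) H' => x y xy x0.
by have := le_lt_trans x0 xy; rewrite pmulr_rgt0// addr_gt0.
Qed.

Lemma small_powR (R : realType) (C a k : R) : 0 <= C -> 0 < a -> 0 < k ->
  exists2 e0 : R, 0 < e0 & forall e, 0 < e -> e <= e0 -> C * e `^ a <= k.
Proof.
move=> C0 a0 k0; have C1 : 0 < C + 1 by rewrite ltr_wpDl.
have kC : 0 < k / (C + 1) by rewrite divr_gt0.
exists ((k / (C + 1)) `^ a^-1); first exact: powR_gt0.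
move=> e e0 ee; have H : e `^ a <= k / (C + 1).
  have -> : k / (C + 1) = ((k / (C + 1)) `^ a^-1) `^ a by rewrite -powRrM mulVf ?gt_eqF// powRr1// ltW.
  by apply: ge0_ler_powR; rewrite ?nnegrE ?powR_ge0 ?(ltW a0) ?(ltW e0).
rewrite ler_pdivlMr// in H; apply: le_trans H; rewrite mulrC ler_wpM2l ?powR_ge0//.
by rewrite lerDl.
Qed.

Lemma mean_functional_widen (R : realType) (T T' : R) L : T <= T' -> mean_functional T L -> mean_functional T' L.
Proof.
move=> TT [L1 LD LZ Lle]; split=> // f g cf cg fg; apply: Lle => // t tT; apply: fg; exact: le_trans tT TT.
Qed.

Lemma ratio_close (R : realFieldType) (eta lo hi mlo mhi V S : R) : 0 < eta -> 0 < hi ->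
  lo <= (1 + eta / 2) * hi -> hi <= S -> S <= lo -> `|mlo - lo| <= eta / 2 * hi ->
  `|mhi - hi| <= eta / 2 * hi -> mhi <= V -> V <= mlo -> `|V - S| <= eta * S.
Proof.
move=> eta0 hi0 H1 H2 H3; rewrite ler_norml => /andP[_ G1]; rewrite ler_norml => /andP[G2 _] H4 H5.
have H6 : eta * hi <= eta * S by rewrite ler_wpM2l// ltW.
by rewrite ler_norml; apply/andP; split; lra.
Qed.

Lemma cap_margin (R : realFieldType) (b d w t : R) : 0 < d -> - d <= w -> b + w < t -> b - 4 * d + d <= t.
Proof. by move=> *; lra. Qed.

(** * Comparison of caps on the hypersurface and on the sphere *)

Section CapMembership.
Variables (R : realType) (n : nat) (M : closedHypersurface R n).
Hypothesis hn : (0 < n)%N.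
Local Notation X := (@hs_map R n M).
Local Notation h := (hs_norm 2 (@curv R n M)).
Variables (y : 'rV[R]_n.+1) (rho d : R).
Hypotheses (y1 : edot y y = 1) (rho0 : 0 < rho) (d0 : 0 < d).
Hypothesis near_sphere : forall x : M, `|h * hs_dist x - 1| <= Num.min 1 (d / 3).

Let h0 : 0 < h := @h_gt0 _ _ M hn.

Lemma cap_theight_le2 (x : M) : `|theight y x| <= 2.
Proof.
have := near_sphere x; rewrite le_min => /andP[H _]; move: H; rewrite ler_norml => /andP[_ H].
have en : enorm y = 1 by rewrite /enorm y1 sqrtr1.
apply: (@le_trans _ _ (h * hs_dist x)); last by lra.
rewrite /theight normrM (gtr0_norm h0) ler_wpM2l ?(ltW h0)// /height /hs_dist.
rewrite ler_norml lerNl -[- edot _ y](_ : edot (- (X x - hs_center M)) y = _); last first.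
  by rewrite /edot -sumrN; apply: eq_bigr => j _; rewrite mxE mulNr.
have := edot_enorm (X x - hs_center M) y; have := edot_enorm (- (X x - hs_center M)) y.
by rewrite enormN en !mulr1 => -> ->.
Qed.

(** Law of cosines with |Y| in place of 1/h: the threshold for the height moves by half of (h |Y|)^2
    - 1, which the radius estimate makes small. *)
Lemma cap_membership (x : M) : exists2 w, `|w| <= d &
  eball (hs_center M + h^-1 *: y) (rho / h) (X x) <-> 1 - rho ^+ 2 / 2 + w < theight y x.
Proof.
exists (((h * hs_dist x) ^+ 2 - 1) / 2).
  have := near_sphere x; rewrite le_min => /andP[]; move: (h * hs_dist x) => z H1 H2.
  have -> : (z ^+ 2 - 1) / 2 = (z - 1) * ((z - 1) / 2 + 1) by field.
  rewrite normrM; apply: (@le_trans _ _ (d / 3 * 2)); last by move: d0; lra.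
  apply: ler_pM => //; apply: le_trans (ler_normD _ _) _; rewrite normrM [`|2^-1|]ger0_norm// normr1; lra.
rewrite /eball/=.
have -> : (enorm (X x - (hs_center M + h^-1 *: y)) < rho / h) =
    (edot (X x - (hs_center M + h^-1 *: y)) (X x - (hs_center M + h^-1 *: y)) < (rho / h) ^+ 2).
  by rewrite -sqr_enorm ltr_pXn2r ?nnegrE ?enorm_ge0// divr_ge0 ?ltW.
have -> : edot (X x - (hs_center M + h^-1 *: y)) (X x - (hs_center M + h^-1 *: y)) =
    hs_dist x ^+ 2 - 2 * h^-1 * height (hs_center M) y x + h^-1 ^+ 2 * edot y y.
  rewrite sqr_hs_dist /dist2 /height /edot !mulr_sumr -sumrB -big_split/=; apply: eq_bigr => j _.
  by rewrite opprD addrA coordBZ; ring.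
rewrite y1 /theight; move: (hs_dist x) (height _ _ _) => r z; move: h h0 => H H0.
have -> : r ^+ 2 - 2 * H^-1 * z + H^-1 ^+ 2 * 1 = ((H * r) ^+ 2 - 2 * (H * z) + 1) / H ^+ 2 by field; rewrite gt_eqF.
rewrite expr_div_n ltr_pM2r ?invr_gt0 ?exprn_gt0//; move: ((H * r) ^+ 2) (H * z) => a b.
by split=> ?; lra.
Qed.

End CapMembership.

Section CapVolumes.
Variables (R : realType) (n : nat) (q : R).
Hypotheses (hn : (2 <= n)%N) (hq : n%:R < q).
Variables (p A : R).
Hypotheses (hp : 2 < p) (A0 : 0 < A).
Let n0 : (0 < n)%N. Proof. exact: leq_trans hn. Qed.

Lemma cap_estimate (rho eta : R) : 0 < rho -> 0 < eta -> exists eps0 : R, 0 < eps0 /\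
  forall (eps : R) (M : closedHypersurface R n), 0 < eps -> eps < 1 -> eps <= eps0 -> pinched M p q A eps ->
  let h := hs_norm 2 (@curv R n M) in let S := sphere_volume (hs_center M) h^-1 in
  forall y : 'rV[R]_n.+1, edot y y = 1 ->
  let B := eball (hs_center M + h^-1 *: y) (rho / h) in
  `|hs_volume (@hs_map R n M @^-1` B) / hs_volume [set: M] - S B / S setT| <= eta * (S B / S setT).
Proof.
move=> rho0 eta0; pose b := 1 - rho ^+ 2 / 2.
have b1 : b < 1 by have := exprn_gt0 2 rho0; rewrite /b; lra.
have eta2 : 0 < eta / 2 by rewrite divr_gt0.
(* The ramps are fixed first, then the number and accuracy of the moments, and eps last; none of
   these choices involves [M] or [y]. *)
have [d [lo [hi [d0 hi0 lohi Hsph]]]] := cap_approximation n0 b1 eta2.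
have kap0 : 0 < eta / 2 * hi by rewrite mulr_gt0.
have di : 0 <= d^-1 by rewrite invr_ge0 ltW.
have [N1 [k1 [k10 H1]]] := mean_functional_compare di kap0 (ltr0Sn R 1)
  (@continuous_ramp R (b - 4 * d) d) (ramp_lipschitz (b - 4 * d) d0).
have [N2 [k2 [k20 H2]]] := mean_functional_compare di kap0 (ltr0Sn R 1)
  (@continuous_ramp R (b + 3 * d) d) (ramp_lipschitz (b + 3 * d) d0).
have [C HC] := choice (sphere_moment_stable R n0).
have C0 i : 0 <= C i by have [] := HC i.
have [K [K0 HK]] := theight_err_bound hp.
have [C1 [C10 HR]] := radius_estimate hn hq hp A0.
pose CC := \sum_(i < maxn N1 N2) C i.
have CC0 : 0 <= CC by apply: sumr_ge0.
have CCi i : (i < maxn N1 N2)%N -> C i <= CC.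
  by move=> iN; rewrite /CC (bigD1 (Ordinal iN))//= lerDl sumr_ge0.
have half0 : 0 < 2^-1 :> R by rewrite invr_gt0.
have k0 : 0 < Num.min k1 k2 by rewrite lt_min k10.
have dd0 : 0 < Num.min 1 (d / 3) by rewrite lt_min ltr01 divr_gt0.
have [e1 e10 He1] := small_powR (mulr_ge0 CC0 K0) half0 k0.
have [e2 e20 He2] := small_powR (ltW C10) (alpha_exp_gt0 R n) dd0.
exists (Num.min e1 e2); split=> [|eps M eps0 eps1]; first by rewrite lt_min e10.
rewrite le_min => /andP[ee1 ee2] pin h S y y1; pose B := eball (hs_center M + h^-1 *: y) (rho / h).
suff G : `|hs_volume (@hs_map R n M @^-1` B) / hs_volume [set: M] - S B / S setT| <= eta * (S B / S setT) by exact: G.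
have h0 : 0 < h := @h_gt0 _ _ M n0; have s0 : 0 < h^-1 by rewrite invr_gt0.
have near_sphere (x : M) : `|h * hs_dist x - 1| <= Num.min 1 (d / 3).
  apply: le_trans (He2 _ eps0 ee2); have := HR eps M eps0 eps1 pin x; rewrite -/h.
  move: (hs_dist x) (eps `^ _) => r z; rewrite ler_pdivlMr// -[X in _ * X](gtr0_norm h0) -normrM.
  by rewrite mulrBl mulVf ?gt_eqF// mulrC.
have t2 := cap_theight_le2 n0 y1 near_sphere.
have LM := theight_mean t2.
have cy := dir_split y1.
(* Heights on the sphere lie in [-1, 1], those on [M] only in [-2, 2]; the comparison needs a common
   interval. *)
have LS := mean_functional_widen (_ : 1 <= 2) (sph_mean s0 cy).
have {LS}LS := LS (ler1n _ 2).
have [Elo Ehi /andP[SB1 SB2]] := Hsph _ _ _ s0 cy.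
have pinc : hs_norm p (@curv R n M) * hs_norm 2 (@hs_dist R n M) <= 1 + eps.
  by have [] := pin; rewrite hs_norm_curv.
have HT := HK n M eps n0 eps0 eps1 pinc.
have T0 : 0 <= K * Num.sqrt eps by rewrite mulr_ge0.
have moments i : (i < maxn N1 N2)%N -> `|@hs_average R n M (fun x => theight y x ^+ i) -
    sph h^-1 (y 0 0) (tailr y) (fun t => t ^+ i) / sph h^-1 (y 0 0) (tailr y) (fun=> 1)| <= Num.min k1 k2.
  move=> iN; rewrite (sph_moment s0 cy i n0).
  have [_ Hi] := HC i.
  have m0 : @hs_average R n M (fun x => theight y x ^+ 0) = 1 by exact: avg_cst.
  have := Hi (fun i => @hs_average R n M (fun x => theight y x ^+ i)) _ m0 T0 (fun j => theight_moment_bound n0 y1 t2 j HT).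
  move=> H; apply: (le_trans H); apply: le_trans (He1 _ eps0 ee1).
  by rewrite powR12_sqrt ?(ltW eps0)// mulrA ler_wpM2r// ler_wpM2r// CCi.
have G1 := H1 _ _ LM LS (fun i iN => le_trans (moments i (leq_trans iN (leq_maxl _ _))) _).
have {}G1 := G1 (ltac:(by rewrite ge_min lexx)).
have G2 := H2 _ _ LM LS (fun i iN => le_trans (moments i (leq_trans iN (leq_maxr _ _))) _).
have {}G2 := G2 (ltac:(by rewrite ge_min lexx orbT)).
rewrite Elo in G1; rewrite Ehi in G2.
have SE : S B / S setT = sph h^-1 (y 0 0) (tailr y) (fun t => (b < t)%R%:R) / sph h^-1 (y 0 0) (tailr y) (fun=> 1).
  rewrite /S /B (sphere_volume_eball _ s0 y1 rho0) (sphere_volume_setT _ s0 y1).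
  by rewrite -mulf_div divff ?gt_eqF// mul1r.
have ct : continuous (fun x : M => theight y x).
  by have c1 := @continuous_height _ _ M (hs_center M) y; rewrite /theight; cts.
have cr x : continuous (fun z : M => ramp x d (theight y z)) by apply: cts_comp => //; exact: continuous_ramp.
have mB : measurable ((@hs_map R n M @^-1` B) : set (borel M)).
  apply: (@measurable_sublevel _ _ M (fun x => enorm (@hs_map R n M x - (hs_center M + h^-1 *: y))) (rho / h)).
  by apply: cts_sqrt; exact: continuous_dist2.
have V1 := avg_le_indic mB (cr (b + 3 * d)) _.
have V2 := indic_le_avg mB (cr (b - 4 * d)) _.
have mem (x : M) := cap_membership n0 y1 rho0 d0 near_sphere x.
rewrite -/h -/B -/b in mem.
have {}V1 : @hs_average R n M (fun z => ramp (b + 3 * d) d (theight y z)) <= hs_volume (@hs_map R n M @^-1` B) / hs_volume [set: M].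
  apply: V1 => x; have [w wd [_ Hw]] := mem x; move: wd; rewrite ler_norml => /andP[w1 w2].
  case: (leP (theight y x) (b + 3 * d)) => tx; first by rewrite ramp0.
  have bx : B (@hs_map R n M x).
    by apply: Hw; apply: le_lt_trans tx; rewrite lerD2l (le_trans w2)// ler_peMl ?(ltW d0)// ler1n.
  by rewrite indicE mem_set//; exact: ramp_le1.
have {}V2 : hs_volume (@hs_map R n M @^-1` B) / hs_volume [set: M] <= @hs_average R n M (fun z => ramp (b - 4 * d) d (theight y z)).
  apply: V2 => x; have [w wd [Hw _]] := mem x; move: wd; rewrite ler_norml => /andP[w1 w2].
  rewrite indicE; case: (boolP (x \in _)) => [/set_mem/Hw Hx|_]; last exact: ramp_ge0.
  by rewrite ramp1//; exact: cap_margin d0 w1 Hx.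
rewrite SE; exact: ratio_close eta0 hi0 lohi SB1 SB2 G1 G2 V1 V2.
Qed.
End CapVolumes.

Theorem theorem1p2 (R : realType) (n : nat) (hn : (2 <= n)%N)
    (q : R) (hq : n%:R < q) :
  exists alpha : R, 0 < alpha /\
  forall p A : R, 2 < p -> 0 < A ->
  [/\ (exists C : R, 0 < C /\
       forall (eps : R) (M : closedHypersurface R n),
         0 < eps -> eps < 1 -> pinched M p q A eps ->
         let h := hs_norm 2 (@mean_curvature R n M) in
         (hs_supnorm (fun x : M => (hs_dist x - h^-1)%R)
           <= (C * eps `^ alpha * h^-1)%R%:E)%E),
      (forall r : R, 1 <= r -> r < q ->
       exists C' : R, 0 < C' /\
       forall (eps : R) (M : closedHypersurface R n),
         0 < eps -> eps < 1 -> pinched M p q A eps ->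
         let h := hs_norm 2 (@mean_curvature R n M) in
         let beta := alpha * (q - r) / (r * (q - 1)) in
         hs_norm r (fun x : M => `|mean_curvature x| - h)
           <= C' * eps `^ beta * h)
    & (Num.max 4 n%:R < q ->
       forall rho eta : R, 0 < rho -> 0 < eta ->
       exists eps0 : R, 0 < eps0 /\
       forall (eps : R) (M : closedHypersurface R n),
         0 < eps -> eps < 1 -> eps <= eps0 -> pinched M p q A eps ->
         let h := hs_norm 2 (@mean_curvature R n M) in
         let S := sphere_volume (hs_center M) h^-1 in
         forall x : 'rV[R]_n.+1, esphere (hs_center M) h^-1 x ->
           let B := eball x (rho / h) in
           `|hs_volume (@hs_map R n M @^-1` B) / hs_volume [set: M]
               - S B / S setT|
             <= eta * (S B / S setT))].
Proof.
exists (alpha_exp R n); split=> [|p A hp A0]; first exact: alpha_exp_gt0.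
split.
- have [C [C0 H]] := radius_estimate hn hq hp A0; exists C; split=> // eps M e0 e1 pin.
  rewrite hs_norm_curv; apply: ge_ereal_sup => _ [x _ <-]; rewrite lee_fin.
  exact: H pin x.
- move=> r r1 rq; have [C [C0 H]] := curvature_estimate hn hq hp A0 r1 rq.
  exists C; split; first exact: C0.
  move=> eps M e0 e1 pin; have key (h1 h2 c : R) : h1 = h2 -> hs_norm r (fun x : M => curv x - h2) <= c * h2 ->
    hs_norm r (fun x : M => `|mean_curvature x| - h1) <= c * h1 by move=> ->.
  exact: key (hs_norm_curv M 2) (H eps M e0 e1 pin).
- move=> _ rho eta rho0 eta0; have [e0 [e00 H]] := cap_estimate hn hq hp A0 rho0 eta0.
  exists e0; split=> // eps M eps0 eps1 ee pin; rewrite hs_norm_curv => h S x [y y1 <-].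
  apply: (H eps M eps0 eps1 ee pin y); by rewrite -sqr_enorm y1 expr1n.
Qed.
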